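(* There exists no proper weakly Einstein four-dimensional Riemannian manifold with harmonic curvature.
   Context: Manifolds are connected and everything is smooth. A Riemannian four-manifold $(M,g)$ with curvature tensor $R$ is weakly Einstein if, for some function $\phi$ on $M$, $R_{ikpq}R_j{}^{kpq}=\phi g_{ij}$. A weakly Einstein four-manifold is called proper if it is not Einstein and it is not both conformally flat and scalar-flat. (Every four-manifold which is Einstein, or conformally flat and scalar-flat, is weakly Einstein.) A Riemannian manifold has harmonic curvature if the divergence of its curvature tensor vanishes identically or, equivalently, its Ricci tensor satisfies the Codazzi equation. *)

(* Defs.v *)
From HB Require Import structures.
From mathcomp Require Import all_boot all_order all_algebra.
From mathcomp Require Import all_classical all_reals all_analysis.

Set Implicit Arguments.
Unset Strict Implicit.
Unset Printing Implicit Defensive.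

Import Order.TTheory GRing.Theory Num.Theory.
Import numFieldNormedType.Exports.

Local Open Scope classical_set_scope.
Local Open Scope ring_scope.

Section calculus.
Context {R : realType} {n : nat}.
Implicit Types (U : set 'rV[R]_n) (f : 'rV[R]_n -> R).

Definition partial (i : 'I_n) f : 'rV[R]_n -> R :=
  fun x => 'D_(delta_mx 0 i) f x.

(* C^oo on an open set U: all iterated partial derivatives of f, of every
   order, exist and are differentiable on U. *)
Definition smooth_on U f :=
  forall s : seq 'I_n, forall x, U x -> differentiable (foldr partial f s) x.

End calculus.

(* Smooth n-manifolds, presented by a (not necessarily maximal) smooth atlas.
   A chart a is the homeomorphism coord a from the open set dom a onto the open
   set coord a @` dom a; param a is its inverse, with irrelevant values outside
   coord a @` dom a. *)
Record smooth_manifold (R : realType) (n : nat) (M : topologicalType) := {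
  chart : Type;
  dom : chart -> set M;
  coord : chart -> M -> 'rV[R]_n;
  param : chart -> 'rV[R]_n -> M;
  manifold_hausdorff : hausdorff_space M;
  manifold_second_countable : @second_countable M;
  manifold_connected : connected [set: M];
  dom_cover : forall p : M, exists a, dom a p;
  dom_open : forall a, open (dom a);
  coord_open : forall a, open (coord a @` dom a);
  coordK : forall a p, dom a p -> param a (coord a p) = p;
  coord_continuous : forall a, {within dom a, continuous (coord a)};
  param_continuous :
    forall a, {within coord a @` dom a, continuous (param a)};
  transition_smooth : forall a b (k : 'I_n),
    smooth_on (coord a @` (dom a `&` dom b))
              (fun x => coord b (param a x) 0 k)
}.

(* A metric is given by its component matrices in the charts, which are subject
   to the transformation law of covariant 2-tensors. The value of metric a
   outside coord a @` dom a is irrelevant. *)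
Record riemannian_metric (R : realType) (n : nat) (M : topologicalType)
    (X : smooth_manifold R n M) := {
  metric :> chart X -> 'rV[R]_n -> 'M[R]_n;
  metric_smooth : forall a (i j : 'I_n),
    smooth_on (coord a @` dom a) (fun x => metric a x i j);
  metric_sym : forall a p, dom a p ->
    (metric a (coord a p))^T = metric a (coord a p);
  metric_posdef : forall a p, dom a p -> forall v : 'rV[R]_n, v != 0 ->
    0 < (v *m metric a (coord a p) *m v^T) 0 0;
  metric_transition : forall a b p, dom a p -> dom b p -> forall i j : 'I_n,
    metric a (coord a p) i j =
    \sum_k \sum_l partial i (fun x => coord b (param a x) 0 k) (coord a p)
                * partial j (fun x => coord b (param a x) 0 l) (coord a p)
                * metric b (coord b p) k l
}.

(* Coordinate expressions for a metric with component matrix G x at x. *)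
Section local_geometry.
Context {R : realType} {n : nat}.
Implicit Types (G : 'rV[R]_n -> 'M[R]_n) (x : 'rV[R]_n) (i j k l m : 'I_n).

Definition ginv G x : 'M[R]_n := invmx (G x).

(* Gamma^k_ij *)
Definition christoffel G k i j x : R :=
  2^-1 * \sum_l ginv G x k l *
    (partial i (fun y => G y j l) x + partial j (fun y => G y i l) x
     - partial l (fun y => G y i j) x).

(* R_ijk^l, where R(d_i, d_j) d_k = R_ijk^l d_l and
   R(X, Y) = [nabla_X, nabla_Y] - nabla_[X, Y] *)
Definition riemann_up G i j k l x : R :=
  partial i (christoffel G l j k) x - partial j (christoffel G l i k) x
  + \sum_m (christoffel G l i m x * christoffel G m j k x
            - christoffel G l j m x * christoffel G m i k x).

(* R_ijkl = R_ijk^m g_ml *)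
Definition riemann G i j k l x : R :=
  \sum_m riemann_up G i j k m x * G x m l.

(* R_jk = R_ijk^i, positive on round spheres *)
Definition ricci G j k x : R := \sum_i riemann_up G i j k i x.

Definition scalar_curvature G x : R :=
  \sum_j \sum_k ginv G x j k * ricci G j k x.

(* R_ikpq R_j^kpq *)
Definition curvature_square G i j x : R :=
  \sum_k \sum_p \sum_q \sum_k' \sum_p' \sum_q'
    ginv G x k k' * ginv G x p p' * ginv G x q q'
    * riemann G i k p q x * riemann G j k' p' q' x.

(* nabla_m R_ijkl *)
Definition nabla_riemann G m i j k l x : R :=
  partial m (riemann G i j k l) x
  - \sum_s (christoffel G s m i x * riemann G s j k l x
            + christoffel G s m j x * riemann G i s k l x
            + christoffel G s m k x * riemann G i j s l x
            + christoffel G s m l x * riemann G i j k s x).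

(* nabla^l R_ijkl; contracting nabla with any other index of R gives the same
   tensor up to sign and order of indices. *)
Definition div_riemann G i j k x : R :=
  \sum_m \sum_l ginv G x m l * nabla_riemann G m i j k l x.

Definition flat_on (V : set 'rV[R]_n) G :=
  forall x, V x -> forall i j k l, riemann G i j k l x = 0.

End local_geometry.

Section global_geometry.
Context {R : realType} {n : nat} {M : topologicalType}.
Context {X : smooth_manifold R n M}.
Implicit Types g : riemannian_metric X.

Definition weakly_einstein g :=
  exists phi : M -> R, forall a p, dom a p -> forall i j : 'I_n,
    curvature_square (g a) i j (coord a p) = phi p * g a (coord a p) i j.

Definition einstein g :=
  exists lambda : R, forall a p, dom a p -> forall i j : 'I_n,
    ricci (g a) i j (coord a p) = lambda * g a (coord a p) i j.

Definition scalar_flat g :=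
  forall a p, dom a p -> scalar_curvature (g a) (coord a p) = 0.

(* Conformal flatness is local: near every point, some metric e^(2u) g
   conformal to g is flat. *)
Definition conformally_flat g :=
  forall a p, dom a p ->
    exists (V : set 'rV[R]_n) (u : 'rV[R]_n -> R),
      [/\ open V, V (coord a p), V `<=` coord a @` dom a, smooth_on V u
        & flat_on V (fun x => expR (2 * u x) *: g a x)].

Definition harmonic_curvature g :=
  forall a p, dom a p -> forall i j k : 'I_n,
    div_riemann (g a) i j k (coord a p) = 0.

Definition proper_weakly_einstein g :=
  [/\ weakly_einstein g, ~ einstein g
    & ~ (conformally_flat g /\ scalar_flat g)].

End global_geometry.

(* Main.v *)
(* Harmonic curvature makes the scalar curvature s constant and the Ricci tensor a Codazzi
   tensor. Applying the exterior covariant derivative twice to the latter gives an algebraic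
   relation between the curvature R and the traceless Ricci tensor E. In an orthonormal
   frame diagonalizing E, this relation and the weakly Einstein identity are polynomial
   equations. With A.B the Kulkarni-Nomizu product and Q the traceless part of E^2, they
   force R = E.g/2 + s/16 (Q.Q/r + g.g), r = |Q|^2/4, where Q is nonzero; if Q = 0 on an
   open set where E has no zeros, then E is parallel, and hence s = 0 and R = E.g/2.

   If s is nonzero, then E = 0: otherwise div R = 0 makes Q/sqrt r parallel, which
   contradicts the formula for R. If s = 0, then R = E.g/2, that is, the Weyl tensor
   vanishes, wherever E is nonzero. By a Carleman estimate for the elliptic system satisfied
   by E, either E vanishes identically and g is Einstein, or the zeros of E have empty
   interior and the Weyl tensor vanishes everywhere. In the latter case the conformal tractor
   connection is flat (the Cotton tensor vanishes because Ric is Codazzi and s = 0), and a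
   parallel section gives local flat metrics conformal to g. *)

(* Unless all eigenvalues e_a of E have the same square, the relations leave only sectional
   curvatures in an eigenframe, and the weakly Einstein identity makes those of complementary planes
   equal up to sign. No or one minus sign would make the e_a^2 equal, two give the term with Q,
   three give s = 0 without it. Points where E^2 is a multiple of g escape this algebra; they are
   treated on open sets, where that condition can be differentiated.

   For s nonzero, F = Q/sqrt r has F^2 = g and trace zero, so its eigenvalues are 1, 1, -1, -1. If F
   is parallel, a plane spanned by eigenvectors for different signs has curvature zero, while the
   formula gives it the curvature (e_a + e_b)/2. Hence all e_a^2 agree and Q = 0.

   The metric is only assumed smooth, so E is not continued by power series. The Codazzi equation
   and the vanishing divergence of E express g^li d_l d_i E_jk through E and its first derivatives;
   this is the elliptic system. The Carleman argument is run pointwise, with a divergence term that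
   is summed over a fine lattice instead of being integrated. *)
Require Import Defs.
From HB Require Import structures.
From mathcomp Require Import all_boot all_order all_algebra.
From mathcomp Require Import all_classical all_reals all_analysis.
From mathcomp Require Import ring lra.
Set Implicit Arguments.
Unset Strict Implicit.
Unset Printing Implicit Defensive.
Import Order.TTheory GRing.Theory Num.Theory.
Import numFieldNormedType.Exports.
Local Open Scope classical_set_scope.
Local Open Scope ring_scope.

(** * Smooth functions on open sets *)

(* Locked, as unification would otherwise unfold partial derivatives. *)
HB.lock Definition pd (R : realType) (n : nat) (i : 'I_n) (f : 'rV[R]_n -> R) x : R :=
  partial i f x.

Lemma pdE (R : realType) (n : nat) (i : 'I_n) (f : 'rV[R]_n -> R) x :
  pd i f x = partial i f x.
Proof. by rewrite pd.unlock. Qed.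

Section smooth_functions.
Context {R : realType} {n : nat}.
Implicit Types (D : set 'rV[R]_n) (f g : 'rV[R]_n -> R) (x : 'rV[R]_n).

Lemma eq_on_near (T : Type) D (f g : 'rV[R]_n -> T) x : open D ->
  (forall y, D y -> f y = g y) -> D x -> \forall y \near x, f y = g y.
Proof. by move=> oD fg Dx; apply: (filterS fg); apply: open_nbhs_nbhs. Qed.

(** The differential is the zero map. [differentiableE] reduces to this case by subtracting a linear
    form. *)
Lemma flat_differentiable f x :
  (forall e : R, 0 < e -> \forall y \near x, `|f y - f x| <= e * `|y - x|) ->
  differentiable f x.
Proof.
move=> fe; apply/diffP => /=.
apply: (@getPex _ (fun (df : {linear 'rV[R]_n -> R}) => continuous df /\
  forall y, f y = f (lim (nbhs x)) + df (y - lim (nbhs x))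
                  +o_(y \near x) (y - lim (nbhs x)))).
have zl : linear (fun _ : 'rV[R]_n => 0 : R^o) by move=> k u v; rewrite scaler0 addr0.
pose zM := GRing.isLinear.Build _ _ _ _ _ zl.
pose z : {linear 'rV[R]_n -> R^o} := HB.pack (fun _ : 'rV[R]_n => 0 : R^o) zM.
exists z.
split=> [v|].
  exact: (@cst_continuous _ _ (0 : R) v).
have h : f = cst (f x) +o_x (center x).
  apply/eqaddoP => e e0; near=> y; rewrite !fctE /=.
  by near: y; exact: fe.
by apply: eqaddoEx => y; rewrite lim_id //= addr0 {1}h.
Unshelve. all: by end_near. Qed.

Lemma linear_form_differentiable (a : 'I_n -> R) x y :
  differentiable (fun z : 'rV[R]_n => \sum_i a i * (z - x) 0 i) y.
Proof.
have -> : (fun z : 'rV[R]_n => \sum_i a i * (z - x) 0 i) =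
   \sum_i (fun z : 'rV[R]_n => a i * (z 0 i - x 0 i)).
  by apply/funext => z; rewrite fct_sumE; apply: eq_bigr => i _; rewrite !mxE.
apply: differentiable_sum => i.
apply: differentiableM => //; apply: differentiableB => //.
exact: differentiable_coord.
Qed.

(** This form involves f only through its values near x, so differentiability passes to functions
    that agree with f near x ([near_differentiable]). *)
Lemma differentiableE f x : differentiable f x <->
  exists a : 'I_n -> R, forall e : R, 0 < e -> \forall y \near x,
    `|f y - f x - \sum_i a i * (y - x) 0 i| <= e * `|y - x|.
Proof.
split=> [df|[a fa]].
  exists (fun i => pd i f x) => e e0.
  have dE (h : 'rV[R]_n) : 'd f x h = \sum_i pd i f x * h 0 i.
    rewrite {1}(row_sum_delta h) linear_sum; apply: eq_bigr => i _.
    by rewrite linearZ /= !pd.unlock /partial deriveE // mulrC.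
  have /diff_locally := df => /eqaddoP /(_ _ e0) H0.
  have := H0 : \forall h \near (0 : 'rV[R]_n),
    `|(f \o shift x - (cst (f x) + 'd f x)) h| <= e * `|h|.
  rewrite (near_shift x 0) sub0r => H; near=> y.
  have : `|(f \o shift x - (cst (f x) + 'd f x)) (y - x)| <= e * `|y - x|.
    by near: y; apply: filterS H.
  by rewrite !fctE /= subrK dE opprD addrA.
pose L y := \sum_i a i * (y - x) 0 i.
have -> : f = (fun y => f y - L y) \+ L by apply/funext => y /=; rewrite subrK.
apply: differentiableD; last exact: linear_form_differentiable.
apply: flat_differentiable => e e0.
have Lx : L x = 0 by rewrite /L big1 // => i _; rewrite subrr mxE mulr0.
move: (fa _ e0); apply: filterS => y; rewrite Lx subr0.
by rewrite addrAC.
Unshelve. all: by end_near. Qed.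

Lemma near_differentiable f g x :
  (\forall y \near x, f y = g y) -> differentiable f x -> differentiable g x.
Proof.
move=> fg /differentiableE[a fa]; apply/differentiableE; exists a => e e0.
have fgx : f x = g x by exact: nbhs_singleton fg.
near=> y; have <- : f y = g y by near: y.
by rewrite -fgx; near: y; exact: fa.
Unshelve. all: by end_near. Qed.

Lemma eq_on_differentiable D f g x : open D -> (forall y, D y -> f y = g y) ->
  D x -> differentiable f x -> differentiable g x.
Proof. by move=> oD fg Dx; apply: near_differentiable; apply: eq_on_near Dx. Qed.

Lemma eq_on_partial D f g x i : open D -> (forall y, D y -> f y = g y) ->
  D x -> pd i f x = pd i g x.
Proof. by move=> oD fg Dx; rewrite !pd.unlock; apply: near_eq_derive; apply: eq_on_near Dx. Qed.

Lemma diff_partial f x : differentiable f x ->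
  forall v, 'd f x v = \sum_i pd i f x * v 0 i.
Proof.
move=> df v; rewrite {1}(row_sum_delta v) linear_sum; apply: eq_bigr => i _.
by rewrite linearZ /= !pd.unlock /partial deriveE // mulrC.
Qed.

Lemma differentiable_approx f x : differentiable f x ->
  forall e : R, 0 < e -> \forall y \near x,
    `|f y - f x - \sum_i pd i f x * (y - x) 0 i| <= e * `|y - x|.
Proof.
move=> df e e0; have /eqaddoP /(_ _ e0) H0 := diff_locally df.
have := H0 : \forall h \near (0 : 'rV[R]_n),
    `|(f \o shift x - (cst (f x) + 'd f x)) h| <= e * `|h|.
rewrite (near_shift x 0) sub0r => H; near=> y.
have : `|(f \o shift x - (cst (f x) + 'd f x)) (y - x)| <= e * `|y - x|.
  by near: y; apply: filterS H.
by rewrite !fctE /= subrK diff_partial // opprD addrA.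
Unshelve. all: by end_near. Qed.

Lemma partial_cst i (c : R) x : pd i (fun=> c) x = 0.
Proof. rewrite pd.unlock; exact: derive_cst. Qed.

Lemma partialD i f g x : differentiable f x -> differentiable g x ->
  pd i (fun y => f y + g y) x = pd i f x + pd i g x.
Proof. by move=> df dg; rewrite !pd.unlock /partial deriveD //; exact: diff_derivable. Qed.

Lemma partialB i f g x : differentiable f x -> differentiable g x ->
  pd i (fun y => f y - g y) x = pd i f x - pd i g x.
Proof. by move=> df dg; rewrite !pd.unlock /partial deriveB //; exact: diff_derivable. Qed.

Lemma partialN i f x : differentiable f x ->
  pd i (fun y => - f y) x = - pd i f x.
Proof. by move=> df; rewrite !pd.unlock /partial deriveN //; exact: diff_derivable. Qed.

Lemma partialM i f g x : differentiable f x -> differentiable g x ->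
  pd i (fun y => f y * g y) x = pd i f x * g x + f x * pd i g x.
Proof.
move=> df dg; rewrite !pd.unlock /partial deriveM //; try exact: diff_derivable.
by rewrite /GRing.scale /= addrC [g x * _]mulrC.
Qed.

Lemma partialZ i c f x : differentiable f x ->
  pd i (fun y => c * f y) x = c * pd i f x.
Proof. by move=> df; rewrite partialM // partial_cst mul0r add0r. Qed.

Lemma differentiable_bigsum (I : Type) (r : seq I) (P : pred I)
    (h : I -> 'rV[R]_n -> R) x :
  (forall k, differentiable (h k) x) ->
  differentiable (fun y => \sum_(k <- r | P k) h k y) x.
Proof.
move=> dh; elim: r => [|k r IH].
  by under eq_fun do rewrite big_nil.
under eq_fun do rewrite big_cons; case: (P k) => //.
by apply: differentiableD.
Qed.

Lemma partial_sum (I : Type) (r : seq I) (P : pred I)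
    (h : I -> 'rV[R]_n -> R) i x :
  (forall k, differentiable (h k) x) ->
  pd i (fun y => \sum_(k <- r | P k) h k y) x =
  \sum_(k <- r | P k) pd i (h k) x.
Proof.
move=> dh; elim: r => [|k r IH].
  by under eq_fun do rewrite big_nil; rewrite big_nil partial_cst.
rewrite big_cons; under eq_fun do rewrite big_cons.
case: (P k) => //; rewrite partialD ?IH //.
exact: differentiable_bigsum.
Qed.

Lemma comp1_differentiable (h : R -> R) f x (dh : R) :
  is_derive (f x) 1 h dh -> differentiable f x ->
  differentiable (fun y => h (f y)) x.
Proof.
move=> [dhf _] df; apply: (@differentiable_comp _ _ _ _ f h) => //.
exact/derivable1_diffP.
Qed.

Lemma partial_comp1 (h : R -> R) f x (dh : R) i :
  is_derive (f x) 1 h dh -> differentiable f x ->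
  pd i (fun y => h (f y)) x = dh * pd i f x.
Proof.
move=> [dhf hE] df; have dh' : differentiable h (f x) by exact/derivable1_diffP.
rewrite !pd.unlock /partial deriveE; last exact: (@differentiable_comp _ _ _ _ f h).
rewrite (@diff_comp _ _ _ _ f h) //= deriv1E // derive1E hE deriveE //.
by rewrite mulrC.
Qed.

Lemma partialV i f x : differentiable f x -> f x != 0 ->
  pd i (fun y => (f y)^-1) x = - pd i f x / (f x) ^+ 2.
Proof.
move=> df f0; rewrite !pd.unlock /partial deriveV //; last exact: diff_derivable.
by rewrite /GRing.scale /= !mulNr mulrC.
Qed.

Lemma line_is_derive f y v (s : R) : differentiable f (y + s *: v) ->
  is_derive s 1 (fun t => f (y + t *: v)) ('D_v f (y + s *: v)).
Proof.
move=> df.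
have dl : is_diff s (fun t : R => y + t *: v) (fun t => t *: v).
  by apply: is_diff_eq; rewrite add0r.
have dc : differentiable (fun t : R => f (y + t *: v)) s.
  by apply: (@differentiable_comp _ _ _ _ (fun t : R => y + t *: v) f).
split; first exact: diff_derivable.
rewrite !deriveE // (@diff_comp _ _ _ _ (fun t : R => y + t *: v) f) //=.
by rewrite (diff_val (is_diff_def := dl)) scale1r.
Qed.

Lemma MVT_line f y v (h : R) : 0 < h ->
  (forall s, 0 <= s <= h -> differentiable f (y + s *: v)) ->
  exists2 c, 0 < c < h & f (y + h *: v) - f y = 'D_v f (y + c *: v) * h.
Proof.
move=> h0 df.
have [c /= c0h E] : exists2 c, c \in `]0, h[%R &
    f (y + h *: v) - f (y + 0 *: v) = 'D_v f (y + c *: v) * (h - 0).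
  apply: (@MVT R (fun t => f (y + t *: v))) => // [s s0h|].
    apply: line_is_derive; apply: df.
    by move: s0h; rewrite in_itv /= => /andP[/ltW -> /ltW ->].
  apply: derivable_within_continuous => s s0h.
  have := @line_is_derive f y v s; case=> //; apply: df.
  by move: s0h; rewrite in_itv.
exists c; first by move: c0h; rewrite in_itv.
by move: E; rewrite scale0r addr0 subr0.
Qed.

Lemma norm_delta_row (i : 'I_n) : `|delta_mx 0 i : 'rV[R]_n| <= 1.
Proof.
rewrite /Num.Def.normr /= mx_normrE bigmax_le // => -[k l] _ /=.
by rewrite mxE; case: (_ && _); rewrite ?normr1 ?normr0.
Qed.

Lemma sum_scale_delta (a : 'I_n -> R) (c : R) i :
  \sum_k a k * (c *: delta_mx 0 i : 'rV[R]_n) 0 k = c * a i.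
Proof.
rewrite (bigD1 i) //= big1 ?addr0 => [|k ki]; rewrite !mxE eqxx /= ?eqxx ?mulr1 1?mulrC //.
by rewrite (negPf ki) mulr0 mul0r.
Qed.

Lemma derive_translate f v w z : 'D_v (fun y => f (y + w)) z = 'D_v f (z + w).
Proof.
rewrite /derive; congr (lim _).
by under eq_fun do rewrite /= -addrA.
Qed.

(** Mean value theorem along e_i for phi(y) = f(y + h e_j) - f(y), at an intermediate c in (0, h),
    followed by the expansion of g = d_i f at x in both terms of d_i phi. The two errors are at most
    e (c + h) and e c, whence the factor 3. *)
Lemma second_difference f x i j (D : set 'rV[R]_n) : open D -> D x ->
  (forall y, D y -> differentiable f y) -> differentiable (pd i f) x ->
  forall e : R, 0 < e -> \forall h \near (0 : R)^'+,
   `|f (x + h *: delta_mx 0 i + h *: delta_mx 0 j) - f (x + h *: delta_mx 0 i)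
     - f (x + h *: delta_mx 0 j) + f x - h ^+ 2 * pd j (pd i f) x|
   <= 3 * e * h ^+ 2.
Proof.
move=> oD Dx fD dg e e0; set g := pd i f in dg *.
have /nbhs_ballP[d1 /= d10 Hd1] := differentiable_approx dg e0.
have /nbhs_ballP[d2 /= d20 Hd2] : nbhs x D by exact: open_nbhs_nbhs.
(* Halved because the points x + c e_i + k e_j with c, k <= h are at distance at most h + h from
   x. *)
pose d := Num.min d1 d2 / 2.
have d0 : 0 < d by rewrite divr_gt0 // lt_min d10.
near=> h.
have h0 : 0 < h by near: h; exact: nbhs_right_gt.
have hd : h < d by near: h; exact: nbhs_right_lt.
have near_x (c k : R) : 0 <= c <= h -> 0 <= k <= h ->
    `|c *: delta_mx 0 i + k *: delta_mx 0 j : 'rV[R]_n| <= c + k.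
  move=> /andP[c0 _] /andP[k0 _].
  rewrite (le_trans (ler_normD _ _)) // !normrZ (ger0_norm c0) (ger0_norm k0).
  by rewrite lerD // ler_piMr // norm_delta_row.
have hd12 : (h + h < d1) /\ (h + h < d2).
  by move: hd; rewrite /d ltr_pdivlMr // lt_min => /andP[]; split; lra.
have inb (c k : R) : 0 <= c <= h -> 0 <= k <= h ->
    ball x d1 (x + (c *: delta_mx 0 i + k *: delta_mx 0 j)) /\
    ball x d2 (x + (c *: delta_mx 0 i + k *: delta_mx 0 j)).
  move=> ch kh; have := near_x _ _ ch kh.
  move: ch kh hd12 => /andP[_ ch] /andP[_ kh] [h1 h2] N.
  by rewrite -!ball_normE /= opprD addNKr normrN; split; lra.
pose phi y := f (y + h *: delta_mx 0 j) - f y.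
have h0h : 0 <= h <= h by rewrite ltW //=.
have [c /andP[c0 ch] E] : exists2 c, 0 < c < h &
    phi (x + h *: delta_mx 0 i) - phi x = 'D_(delta_mx 0 i) phi (x + c *: delta_mx 0 i) * h.
  apply: MVT_line => // s sh; apply: differentiableB; last first.
    apply: fD; apply: Hd2; have := (inb s 0 sh); rewrite scale0r addr0; case=> //.
    by rewrite lexx ltW.
  have df1 : differentiable f (x + s *: delta_mx 0 i + h *: delta_mx 0 j).
    by apply: fD; apply: Hd2; rewrite -addrA; have [] := inb s h sh h0h.
  apply: (@differentiable_comp _ _ _ _ (fun y => y + h *: delta_mx 0 j) f) => //.
have c0h : 0 <= c <= h by rewrite !ltW.
have i00 : (0 : R) <= 0 <= h by rewrite lexx ltW.
have [B1 B2] := inb c h c0h h0h.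
have [B3 B4] := inb c 0 c0h i00.
rewrite scale0r addr0 in B3 B4.
have Dphi : 'D_(delta_mx 0 i) phi (x + c *: delta_mx 0 i) =
   g (x + (c *: delta_mx 0 i + h *: delta_mx 0 j)) - g (x + c *: delta_mx 0 i).
  rewrite /phi deriveB; first by rewrite derive_translate -addrA /g !pd.unlock.
    apply: diff_derivable.
    apply: (@differentiable_comp _ _ _ _ (fun y => y + h *: delta_mx 0 j) f) => //.
    by apply: fD; apply: Hd2; rewrite -addrA.
  by apply: diff_derivable; apply: fD; apply: Hd2.
have := Hd1 _ B1; have := Hd1 _ B3 => /=.
rewrite !(addrC x) !addrK sum_scale_delta.
under eq_bigr do rewrite mxE mulrDr.
rewrite big_split /= !sum_scale_delta -!(addrC x) -/(pd j g x) => A1 A2.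
have -> : f (x + h *: delta_mx 0 i + h *: delta_mx 0 j) - f (x + h *: delta_mx 0 i)
     - f (x + h *: delta_mx 0 j) + f x = phi (x + h *: delta_mx 0 i) - phi x.
  by rewrite /phi; ring.
rewrite E Dphi expr2.
set u := g (x + (c *: _ + _)) in A2 *; set v := g (x + c *: _) in A1 *.
have -> : (u - v) * h - h * h * pd j g x =
  h * ((u - g x - (c * pd i g x + h * pd j g x)) - (v - g x - c * pd i g x)).
  clearbody u v g; move: (g x) (pd i g x) (pd j g x) => a b b'.
  by ring.
rewrite normrM (ger0_norm (ltW h0)) mulrA [leRHS]mulrC ler_pM2l //.
rewrite (le_trans (ler_normB _ _)) // (le_trans (lerD A2 A1)) //.
have N1 := near_x c h c0h h0h.
have N2 := near_x c 0 c0h i00; rewrite scale0r !addr0 in N2.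
have := ler_pM2l e0 => M; rewrite -(M _ (c + h)) in N1; rewrite -(M _ c) in N2.
have ech : e * c <= e * h by rewrite M ltW.
lra.
Unshelve. all: by end_near. Qed.

(** The second difference is symmetric in i and j, so h^2 times either mixed derivative approximates
    it; two errors of 3 (e / 6) h^2 add up to e h^2. *)
Lemma partial_comm D f x i j : open D -> D x ->
  (forall y, D y -> differentiable f y) ->
  differentiable (pd i f) x -> differentiable (pd j f) x ->
  pd i (pd j f) x = pd j (pd i f) x.
Proof.
move=> oD Dx fD di dj; apply/eqP; rewrite -subr_eq0 -normr_le0.
apply/ler_addgt0Pr => e e0; rewrite add0r.
have e6 : 0 < e / 6 by rewrite divr_gt0.
have HA := @second_difference f x i j D oD Dx fD di _ e6.
have HB := @second_difference f x j i D oD Dx fD dj _ e6.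
have [h [[A B] h0]] := filter_ex (filterI (filterI HA HB) (nbhs_right_gt (0 : R))).
rewrite /= in A B h0.
rewrite (addrAC x) in B.
have h2 : 0 < h ^+ 2 by rewrite exprn_gt0.
rewrite -(ler_pM2l h2) -{1}(gtr0_norm h2) -normrM.
move: A B; set p := pd _ _ _; set q := pd _ _ _.
clearbody p q; move: (h ^+ 2) h2 => k k0; 
move: (f (_ + _ + _)) (f (x + h *: delta_mx 0 i)) (f (x + h *: delta_mx 0 j)) (f x).
move=> a b c d.
rewrite !ler_norml => /andP[A1 A2] /andP[B1 B2].
by apply/andP; split; lra.
Qed.

(** Every iterated derivative of a member of P agrees on D with a member of P. Smoothness is proved
    below by exhibiting a class P that is closed under derivatives. *)
Lemma smooth_coind (P : ('rV[R]_n -> R) -> Prop) D : open D ->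
  (forall f, P f -> forall x, D x -> differentiable f x) ->
  (forall f i, P f -> exists2 g, P g & forall x, D x -> pd i f x = g x) ->
  forall f, P f -> smooth_on D f.
Proof.
move=> oD Pd Pp f Pf s; have [g Pg fg] : exists2 g, P g &
    forall x, D x -> foldr partial f s x = g x.
  elim: s => [|i s [g Pg fg]] /=; first by exists f.
  have [g' Pg' gg'] := Pp g i Pg; exists g' => // x Dx.
  by rewrite -gg' // -pdE; exact: eq_on_partial Dx.
move=> x Dx; apply: (@eq_on_differentiable D g) => //; last exact: Pd.
by move=> y Dy; rewrite fg.
Qed.

Lemma smooth_differentiable D f x : smooth_on D f -> D x -> differentiable f x.
Proof. by move=> /(_ [::] x). Qed.

Lemma smooth_partial D f i : smooth_on D f -> smooth_on D (pd i f).
Proof. by move=> sf s x Dx; have := sf (rcons s i) x Dx; rewrite foldr_rcons pd.unlock. Qed.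

Lemma smooth_sub D D' f : D' `<=` D -> smooth_on D f -> smooth_on D' f.
Proof. by move=> DD sf s x /DD; exact: sf. Qed.

Lemma smooth_cst D (c : R) : smooth_on D (fun=> c).
Proof.
move=> s; suff [c' ->] : exists c', foldr partial (fun=> c) s = (fun=> c' : R).
  by move=> x _; exact: differentiable_cst.
elim: s => [|i s [c' E]] /=; first by exists c.
by exists 0; rewrite E; apply/funext => x; rewrite -pdE partial_cst.
Qed.

(** The base B is for functions whose derivatives are known only in terms of B itself: pullbacks
    under a smooth map in [smooth_comp], solutions of linear systems in [flat_system_solution]. *)
Inductive smooth_closure D (B : ('rV[R]_n -> R) -> Prop) : ('rV[R]_n -> R) -> Prop :=
| sc_base f : B f -> smooth_closure D B f
| sc_smooth f : smooth_on D f -> smooth_closure D B f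
| sc_add f g : smooth_closure D B f -> smooth_closure D B g ->
    smooth_closure D B (fun x => f x + g x)
| sc_mul f g : smooth_closure D B f -> smooth_closure D B g ->
    smooth_closure D B (fun x => f x * g x)
| sc_inv f : smooth_closure D B f -> (forall x, D x -> f x != 0) ->
    smooth_closure D B (fun x => (f x)^-1)
| sc_exp f : smooth_closure D B f -> smooth_closure D B (fun x => expR (f x))
| sc_ln f : smooth_closure D B f -> (forall x, D x -> 0 < f x) ->
    smooth_closure D B (fun x => ln (f x)).

Lemma smooth_closure_smooth D B : open D ->
  (forall b, B b -> forall x, D x -> differentiable b x) ->
  (forall b i, B b -> exists2 g, smooth_closure D B g &
     forall x, D x -> pd i b x = g x) ->
  forall f, smooth_closure D B f -> smooth_on D f.
Proof.
move=> oD Bd Bp.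
have Cd f : smooth_closure D B f -> forall x, D x -> differentiable f x.
  elim=> {f} [f /Bd //|f sf x /(smooth_differentiable sf) //|f g _ df _ dg x Dx
    |f g _ df _ dg x Dx|f _ df f0 x Dx|f _ df x Dx|f _ df f0 x Dx].
  - by apply: differentiableD; [exact: df|exact: dg].
  - by apply: differentiableM; [exact: df|exact: dg].
  - by apply: differentiableV; [exact: df|exact: f0].
  - by apply: comp1_differentiable (df _ Dx); exact: is_derive_expR.
  - by apply: comp1_differentiable (df _ Dx); exact: is_derive1_ln (f0 _ Dx).
apply: smooth_coind => // f i; elim=> {f} [f /Bp //|f sf|f g cf [f' cf' ef] cg [g' cg' eg]
    |f g cf [f' cf' ef] cg [g' cg' eg]|f cf [f' cf' ef] f0|f cf [f' cf' ef]
    |f cf [f' cf' ef] f0].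
- by exists (pd i f) => //; apply: sc_smooth; exact: smooth_partial.
- exists (fun x => f' x + g' x); first exact: sc_add.
  by move=> x Dx; rewrite partialD ?ef ?eg //; exact: Cd.
- exists (fun x => f' x * g x + f x * g' x).
    by apply: sc_add; apply: sc_mul.
  by move=> x Dx; rewrite partialM ?ef ?eg //; exact: Cd.
- exists (fun x => -1 * f' x * ((f x)^-1 * (f x)^-1)).
    apply: sc_mul; last by apply: sc_mul; exact: sc_inv.
    by apply: sc_mul => //; apply: sc_smooth; exact: smooth_cst.
  move=> x Dx; rewrite partialV ?f0 ?ef //; last exact: Cd.
  by rewrite expr2 invfM mulN1r.
- exists (fun x => expR (f x) * f' x); first by apply: sc_mul => //; exact: sc_exp.
  by move=> x Dx; rewrite (@partial_comp1 expR f x (expR (f x))) ?ef //; exact: Cd.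
- exists (fun x => (f x)^-1 * f' x).
    by apply: sc_mul => //; apply: sc_inv => // x Dx; rewrite gt_eqF // f0.
  move=> x Dx; have dl := is_derive1_ln (f0 _ Dx).
  by rewrite (partial_comp1 _ dl) ?ef //; exact: Cd.
Qed.

Section closure.
Variable D : set 'rV[R]_n.
Hypothesis oD : open D.

Let noB := fun _ : 'rV[R]_n -> R => False.

Let C f := smooth_closure D noB f.

Let CS f : C f -> smooth_on D f.
Proof. by apply: smooth_closure_smooth. Qed.

Lemma smoothD f g : smooth_on D f -> smooth_on D g -> smooth_on D (fun x => f x + g x).
Proof. by move=> sf sg; apply: CS; apply: sc_add; apply: sc_smooth. Qed.

Lemma smoothM f g : smooth_on D f -> smooth_on D g -> smooth_on D (fun x => f x * g x).
Proof. by move=> sf sg; apply: CS; apply: sc_mul; apply: sc_smooth. Qed.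

Lemma smooth_eq f g : (forall x, D x -> f x = g x) -> smooth_on D f -> smooth_on D g.
Proof.
move=> fg sf; apply: (@smooth_coind (fun h => exists2 k, smooth_on D k &
    forall x, D x -> k x = h x)) => //.
- move=> h [k sk kh] x Dx; apply: (@eq_on_differentiable D k) => //.
  exact: smooth_differentiable Dx.
- move=> h i [k sk kh]; exists (pd i h) => //; exists (pd i k).
    exact: smooth_partial.
  by move=> x Dx; apply: eq_on_partial Dx.
- by exists f.
Qed.

Lemma smoothN f : smooth_on D f -> smooth_on D (fun x => - f x).
Proof.
move=> sf; apply: (@smooth_eq (fun x => -1 * f x)) => [x _|]; first by rewrite mulN1r.
by apply: smoothM => //; exact: smooth_cst.
Qed.

Lemma smoothB f g : smooth_on D f -> smooth_on D g -> smooth_on D (fun x => f x - g x).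
Proof. by move=> sf sg; apply: smoothD => //; exact: smoothN. Qed.

Lemma smoothV f : smooth_on D f -> (forall x, D x -> f x != 0) ->
  smooth_on D (fun x => (f x)^-1).
Proof. by move=> sf f0; apply: CS; apply: sc_inv => //; apply: sc_smooth. Qed.

Lemma smooth_expR f : smooth_on D f -> smooth_on D (fun x => expR (f x)).
Proof. by move=> sf; apply: CS; apply: sc_exp => //; apply: sc_smooth. Qed.

Lemma smooth_ln f : smooth_on D f -> (forall x, D x -> 0 < f x) ->
  smooth_on D (fun x => ln (f x)).
Proof. by move=> sf f0; apply: CS; apply: sc_ln => //; apply: sc_smooth. Qed.

Lemma smooth_sum (I : Type) (r : seq I) (P : pred I) (h : I -> 'rV[R]_n -> R) :
  (forall k, smooth_on D (h k)) -> smooth_on D (fun y => \sum_(k <- r | P k) h k y).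
Proof.
move=> sh; elim: r => [|k r IH].
  by under eq_fun do rewrite big_nil; exact: smooth_cst.
under eq_fun do rewrite big_cons; case: (P k) => //.
exact: smoothD.
Qed.

Lemma smooth_prod (I : Type) (r : seq I) (P : pred I) (h : I -> 'rV[R]_n -> R) :
  (forall k, smooth_on D (h k)) -> smooth_on D (fun y => \prod_(k <- r | P k) h k y).
Proof.
move=> sh; elim: r => [|k r IH].
  by under eq_fun do rewrite big_nil; exact: smooth_cst.
under eq_fun do rewrite big_cons; case: (P k) => //.
exact: smoothM.
Qed.

Lemma smooth_det m (A : 'rV[R]_n -> 'M[R]_m) :
  (forall i j, smooth_on D (fun x => A x i j)) -> smooth_on D (fun x => \det (A x)).
Proof.
move=> sA; rewrite /determinant; apply: smooth_sum => s.
by apply: smoothM; [exact: smooth_cst|apply: smooth_prod].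
Qed.

Lemma smooth_invmx m (A : 'rV[R]_n -> 'M[R]_m) :
  (forall i j, smooth_on D (fun x => A x i j)) ->
  (forall x, D x -> A x \in unitmx) ->
  forall i j, smooth_on D (fun x => invmx (A x) i j).
Proof.
move=> sA uA i j.
apply: (@smooth_eq (fun x => (\det (A x))^-1 * (\adj (A x)) i j)).
  by move=> x Dx; rewrite /invmx uA // [RHS]mxE.
apply: smoothM.
  by apply: smoothV => [|x /uA]; [exact: smooth_det|rewrite unitmxE unitfE].
under eq_fun do rewrite mxE.
apply: smoothM; first exact: smooth_cst.
by apply: smooth_det => k l; under eq_fun do rewrite !mxE; exact: sA.
Qed.

Lemma smooth_partial_comm f x i j : smooth_on D f -> D x ->
  pd i (pd j f) x = pd j (pd i f) x.
Proof.
move=> sf Dx; apply: (partial_comm oD Dx).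
- by move=> y; exact: smooth_differentiable.
- by apply: smooth_differentiable Dx; exact: smooth_partial.
- by apply: smooth_differentiable Dx; exact: smooth_partial.
Qed.

End closure.

End smooth_functions.

Section chain_rule.
Context {R : realType} {n m : nat}.
Implicit Types (tau : 'rV[R]_n -> 'rV[R]_m) (f : 'rV[R]_m -> R).

Lemma rV_differentiable tau x :
  (forall k, differentiable (fun y => tau y 0 k) x) -> differentiable tau x.
Proof.
move=> dt; have -> : tau = \sum_k (fun y => tau y 0 k *: (delta_mx 0 k : 'rV[R]_m)).
  by apply/funext => y; rewrite fct_sumE [LHS]row_sum_delta.
by apply: differentiable_sum => k; exact: differentiableZl.
Qed.

Lemma chain_differentiable tau f x :
  (forall k, differentiable (fun y => tau y 0 k) x) -> differentiable f (tau x) ->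
  differentiable (fun y => f (tau y)) x.
Proof.
by move=> dt df; apply: (@differentiable_comp _ _ _ _ tau f) => //; exact: rV_differentiable.
Qed.

Lemma partial_chain tau f x i :
  (forall k, differentiable (fun y => tau y 0 k) x) -> differentiable f (tau x) ->
  pd i (fun y => f (tau y)) x =
  \sum_k pd i (fun y => tau y 0 k) x * pd k f (tau x).
Proof.
move=> dt df; have dtau := rV_differentiable dt.
rewrite !pd.unlock /partial deriveE; last exact: (@differentiable_comp _ _ _ _ tau f).
rewrite (@diff_comp _ _ _ _ tau f) //= diff_partial //.
apply: eq_bigr => k _; rewrite mulrC pdE; congr (_ * _).
rewrite -deriveE // derive_mx; last exact: diff_derivable.
by rewrite mxE.
Qed.

Lemma smooth_comp (D : set 'rV[R]_n) (D' : set 'rV[R]_m) tau f : open D ->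
  (forall k, smooth_on D (fun y => tau y 0 k)) ->
  (forall x, D x -> D' (tau x)) -> smooth_on D' f ->
  smooth_on D (fun y => f (tau y)).
Proof.
move=> oD st DD' sf.
pose B h := exists2 g, smooth_on D' g & h = (fun y => g (tau y)).
apply: (@smooth_closure_smooth _ _ D B) => //.
- move=> _ [g sg ->] x Dx; apply: chain_differentiable.
    by move=> k; exact: smooth_differentiable (st k) Dx.
  exact: smooth_differentiable sg (DD' _ Dx).
- move=> _ i [g sg ->].
  exists (fun x => \sum_k pd i (fun y => tau y 0 k) x * pd k g (tau x)).
    elim: (index_enum _) => [|k r IH].
      by under eq_fun do rewrite big_nil; apply: sc_smooth; exact: smooth_cst.
    under eq_fun do rewrite big_cons; apply: sc_add => //.
    apply: sc_mul; first by apply: sc_smooth; exact: smooth_partial.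
    by apply: sc_base; exists (pd k g) => //; exact: smooth_partial.
  move=> x Dx; apply: partial_chain; last exact: smooth_differentiable sg (DD' _ Dx).
  by move=> k; exact: smooth_differentiable (st k) Dx.
- by apply: sc_base; exists f.
Qed.

End chain_rule.

(** * Local Riemannian geometry *)

(* Locked, as unification would otherwise unfold matrix entries. *)
HB.lock Definition dmx (R : realType) (n p q : nat) (i : 'I_n)
    (A : 'rV[R]_n -> 'M[R]_(p, q)) (x : 'rV[R]_n) : 'M[R]_(p, q) :=
  \matrix_(k, l) pd i (fun y => A y k l) x.

(* Connection and curvature matrices: om G i has entries (k, l) |-> Gamma^l_ik, and
   cur G i j has entries (k, l) |-> R_ijk^l. *)
HB.lock Definition om (R : realType) (n : nat) (G : 'rV[R]_n -> 'M[R]_n) (i : 'I_n)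
    (x : 'rV[R]_n) : 'M[R]_n :=
  \matrix_(k, l) christoffel G l i k x.

HB.lock Definition cur (R : realType) (n : nat) (G : 'rV[R]_n -> 'M[R]_n) (i j : 'I_n)
    (x : 'rV[R]_n) : 'M[R]_n :=
  dmx i (om G j) x - dmx j (om G i) x + om G j x *m om G i x - om G i x *m om G j x.

HB.lock Definition iG (R : realType) (n : nat) (G : 'rV[R]_n -> 'M[R]_n)
    (x : 'rV[R]_n) : 'M[R]_n := ginv G x.

Lemma iGE (R : realType) (n : nat) (G : 'rV[R]_n -> 'M[R]_n) x : iG G x = ginv G x.
Proof. by rewrite iG.unlock. Qed.

Section matrix_derivative.
Context {R : realType} {n : nat}.

Definition mxsmooth p q (D : set 'rV[R]_n) (A : 'rV[R]_n -> 'M[R]_(p, q)) :=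
  forall k l, smooth_on D (fun y => A y k l).

Lemma dmxE p q i (A : 'rV[R]_n -> 'M[R]_(p, q)) x k l :
  dmx i A x k l = pd i (fun y => A y k l) x.
Proof. by rewrite dmx.unlock mxE. Qed.

Lemma addmxE p q (A B : 'M[R]_(p, q)) i j : (A + B) i j = A i j + B i j.
Proof. by rewrite mxE. Qed.

Lemma oppmxE p q (A : 'M[R]_(p, q)) i j : (- A) i j = - A i j.
Proof. by rewrite mxE. Qed.

Lemma scalemxE p q c (A : 'M[R]_(p, q)) i j : (c *: A) i j = c * A i j.
Proof. by rewrite mxE. Qed.

Lemma trmxE p q (A : 'M[R]_(p, q)) i j : A^T i j = A j i.
Proof. by rewrite mxE. Qed.

Lemma mxmulE p q r (A : 'M[R]_(p, q)) (B : 'M[R]_(q, r)) i j :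
  (A *m B) i j = \sum_k A i k * B k j.
Proof. by rewrite mxE. Qed.

Lemma zeromxE p q i j : (0 : 'M[R]_(p, q)) i j = 0.
Proof. by rewrite mxE. Qed.

Lemma trmxZ p q c (A : 'M[R]_(p, q)) : (c *: A)^T = c *: A^T.
Proof. by rewrite linearZ. Qed.

Lemma trmxD p q (A B : 'M[R]_(p, q)) : (A + B)^T = A^T + B^T.
Proof. by rewrite linearD. Qed.

Lemma trmxN p q (A : 'M[R]_(p, q)) : (- A)^T = - A^T.
Proof. by rewrite linearN. Qed.

Variable D : set 'rV[R]_n.
Hypothesis oD : open D.

Lemma mxsmooth_differentiable p q (A : 'rV[R]_n -> 'M[R]_(p, q)) x k l :
  mxsmooth D A -> D x -> differentiable (fun y => A y k l) x.
Proof. by move=> sA Dx; exact: smooth_differentiable (sA k l) Dx. Qed.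
Hint Resolve mxsmooth_differentiable : core.

Lemma mxsmooth_dmx p q i (A : 'rV[R]_n -> 'M[R]_(p, q)) :
  mxsmooth D A -> mxsmooth D (dmx i A).
Proof. by move=> sA k l; under eq_fun do rewrite dmxE; exact: smooth_partial. Qed.

Lemma mxsmoothM p q r (A : 'rV[R]_n -> 'M[R]_(p, q)) (B : 'rV[R]_n -> 'M[R]_(q, r)) :
  mxsmooth D A -> mxsmooth D B -> mxsmooth D (fun x => A x *m B x).
Proof.
move=> sA sB k l; under eq_fun do rewrite mxE.
by apply: smooth_sum => // s; apply: smoothM.
Qed.

Lemma mxsmoothD p q (A B : 'rV[R]_n -> 'M[R]_(p, q)) :
  mxsmooth D A -> mxsmooth D B -> mxsmooth D (fun x => A x + B x).
Proof. by move=> sA sB k l; under eq_fun do rewrite mxE; exact: smoothD. Qed.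

Lemma mxsmoothN p q (A : 'rV[R]_n -> 'M[R]_(p, q)) :
  mxsmooth D A -> mxsmooth D (fun x => - A x).
Proof. by move=> sA k l; under eq_fun do rewrite mxE; exact: smoothN. Qed.

Lemma mxsmooth_tr p q (A : 'rV[R]_n -> 'M[R]_(p, q)) :
  mxsmooth D A -> mxsmooth D (fun x => (A x)^T).
Proof. by move=> sA k l; under eq_fun do rewrite mxE; exact: sA. Qed.

Lemma mxsmoothZ p q (f : 'rV[R]_n -> R) (A : 'rV[R]_n -> 'M[R]_(p, q)) :
  smooth_on D f -> mxsmooth D A -> mxsmooth D (fun x => f x *: A x).
Proof. by move=> sf sA k l; under eq_fun do rewrite mxE; exact: smoothM. Qed.

Lemma eq_on_dmx p q i (A B : 'rV[R]_n -> 'M[R]_(p, q)) x :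
  (forall y, D y -> A y = B y) -> D x -> dmx i A x = dmx i B x.
Proof.
move=> AB Dx; apply/matrixP => k l; rewrite !dmxE.
by apply: eq_on_partial Dx => // y Dy; rewrite AB.
Qed.

Lemma dmxM p q r i (A : 'rV[R]_n -> 'M[R]_(p, q)) (B : 'rV[R]_n -> 'M[R]_(q, r)) x :
  mxsmooth D A -> mxsmooth D B -> D x ->
  dmx i (fun y => A y *m B y) x = dmx i A x *m B x + A x *m dmx i B x.
Proof.
move=> sA sB Dx; apply/matrixP => k l; rewrite addmxE !mxmulE dmxE -big_split /=.
under eq_fun do rewrite mxmulE.
rewrite partial_sum => [|s]; last by apply: differentiableM; eauto.
by apply: eq_bigr => s _; rewrite partialM ?dmxE //; eauto.
Qed.

Lemma dmxD p q i (A B : 'rV[R]_n -> 'M[R]_(p, q)) x :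
  mxsmooth D A -> mxsmooth D B -> D x ->
  dmx i (fun y => A y + B y) x = dmx i A x + dmx i B x.
Proof.
move=> sA sB Dx; apply/matrixP => k l; rewrite addmxE !dmxE.
by under eq_fun do rewrite addmxE; rewrite partialD //; eauto.
Qed.

Lemma dmxN p q i (A : 'rV[R]_n -> 'M[R]_(p, q)) x :
  mxsmooth D A -> D x -> dmx i (fun y => - A y) x = - dmx i A x.
Proof.
move=> sA Dx; apply/matrixP => k l; rewrite oppmxE !dmxE.
by under eq_fun do rewrite oppmxE; rewrite partialN //; eauto.
Qed.

Lemma dmxZ p q i (f : 'rV[R]_n -> R) (A : 'rV[R]_n -> 'M[R]_(p, q)) x :
  smooth_on D f -> mxsmooth D A -> D x ->
  dmx i (fun y => f y *: A y) x = pd i f x *: A x + f x *: dmx i A x.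
Proof.
move=> sf sA Dx; apply/matrixP => k l; rewrite addmxE !scalemxE !dmxE.
under eq_fun do rewrite scalemxE; rewrite partialM //; eauto.
exact: smooth_differentiable Dx.
Qed.

Lemma dmx_tr p q i (A : 'rV[R]_n -> 'M[R]_(p, q)) x :
  dmx i (fun y => (A y)^T) x = (dmx i A x)^T.
Proof. by apply/matrixP => k l; rewrite trmxE !dmxE; under eq_fun do rewrite trmxE. Qed.

Lemma dmx_cst p q i (A : 'M[R]_(p, q)) (x : 'rV[R]_n) : dmx i (fun=> A) x = 0.
Proof. by apply/matrixP => k l; rewrite dmxE mxE partial_cst. Qed.

Lemma dmx_comm p q i j (A : 'rV[R]_n -> 'M[R]_(p, q)) x : mxsmooth D A -> D x ->
  dmx i (dmx j A) x = dmx j (dmx i A) x.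
Proof.
move=> sA Dx; apply/matrixP => k l; rewrite !dmxE.
under eq_fun do rewrite dmxE; under [in RHS]eq_fun do rewrite dmxE.
exact: (smooth_partial_comm oD).
Qed.

End matrix_derivative.

Ltac mxring :=
  rewrite ?(trmxD, trmxN, mulmxDl, mulmxDr, mulmxN, mulNmx, trmx_mul, trmxK, mulmxA, opprK);
  apply/matrixP => ? ?; rewrite ?(addmxE, oppmxE, zeromxE); ring.

Record local_metric (R : realType) n (D : set 'rV[R]_n) (G : 'rV[R]_n -> 'M[R]_n) := {
  lm_open : open D;
  lm_smooth : mxsmooth D G;
  lm_sym : forall x, D x -> (G x)^T = G x;
  lm_pos : forall x, D x -> forall v : 'rV[R]_n, v != 0 -> 0 < (v *m G x *m v^T) 0 0 }.

Section curvature.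
Context {R : realType} {n : nat}.
Variables (D : set 'rV[R]_n) (G : 'rV[R]_n -> 'M[R]_n).
Hypothesis lm : local_metric D G.

Let oD := lm_open lm.
Let sG := lm_smooth lm.

Lemma lm_unit x : D x -> G x \in unitmx.
Proof.
move=> Dx; rewrite -row_free_unit -kermx_eq0; apply/eqP/row_matrixP => i.
rewrite row0; apply/eqP/negPn/negP => v0.
have := lm_pos lm Dx v0; rewrite -row_mul mulmx_ker.
by rewrite row0 mul0mx mxE ltxx.
Qed.

Lemma lm_symE x i j : D x -> G x i j = G x j i.
Proof. by move=> Dx; rewrite -{1}(lm_sym lm Dx) mxE. Qed.

Lemma ginv_smooth : mxsmooth D (iG G).
Proof.
move=> i j; under eq_fun do rewrite iG.unlock.
by apply: smooth_invmx => // x; exact: lm_unit.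
Qed.

Lemma ginv_sym x : D x -> (iG G x)^T = iG G x.
Proof. by move=> Dx; rewrite iG.unlock /ginv trmx_inv (lm_sym lm). Qed.

Lemma ginv_symE x i j : D x -> iG G x i j = iG G x j i.
Proof. by move=> Dx; rewrite -{1}(ginv_sym Dx) mxE. Qed.

Lemma mulVG x : D x -> iG G x *m G x = 1%:M.
Proof. by move=> Dx; rewrite iG.unlock mulVmx // lm_unit. Qed.

Lemma mulGV x : D x -> G x *m iG G x = 1%:M.
Proof. by move=> Dx; rewrite iG.unlock mulmxV // lm_unit. Qed.

Local Notation om := (om G).
Local Notation cur := (cur G).

Lemma omE i k l x : om i x k l = christoffel G l i k x.
Proof. by rewrite om.unlock mxE. Qed.

Lemma om_sym i k l x : D x -> om i x k l = om k x i l.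
Proof.
move=> Dx; rewrite !omE /christoffel; congr (_ * _); apply: eq_bigr => s _; congr (_ * _).
rewrite [partial i _ _ + _]addrC; congr (_ - _).
by rewrite -!pdE; apply: eq_on_partial Dx => // y Dy; exact: lm_symE.
Qed.

Lemma dG_sym i j k x : D x -> dmx i G x j k = dmx i G x k j.
Proof.
move=> Dx; rewrite !dmxE; apply: eq_on_partial Dx => // y Dy; exact: lm_symE.
Qed.

Lemma om_low i x k m : D x ->
  (om i x *m G x) k m = 2^-1 * (dmx i G x k m + dmx k G x i m - dmx m G x i k).
Proof.
move=> Dx; pose K : 'M[R]_n :=
  \matrix_(k, m) (2^-1 * (dmx i G x k m + dmx k G x i m - dmx m G x i k)).
suff -> : om i x = K *m iG G x by rewrite -mulmxA mulVG // mulmx1 mxE.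
apply/matrixP => a b; rewrite omE mxmulE /christoffel mulr_sumr; apply: eq_bigr => s _.
rewrite -!pdE -iGE.
rewrite mxE !dmxE (ginv_symE s b) //.
move: (iG _ _ _ _) (pd _ _ _) (pd _ _ _) (pd _ _ _) => *; ring.
Qed.

Lemma om_compat i x : D x -> dmx i G x = om i x *m G x + G x *m (om i x)^T.
Proof.
move=> Dx; rewrite -[X in X *m _^T](lm_sym lm Dx) -trmx_mul.
apply/matrixP => k m; rewrite addmxE trmxE !om_low //.
rewrite (dG_sym i m k) //.
move: (dmx i G x k m) (dmx k G x i m) (dmx m G x i k) => a b c.
by field.
Qed.

(** The Koszul argument: symmetry and compatibility with G determine the connection. The laws for
    conformal changes and for changes of coordinates are obtained below by verifying these two
    properties of a candidate. *)
Lemma om_uniq (W : 'I_n -> 'M[R]_n) x : D x ->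
  (forall i k l, W i k l = W k i l) ->
  (forall i, dmx i G x = W i *m G x + G x *m (W i)^T) -> forall i, W i = om i x.
Proof.
move=> Dx Ws Wc i; apply: (can_inj (mulmxK (lm_unit Dx))).
apply/matrixP => k m; rewrite om_low //.
have L j a b : dmx j G x a b = (W j *m G x) a b + (W j *m G x) b a.
  by rewrite Wc -[X in X *m _^T](lm_sym lm Dx) -trmx_mul addmxE trmxE.
have Ls j a b : (W j *m G x) a b = (W a *m G x) j b.
  by rewrite !mxmulE; apply: eq_bigr => s _; rewrite Ws.
rewrite !L (Ls m i k) (Ls m k i) (Ls k i m) (Ls k m i).
rewrite (Ls i m k).
move: (W i *m G x) (W m *m G x) => A B; move: (A k m) (B i k) (B k i) => *; by field.
Qed.

Lemma om_smooth i : mxsmooth D (om i).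
Proof.
move=> k l; under eq_fun do rewrite omE /christoffel.
apply: smoothM => //; first exact: smooth_cst.
apply: smooth_sum => // s; apply: smoothM => //.
  by have := ginv_smooth l s; rewrite iG.unlock.
under eq_fun do rewrite -!pdE.
by apply: smoothB => //; [apply: smoothD => //|]; apply: smooth_partial; exact: sG.
Qed.

Lemma curE i j k l x : cur i j x k l = riemann_up G i j k l x.
Proof.
rewrite cur.unlock /riemann_up !(addmxE, oppmxE) !dmxE -!pdE -!addrA.
congr (_ + _); first by under eq_fun do rewrite omE.
congr (_ + _); first by under eq_fun do rewrite omE.
rewrite !mxmulE -sumrB; apply: eq_bigr => s _.
by rewrite !omE mulrC; congr (_ - _); rewrite mulrC.
Qed.

Definition Rm i j x : 'M[R]_n := cur i j x *m G x.

Lemma RmE i j k l x : Rm i j x k l = riemann G i j k l x.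
Proof. by rewrite /Rm mxmulE; apply: eq_bigr => s _; rewrite curE. Qed.

Lemma cur_skew i j x : cur i j x = - cur j i x.
Proof.
rewrite cur.unlock; move: (dmx _ _ _) (dmx _ _ _) (_ *m _) (_ *m _) => a b c d.
by apply/matrixP => k l; rewrite !(addmxE, oppmxE); ring.
Qed.

Lemma cur_smooth i j : mxsmooth D (cur i j).
Proof.
rewrite cur.unlock; apply: mxsmoothD => //; last first.
  by apply: mxsmoothN => //; apply: mxsmoothM => //; exact: om_smooth.
apply: mxsmoothD => //; last by apply: mxsmoothM => //; exact: om_smooth.
by apply: mxsmoothD => //; [|apply: mxsmoothN => //]; apply: mxsmooth_dmx; exact: om_smooth.
Qed.

Lemma dom_sym m i k l x : D x -> dmx m (om i) x k l = dmx m (om k) x i l.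
Proof.
by move=> Dx; rewrite !dmxE; apply: eq_on_partial Dx => // y Dy; exact: om_sym.
Qed.

Lemma bianchi1 i j k l x : D x -> cur i j x k l + cur j k x i l + cur k i x j l = 0.
Proof.
move=> Dx; rewrite cur.unlock !(addmxE, oppmxE).
have Q a b c : (om a x *m om b x) c l = (om c x *m om b x) a l.
  by rewrite !mxmulE; apply: eq_bigr => s _; rewrite om_sym.
rewrite (dom_sym j i k) // (dom_sym i j k) // (dom_sym k j i) //.
by rewrite (Q j i k) (Q i j k) (Q j k i); ring.
Qed.

(** The mixed second derivatives of P agree, and each is expanded by using the first-order equation
    twice. For P = G this is the skew-symmetry of R in its last two indices; for other parallel
    tensors it restricts the curvature. *)
Lemma parallel_cur (P : 'rV[R]_n -> 'M[R]_n) : mxsmooth D P ->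
  (forall i x, D x -> dmx i P x = om i x *m P x + P x *m (om i x)^T) ->
  forall i j x, D x -> cur i j x *m P x + P x *m (cur i j x)^T = 0.
Proof.
move=> sP dP i j x Dx.
have dd a b : dmx a (dmx b P) x = dmx a (om b) x *m P x + om b x *m dmx a P x
    + (dmx a P x *m (om b x)^T + P x *m (dmx a (om b) x)^T).
  rewrite (@eq_on_dmx _ _ D oD _ _ a _ (fun y => om b y *m P y + P y *m (om b y)^T)) //.
    rewrite (@dmxD _ _ D); [|by apply: mxsmoothM => //; exact: om_smooth
      |by apply: mxsmoothM => //; apply: mxsmooth_tr; exact: om_smooth|by []].
    rewrite (@dmxM _ _ D) //; last exact: om_smooth.
    rewrite (@dmxM _ _ D) //; last by apply: mxsmooth_tr; exact: om_smooth.
    by rewrite dmx_tr.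
  by move=> y Dy; exact: dP.
have /eqP := dmx_comm oD i j sP Dx; rewrite -subr_eq0 => /eqP; rewrite !dd !dP // => H.
rewrite -[RHS]H cur.unlock; mxring.
Qed.

Lemma Rm_skew i j x k l : D x -> Rm i j x k l = - Rm i j x l k.
Proof.
move=> Dx; have := parallel_cur sG om_compat i j Dx.
rewrite -[X in X *m _^T](lm_sym lm Dx) -trmx_mul -/(Rm i j x).
move=> /matrixP/(_ k l); rewrite addmxE trmxE [RHS]mxE => /eqP.
by rewrite addr_eq0 => /eqP.
Qed.

End curvature.

(* ncur m i j is the matrix, in the last two indices, of nabla_m R_ijk^l. *)
HB.lock Definition ncur (R : realType) (n : nat) (G : 'rV[R]_n -> 'M[R]_n) (m i j : 'I_n)
    (x : 'rV[R]_n) : 'M[R]_n :=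
  dmx m (cur G i j) x - om G m x *m cur G i j x + cur G i j x *m om G m x
  - \sum_s (om G m x i s *: cur G s j x + om G m x j s *: cur G i s x).

HB.lock Definition ric (R : realType) (n : nat) (G : 'rV[R]_n -> 'M[R]_n)
    (x : 'rV[R]_n) : 'M[R]_n :=
  \matrix_(j, k) ricci G j k x.

(** Covariant derivative of a tensor with two lower indices, as a matrix in these indices. *)
Definition Dc (R : realType) (n : nat) (G : 'rV[R]_n -> 'M[R]_n) (i : 'I_n)
    (E : 'rV[R]_n -> 'M[R]_n) (x : 'rV[R]_n) : 'M[R]_n :=
  dmx i E x - om G i x *m E x - E x *m (om G i x)^T.

(** The first Bianchi identity is used for the four cyclic rotations of the indices; once components
    are identified up to sign, the claim is a linear combination of these. *)
Lemma curvature_pair (R : realType) n (T : 'I_n -> 'I_n -> 'I_n -> 'I_n -> R) :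
  (forall a b c d, T a b c d = - T b a c d) ->
  (forall a b c d, T a b c d = - T a b d c) ->
  (forall a b c d, T a b c d + T b c a d + T c a b d = 0) ->
  forall i j k l, T i j k l = T k l i j.
Proof.
move=> s12 s34 b1 i j k l.
have := b1 i j k l; have := b1 j k l i; have := b1 k l i j; have := b1 l i j k.
have := s34 j k i l; have := s12 k i j l; have := s34 k l j i; have := s34 i k l j.
have := s12 l i j k; have := s34 i l j k; have := s34 i j l k; have := s12 j l i k.
have := s34 l j i k; have := s12 l i k j; have := s34 l i j k.
move: (T i j k l) (T j k i l) (T k i j l) (T j k l i) (T k l j i) (T l j k i)
  (T k l i j) (T l i k j) (T i k l j) (T l i j k) (T i j l k) (T j l i k)
  (T i k j l) (T i l j k) (T i l k j) (T l j i k).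
move=> *; lra.
Qed.

(** * Bianchi identities and their contractions *)

Section bianchi.
Context {R : realType} {n : nat}.
Variables (D : set 'rV[R]_n) (G : 'rV[R]_n -> 'M[R]_n).
Hypothesis lm : local_metric D G.

Let oD := lm_open lm.
Let sG := lm_smooth lm.
Let som := om_smooth lm.
Let scur := cur_smooth lm.
Local Notation om := (om G).
Local Notation cur := (cur G).
Local Notation ncur := (ncur G).
Local Notation Dc := (Dc G).

Lemma Rm_pair i j k l x : D x -> Rm G i j x k l = Rm G k l x i j.
Proof.
move=> Dx.
have s34 a b c d : Rm G a b x c d = - Rm G a b x d c by exact: (Rm_skew lm).
have s12 a b c d : Rm G a b x c d = - Rm G b a x c d.
  by rewrite /Rm cur_skew mulNmx mxE.
have b1 a b c d : Rm G a b x c d + Rm G b c x a d + Rm G c a x b d = 0.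
  rewrite /Rm !mxmulE -!big_split /= big1 // => s _.
  by rewrite -!mulrDl (bianchi1 lm) // mul0r.
exact: (@curvature_pair _ _ (fun a b c d => Rm G a b x c d)).
Qed.

Lemma ricE x j k : ric G x j k = \sum_i cur i j x k i.
Proof. by rewrite ric.unlock mxE; apply: eq_bigr => i _; rewrite curE. Qed.

Lemma curG i j x : D x -> cur i j x = Rm G i j x *m iG G x.
Proof. by move=> Dx; rewrite /Rm -mulmxA (mulGV lm) // mulmx1. Qed.

Lemma ric_low x j k : D x -> ric G x j k = \sum_i \sum_l iG G x i l * Rm G i j x k l.
Proof.
move=> Dx; rewrite ricE; apply: eq_bigr => i _; rewrite curG // mxmulE.
by apply: eq_bigr => l _; rewrite mulrC (ginv_symE lm).
Qed.

Lemma ric_sym x j k : D x -> ric G x j k = ric G x k j.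
Proof.
move=> Dx; rewrite !ric_low // exchange_big; apply: eq_bigr => l _.
apply: eq_bigr => i _; rewrite (ginv_symE lm) //; congr (_ * _).
by rewrite Rm_pair // (Rm_skew lm) // {1}/Rm cur_skew mulNmx oppmxE opprK.
Qed.

Lemma ric_smooth : mxsmooth D (ric G).
Proof.
move=> j k; under eq_fun do rewrite ricE.
by apply: smooth_sum => // i; exact: scur.
Qed.

Lemma dcurE m i j x : D x -> dmx m (cur i j) x =
  dmx m (dmx i (om j)) x - dmx m (dmx j (om i)) x
  + (dmx m (om j) x *m om i x + om j x *m dmx m (om i) x)
  - (dmx m (om i) x *m om j x + om i x *m dmx m (om j) x).
Proof.
move=> Dx; rewrite (@eq_on_dmx _ _ D oD _ _ m (cur i j) (fun y => dmx i (om j) y - dmx j (om i) y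
  + om j y *m om i y - om i y *m om j y)) //; last by rewrite cur.unlock.
have s1 a b : mxsmooth D (dmx a (om b)) by apply: mxsmooth_dmx; exact: som.
have s2 a b : mxsmooth D (fun y => om a y *m om b y) by exact: mxsmoothM.
have s3 a b : mxsmooth D (fun y => - dmx a (om b) y) by exact: mxsmoothN.
have s4 : mxsmooth D (fun y => dmx i (om j) y - dmx j (om i) y) by exact: mxsmoothD.
have s5 : mxsmooth D (fun y => dmx i (om j) y - dmx j (om i) y + om j y *m om i y).
  exact: mxsmoothD.
have s6 : mxsmooth D (fun y => - (om i y *m om j y)) by exact: mxsmoothN.
rewrite (dmxD m s5 s6) // (dmxD m s4 (s2 j i)) // (dmxD m (s1 i j) (s3 j i)) //.
by rewrite (dmxN m (s1 j i)) // (dmxN m (s2 i j)) // !(dmxM m (som _) (som _)).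
Qed.

(** Mixed second derivatives of the connection matrices cancel in pairs, and the rest is algebra in
    matrices. The Christoffel terms for the indices i, j, m of the curvature form are left out here;
    they cancel in [bianchi2] because the connection is torsion-free. *)
Lemma bianchi2_cur m i j x : D x ->
  (dmx m (cur i j) x - om m x *m cur i j x + cur i j x *m om m x)
  + (dmx i (cur j m) x - om i x *m cur j m x + cur j m x *m om i x)
  + (dmx j (cur m i) x - om j x *m cur m i x + cur m i x *m om j x) = 0.
Proof.
move=> Dx; rewrite !dcurE //.
rewrite (dmx_comm oD j m) // (dmx_comm oD i m) // (dmx_comm oD j i) //.
rewrite cur.unlock.
move: (dmx _ (dmx _ _) x) (dmx _ (dmx _ _) x) (dmx _ (dmx _ _) x) => a b c.
move: (dmx m (om i) x) (dmx m (om j) x) (dmx i (om m) x) (dmx i (om j) x)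
  (dmx j (om m) x) (dmx j (om i) x) => mi mj im ij jm ji.
move: (om m x) (om i x) (om j x) => M I J; mxring.
Qed.

Lemma bianchi2 m i j x : D x -> ncur m i j x + ncur i j m x + ncur j m i x = 0.
Proof.
move=> Dx; rewrite ncur.unlock -[RHS](bianchi2_cur m i j Dx).
set A := _ + _ *m om m x; set B := _ + _ *m om i x; set C := _ + _ *m om j x.
set a := \sum_s _; set b := \sum_s _; set c := \sum_s _.
suff : a + b + c = 0.
  move=> abc; rewrite -[RHS]subr0 -abc; clear; apply/matrixP => ? ?.
  by rewrite !(addmxE, oppmxE); ring.
rewrite -!big_split big1 //= => s _.
rewrite (om_sym lm i m s) // (om_sym lm j m s) // (om_sym lm j i s) //.
rewrite (cur_skew _ s j) (cur_skew _ s m) (cur_skew _ s i).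
by clear; apply/matrixP => ? ?; rewrite !(addmxE, scalemxE, oppmxE) mxE; ring.
Qed.

Lemma nabla_riemannE m i j k l x : D x ->
  nabla_riemann G m i j k l x = (ncur m i j x *m G x) k l.
Proof.
move=> Dx; rewrite /nabla_riemann -pdE.
have -> : riemann G i j k l = (fun y => (cur i j y *m G y) k l).
  by apply/funext => y; rewrite -RmE.
rewrite -dmxE (dmxM m (scur i j) sG) // (om_compat lm) //.
rewrite !big_split /=.
have e3 : \sum_s christoffel G s m k x * riemann G i j s l x = (om m x *m Rm G i j x) k l.
  by rewrite mxmulE; apply: eq_bigr => s _; rewrite omE RmE.
have e4 : \sum_s christoffel G s m l x * riemann G i j k s x =
    (Rm G i j x *m (om m x)^T) k l.
  by rewrite mxmulE; apply: eq_bigr => s _; rewrite trmxE omE RmE mulrC.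
have e12 : \sum_s christoffel G s m i x * riemann G s j k l x +
    \sum_s christoffel G s m j x * riemann G i s k l x =
    ((\sum_s (om m x i s *: cur s j x + om m x j s *: cur i s x)) *m G x) k l.
  rewrite -big_split mulmx_suml summxE; apply: eq_bigr => s _.
  by rewrite mulmxDl -!scalemxAl addmxE !scalemxE !omE -!RmE.
rewrite -/Rm e12 e3 e4; clear e12 e3 e4; rewrite ncur.unlock.
set S := \sum_s _; rewrite /Rm.
rewrite -!(addmxE, oppmxE); congr (fun_of_matrix _ k l).
move: (dmx _ _ _) (om m x) (cur i j x) (G x) => a b c d; mxring.
Qed.

Lemma ncur_low m i j k x : D x ->
  \sum_l iG G x m l * (ncur m i j x *m G x) k l = ncur m i j x k m.
Proof.
move=> Dx; have -> : ncur m i j x k m = (ncur m i j x *m G x *m iG G x) k m.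
  by rewrite -mulmxA (mulGV lm) // mulmx1.
by rewrite [RHS]mxmulE; apply: eq_bigr => l _; rewrite mulrC (ginv_symE lm).
Qed.

Lemma div_riemannE i j k x : D x -> div_riemann G i j k x = \sum_m ncur m i j x k m.
Proof.
move=> Dx; apply: eq_bigr => m _; rewrite -ncur_low //; apply: eq_bigr => l _.
by rewrite nabla_riemannE // iGE.
Qed.

Lemma ncur_skew12 m i j x : D x -> ncur m i j x = - ncur m j i x.
Proof.
move=> Dx; rewrite ncur.unlock.
have -> : dmx m (cur i j) x = - dmx m (cur j i) x.
  rewrite -(@dmxN _ _ D) //; congr (dmx _ _ _).
  by apply/funext => y; exact: cur_skew.
rewrite [cur i j x]cur_skew mulmxN mulNmx.
have -> : \sum_s (om m x i s *: cur s j x + om m x j s *: cur i s x) =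
  - \sum_s (om m x j s *: cur s i x + om m x i s *: cur j s x).
  rewrite -sumrN; apply: eq_bigr => s _.
  by rewrite addrC opprD -!scalerN -!cur_skew.
by rewrite !opprD !opprK.
Qed.

(** Contraction commutes with nabla: the two connection terms for the contracted pair of an upper
    and a lower index cancel, by [H]. *)
Lemma ncur_ric j i k x : D x -> \sum_m ncur j m i x k m = Dc j (ric G) x i k.
Proof.
move=> Dx; rewrite /Dc !(addmxE, oppmxE) dmxE.
have -> : (fun y => ric G y i k) = (fun y => \sum_m cur m i y k m).
  by apply/funext => y; rewrite ricE.
rewrite partial_sum => [|m]; last exact: mxsmooth_differentiable (scur m i) Dx.
have -> : (om j x *m ric G x) i k = \sum_m \sum_s om j x i s * cur m s x k m.
  rewrite exchange_big mxmulE; apply: eq_bigr => s _ /=.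
  by rewrite ricE mulr_sumr.
have -> : (ric G x *m (om j x)^T) i k = \sum_m (om j x *m cur m i x) k m.
  rewrite mxmulE; under eq_bigr do rewrite ricE mulr_suml.
  rewrite exchange_big; apply: eq_bigr => m _ /=; rewrite mxmulE.
  by apply: eq_bigr => s _; rewrite trmxE mulrC.
have H : \sum_m (cur m i x *m om j x) k m = \sum_m \sum_s om j x m s * cur s i x k m.
  rewrite exchange_big /=; apply: eq_bigr => m _; rewrite mxmulE.
  by apply: eq_bigr => s _; rewrite mulrC.
have E m : ncur j m i x k m = pd j (fun y => cur m i y k m) x - (om j x *m cur m i x) k m
   + (cur m i x *m om j x) k m - (\sum_s om j x m s * cur s i x k m
   + \sum_s om j x i s * cur m s x k m).
  rewrite ncur.unlock !(addmxE, oppmxE) dmxE; congr (_ - _).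
  rewrite summxE -big_split; apply: eq_bigr => s _.
  by rewrite addmxE !scalemxE.
rewrite (eq_bigr _ (fun m _ => E m)) !(big_split, sumrN) /= H.
by rewrite opprD addrA addrK addrAC.
Qed.

(** The contracted second Bianchi identity, which turns harmonic curvature into the Codazzi equation
    for Ric. *)
Lemma div_riemann_ric i j k x : D x ->
  div_riemann G i j k x = Dc i (ric G) x j k - Dc j (ric G) x i k.
Proof.
move=> Dx; rewrite div_riemannE // -!ncur_ric //.
rewrite -sumrB; apply: eq_bigr => m _.
have := bianchi2 m i j Dx => /matrixP/(_ k m); rewrite !addmxE zeromxE.
rewrite (ncur_skew12 i j m) // oppmxE => /eqP; rewrite -addrA addr_eq0 => /eqP ->.
by rewrite opprD opprK.
Qed.

Section harmonic.
Hypothesis harm : forall x, D x -> forall i j k, div_riemann G i j k x = 0.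

Lemma codazzi_ric i j k x : D x -> Dc i (ric G) x j k = Dc j (ric G) x i k.
Proof. by move=> Dx; apply/eqP; rewrite -subr_eq0 -div_riemann_ric // harm. Qed.

End harmonic.

(** The skew-symmetry [sk] of the curvature is differentiated; the connection terms are products
    with [sk] itself. *)
Lemma ncur_low_skew m i j x : D x ->
  ncur m i j x *m G x + G x *m (ncur m i j x)^T = 0.
Proof.
move=> Dx.
have sk a b y : D y -> cur a b y *m G y + G y *m (cur a b y)^T = 0.
  by move=> Dy; apply: (parallel_cur lm sG) => // *; exact: (om_compat lm).
have d0 : dmx m (fun y => cur i j y *m G y + G y *m (cur i j y)^T) x = 0.
  rewrite -[RHS](@dmx_cst _ _ n n m 0 x).
  by apply: (eq_on_dmx oD m) => // y Dy; exact: sk.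
have sct := mxsmooth_tr (scur i j).
rewrite (dmxD m (mxsmoothM oD (scur i j) sG) (mxsmoothM oD sG sct)) // in d0.
rewrite (dmxM m (scur i j) sG) // (dmxM m sG sct) // dmx_tr in d0.
have ss : (\sum_s (om m x i s *: cur s j x + om m x j s *: cur i s x)) *m G x +
  G x *m (\sum_s (om m x i s *: cur s j x + om m x j s *: cur i s x))^T = 0.
  rewrite mulmx_suml raddf_sum mulmx_sumr -big_split big1 //= => s _.
  rewrite mulmxDl trmxD mulmxDr !trmxZ -!scalemxAl -!scalemxAr addrACA -!scalerDr.
  by rewrite !sk // !scaler0 addr0.
rewrite (om_compat lm) // in d0.
have := sk i j x Dx; rewrite ncur.unlock; move: d0 ss.
set S := \sum_s _; move: (dmx _ _ _) (cur i j x) S (om m x) (G x) => a b c d g.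
clear => H1 H2 H3.
have H4 : d *m (b *m g + g *m b^T) = 0 by rewrite H3 mulmx0.
have H5 : (b *m g + g *m b^T) *m d^T = 0 by rewrite H3 mul0mx.
have {}H1 := congr1 (fun m => m - (d *m (b *m g + g *m b^T)) - (b *m g + g *m b^T) *m d^T
  - (c *m g + g *m c^T)) H1.
rewrite /= {2}H4 {2}H5 {2}H2 !subr0 in H1.
rewrite -[RHS]H1; mxring.
Qed.

(** Trace of div R over j and k. As nabla R is skew in its last pair of indices, the two indices of
    that pair may be exchanged between the contractions, which produces the divergence of Ric up to
    sign. *)
Lemma div_ric x i : D x -> (forall j k, div_riemann G i j k x = 0) ->
  \sum_m \sum_k iG G x m k * Dc m (ric G) x i k = 0.
Proof.
move=> Dx H.
have skew m j a b : (iG G x *m ncur m i j x) a b = - (iG G x *m ncur m i j x) b a.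
  have E : iG G x *m ncur m i j x + (iG G x *m ncur m i j x)^T = 0.
    have := ncur_low_skew m i j Dx => /(congr1 (fun M => iG G x *m M *m iG G x)).
    rewrite /= mulmx0 mul0mx mulmxDr mulmxDl !mulmxA (mulVG lm) // mul1mx.
    rewrite -!mulmxA (mulGV lm) // mulmx1 => <-; congr (_ + _).
    by rewrite trmx_mul (ginv_sym lm).
  have /matrixP/(_ a b) := E; rewrite addmxE trmxE zeromxE => /eqP.
  by rewrite addr_eq0 => /eqP.
have E1 : \sum_m \sum_j (iG G x *m ncur m i j x) j m = 0.
  rewrite exchange_big big1 //= => j _.
  under eq_bigr do rewrite mxmulE.
  rewrite exchange_big big1 //= => k _.
  by rewrite -mulr_sumr -div_riemannE // H mulr0.
have : \sum_m \sum_j (iG G x *m ncur m i j x) m j = 0.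
  apply/eqP; rewrite -oppr_eq0 -sumrN -[X in _ == X]E1; apply/eqP/eq_bigr => m _.
  by rewrite -sumrN; apply: eq_bigr => j _; rewrite skew opprK.
rewrite -[X in X = 0]opprK -[RHS]oppr0 => /oppr_inj; rewrite -sumrN => E2.
rewrite -[RHS]E2; apply: eq_bigr => m _; rewrite -sumrN.
under [RHS]eq_bigr do rewrite mxmulE -sumrN.
rewrite exchange_big; apply: eq_bigr => k _ /=.
rewrite -ncur_ric // mulr_sumr; apply: eq_bigr => j _.
by rewrite ncur_skew12 // oppmxE mulrN.
Qed.

End bianchi.

(** * Traces and curvature identities for Codazzi tensors *)

Section codazzi.
Context {R : realType} {n : nat}.
Variables (D : set 'rV[R]_n) (G : 'rV[R]_n -> 'M[R]_n).
Hypothesis lm : local_metric D G.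

Let oD := lm_open lm.
Let sG := lm_smooth lm.
Let som := om_smooth lm.
Local Notation om := (om G).
Local Notation cur := (cur G).
Local Notation Dc := (Dc G).

Lemma pd_trmx m i (A : 'rV[R]_n -> 'M[R]_m) x : mxsmooth D A -> D x ->
  pd i (fun y => \tr (A y)) x = \tr (dmx i A x).
Proof.
move=> sA Dx; rewrite /mxtrace partial_sum => [|k].
  by apply: eq_bigr => k _; rewrite dmxE.
exact: mxsmooth_differentiable sA Dx.
Qed.

Lemma diG i x : D x -> dmx i (iG G) x = - (iG G x *m om i x) - (om i x)^T *m iG G x.
Proof.
move=> Dx; have siG := ginv_smooth lm.
have : dmx i (fun y => iG G y *m G y) x = 0.
  rewrite -(@dmx_cst R n n n i 1%:M x); apply: (eq_on_dmx oD) => // y Dy.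
  exact: (mulVG lm).
rewrite (dmxM i siG sG) // => /(congr1 (fun M => M *m iG G x)).
rewrite mulmxDl mul0mx -mulmxA (mulGV lm) // mulmx1 (om_compat lm) //.
rewrite mulmxDr !mulmxA (mulVG lm) // mul1mx mulmxDl -mulmxA -mulmxA (mulGV lm) // mulmx1.
by move/eqP; rewrite addr_eq0 opprD => /eqP.
Qed.

Lemma pd_trace_metric i (E : 'rV[R]_n -> 'M[R]_n) x : mxsmooth D E -> D x ->
  pd i (fun y => \tr (iG G y *m E y)) x = \tr (iG G x *m Dc i E x).
Proof.
move=> sE Dx; have siG := ginv_smooth lm.
rewrite pd_trmx //; last exact: mxsmoothM.
rewrite (dmxM i siG sE) // diG // /Dc !mulmxDr mulmxDl !(mulNmx, mulmxN) !mulmxA.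
have trD (A B : 'M[R]_n) : \tr (A + B) = \tr A + \tr B by rewrite linearD.
have trN (A : 'M[R]_n) : \tr (- A) = - \tr A by rewrite linearN.
rewrite -[(om i x)^T *m _ *m _]mulmxA !(trD, trN) [\tr (_^T *m _)]mxtrace_mulC.
by rewrite addrC addrA.
Qed.

Lemma tr_mul_sym (A B : 'M[R]_n) : B^T = B -> \tr (A *m B) = \sum_j \sum_k A j k * B j k.
Proof.
move=> sB; apply: eq_bigr => j _; rewrite mxmulE; apply: eq_bigr => k _.
by rewrite -{1}sB trmxE.
Qed.

Lemma ric_tr x : D x -> (ric G x)^T = ric G x.
Proof. by move=> Dx; apply/matrixP => i j; rewrite trmxE (ric_sym lm). Qed.

Lemma scalar_curvatureE x : D x -> scalar_curvature G x = \tr (iG G x *m ric G x).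
Proof.
move=> Dx; rewrite tr_mul_sym; last exact: ric_tr.
apply: eq_bigr => j _; apply: eq_bigr => k _.
by rewrite iGE ric.unlock mxE.
Qed.

Lemma Dc_sym i (E : 'rV[R]_n -> 'M[R]_n) x : (forall y, D y -> (E y)^T = E y) -> D x ->
  (Dc i E x)^T = Dc i E x.
Proof.
move=> symE Dx; rewrite /Dc !(trmxD, trmxN, trmx_mul, trmxK) symE // -dmx_tr.
by rewrite (eq_on_dmx oD i (symE)) // addrAC.
Qed.

(** The derivative of the trace is the trace of nabla_i Ric, which the Codazzi equation turns into
    the divergence of Ric. *)
Lemma scalar_curvature_pd0 x i : D x ->
  (forall y, D y -> forall i j k, div_riemann G i j k y = 0) ->
  pd i (scalar_curvature G) x = 0.
Proof.
move=> Dx harm.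
rewrite (eq_on_partial i oD (fun y (Dy : D y) => scalar_curvatureE Dy) Dx).
rewrite pd_trace_metric //; last exact: ric_smooth.
rewrite tr_mul_sym; last by apply: Dc_sym => // y; exact: ric_tr.
rewrite -[RHS](div_ric lm Dx (harm x Dx i)); apply: eq_bigr => j _.
by apply: eq_bigr => k _; rewrite (codazzi_ric lm harm).
Qed.

(** The rows of E form a one-form with values in covectors whose exterior covariant derivative
    vanishes; differentiating once more leaves the curvature acting on it. In the proof the row
    [e j] is a column vector, so that [om] acts on it from the left. *)
Lemma codazzi_cur (E : 'rV[R]_n -> 'M[R]_n) : mxsmooth D E ->
  (forall x, D x -> forall i j k, Dc i E x j k = Dc j E x i k) ->
  forall l i j k x, D x ->
  (cur l i x *m (E x)^T) k j + (cur i j x *m (E x)^T) k l + (cur j l x *m (E x)^T) k i = 0.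
Proof.
move=> sE cE l i j k x Dx.
pose e j y : 'cV[R]_n := (row j (E y))^T.
have eE a y b : (e a y) b 0 = E y a b by rewrite /e !mxE.
have se a : mxsmooth D (e a).
  move=> b z; rewrite (ord1 z); apply: smooth_eq (sE a b) => // y _.

have H a b y : D y -> dmx a (e b) y = dmx b (e a) y + om a y *m e b y - om b y *m e a y.
  move=> Dy; apply/matrixP => c z; rewrite (ord1 z).
  have M p q : (om p y *m e q y) c 0 = (E y *m (om p y)^T) q c.
    by rewrite !mxmulE; apply: eq_bigr => s _; rewrite eE trmxE mulrC.
  have := cE y Dy a b c; rewrite /Dc !(addmxE, oppmxE) !M !dmxE.
  have -> : (fun y0 => E y0 b c) = (fun y0 => e b y0 c 0) by apply/funext => ?; rewrite eE.
  have -> : (fun y0 => E y0 a c) = (fun y0 => e a y0 c 0) by apply/funext => ?; rewrite eE.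
  have -> : (om a y *m E y) b c = (om b y *m E y) a c.
    by rewrite !mxmulE; apply: eq_bigr => s _; rewrite (om_sym lm).
  move: (pd a _ y) (pd b _ y) ((om b y *m E y) a c) ((E y *m (om a y)^T) b c)
    ((E y *m (om b y)^T) a c) => *; lra.
have dH c a b : dmx c (dmx a (e b)) x = dmx c (dmx b (e a)) x
    + (dmx c (om a) x *m e b x + om a x *m dmx c (e b) x)
    - (dmx c (om b) x *m e a x + om b x *m dmx c (e a) x).
  have s1 p q : mxsmooth D (fun y => om p y *m e q y) by exact: mxsmoothM.
  have s2 p q : mxsmooth D (dmx p (e q)) by exact: mxsmooth_dmx.
  have s3 : mxsmooth D (fun y => - (om b y *m e a y)) by exact: mxsmoothN.
  have s4 : mxsmooth D (fun y => dmx b (e a) y + om a y *m e b y) by exact: mxsmoothD.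
  rewrite (eq_on_dmx oD c (fun y (Dy : D y) => H a b y Dy)) // (dmxD c s4 s3) //.
  rewrite (dmxD c (s2 b a) (s1 a b)) // (dmxN c (s1 b a)) //.
  by rewrite !(dmxM c (som _) (se _)).
have col p q b : (cur p q x *m (E x)^T) k b = (cur p q x *m e b x) k 0.
  by rewrite !mxmulE; apply: eq_bigr => s _; rewrite trmxE eE.
rewrite !col -!addmxE.
suff -> : cur l i x *m e j x + cur i j x *m e l x + cur j l x *m e i x = 0.
  by rewrite zeromxE.
have := dH l i j; have := dH i j l; have := dH j l i.
rewrite (dmx_comm oD l j (se i)) // (dmx_comm oD i l (se j)) // (dmx_comm oD j i (se l)) //.
rewrite (H l j) // (H i l) // (H j i) //.
rewrite cur.unlock.
move: (dmx _ (dmx _ _) x) (dmx _ (dmx _ _) x) (dmx _ (dmx _ _) x) => a b c.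
move: (dmx i (om l) x) (dmx l (om i) x) (dmx i (om j) x) (dmx j (om i) x)
  (dmx l (om j) x) (dmx j (om l) x) (dmx _ (e _) x) (dmx _ (e _) x) (dmx _ (e _) x).
move: (om l x) (om i x) (om j x) (e l x) (e i x) (e j x).
clear => L I J l i j il li ij ji lj jl d1 d2 d3 E1 E2 E3.
have := congr2 (+%R) (congr2 (+%R) E1 E2) E3.
move/eqP; rewrite -subr_eq0 => /eqP H; rewrite -[RHS]oppr0 -{}H; mxring.
Qed.

End codazzi.

(** * Simultaneous diagonalization by Rayleigh quotients *)

Section diagonalization.
Context {R : realType}.

Lemma quad_smul n (A : 'M[R]_n) c (v : 'rV[R]_n) :
  ((c *: v) *m A *m (c *: v)^T) 0 0 = c ^+ 2 * (v *m A *m v^T) 0 0.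
Proof. by rewrite trmxZ -!scalemxAl -scalemxAr !scalemxE mulrA expr2. Qed.

Lemma quad_differentiable n (A : 'M[R]_n) (v : 'rV[R]_n) :
  differentiable (fun v : 'rV[R]_n => (v *m A *m v^T) 0 0) v.
Proof.
under eq_fun do rewrite mxmulE; apply: differentiable_bigsum => k.
apply: differentiableM; last by under eq_fun do rewrite trmxE; exact: differentiable_coord.
under eq_fun do rewrite mxmulE; apply: differentiable_bigsum => l.
by apply: differentiableM => //; exact: differentiable_coord.
Qed.

(** The quotient of the two forms is homogeneous of degree zero, so its maximum on the unit sphere
    of the supremum norm inside the subspace v C = 0 is a maximum on the whole subspace. The
    inequality is multiplied out so as to include w = 0. *)
Lemma rayleigh_max n p (G A : 'M[R]_n) (C : 'M[R]_(n, p)) :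
  (forall v : 'rV[R]_n, v != 0 -> 0 < (v *m G *m v^T) 0 0) ->
  (exists2 v : 'rV[R]_n, v != 0 & v *m C = 0) ->
  exists2 v : 'rV[R]_n, v != 0 /\ v *m C = 0 &
    forall w : 'rV[R]_n, w *m C = 0 ->
    (w *m A *m w^T) 0 0 * (v *m G *m v^T) 0 0 <= (v *m A *m v^T) 0 0 * (w *m G *m w^T) 0 0.
Proof.
move=> posG [v0 v00 v0C].
pose S := [set v : 'rV[R]_n | `|v| = 1 /\ v *m C = 0].
pose f (v : 'rV[R]_n) := (v *m A *m v^T) 0 0 / (v *m G *m v^T) 0 0.
have S0 : S !=set0.
  exists (`|v0|^-1 *: v0); split; last by rewrite -scalemxAl v0C scaler0.
  by rewrite normrZ normfV normr_id mulVf // normr_eq0.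
have cS : compact S.
  apply: bounded_closed_compact.
    by exists 1; split => // M M1 v [v1 _]; rewrite /= v1 ltW.
  have -> : S = (fun v : 'rV[R]_n => `|v|) @^-1` [set 1] `&`
     \bigcap_(k in [set: 'I_p]) (fun v : 'rV[R]_n => (v *m C) 0 k) @^-1` [set 0].
    apply/seteqP; split => v /=.
      by move=> [v1 vC]; split => // k _ /=; rewrite vC mxE.
    by move=> [v1 vC]; split => //; apply/rowP => k; rewrite vC // mxE.
  apply: closedI.
    apply: preimage_closed; first by move=> v _; exact: norm_continuous.
    exact: closed_eq.
  apply: closed_bigI => k _; apply: preimage_closed; last exact: closed_eq.
  move=> v _; apply: (@differentiable_continuous _ _ _ v (fun v : 'rV[R]_n => (v *m C) 0 k)).
  under eq_fun do rewrite mxmulE; apply: differentiable_bigsum => l.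
  by apply: differentiableM => //; exact: differentiable_coord.
have cf : {within S, continuous f}.
  apply: continuous_in_subspaceT => v /set_mem[v1 _].
  have v0' : v != 0 by rewrite -normr_eq0 v1 oner_eq0.
  apply: differentiable_continuous; apply: differentiableM.
    exact: quad_differentiable.
  apply: differentiableV; first exact: quad_differentiable.
  by rewrite gt_eqF // posG.
have [v /set_mem[v1 vC] vmax] := EVT_max_rV S0 cS cf.
have v0' : v != 0 by rewrite -normr_eq0 v1 oner_eq0.
exists v => // w wC; have [->|w0] := eqVneq w 0.
  by rewrite !mul0mx mxE mul0r mulr0.
have Sw : S (`|w|^-1 *: w).
  split; last by rewrite -scalemxAl wC scaler0.
  by rewrite normrZ normfV normr_id mulVf // normr_eq0.
have := vmax _ (mem_set Sw); rewrite /f !quad_smul.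
have c0 : `|w|^-1 ^+ 2 != 0 by rewrite expf_neq0 // invr_eq0 normr_eq0.
rewrite invfM mulrACA divff // mul1r.
by rewrite ler_pdivrMr ?posG // mulrAC ler_pdivlMr ?posG.
Qed.

Lemma quad_psd_ker n (B : 'M[R]_n) (v w : 'rV[R]_n) : B^T = B ->
  (v *m B *m v^T) 0 0 = 0 -> (forall t : R, ((v + t *: w) *m B *m (v + t *: w)^T) 0 0 <= 0) ->
  (v *m B *m w^T) 0 0 = 0.
Proof.
move=> sB vBv H.
have sw : (w *m B *m v^T) 0 0 = (v *m B *m w^T) 0 0.
  by rewrite -[LHS]trmxE !trmx_mul trmxK sB mulmxA.
have E t : ((v + t *: w) *m B *m (v + t *: w)^T) 0 0 =
   2 * t * (v *m B *m w^T) 0 0 + t ^+ 2 * (w *m B *m w^T) 0 0.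
  rewrite trmxD trmxZ !mulmxDl !mulmxDr -!scalemxAl -!scalemxAr !addmxE !scalemxE.
  by rewrite vBv sw; ring.
move: E; set b := (v *m B *m w^T) 0 0; set c := (w *m B *m w^T) 0 0 => E.
apply/eqP/negPn/negP => b0.
(* This denominator makes |c / d| < 1, so that at t = b / d the form takes the positive value b^2 /
   d (2 + c / d). *)
pose d := `|c| + 1.
have d0 : 0 < d by rewrite ltr_wpDl.
have := H (b / d); rewrite E leNgt => /negP; apply.
have -> : 2 * (b / d) * b + (b / d) ^+ 2 * c = b ^+ 2 / d * (2 + c / d).
  by field; rewrite gt_eqF.
apply: mulr_gt0; first by rewrite divr_gt0 // exprn_even_gt0.
have : `|c / d| < 1 by rewrite normrM normfV (gtr0_norm d0) ltr_pdivrMr // mul1r /d ltrDl.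
by rewrite ltr_norml => /andP[]; lra.
Qed.

(** Induction on the number of eigenvectors: the next one maximizes the Rayleigh quotient on the
    G-orthogonal complement of the previous ones. Maximality gives v (A - lam G) w^T = 0 for w in
    this complement, and the eigenvector equations of h give it for the rows of h. *)
Lemma orthonormal_extend n k (G A : 'M[R]_n) : G^T = G -> A^T = A ->
  (forall v : 'rV[R]_n, v != 0 -> 0 < (v *m G *m v^T) 0 0) -> (k <= n)%N ->
  exists (h : 'M[R]_(k, n)) (d : 'rV[R]_k),
    h *m G *m h^T = 1%:M /\ h *m A = diag_mx d *m h *m G.
Proof.
move=> sG sA posG; elim: k => [_|k IH kn].
  by exists 0, 0; split; apply/matrixP => -[].
have [h [d [hG hA]]] := IH (ltnW kn).
have [|v [v0 vC] vmax] := @rayleigh_max n k G A (G *m h^T) posG.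
  have : kermx (G *m h^T) != 0.
    rewrite -mxrank_eq0 mxrank_ker subn_eq0 -ltnNge.
    by rewrite (leq_ltn_trans _ kn) // rank_leq_col.
  move=> /rowV0Pn[v vk v0]; exists v => //.
  by apply/sub_kermxP.
rewrite mulmxA in vC.
have g0 := posG v v0; set g := (v *m G *m v^T) 0 0 in g0 vmax.
pose lam := (v *m A *m v^T) 0 0 / g.
have vB : v *m (A - lam *: G) = 0.
  pose B := A - lam *: G.
  have sB : B^T = B by rewrite /B trmxD trmxN trmxZ sA sG.
  have qB (w : 'rV[R]_n) : (w *m B *m w^T) 0 0 = (w *m A *m w^T) 0 0 - lam * (w *m G *m w^T) 0 0.
    by rewrite /B mulmxBr mulmxBl -scalemxAr -scalemxAl addmxE oppmxE scalemxE.
  have vBw (w : 'rV[R]_n) : w *m (G *m h^T) = 0 -> (v *m B *m w^T) 0 0 = 0.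
    move=> wC; apply: quad_psd_ker => // [|t].
      by rewrite qB /lam -/g divfK ?subrr // gt_eqF.
    rewrite qB subr_le0 /lam mulrAC ler_pdivlMr //; apply: vmax.
    by rewrite mulmxDl -scalemxAl wC mulmxA vC scaler0 addr0.
  have vBh : v *m B *m h^T = 0.
    rewrite /B mulmxBr mulmxBl -scalemxAr -scalemxAl vC scaler0 subr0.
    apply: trmx_inj; rewrite trmx0 !trmx_mul trmxK sA mulmxA hA -!mulmxA.
    have -> : h *m (G *m v^T) = 0.
      by apply: trmx_inj; rewrite trmx0 !trmx_mul trmxK sG vC.
    by rewrite mulmx0.
  apply/rowP => j; rewrite zeromxE.
  pose x : 'rV[R]_n := delta_mx 0 j.
  (* The component of the basis vector x that is G-orthogonal to the rows of h. *)
  pose w := x - x *m G *m h^T *m h.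
  rewrite -/B.
  have -> : (v *m B) 0 j = (v *m B *m x^T) 0 0.
    have xE i : x 0 i = (i == j)%:R by rewrite mxE.
    rewrite [RHS]mxmulE (bigD1 j) //= big1 ?addr0 => [|i ij]; rewrite trmxE xE.
      by rewrite eqxx mulr1.
    by rewrite (negPf ij) mulr0.
  have -> : x = w + x *m G *m h^T *m h by rewrite /w subrK.
  rewrite trmxD mulmxDr addmxE vBw.
    by rewrite add0r trmx_mul mulmxA vBh mul0mx mxE.
  by rewrite /w mulmxBl -!mulmxA (mulmxA h) hG mulmx1 subrr.
have {}vB : v *m A = lam *: (v *m G).
  by apply/eqP; rewrite -subr_eq0 scalemxAr -mulmxBr vB.
have sq : Num.sqrt g ^+ 2 = g by rewrite sqr_sqrtr // ltW.
have sg0 : 0 < Num.sqrt g by rewrite sqrtr_gt0.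
pose u := (Num.sqrt g)^-1 *: v.
have uG : u *m G *m u^T = 1%:M.
  apply/matrixP => a b; rewrite !ord1 quad_smul -/g mxE eqxx.
  by rewrite exprVn sq mulVf // gt_eqF.
have uC : u *m G *m h^T = 0 by rewrite -!scalemxAl vC scaler0.
rewrite -addn1; exists (col_mx h u), (row_mx d lam%:M); split.
  rewrite mul_col_mx tr_col_mx mul_col_row hG uG uC.
  have -> : h *m G *m u^T = 0.
    by apply: trmx_inj; rewrite trmx0 !trmx_mul trmxK sG mulmxA uC.
  by rewrite -scalar_mx_block.
rewrite mul_col_mx hA; apply/esym.
rewrite -mulmxA mul_col_mx diag_mx_row mul_block_col !mul0mx addr0 add0r mulmxA.
congr (col_mx _ _).
have -> : diag_mx lam%:M = lam%:M :> 'M[R]_1.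
  by apply/matrixP => a b; rewrite !ord1 !mxE eqxx.
by rewrite mul_scalar_mx /u -!scalemxAl vB !scalerA mulrC.
Qed.

Lemma simultaneous_diag n (G A : 'M[R]_n) : G^T = G -> A^T = A ->
  (forall v : 'rV[R]_n, v != 0 -> 0 < (v *m G *m v^T) 0 0) ->
  exists (h : 'M[R]_n) (d : 'rV[R]_n),
    h *m G *m h^T = 1%:M /\ h *m A *m h^T = diag_mx d.
Proof.
move=> sG sA posG; have [h [d [hG hA]]] := orthonormal_extend sG sA posG (leqnn n).
by exists h, d; split => //; rewrite hA -!mulmxA (mulmxA h) hG mulmx1.
Qed.

End diagonalization.

(** * Curvature tensors in an eigenframe of the Ricci tensor *)

Definition o0 : 'I_4 := @Ordinal 4 0 isT.
Definition o1 : 'I_4 := @Ordinal 4 1 isT.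
Definition o2 : 'I_4 := @Ordinal 4 2 isT.
Definition o3 : 'I_4 := @Ordinal 4 3 isT.

Lemma ord4P (P : 'I_4 -> Prop) : P o0 -> P o1 -> P o2 -> P o3 -> forall i, P i.
Proof.
move=> P0 P1 P2 P3 [[|[|[|[|//]]]] h].
- by rewrite (_ : Ordinal h = o0) //; exact: val_inj.
- by rewrite (_ : Ordinal h = o1) //; exact: val_inj.
- by rewrite (_ : Ordinal h = o2) //; exact: val_inj.
- by rewrite (_ : Ordinal h = o3) //; exact: val_inj.
Qed.

Lemma perm_enum4 (a b c d : 'I_4) : uniq [:: a; b; c; d] ->
  perm_eq (index_enum 'I_4) [:: a; b; c; d].
Proof.
move=> u; rewrite perm_sym; apply: uniq_perm => //; first exact: index_enum_uniq.
have sz : (size (index_enum 'I_4) <= size [:: a; b; c; d])%N.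
  by rewrite -[index_enum _]/(Finite.enum _) -enumT size_enum_ord.
by have [] := uniq_min_size u (fun x _ => mem_index_enum x) sz.
Qed.

Lemma sum_uniq4 (R : nmodType) (f : 'I_4 -> R) (a b c d : 'I_4) :
  uniq [:: a; b; c; d] -> \sum_i f i = f a + (f b + (f c + f d)).
Proof.
by move=> u; rewrite (perm_big _ (perm_enum4 u)) !big_cons big_nil /= addr0.
Qed.

(** * Algebraic curvature tensors in dimension four: [cyc] is the Codazzi relation, [CS] the weakly
    Einstein identity *)

Section algebraic_curvature.
Context {R : realType}.
Variables (T : 'I_4 -> 'I_4 -> 'I_4 -> 'I_4 -> R) (l : 'I_4 -> R) (phi : R).
Hypothesis s12 : forall a b c d, T a b c d = - T b a c d.
Hypothesis s34 : forall a b c d, T a b c d = - T a b d c.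
Hypothesis pair : forall a b c d, T a b c d = T c d a b.
Hypothesis b1 : forall a b c d, T a b c d + T b c a d + T c a b d = 0.
Hypothesis Tric : forall j k, \sum_i T i j k i = l j * (j == k)%:R.
Hypothesis cyc : forall a b c d, T a b d c * l c + T b c d a * l a + T c a d b * l b = 0.
Hypothesis CS : forall a c, \sum_b \sum_p \sum_q T a b p q * T c b p q = phi * (a == c)%:R.

Lemma T11 a c d : T a a c d = 0.
Proof. by have := s12 a a c d; lra. Qed.

Lemma T22 a c d : T c d a a = 0.
Proof. by rewrite pair T11. Qed.

Section four_indices.
Variables a b c d : 'I_4.
Hypothesis u : uniq [:: a; b; c; d].

Let nab : (a == b) = false. Proof. by move: u; rewrite /= !inE; case: (a == b). Qed.
Let nac : (a == c) = false. Proof. by move: u; rewrite /= !inE; case: (a == c); rewrite ?orbT. Qed.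
Let nad : (a == d) = false. Proof. by move: u; rewrite /= !inE; case: (a == d); rewrite ?orbT. Qed.
Let nbc : (b == c) = false. Proof. by move: u; rewrite /= !inE; case: (b == c); rewrite ?orbT ?andbF. Qed.
Let nbd : (b == d) = false. Proof. by move: u; rewrite /= !inE; case: (b == d); rewrite ?orbT ?andbF. Qed.
Let ncd : (c == d) = false. Proof. by move: u; rewrite /= !inE; case: (c == d); rewrite ?orbT ?andbF. Qed.

Let F1 x y := s12 b a x y. Let F2 x y := s12 c a x y. Let F3 x y := s12 d a x y.
Let F4 x y := s12 c b x y. Let F5 x y := s12 d b x y. Let F6 x y := s12 d c x y.
Let G1 x y := s34 x y b a. Let G2 x y := s34 x y c a. Let G3 x y := s34 x y d a.
Let G4 x y := s34 x y c b. Let G5 x y := s34 x y d b. Let G6 x y := s34 x y d c.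
Let P1 := pair a c a b. Let P2 := pair a d a b. Let P3 := pair b c a b.
Let P4 := pair b d a b. Let P5 := pair c d a b. Let P6 := pair a d a c.
Let P7 := pair b c a c. Let P8 := pair b d a c. Let P9 := pair c d a c.
Let P10 := pair b c a d. Let P11 := pair b d a d. Let P12 := pair c d a d.
Let P13 := pair b d b c. Let P14 := pair c d b c. Let P15 := pair c d b d.

Let S (f : 'I_4 -> R) := sum_uniq4 f u.

(** Brings every component to the order a, b, c, d inside both index pairs and puts the pair that is
    first lexicographically in front. *)
Ltac norm := rewrite ?(T11, T22) ?(F1, F2, F3, F4, F5, F6) ?(G1, G2, G3, G4, G5, G6)
  ?(P1, P2, P3, P4, P5, P6, P7, P8, P9, P10, P11, P12, P13, P14, P15)
  ?(mul0r, mulr0, add0r, addr0, mulNr, mulrN, opprK, oppr0).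

Lemma offdiag_cyc : T a c c b * (l a - l b) = 0.
Proof. by have := cyc a c b c; norm; lra. Qed.

Lemma ric_relations :
  [/\ T a d b d = - T a c b c, T a d c d = T a b b c, T b d c d = - T a b a c,
      T a c c d = T a b b d * -1 & T b c c d = T a b a d] /\
  [/\ T a d b c = T a c b d - T a b c d,
      T a b c d * (l a - l c) + T a c b d * (l b - l a) = 0,
      T a b c d * (l b - l d) + T a c b d * (l d - l c) = 0,
      T a b c d * (l c - l a) + T a c b d * (l d - l c) = 0 &
      T a b c d * (l d - l b) + T a c b d * (l b - l a) = 0].
Proof.
have C : T a d b c = T a c b d - T a b c d by have := b1 a b c d; norm; lra.
split; split => //.
- by have := Tric a b; rewrite S nab; norm; lra.
- by have := Tric a c; rewrite S nac; norm; lra.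
- by have := Tric b c; rewrite S nbc; norm; lra.
- by have := Tric a d; rewrite S nad; norm; lra.
- by have := Tric b d; rewrite S nbd; norm; lra.
- by have := cyc a b c d; norm; rewrite C; lra.
- by have := cyc b c d a; norm; rewrite C; lra.
- by have := cyc a c d b; norm; rewrite C; lra.
- by have := cyc a b d c; norm; rewrite C; lra.
Qed.

Lemma ric_diag_values : l c - l d = T a c c a + T b c c b - T a d d a - T b d d b.
Proof.
have := Tric c c; have := Tric d d; rewrite !S !eqxx /= !mulr1; norm; lra.
Qed.

(** This is the (a, b) component of the weakly Einstein identity. After elimination by the vanishing
    off-diagonal Ricci components, what is left is a multiple of T_accb times K_ac + K_bc - K_ad -
    K_bd, and the last factor is l_c - l_d. *)
Lemma offdiag_CS : T a c c b * (l c - l d) = 0.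
Proof.
have [[h1 h2 h3 h4 h5] [h6 _ _ _ _]] := ric_relations.
have h7 : T b d b c = T a d a c * -1.
  by have := Tric c d; rewrite S ncd; norm; lra.
have := CS a b; rewrite nab !S; norm.
rewrite ric_diag_values; norm.
rewrite P13 in h7; rewrite P6 in h7.
rewrite h7 h1 h2 h3 h4 h5 h6.
norm.
move: (T a b a b) (T a c a c) (T a d a d) (T b c b c) (T b d b d) (T c d c d)
 (T a c b c) (T a b b c) (T a b a c) (T a b b d) (T a b a d) (T a c a d) (T a b c d) (T a c b d).
move=> *; lra.
Qed.

Let s := \sum_i l i.
Let e x := l x - s / 4.

Let sume : e a + (e b + (e c + e d)) = 0.
Proof. by rewrite /e /s S; lra. Qed.

Let mem4 x : x \in [:: a; b; c; d].
Proof. by rewrite -(perm_mem (perm_enum4 u)) mem_index_enum. Qed.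

Let all_sq : (e a) ^+ 2 = (e b) ^+ 2 -> (e a) ^+ 2 = (e c) ^+ 2 ->
  (e a) ^+ 2 = (e d) ^+ 2 -> forall x y, (e x) ^+ 2 = (e y) ^+ 2.
Proof.
move=> h1 h2 h3; have H x : (e x) ^+ 2 = (e a) ^+ 2.
  by have := mem4 x; rewrite !inE => /or4P[] /eqP ->.
by move=> x y; rewrite !H.
Qed.

(** A nonzero component forces l_a = l_b and l_c = l_d; as e is trace-free, its entries are x, x,
    -x, -x. *)
Lemma offdiag_neq0 : T a c c b != 0 -> forall x y, (e x) ^+ 2 = (e y) ^+ 2.
Proof.
move=> T0; have := offdiag_cyc; have := offdiag_CS => /eqP.
rewrite mulf_eq0 (negPf T0) subr_eq0 => /= /eqP h1 /eqP.
rewrite mulf_eq0 (negPf T0) subr_eq0 => /= /eqP h2.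
have h3 : e a = e b by rewrite /e h2.
have h4 : e c = e d by rewrite /e h1.
have h5 : e d = - e a by move: sume; rewrite -h3 h4; lra.
by apply: all_sq; rewrite ?h4 ?h5 ?sqrrN -?h3.
Qed.

(** The four relations between the components T_abcd and T_acbd are linear in the differences of the
    e_i. Whether one or both of the components are nonzero, the trace-free e has entries x and -x
    only. *)
Lemma mixed_neq0 : (T a b c d != 0) || (T a c b d != 0) ->
  forall x y, (e x) ^+ 2 = (e y) ^+ 2.
Proof.
have [_ [_ m1 m2 m3 m4]] := ric_relations.
have E x y : l x - l y = e x - e y by rewrite /e; lra.
rewrite !E in m1 m2 m3 m4.
move: sume m1 m2 m3 m4 all_sq.
move: (T a b c d) (T a c b d) (e a) (e b) (e c) (e d).
move=> A B x y z w S0 m1 m2 m3 m4 H /orP[A0|B0].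
- have h1 : y = - x.
    have : A * (x - z - w + y) = 0 by lra.
    by move/eqP; rewrite mulf_eq0 (negPf A0) /= => /eqP; lra.
  have [B0|B0] := eqVneq B 0.
    have h2 : x = z.
      have : A * (x - z) = 0 by rewrite B0 in m1; lra.
      by move/eqP; rewrite mulf_eq0 (negPf A0) /= => /eqP; lra.
    have h3 : w = - x by lra.
    by apply: H; rewrite ?h1 -?h2 ?h3 ?sqrrN.
  have h2 : y + w = 0.
    have : B * (y - x + w - z) = 0 by lra.
    by move/eqP; rewrite mulf_eq0 (negPf B0) /= => /eqP; lra.
  have h3 : z = - x by lra. have h4 : w = x by lra.
  by apply: H; rewrite ?h1 ?h3 ?h4 ?sqrrN.
- have h1 : y + w = 0.
    have : B * (y - x + w - z) = 0 by lra.
    by move/eqP; rewrite mulf_eq0 (negPf B0) /= => /eqP; lra.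
  have h3 : z = - x by lra.
  have [A0|A0] := eqVneq A 0.
    have h2 : y = x.
      have : B * (y - x) = 0 by rewrite A0 in m1; lra.
      by move/eqP; rewrite mulf_eq0 (negPf B0) /= => /eqP; lra.
    have h4 : w = - x by lra.
    by apply: H; rewrite ?h2 ?h3 ?h4 ?sqrrN.
  have h2 : y = - x.
    have : A * (x - z - w + y) = 0 by lra.
    by move/eqP; rewrite mulf_eq0 (negPf A0) /= => /eqP; lra.
  have h4 : w = x by lra.
  by apply: H; rewrite ?h2 ?h3 ?h4 ?sqrrN.
Qed.

Lemma CS_diag :
  (forall x y z, x != y -> z != x -> z != y -> T x z z y = 0) ->
  (forall x y z w, uniq [:: x; y; z; w] -> T x y z w = 0) ->
  phi = 2 * (T a b b a ^+ 2 + T a c c a ^+ 2 + T a d d a ^+ 2).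
Proof.
move=> off mix; have := CS a a; rewrite eqxx mulr1 => <-.
have nba : (b == a) = false by rewrite eq_sym. have nca : (c == a) = false by rewrite eq_sym.
have nda : (d == a) = false by rewrite eq_sym. have ncb : (c == b) = false by rewrite eq_sym.
have ndb : (d == b) = false by rewrite eq_sym. have ndc : (d == c) = false by rewrite eq_sym.
have N := (nab, nac, nad, nbc, nbd, ncd, nba, nca, nda, ncb, ndb, ndc).
have z1 : T a b a c = 0 by have := off b c a; rewrite !N; norm => H; have := H isT isT isT; lra.
have z2 : T a b a d = 0 by have := off b d a; rewrite !N; norm => H; have := H isT isT isT; lra.
have z3 : T a c a d = 0 by have := off c d a; rewrite !N; norm => H; have := H isT isT isT; lra.
have z4 : T a b b c = 0 by have := off a c b; rewrite !N; norm => H; have := H isT isT isT; lra.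
have z5 : T a b b d = 0 by have := off a d b; rewrite !N; norm => H; have := H isT isT isT; lra.
have z6 : T a c b c = 0 by have := off a b c; rewrite !N; norm => H; have := H isT isT isT; lra.
have z7 : T a c c d = 0 by have := off a d c; rewrite !N; norm => H; have := H isT isT isT; lra.
have z8 : T a d b d = 0 by have := off a b d; rewrite !N; norm => H; have := H isT isT isT; lra.
have z9 : T a d c d = 0 by have := off a c d; rewrite !N; norm => H; have := H isT isT isT; lra.
have m1 : T a b c d = 0 by apply: mix; rewrite /= !inE !N.
have m2 : T a c b d = 0 by apply: mix; rewrite /= !inE !N.
have m3 : T a d b c = 0 by apply: mix; rewrite /= !inE !N.
rewrite !S; norm.
rewrite z1 z2 z3 z4 z5 z6 z7 z8 z9 m1 m2 m3; norm.
by rewrite !expr2; norm; lra.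
Qed.

End four_indices.

Lemma fourth (a b c : 'I_4) : uniq [:: a; b; c] -> exists d, uniq [:: a; b; c; d].
Proof.
move=> u; case: (pickP (fun d => d \notin [:: a; b; c])) => [d dn|H].
  by exists d; rewrite -[[:: a; b; c; d]]/([:: a; b; c] ++ [:: d]) cat_uniq u /= orbF dn.
have := @uniq_leq_size _ (enum 'I_4) [:: a; b; c] (enum_uniq _).
rewrite size_enum_ord /= => /(_ _)/wrap[] // x _.
by have := H x => /negbFE.
Qed.

Let s := \sum_i l i.
Let e x := l x - s / 4.
Hypothesis nsq : ~ forall x y, (e x) ^+ 2 = (e y) ^+ 2.

Lemma off0 x y z : x != y -> z != x -> z != y -> T x z z y = 0.
Proof.
move=> xy zx zy; have u : uniq [:: x; y; z] by rewrite /= !inE (negPf xy) eq_sym (negPf zx) eq_sym (negPf zy).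
have [d ud] := fourth u.
by apply/eqP/negPn/negP => T0; apply: nsq; exact: offdiag_neq0 ud T0.
Qed.

Lemma mix0 x y z w : uniq [:: x; y; z; w] -> T x y z w = 0.
Proof.
move=> u; apply/eqP/negPn/negP => T0; apply: nsq; apply: mixed_neq0 u _.
by rewrite T0.
Qed.

(** Components with three distinct indices vanish by [off0], those with four by [mix0]: the
    curvature operator is diagonal with respect to the coordinate planes. *)
Lemma T_diag x y z w :
  T x y z w = T x y y x * ((x == w)%:R * (y == z)%:R - (x == z)%:R * (y == w)%:R).
Proof.
have [<-|xy] := eqVneq x y; first by rewrite !T11 mul0r.
have [<-|zw] := eqVneq z w; first by rewrite T22 subrr mulr0.
have [xz|xz] := eqVneq x z.
  subst z; have [yw|yw] := eqVneq y w.
    by subst w; rewrite s34 (negPf xy) mul0r sub0r mulr1 mulrN1.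
  rewrite (negPf zw) mul0r mulr0 subr0 mulr0 s12.
  by rewrite off0 ?oppr0 // eq_sym.
have [xw|xw] := eqVneq x w.
  subst w; have [yz|yz] := eqVneq y z; first by subst z; rewrite mul1r mul0r subr0 mulr1.
  by rewrite mulr0 mul0r subr0 mulr0 s12 s34 off0 ?oppr0 // eq_sym.
rewrite !mul0r subr0 mulr0.
have [yz|yz] := eqVneq y z; first by subst z; rewrite off0 // eq_sym.
have [yw|yw] := eqVneq y w; first by subst w; rewrite s34 off0 ?oppr0 // eq_sym.
by apply: mix0; rewrite /= !inE (negPf xy) (negPf xz) (negPf xw) (negPf yz) (negPf yw) zw.
Qed.

End algebraic_curvature.

Lemma sqr_eq_cases (R : realDomainType) (x y : R) : x ^+ 2 = y ^+ 2 -> y = x \/ y = - x.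
Proof.
by move/eqP; rewrite eqf_sqr => /orP[] /eqP ->; [left|right; rewrite opprK].
Qed.

(* Sectional curvatures p = K01, p' = K23, q = K02, q' = K13, t = K03, t' = K12. *)
Lemma sectional_cases (R : realType) (p p' q q' t t' s e0 e1 e2 e3 m q0 q1 q2 q3 : R) :
  p ^+ 2 + q ^+ 2 + t ^+ 2 = p ^+ 2 + t' ^+ 2 + q' ^+ 2 ->
  p ^+ 2 + q ^+ 2 + t ^+ 2 = q ^+ 2 + t' ^+ 2 + p' ^+ 2 ->
  p ^+ 2 + q ^+ 2 + t ^+ 2 = t ^+ 2 + q' ^+ 2 + p' ^+ 2 ->
  s = 2 * (p + p' + q + q' + t + t') ->
  e0 = p + q + t - s / 4 -> e1 = p + t' + q' - s / 4 ->
  e2 = q + t' + p' - s / 4 -> e3 = t + q' + p' - s / 4 ->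
  m = (e0 ^+ 2 + e1 ^+ 2 + e2 ^+ 2 + e3 ^+ 2) / 4 ->
  q0 = e0 ^+ 2 - m -> q1 = e1 ^+ 2 - m -> q2 = e2 ^+ 2 - m -> q3 = e3 ^+ 2 - m ->
  ~ (e0 ^+ 2 = e1 ^+ 2 /\ e0 ^+ 2 = e2 ^+ 2 /\ e0 ^+ 2 = e3 ^+ 2) ->
  (s = 0 /\ [/\ p = (e0 + e1) / 2, q = (e0 + e2) / 2 & t = (e0 + e3) / 2] /\
     [/\ t' = (e1 + e2) / 2, q' = (e1 + e3) / 2 & p' = (e2 + e3) / 2]) \/
  (exists r, [/\ r != 0, q0 ^+ 2 = r, q1 ^+ 2 = r, q2 ^+ 2 = r & q3 ^+ 2 = r] /\
    [/\ p = (e0 + e1) / 2 + s / 8 * (q0 * q1 / r + 1),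
        q = (e0 + e2) / 2 + s / 8 * (q0 * q2 / r + 1) &
        t = (e0 + e3) / 2 + s / 8 * (q0 * q3 / r + 1)] /\
    [/\ t' = (e1 + e2) / 2 + s / 8 * (q1 * q2 / r + 1),
        q' = (e1 + e3) / 2 + s / 8 * (q1 * q3 / r + 1) &
        p' = (e2 + e3) / 2 + s / 8 * (q2 * q3 / r + 1)]).
Proof.
move=> h1 h2 h3 sE E0 E1 E2 E3 mE Q0 Q1 Q2 Q3 N.
have hp : p ^+ 2 = p' ^+ 2 by lra.
have hq : q ^+ 2 = q' ^+ 2 by lra.
have ht : t ^+ 2 = t' ^+ 2 by lra.
(* One case for each choice of p' = p or -p, q' = q or -q, t' = t or -t. With no or one minus sign
   all e_i^2 agree, against [N]; two minus signs give the second alternative, three give the first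
   one. *)
case: (sqr_eq_cases hp) => pE; case: (sqr_eq_cases hq) => qE; case: (sqr_eq_cases ht) => tE.
- exfalso; apply: N; subst; split; [|split]; congr (_ ^+ 2); lra.
- exfalso; apply: N; subst; split; [|split].
  + have -> : p + - t + q - 2 * (p + p + q + q + t + - t) / 4 = - t by lra.
    have -> : p + q + t - 2 * (p + p + q + q + t + - t) / 4 = t by lra.
    by rewrite sqrrN.
  + have -> : q + - t + p - 2 * (p + p + q + q + t + - t) / 4 = - t by lra.
    have -> : p + q + t - 2 * (p + p + q + q + t + - t) / 4 = t by lra.
    by rewrite sqrrN.
  + congr (_ ^+ 2); lra.
- exfalso; apply: N; subst; split; [|split].
  + have -> : p + t + - q - 2 * (p + p + q + - q + t + t) / 4 = - q by lra.
    have -> : p + q + t - 2 * (p + p + q + - q + t + t) / 4 = q by lra.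
    by rewrite sqrrN.
  + congr (_ ^+ 2); lra.
  + have -> : t + - q + p - 2 * (p + p + q + - q + t + t) / 4 = - q by lra.
    have -> : p + q + t - 2 * (p + p + q + - q + t + t) / 4 = q by lra.
    by rewrite sqrrN.
(* Here s = 4 p and the e_i are q + t, - q - t, q - t, t - q, so that q0 = q1 = 2 q t and q2 = q3 =
   - 2 q t. If q or t is zero, all e_i^2 agree. *)
- right; exists (4 * q ^+ 2 * t ^+ 2).
  have [q_0|q_0] := eqVneq q 0.
    by exfalso; apply: N; subst; split; [|split]; field.
  have [t_0|t_0] := eqVneq t 0.
    by exfalso; apply: N; subst; split; [|split]; field.
  split; [split|split; split]; try by [rewrite !mulf_neq0 // ?expf_neq0]; subst; field;
    rewrite ?q_0 ?t_0 //.
- exfalso; apply: N; subst; split; [|split].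
  + congr (_ ^+ 2); lra.
  + have -> : q + t + - p - 2 * (p + - p + q + q + t + t) / 4 = - p by lra.
    have -> : p + q + t - 2 * (p + - p + q + q + t + t) / 4 = p by lra.
    by rewrite sqrrN.
  + have -> : t + q + - p - 2 * (p + - p + q + q + t + t) / 4 = - p by lra.
    have -> : p + q + t - 2 * (p + - p + q + q + t + t) / 4 = p by lra.
    by rewrite sqrrN.
- right; exists (4 * p ^+ 2 * t ^+ 2).
  have [p_0|p_0] := eqVneq p 0.
    by exfalso; apply: N; subst; split; [|split]; field.
  have [t_0|t_0] := eqVneq t 0.
    by exfalso; apply: N; subst; split; [|split]; field.
  split; [split|split; split]; try by [rewrite !mulf_neq0 // ?expf_neq0]; subst; field;
    rewrite ?p_0 ?t_0 //.
- right; exists (4 * p ^+ 2 * q ^+ 2).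
  have [p_0|p_0] := eqVneq p 0.
    by exfalso; apply: N; subst; split; [|split]; field.
  have [q_0|q_0] := eqVneq q 0.
    by exfalso; apply: N; subst; split; [|split]; field.
  split; [split|split; split]; try by [rewrite !mulf_neq0 // ?expf_neq0]; subst; field;
    rewrite ?p_0 ?q_0 //.
- left; subst; split; [lra|split; split; lra].
Qed.

Section sectional_form.
Context {R : realType}.
Variables (T : 'I_4 -> 'I_4 -> 'I_4 -> 'I_4 -> R) (l : 'I_4 -> R) (phi : R).
Hypothesis s12 : forall a b c d, T a b c d = - T b a c d.
Hypothesis s34 : forall a b c d, T a b c d = - T a b d c.
Hypothesis pair : forall a b c d, T a b c d = T c d a b.
Hypothesis b1 : forall a b c d, T a b c d + T b c a d + T c a b d = 0.
Hypothesis Tric : forall j k, \sum_i T i j k i = l j * (j == k)%:R.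
Hypothesis cyc : forall a b c d, T a b d c * l c + T b c d a * l a + T c a d b * l b = 0.
Hypothesis CS : forall a c, \sum_b \sum_p \sum_q T a b p q * T c b p q = phi * (a == c)%:R.
Let s := \sum_i l i.
Let e x := l x - s / 4.
Let m := (\sum_i e i ^+ 2) / 4.
Let q x := e x ^+ 2 - m.
Hypothesis nsq : ~ forall x y, (e x) ^+ 2 = (e y) ^+ 2.

Lemma sectional_form :
  (s = 0 /\ forall a b, a != b -> T a b b a = (e a + e b) / 2) \/
  (exists r, [/\ r != 0, forall a, q a ^+ 2 = r & forall a b, a != b ->
     T a b b a = (e a + e b) / 2 + s / 8 * (q a * q b / r + 1)]).
Proof.
have K x y : T x y y x = T y x x y by rewrite s12 s34 opprK.
have off x y z : x != y -> z != x -> z != y -> T x z z y = 0.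
  by apply: (off0 (l := l) (phi := phi)).
have mix x y z w : uniq [:: x; y; z; w] -> T x y z w = 0.
  by apply: (mix0 (l := l)).
have S (f : 'I_4 -> R) := @sum_uniq4 R f _ _ _ _ (isT : uniq [:: o0; o1; o2; o3]).
have C a b c d (u : uniq [:: a; b; c; d]) :
    phi = 2 * (T a b b a ^+ 2 + T a c c a ^+ 2 + T a d d a ^+ 2).
  exact: (CS_diag s12 s34 pair CS u off mix).
have C0 := C _ _ _ _ (isT : uniq [:: o0; o1; o2; o3]).
have C1 := C _ _ _ _ (isT : uniq [:: o1; o0; o2; o3]).
have C2 := C _ _ _ _ (isT : uniq [:: o2; o0; o1; o3]).
have C3 := C _ _ _ _ (isT : uniq [:: o3; o0; o1; o2]).
rewrite (K o1 o0) in C1; rewrite (K o2 o0) (K o2 o1) in C2.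
rewrite (K o3 o0) (K o3 o1) (K o3 o2) in C3.
have T0 x : T x x x x = 0 by have := s12 x x x x; lra.
have L x : l x = T x o0 o0 x + (T x o1 o1 x + (T x o2 o2 x + T x o3 o3 x)).
  have := Tric x x; rewrite eqxx mulr1 S => <-.
  by rewrite (K o0) (K o1) (K o2) (K o3).
have sE : s = l o0 + (l o1 + (l o2 + l o3)) by rewrite /s S.
have mE : m = (e o0 ^+ 2 + e o1 ^+ 2 + e o2 ^+ 2 + e o3 ^+ 2) / 4.
  by rewrite /m S !addrA.
have L0 := L o0; have L1 := L o1; have L2 := L o2; have L3 := L o3.
rewrite T0 in L0; rewrite T0 (K o1 o0) in L1; rewrite T0 (K o2 o0) (K o2 o1) in L2.
rewrite T0 (K o3 o0) (K o3 o1) (K o3 o2) in L3.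
have N : ~ (e o0 ^+ 2 = e o1 ^+ 2 /\ e o0 ^+ 2 = e o2 ^+ 2 /\ e o0 ^+ 2 = e o3 ^+ 2).
  move=> [n1 [n2 n3]]; apply: nsq.
  have H : forall x, e x ^+ 2 = e o0 ^+ 2 by apply: ord4P.
  by move=> x y; rewrite !H.
have E0 : e o0 = T o0 o1 o1 o0 + T o0 o2 o2 o0 + T o0 o3 o3 o0 - s / 4 by rewrite /e L0; lra.
have E1 : e o1 = T o0 o1 o1 o0 + T o1 o2 o2 o1 + T o1 o3 o3 o1 - s / 4 by rewrite /e L1; lra.
have E2 : e o2 = T o0 o2 o2 o0 + T o1 o2 o2 o1 + T o2 o3 o3 o2 - s / 4 by rewrite /e L2; lra.
have E3 : e o3 = T o0 o3 o3 o0 + T o1 o3 o3 o1 + T o2 o3 o3 o2 - s / 4 by rewrite /e L3; lra.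
have sE' : s = 2 * (T o0 o1 o1 o0 + T o2 o3 o3 o2 + T o0 o2 o2 o0 + T o1 o3 o3 o1
   + T o0 o3 o3 o0 + T o1 o2 o2 o1) by rewrite sE L0 L1 L2 L3; lra.
have A1 : T o0 o1 o1 o0 ^+ 2 + T o0 o2 o2 o0 ^+ 2 + T o0 o3 o3 o0 ^+ 2 =
  T o0 o1 o1 o0 ^+ 2 + T o1 o2 o2 o1 ^+ 2 + T o1 o3 o3 o1 ^+ 2 by lra.
have A2 : T o0 o1 o1 o0 ^+ 2 + T o0 o2 o2 o0 ^+ 2 + T o0 o3 o3 o0 ^+ 2 =
  T o0 o2 o2 o0 ^+ 2 + T o1 o2 o2 o1 ^+ 2 + T o2 o3 o3 o2 ^+ 2 by lra.
have A3 : T o0 o1 o1 o0 ^+ 2 + T o0 o2 o2 o0 ^+ 2 + T o0 o3 o3 o0 ^+ 2 =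
  T o0 o3 o3 o0 ^+ 2 + T o1 o3 o3 o1 ^+ 2 + T o2 o3 o3 o2 ^+ 2 by lra.
case: (sectional_cases A1 A2 A3 sE' E0 E1 E2 E3 mE (erefl _) (erefl _) (erefl _) (erefl _) N).
- move=> [s0 [[k1 k2 k3] [k4 k5 k6]]]; left; split => //.
  apply: ord4P; apply: ord4P => // _; rewrite ?(K o1 o0) ?(K o2 o0) ?(K o2 o1)
    ?(K o3 o0) ?(K o3 o1) ?(K o3 o2) ?[e o1 + e o0]addrC ?[e o2 + e o0]addrC ?[e o2 + e o1]addrC
    ?[e o3 + e o0]addrC ?[e o3 + e o1]addrC ?[e o3 + e o2]addrC //.
- move=> [r [[r0 q0 q1 q2 q3] [[k1 k2 k3] [k4 k5 k6]]]]; right; exists r; split => //.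
    by apply: ord4P.
  apply: ord4P; apply: ord4P => // _; rewrite ?(K o1 o0) ?(K o2 o0) ?(K o2 o1)
    ?(K o3 o0) ?(K o3 o1) ?(K o3 o2) ?[e o1 + e o0]addrC ?[e o2 + e o0]addrC ?[e o2 + e o1]addrC
    ?[e o3 + e o0]addrC ?[e o3 + e o1]addrC ?[e o3 + e o2]addrC
    ?[q o1 * q o0]mulrC ?[q o2 * q o0]mulrC ?[q o2 * q o1]mulrC
    ?[q o3 * q o0]mulrC ?[q o3 * q o1]mulrC ?[q o3 * q o2]mulrC //.
Qed.

End sectional_form.

(* Components of a 4-tensor in the frame given by the rows of h. *)
HB.lock Definition frT (R : realType) (n : nat) (h : 'M[R]_n) (X : 'I_n -> 'I_n -> 'M[R]_n)
    (a b : 'I_n) : 'M[R]_n :=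
  \sum_i \sum_j (h a i * h b j) *: (h *m X i j *m h^T).

(** * Components of tensors in an orthonormal frame *)

Section frames.
Context {R : realType} {n : nat}.
Implicit Types (h : 'M[R]_n) (X : 'I_n -> 'I_n -> 'M[R]_n).

Lemma frT_mxE h X a b c d :
  frT h X a b c d = \sum_i \sum_j h a i * h b j * (h *m X i j *m h^T) c d.
Proof.
rewrite frT.unlock summxE; apply: eq_bigr => i _; rewrite summxE; apply: eq_bigr => j _.
by rewrite scalemxE.
Qed.

Lemma frTE h X a b c d : frT h X a b c d =
  \sum_i \sum_j \sum_k \sum_l h a i * h b j * h c k * h d l * X i j k l.
Proof.
rewrite frT_mxE; apply: eq_bigr => i _; apply: eq_bigr => j _.
rewrite mxmulE.
under eq_bigr do rewrite mxmulE mulr_suml.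
rewrite exchange_big mulr_sumr; apply: eq_bigr => k _; rewrite mulr_sumr.
by apply: eq_bigr => l _; rewrite trmxE; ring.
Qed.

Lemma sum_rot (f : 'I_n -> 'I_n -> 'I_n -> 'I_n -> R) :
  \sum_i \sum_j \sum_k \sum_l f i j k l = \sum_i \sum_j \sum_k \sum_l f j l k i.
Proof.
transitivity (\sum_j \sum_i \sum_l \sum_k f j l k i).
  apply: eq_bigr => j _; rewrite [RHS]exchange_big; apply: eq_bigr => l _.
  by rewrite exchange_big.
rewrite exchange_big; apply: eq_bigr => i _; apply: eq_bigr => j _.
by rewrite exchange_big.
Qed.

Lemma frT_cyc h X a b c d :
  (forall i j k l, X i j k l + X j l k i + X l i k j = 0) ->
  frT h X a b d c + frT h X b c d a + frT h X c a d b = 0.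
Proof.
move=> H; rewrite !frTE [X in _ + X + _]sum_rot [X in _ + X]sum_rot [X in _ + X]sum_rot.
rewrite -!big_split big1 //= => i _; rewrite -!big_split big1 //= => j _.
rewrite -!big_split big1 //= => k _; rewrite -!big_split big1 //= => l _.
by rewrite -[RHS](mulr0 (h a i * h b j * h d k * h c l)) -(H i j k l); ring.
Qed.

Lemma frT_eq h X Y a b : (forall i j, X i j = Y i j) -> frT h X a b = frT h Y a b.
Proof.
by move=> XY; rewrite frT.unlock; apply: eq_bigr => i _; apply: eq_bigr => j _; rewrite XY.
Qed.

Lemma frT_skew12 h X a b : (forall i j, X i j = - X j i) -> frT h X a b = - frT h X b a.
Proof.
move=> H; rewrite frT.unlock exchange_big -sumrN; apply: eq_bigr => j _.
rewrite -sumrN; apply: eq_bigr => i _.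
by rewrite (H i j) mulmxN mulNmx scalerN mulrC.
Qed.

Lemma frT_tr h X a b : (frT h X a b)^T = frT h (fun i j => (X i j)^T) a b.
Proof.
rewrite frT.unlock raddf_sum; apply: eq_bigr => i _; rewrite raddf_sum; apply: eq_bigr => j _.
by apply: etrans (trmxZ _ _) _; rewrite !trmx_mul trmxK mulmxA.
Qed.

Section orthonormal.
Variables (G h : 'M[R]_n).
Hypothesis hG : h *m G *m h^T = 1%:M.

Lemma frame_unit : h \in unitmx.
Proof. by move: hG; rewrite -mulmxA => /mulmx1_unit[]. Qed.

Lemma frame_inv : h^T *m h = invmx G.
Proof.
have uh := frame_unit.
have : G *m (h^T *m h) = 1%:M.
  by apply: (can_inj (mulKmx uh)); rewrite !mulmxA hG mul1mx mulmx1.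
move=> H; have [uG _] := mulmx1_unit H.
by apply: (can_inj (mulKmx uG)); rewrite H mulmxV.
Qed.

Lemma contract_frame (A B : 'M[R]_n) :
  \sum_p \sum_q (h *m A *m h^T) p q * (h *m B *m h^T) p q =
  \sum_p \sum_q A p q * (invmx G *m B *m (invmx G)^T) p q.
Proof.
have dot (X Y : 'M[R]_n) : \sum_p \sum_q X p q * Y p q = \tr (X *m Y^T).
  by apply: eq_bigr => p _; rewrite mxmulE; apply: eq_bigr => q _; rewrite trmxE.
rewrite !dot !trmx_mul !trmxK -frame_inv trmx_mul trmxK.
have -> : h *m A *m h^T *m (h *m (B^T *m h^T)) = h *m (A *m h^T *m h *m B^T *m h^T).
  by rewrite !mulmxA.
by rewrite mxtrace_mulC !mulmxA.
Qed.

Lemma quad_entries (V B : 'M[R]_n) p q :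
  (V *m B *m V^T) p q = \sum_p' \sum_q' V p p' * V q q' * B p' q'.
Proof.
rewrite mxmulE exchange_big /=; apply: eq_bigr => q' _.
rewrite mxmulE mulr_suml; apply: eq_bigr => p' _; rewrite trmxE; ring.
Qed.

Lemma exchange_big3 (V : nmodType) (f : 'I_n -> 'I_n -> 'I_n -> V) :
  \sum_q \sum_i \sum_j f q i j = \sum_i \sum_j \sum_q f q i j.
Proof. by rewrite exchange_big; apply: eq_bigr => i _; rewrite exchange_big. Qed.

(** As h^T h is the inverse metric, sums over frame indices are contractions: [contract_frame]
    treats the pair p, q and [frame_inv] the index b. *)
Lemma frT_square X a c :
  \sum_b \sum_p \sum_q frT h X a b p q * frT h X c b p q =
  \sum_i \sum_i' h a i * h c i' * (\sum_k \sum_p \sum_q \sum_k' \sum_p' \sum_q'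
    invmx G k k' * invmx G p p' * invmx G q q' * X i k p q * X i' k' p' q').
Proof.
pose M i j := h *m X i j *m h^T.
have expand b p q : frT h X a b p q * frT h X c b p q =
   \sum_i \sum_i' \sum_j \sum_j' h a i * h c i' * (h b j * h b j') * (M i j p q * M i' j' p q).
  rewrite !frT_mxE mulr_suml; apply: eq_bigr => i _.
  rewrite mulr_sumr; apply: eq_bigr => i' _.
  rewrite mulr_suml; apply: eq_bigr => j _.
  by rewrite mulr_sumr; apply: eq_bigr => j' _; rewrite /M; ring.
under eq_bigr do under eq_bigr do under eq_bigr do rewrite expand.
under eq_bigr do under eq_bigr do rewrite exchange_big3.
under eq_bigr do rewrite exchange_big3.
rewrite exchange_big3; apply: eq_bigr => i _; apply: eq_bigr => i' _.
under eq_bigr do under eq_bigr do rewrite exchange_big3.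
under eq_bigr do rewrite exchange_big3.
rewrite exchange_big3 mulr_sumr; apply: eq_bigr => k _.
rewrite [in RHS]exchange_big3 [in RHS]exchange_big3 mulr_sumr; apply: eq_bigr => k' _.
transitivity (h a i * h c i' * invmx G k k' *
   \sum_p \sum_q X i k p q * (invmx G *m X i' k' *m (invmx G)^T) p q).
  rewrite -contract_frame -frame_inv [(h^T *m h) k k']mxmulE mulr_sumr mulr_suml.
  apply: eq_bigr => b _; rewrite mulr_sumr; apply: eq_bigr => p _.
  by rewrite mulr_sumr; apply: eq_bigr => q _; rewrite trmxE /M; ring.
rewrite -mulrA; congr (_ * _); rewrite mulr_sumr; apply: eq_bigr => p _.
rewrite mulr_sumr; apply: eq_bigr => q _; rewrite quad_entries !mulr_sumr.
apply: eq_bigr => p' _; rewrite !mulr_sumr; apply: eq_bigr => q' _; ring.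
Qed.

End orthonormal.
End frames.

Lemma diag_mxE (R : nzRingType) n (d : 'rV[R]_n) i j : diag_mx d i j = d 0 i * (i == j)%:R.
Proof. by rewrite mxE mulr_natr. Qed.

Section pointwise.
Context {R : realType}.
Variables (D : set 'rV[R]_4) (G : 'rV[R]_4 -> 'M[R]_4).
Hypothesis lm : local_metric D G.
Hypothesis harm : forall x, D x -> forall i j k, div_riemann G i j k x = 0.
Variables (x : 'rV[R]_4) (phi : R).
Hypothesis Dx : D x.
Hypothesis wE : forall i j, curvature_square G i j x = phi * G x i j.
Variables (h : 'M[R]_4) (d : 'rV[R]_4).
Hypothesis hG : h *m G x *m h^T = 1%:M.
Hypothesis hE : h *m ric G x *m h^T = diag_mx d.

Definition frR a b : 'M[R]_4 := frT h (fun i j => Rm G i j x) a b.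

Lemma frR_s12 a b p q : frR a b p q = - frR b a p q.
Proof.
by rewrite /frR frT_skew12 ?oppmxE // => i j; rewrite /Rm cur_skew mulNmx.
Qed.

Lemma frR_s34 a b p q : frR a b p q = - frR a b q p.
Proof.
rewrite -[frR a b q p]trmxE /frR frT_tr frT.unlock !summxE -sumrN; apply: eq_bigr => i _.
rewrite !summxE -sumrN; apply: eq_bigr => j _.
have -> : (Rm G i j x)^T = - Rm G i j x.
  by apply/matrixP => k l; rewrite trmxE oppmxE (Rm_skew lm).
by rewrite mulmxN mulNmx scalerN oppmxE opprK.
Qed.

Lemma frR_b1 a b c p : frR a b c p + frR b c a p + frR c a b p = 0.
Proof.
rewrite (frR_s34 a) (frR_s34 b) (frR_s34 c) -!opprD.
rewrite frT_cyc ?oppr0 // => i j k l.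
have b1 q r s t : Rm G q r x s t + Rm G r s x q t + Rm G s q x r t = 0.
  rewrite /Rm !mxmulE -!big_split /= big1 // => u _.
  by rewrite -!mulrDl (bianchi1 lm) // mul0r.
by rewrite (Rm_skew lm) // (Rm_skew lm _ _ k) // (Rm_skew lm _ _ k j) // -!opprD b1 oppr0.
Qed.

Lemma frR_pair a b c p : frR a b c p = frR c p a b.
Proof.
apply: (@curvature_pair _ _ (fun a b c p => frR a b c p)).
- exact: frR_s12.
- exact: frR_s34.
- exact: frR_b1.
Qed.

Lemma iG_frame : h^T *m h = iG G x.
Proof. by rewrite iGE /ginv (frame_inv hG). Qed.

Lemma frR_ric b c : \sum_a frR a b c a = d 0 b * (b == c)%:R.
Proof.
rewrite -diag_mxE -hE quad_entries.
under eq_bigr do rewrite /frR frTE.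
rewrite exchange_big /=.
transitivity (\sum_i \sum_j \sum_k \sum_l h b j * h c k * (iG G x i l * Rm G i j x k l)).
  apply: eq_bigr => i _; rewrite exchange_big; apply: eq_bigr => j _ /=.
  rewrite exchange_big; apply: eq_bigr => k _ /=.
  rewrite exchange_big; apply: eq_bigr => l _ /=.
  rewrite -iG_frame [(_ *m _) i l]mxmulE mulr_suml mulr_sumr; apply: eq_bigr => a _.
  by rewrite trmxE; ring.
rewrite exchange_big; apply: eq_bigr => j _ /=; rewrite exchange_big; apply: eq_bigr => k _ /=.
rewrite (ric_low lm) // mulr_sumr; apply: eq_bigr => i _.
by rewrite mulr_sumr.
Qed.

Lemma frR_cyc a b c p :
  frR a b p c * d 0 c + frR b c p a * d 0 a + frR c a p b * d 0 b = 0.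
Proof.
have E q r s t : frR q r s t * d 0 t = frT h (fun i j => cur G i j x *m (ric G x)^T) q r s t.
  have -> : frR q r s t * d 0 t = (frR q r *m diag_mx d) s t.
    rewrite mxmulE (bigD1 t) //= big1 => [|i it]; rewrite diag_mxE.
      by rewrite eqxx mulr1 addr0.
    by rewrite (negPf it) !mulr0.
  rewrite /frR frT.unlock mulmx_suml !summxE; apply: eq_bigr => i _.
  rewrite mulmx_suml !summxE; apply: eq_bigr => j _.
  rewrite -scalemxAl -hE (ric_tr lm) // (curG lm) // -iG_frame.
  by rewrite !mulmxA.
rewrite !E; apply: frT_cyc => i j k l.
apply: (codazzi_cur lm (ric_smooth lm)) => // y Dy u v w.
exact: (codazzi_ric lm harm).
Qed.

Lemma frR_square a c :
  \sum_b \sum_p \sum_q frR a b p q * frR c b p q = phi * (a == c)%:R.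
Proof.
rewrite (frT_square hG).
transitivity (\sum_i \sum_i' h a i * h c i' * (phi * G x i i')).
  apply: eq_bigr => i _; apply: eq_bigr => i' _; rewrite -wE; congr (_ * _).
  apply: eq_bigr => k _; apply: eq_bigr => p _; apply: eq_bigr => q _.
  apply: eq_bigr => k' _; apply: eq_bigr => p' _; apply: eq_bigr => q' _.
  by rewrite !RmE.
have := hG => /matrixP/(_ a c); rewrite [1%:M _ _]mxE => <-.
rewrite mxmulE mulr_sumr exchange_big; apply: eq_bigr => i' _ /=.
rewrite mxmulE mulr_suml mulr_sumr; apply: eq_bigr => i _; rewrite trmxE; ring.
Qed.

End pointwise.

(** * Classification at non-Einstein points *)

(* Twice the Kulkarni-Nomizu-type product of symmetric tensors, in the index
   convention R_abba > 0 on spheres: kn G G = 2 (G_il G_jk - G_ik G_jl). *)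
HB.lock Definition kn (R : realType) (n : nat) (A B : 'M[R]_n) (i j : 'I_n) : 'M[R]_n :=
  \matrix_(k, l) (A i l * B j k + B i l * A j k - A i k * B j l - B i k * A j l).

Section kulkarni_nomizu.
Context {R : realType} {n : nat}.
Implicit Types (h A B : 'M[R]_n) (X Y : 'I_n -> 'I_n -> 'M[R]_n).

Lemma knE A B i j k l :
  kn A B i j k l = A i l * B j k + B i l * A j k - A i k * B j l - B i k * A j l.
Proof. by rewrite kn.unlock mxE. Qed.

Lemma frT_comp h' h X a b :
  frT h' (fun i j => frT h X i j) a b = frT (h' *m h) X a b.
Proof.
rewrite [in LHS]frT.unlock.
transitivity (\sum_i \sum_j \sum_k \sum_l
   (h' a i * h i k * (h' b j * h j l)) *: (h' *m h *m X k l *m (h' *m h)^T)).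
  apply: eq_bigr => i _; apply: eq_bigr => j _.
  rewrite mulmx_sumr mulmx_suml scaler_sumr; apply: eq_bigr => k _.
  rewrite mulmx_sumr mulmx_suml scaler_sumr; apply: eq_bigr => l _.
  rewrite -scalemxAr -scalemxAl scalerA trmx_mul !mulmxA; congr (_ *: _); ring.
rewrite frT.unlock exchange_big3.
transitivity (\sum_j \sum_k \sum_l \sum_i
   (h' a i * h i k * (h' b j * h j l)) *: (h' *m h *m X k l *m (h' *m h)^T)).
  by apply: eq_bigr => j _; apply: eq_bigr => k _; rewrite exchange_big.
rewrite exchange_big3; apply: eq_bigr => k _; apply: eq_bigr => l _.
rewrite exchange_big /=.
under eq_bigr do rewrite -scaler_suml.
rewrite -scaler_suml; congr (_ *: _).
rewrite [in RHS]mxmulE mulr_suml; apply: eq_bigr => i _.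
by rewrite mxmulE mulr_sumr.
Qed.

Lemma frT1 X a b : frT 1%:M X a b = X a b.
Proof.
rewrite frT.unlock (bigD1 a) //= [X in _ + X]big1 => [|i ia]; last first.
  by rewrite big1 // => j _; rewrite mxE eq_sym (negPf ia) mul0r scale0r.
rewrite addr0 (bigD1 b) //= big1 => [|j jb]; last first.
  by rewrite [X in _ * X]mxE eq_sym (negPf jb) mulr0 scale0r.
by rewrite !mxE !eqxx mul1r scale1r mul1mx trmx1 mulmx1 addr0.
Qed.

Lemma frT_inj h X Y : h \in unitmx -> (forall a b, frT h X a b = frT h Y a b) ->
  forall i j, X i j = Y i j.
Proof.
move=> uh XY i j; rewrite -(frT1 X) -(frT1 Y) -(mulVmx uh) -!frT_comp.
by apply: frT_eq => a b; exact: XY.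
Qed.

Lemma frT_kn h A B a b :
  frT h (kn A B) a b = kn (h *m A *m h^T) (h *m B *m h^T) a b.
Proof.
have P (A' B' : 'M[R]_n) p q r s : (h *m A' *m h^T) p q * (h *m B' *m h^T) r s =
   \sum_i \sum_j \sum_k \sum_l h p i * h r j * h s k * h q l * (A' i l * B' j k).
  rewrite !quad_entries mulr_suml; apply: eq_bigr => i _.
  rewrite mulr_suml.
  under eq_bigr do rewrite mulr_sumr.
  rewrite exchange_big; apply: eq_bigr => j _.
  under eq_bigr do rewrite mulr_sumr.
  rewrite exchange_big; apply: eq_bigr => k _; apply: eq_bigr => l _; ring.
have P' (A' B' : 'M[R]_n) p q r s : (h *m A' *m h^T) p q * (h *m B' *m h^T) r s =
   \sum_i \sum_j \sum_k \sum_l h p i * h r j * h q k * h s l * (A' i k * B' j l).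
  rewrite P; apply: eq_bigr => i _; apply: eq_bigr => j _; rewrite exchange_big.
  apply: eq_bigr => k _; apply: eq_bigr => l _; ring.
apply/matrixP => c d; rewrite knE frTE.
rewrite (P A B a d b c) (P B A a d b c) (P' A B a c b d) (P' B A a c b d).
rewrite -!sumrN -!big_split; apply: eq_bigr => i _; rewrite /= -!sumrN -!big_split.
apply: eq_bigr => j _; rewrite /= -!sumrN -!big_split.
apply: eq_bigr => k _; rewrite /= -!sumrN -!big_split.
apply: eq_bigr => l _; rewrite /= knE; ring.
Qed.

Lemma frT_lin h X Y (c1 c2 : R) a b :
  frT h (fun i j => c1 *: X i j + c2 *: Y i j) a b = c1 *: frT h X a b + c2 *: frT h Y a b.
Proof.
rewrite frT.unlock !scaler_sumr -big_split; apply: eq_bigr => i _.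
rewrite !scaler_sumr -big_split; apply: eq_bigr => j _ /=.
by rewrite mulmxDr mulmxDl -!scalemxAr -!scalemxAl scalerDr !scalerA ![_ * c1]mulrC ![_ * c2]mulrC.
Qed.

End kulkarni_nomizu.

(** * Covariant derivatives of compositions and of Kulkarni-Nomizu products *)

Section covariant.
Context {R : realType} {n : nat}.
Variables (D : set 'rV[R]_n) (G : 'rV[R]_n -> 'M[R]_n).
Hypothesis lm : local_metric D G.

Let oD := lm_open lm.
Let sG := lm_smooth lm.
Local Notation Dc := (Dc G).

Lemma Dc_metric i x : D x -> Dc i G x = 0.
Proof. by move=> Dx; rewrite /Dc (om_compat lm) //; mxring. Qed.

Lemma DcD i A B x : mxsmooth D A -> mxsmooth D B -> D x ->
  Dc i (fun y => A y + B y) x = Dc i A x + Dc i B x.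
Proof. by move=> sA sB Dx; rewrite /Dc (dmxD i sA sB) //; mxring. Qed.

Lemma DcZ i (f : 'rV[R]_n -> R) A x : smooth_on D f -> mxsmooth D A -> D x ->
  Dc i (fun y => f y *: A y) x = pd i f x *: A x + f x *: Dc i A x.
Proof.
move=> sf sA Dx; rewrite /Dc (dmxZ i sf sA) // !scalerBr -scalemxAr -scalemxAl.
by rewrite -!addrA.
Qed.

Lemma Dc_comp i A B x : mxsmooth D A -> mxsmooth D B -> D x ->
  Dc i (fun y => A y *m iG G y *m B y) x =
  Dc i A x *m iG G x *m B x + A x *m iG G x *m Dc i B x.
Proof.
move=> sA sB Dx; have siG := ginv_smooth lm.
have sAi : mxsmooth D (fun y => A y *m iG G y) by exact: mxsmoothM.
rewrite /Dc (dmxM i sAi sB) // (dmxM i sA siG) // (diG lm) //; mxring.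
Qed.

Lemma eq_on_Dc i A B x : (forall y, D y -> A y = B y) -> D x -> Dc i A x = Dc i B x.
Proof. by move=> AB Dx; rewrite /Dc (eq_on_dmx oD i AB) // AB. Qed.

(* nabla_m of the (0,4)-tensor with components X i j x k l *)
Definition nabla4 (X : 'I_n -> 'I_n -> 'rV[R]_n -> 'M[R]_n) m i j k l x : R :=
  pd m (fun y => X i j y k l) x
  - \sum_s (om G m x i s * X s j x k l + om G m x j s * X i s x k l
     + om G m x k s * X i j x s l + om G m x l s * X i j x k s).

Lemma nabla4_riemann m i j k l x : D x ->
  nabla4 (Rm G) m i j k l x = (ncur G m i j x *m G x) k l.
Proof.
move=> Dx; rewrite -(nabla_riemannE lm) // /nabla4 /nabla_riemann -pdE.
have E p q r s : riemann G p q r s = (fun y => Rm G p q y r s).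
  by apply/funext => y; rewrite RmE.
by rewrite E; congr (_ - _); apply: eq_bigr => s _; rewrite !omE !E.
Qed.

(** The connection terms are arranged index by index, as in [nabla4], so that they cancel there. *)
Lemma pd_prod_covariant (A B : 'rV[R]_n -> 'M[R]_n) m p q r t x :
  mxsmooth D A -> mxsmooth D B -> D x ->
  pd m (fun y => A y p q * B y r t) x =
  Dc m A x p q * B x r t + A x p q * Dc m B x r t +
  \sum_s (om G m x p s * (A x s q * B x r t) + om G m x q s * (A x p s * B x r t)
    + om G m x r s * (A x p q * B x s t) + om G m x t s * (A x p q * B x r s)).
Proof.
move=> sA sB Dx; rewrite partialM; [|exact: mxsmooth_differentiable sA Dx|exact: mxsmooth_differentiable sB Dx].
rewrite -!dmxE /Dc !(addmxE, oppmxE) !mxmulE !big_split /=.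
have E1 (f g : 'I_n -> R) c : \sum_s f s * (g s * c) = (\sum_s f s * g s) * c.
  by rewrite mulr_suml; apply: eq_bigr => s _; rewrite mulrA.
have E2 (f g : 'I_n -> R) c : \sum_s f s * (c * g s) = c * (\sum_s f s * g s).
  by rewrite mulr_sumr; apply: eq_bigr => s _; rewrite mulrCA.
have E3 (X : 'M[R]_n) a b : \sum_s om G m x b s * X a s = \sum_k X a k * (om G m x)^T k b.
  by apply: eq_bigr => s _; rewrite trmxE mulrC.
rewrite !E1 !E2 !E3.
by move: (\sum_s _) (\sum_s _) (\sum_s _) (\sum_s _) => *; ring.
Qed.

Lemma nabla4_kn (A B : 'rV[R]_n -> 'M[R]_n) m i j k l x :
  mxsmooth D A -> mxsmooth D B -> D x ->
  nabla4 (fun i j y => kn (A y) (B y) i j) m i j k l x =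
  kn (Dc m A x) (B x) i j k l + kn (A x) (Dc m B x) i j k l.
Proof.
move=> sA sB Dx; rewrite /nabla4.
have -> : (fun y => kn (A y) (B y) i j k l) = (fun y => A y i l * B y j k + B y i l * A y j k
   - A y i k * B y j l - B y i k * A y j l) by apply/funext => y; rewrite knE.
have d (X Y : 'rV[R]_n -> 'M[R]_n) p q r s : mxsmooth D X -> mxsmooth D Y ->
    differentiable (fun y => X y p q * Y y r s) x.
  by move=> sX sY; apply: differentiableM; exact: mxsmooth_differentiable Dx.
have := d A B; have := d B A => dBA dAB.
rewrite partialB; [|by repeat (apply: differentiableB || apply: differentiableD); auto|by auto].
rewrite partialB; [|by repeat (apply: differentiableB || apply: differentiableD); auto|by auto].
rewrite partialD; [|by auto|by auto].
rewrite !(pd_prod_covariant _ _ _ _ _ sA sB) // !(pd_prod_covariant _ _ _ _ _ sB sA) //.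
rewrite !knE.
under [X in _ - X]eq_bigr do rewrite !knE.
set S1 := \sum_s _; set S2 := \sum_s _; set S3 := \sum_s _; set S4 := \sum_s _; set S5 := \sum_s _.
have -> : S5 = S1 + S2 - S3 - S4.
  rewrite /S1 /S2 /S3 /S4 /S5 -!sumrN -!big_split; apply: eq_bigr => s _ /=.
  by clear; ring.
by clear; move: S1 S2 S3 S4 => *; ring.
Qed.

End covariant.

(* The traceless Ricci tensor when sc is the scalar curvature; Qf is then the traceless
   part of its square. *)
Definition Ef (R : realType) n (G : 'rV[R]_n -> 'M[R]_n) (sc : R) y : 'M[R]_n :=
  ric G y - (sc / n%:R) *: G y.

(** The trace divided by the dimension: subtracting this multiple of G leaves the trace-free
    part. *)
Definition tr4 (R : realType) n (G : 'rV[R]_n -> 'M[R]_n) (A : 'rV[R]_n -> 'M[R]_n) y : R :=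
  \tr (iG G y *m A y) / n%:R.

Definition Qf (R : realType) n (G : 'rV[R]_n -> 'M[R]_n) (sc : R) y : 'M[R]_n :=
  Ef G sc y *m iG G y *m Ef G sc y
  - tr4 G (fun y => Ef G sc y *m iG G y *m Ef G sc y) y *: G y.

(* rf vanishes exactly where the square of the traceless Ricci tensor is a multiple
   of the metric. *)
Definition rf (R : realType) n (G : 'rV[R]_n -> 'M[R]_n) (sc : R) y : R :=
  tr4 G (fun y => Qf G sc y *m iG G y *m Qf G sc y) y.

Section smoothness.
Context {R : realType} {n : nat}.
Variables (D : set 'rV[R]_n) (G : 'rV[R]_n -> 'M[R]_n) (sc : R).
Hypothesis lm : local_metric D G.
Let oD := lm_open lm.
Let sG := lm_smooth lm.
Let siG := ginv_smooth lm.

Lemma tr4_smooth A : mxsmooth D A -> smooth_on D (tr4 G A).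
Proof.
move=> sA; apply: smoothM => //; last exact: smooth_cst.
by apply: smooth_sum => // k; exact: (mxsmoothM oD siG sA).
Qed.

Lemma Ef_smooth : mxsmooth D (Ef G sc).
Proof.
apply: mxsmoothD => //; first exact: (ric_smooth lm).
by apply: mxsmoothN => //; apply: mxsmoothZ => //; exact: smooth_cst.
Qed.

Lemma comp_smooth (A B : 'rV[R]_n -> 'M[R]_n) : mxsmooth D A -> mxsmooth D B ->
  mxsmooth D (fun y => A y *m iG G y *m B y).
Proof. by move=> sA sB; apply: mxsmoothM => //; exact: mxsmoothM. Qed.

Lemma Qf_smooth : mxsmooth D (Qf G sc).
Proof.
have sE := Ef_smooth; have sEE := comp_smooth sE sE.
apply: mxsmoothD => //; apply: mxsmoothN => //; apply: mxsmoothZ => //.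
exact: tr4_smooth.
Qed.

Lemma rf_smooth : smooth_on D (rf G sc).
Proof. by apply: tr4_smooth; apply: comp_smooth; exact: Qf_smooth. Qed.

Lemma Ef_tr x : D x -> (Ef G sc x)^T = Ef G sc x.
Proof. by move=> Dx; rewrite /Ef trmxD trmxN trmxZ (ric_tr lm) // (lm_sym lm). Qed.

Lemma Dc_Ef i x : D x -> Dc G i (Ef G sc) x = Dc G i (ric G) x.
Proof.
move=> Dx; have sc' := @smooth_cst R n D (- (sc / n%:R)).
rewrite (eq_on_Dc lm i (B := fun y => ric G y + (- (sc / n%:R)) *: G y)) //; last first.
  by move=> y _; rewrite /Ef scaleNr.
rewrite (@DcD _ _ D) //; [|exact: (ric_smooth lm)|exact: mxsmoothZ].
by rewrite (@DcZ _ _ D) // partial_cst (Dc_metric lm) // scale0r scaler0 !addr0.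
Qed.

End smoothness.

Section frame_calculus.
Context {R : realType} {n : nat}.
Variables (G : 'rV[R]_n -> 'M[R]_n) (x : 'rV[R]_n) (h : 'M[R]_n).
Hypothesis hG : h *m G x *m h^T = 1%:M.

Lemma fr_iG : h^T *m h = iG G x.
Proof. by rewrite iGE /ginv (frame_inv hG). Qed.

Lemma fr_comp (A B : 'M[R]_n) :
  h *m (A *m iG G x *m B) *m h^T = (h *m A *m h^T) *m (h *m B *m h^T).
Proof. by rewrite -fr_iG !mulmxA. Qed.

Lemma fr_trace (A : 'M[R]_n) : \tr (iG G x *m A) = \tr (h *m A *m h^T).
Proof. by rewrite -fr_iG -mulmxA mxtrace_mulC. Qed.

Lemma fr_inj (A B : 'M[R]_n) : h *m A *m h^T = h *m B *m h^T -> A = B.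
Proof.
have uh := frame_unit hG.
have uht : h^T \in unitmx by rewrite unitmx_tr.
by move/(can_inj (mulmxK uht))/(can_inj (mulKmx uh)).
Qed.

(** Frame components of a tensor with three indices, below a covariant derivative
    [fun l => Dc G l A x]. *)
Definition frS (A : 'I_n -> 'M[R]_n) a : 'M[R]_n := \sum_l h a l *: (h *m A l *m h^T).

Lemma frSE (A : 'I_n -> 'M[R]_n) a b c : frS A a b c = \sum_l \sum_j \sum_k h a l * h b j * h c k * A l j k.
Proof.
rewrite summxE; apply: eq_bigr => l _; rewrite scalemxE quad_entries mulr_sumr.
apply: eq_bigr => j _; rewrite mulr_sumr; apply: eq_bigr => k _; ring.
Qed.

Lemma frS_sym (A : 'I_n -> 'M[R]_n) a b c : (forall l j k, A l j k = A j l k) -> frS A a b c = frS A b a c.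
Proof.
move=> sA; rewrite !frSE exchange_big; apply: eq_bigr => j _; apply: eq_bigr => l _.
apply: eq_bigr => k _; rewrite sA; ring.
Qed.

Lemma frS_symr (A : 'I_n -> 'M[R]_n) a b c : (forall l, (A l)^T = A l) -> frS A a b c = frS A a c b.
Proof.
move=> sA; rewrite !frSE; apply: eq_bigr => l _; rewrite exchange_big.
apply: eq_bigr => j _; apply: eq_bigr => k _.
by rewrite -{1}(sA l) trmxE; ring.
Qed.

Lemma frS_inj0 (A : 'I_n -> 'M[R]_n) : (forall a, frS A a = 0) -> forall l, A l = 0.
Proof.
move=> A0 l; have uh := frame_unit hG.
have H : \sum_a (invmx h) l a *: frS A a = h *m A l *m h^T.
  rewrite /frS; under eq_bigr do rewrite scaler_sumr.
  rewrite exchange_big (bigD1 l) //= [X in _ + X]big1 ?addr0 => [|k kl].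
    under eq_bigr do rewrite scalerA.
    rewrite -scaler_suml; have := mulVmx uh => /matrixP/(_ l l).
    by rewrite mxmulE mxE eqxx => ->; rewrite scale1r.
  under eq_bigr do rewrite scalerA.
  rewrite -scaler_suml; have := mulVmx uh => /matrixP/(_ l k).
  by rewrite mxmulE mxE eq_sym (negPf kl) => ->; rewrite scale0r.
apply: fr_inj; rewrite -H mulmx0 mul0mx big1 // => a _.
by rewrite A0 scaler0.
Qed.

End frame_calculus.

Lemma mean_const (R : realType) (c : R) : (\sum_(i < 4) c) / 4 = c.
Proof. by rewrite sumr_const card_ord -[X in X / _]mulr_natr mulfK // pnatr_eq0. Qed.

Section classification.
Context {R : realType}.
Variables (D : set 'rV[R]_4) (G : 'rV[R]_4 -> 'M[R]_4) (sc : R).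
Hypothesis lm : local_metric D G.
Hypothesis harm : forall x, D x -> forall i j k, div_riemann G i j k x = 0.
Hypothesis wE : forall x, D x -> exists phi, forall i j, curvature_square G i j x = phi * G x i j.
Hypothesis hsc : forall x, D x -> \tr (iG G x *m ric G x) = sc.

Let oD := lm_open lm.
Let sG := lm_smooth lm.
Local Notation EF := (Ef G sc).
Local Notation QF := (Qf G sc).
Local Notation RF := (rf G sc).

Section at_point.
Variables (x : 'rV[R]_4) (h : 'M[R]_4) (d : 'rV[R]_4).
Hypothesis Dx : D x.
Hypothesis hG : h *m G x *m h^T = 1%:M.
Hypothesis hE : h *m ric G x *m h^T = diag_mx d.

(** The eigenvalues of E; [fq] are those of Q, and [RF] is the mean of the squares of the latter. *)
Definition fe a : R := d 0 a - sc / 4.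
Definition fq a : R := fe a ^+ 2 - (\sum_i fe i ^+ 2) / 4.

Lemma frame_sum : \sum_i d 0 i = sc.
Proof. by rewrite -(hsc Dx) (fr_trace hG) hE mxtrace_diag. Qed.

Lemma frame_E : h *m EF x *m h^T = diag_mx (\row_a fe a).
Proof.
rewrite /Ef mulmxBr mulmxBl hE -scalemxAr -scalemxAl hG.
apply/matrixP => a b; rewrite !mxE /fe.
by case: eqP => // _; rewrite ?mulr0n ?mulr1n; ring.
Qed.

Lemma diag_mul (u v : 'I_4 -> R) :
  diag_mx (\row_a u a) *m diag_mx (\row_a v a) = diag_mx (\row_a (u a * v a)).
Proof. by rewrite mulmx_diag; congr diag_mx; apply/rowP => a; rewrite !mxE. Qed.

Lemma tr_diag_row (u : 'I_4 -> R) : \tr (diag_mx (\row_a u a)) = \sum_a u a.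
Proof. by rewrite mxtrace_diag; apply: eq_bigr => a _; rewrite mxE. Qed.

Lemma frame_Q : h *m QF x *m h^T = diag_mx (\row_a fq a).
Proof.
rewrite /Qf mulmxBr mulmxBl (fr_comp hG) frame_E diag_mul.
rewrite -scalemxAr -scalemxAl hG /tr4 (fr_trace hG) (fr_comp hG) frame_E diag_mul tr_diag_row.
apply/matrixP => a b; rewrite !mxE /fq.
by case: eqP => // _; rewrite ?mulr0n ?mulr1n //; ring.
Qed.

Lemma frame_r : RF x = (\sum_a fq a ^+ 2) / 4.
Proof. by rewrite /rf /tr4 (fr_trace hG) (fr_comp hG) frame_Q diag_mul tr_diag_row. Qed.

Lemma rf_eq0 : (RF x == 0) = [forall a, fq a == 0].
Proof.
rewrite frame_r mulf_eq0 invr_eq0 pnatr_eq0 orbF psumr_eq0; last by move=> *; exact: sqr_ge0.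
apply/allP/forallP => [H a|H a _].
  by have := H a (mem_index_enum _); rewrite sqrf_eq0.
by apply/implyP => _; rewrite sqrf_eq0.
Qed.

Lemma fe_sum : \sum_a fe a = 0.
Proof.
have := frame_sum; rewrite !(sum_uniq4 _ (isT : uniq [:: o0; o1; o2; o3])) /fe.
by move: (d 0 o0) (d 0 o1) (d 0 o2) (d 0 o3) => *; lra.
Qed.

Lemma rf_neq0_nsq : RF x != 0 -> ~ forall a b, fe a ^+ 2 = fe b ^+ 2.
Proof.
rewrite rf_eq0 => /forallPn[a /negP qa] H; apply: qa; rewrite /fq.
under eq_bigr do rewrite (H _ a).
by rewrite mean_const subrr.
Qed.

Let frR12 a b c e : frR G x h a b c e = - frR G x h b a c e.
Proof. exact: frR_s12. Qed.
Let frR34 a b c e : frR G x h a b c e = - frR G x h a b e c.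
Proof. exact: (frR_s34 lm Dx). Qed.
Let frRp a b c e : frR G x h a b c e = frR G x h c e a b.
Proof. exact: (frR_pair lm Dx). Qed.
Let frRb a b c e : frR G x h a b c e + frR G x h b c a e + frR G x h c a b e = 0.
Proof. exact: (frR_b1 lm Dx). Qed.
Let frRr b c : \sum_a frR G x h a b c a = d 0 b * (b == c)%:R.
Proof. exact: (frR_ric lm Dx hG hE). Qed.
Let frRc a b c e : frR G x h a b e c * d 0 c + frR G x h b c e a * d 0 a
  + frR G x h c a e b * d 0 b = 0.
Proof. exact: (frR_cyc lm harm Dx hG hE). Qed.
Let frRs phi (H : forall i j, curvature_square G i j x = phi * G x i j) a c :
  \sum_b \sum_p \sum_q frR G x h a b p q * frR G x h c b p q = phi * (a == c)%:R.
Proof. exact: (frR_square H hG). Qed.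

Lemma curvature_alternative : RF x != 0 ->
  (sc = 0 /\ forall a b, a != b -> frR G x h a b b a = (fe a + fe b) / 2) \/
  ((forall a, fq a ^+ 2 = RF x) /\ forall a b, a != b ->
     frR G x h a b b a = (fe a + fe b) / 2 + sc / 8 * (fq a * fq b / RF x + 1)).
Proof.
move=> r0; have [phi wEx] := wE Dx.
have := sectional_form frR12 frR34 frRp frRb frRr frRc (frRs wEx).
rewrite frame_sum => /(_ (rf_neq0_nsq r0))[[s0 H]|[r [r'0 H1 H2]]]; first by left.
right; have rE : RF x = r.
  rewrite frame_r; under eq_bigr do rewrite [fq _ ^+ 2]H1.
  by rewrite mean_const.
by rewrite rE.
Qed.

Lemma frR_diag : RF x != 0 -> forall a b c e, frR G x h a b c e =
  frR G x h a b b a * ((a == e)%:R * (b == c)%:R - (a == c)%:R * (b == e)%:R).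
Proof.
move=> r0; have [phi wEx] := wE Dx.
apply: (T_diag frR12 frR34 frRp frRb frRr frRc (frRs wEx)).
by rewrite frame_sum; exact: rf_neq0_nsq.
Qed.

Lemma kn_diag (u v : 'I_4 -> R) a b c e :
  kn (diag_mx (\row_a u a)) (diag_mx (\row_a v a)) a b c e =
  (u a * v b + v a * u b) * ((a == e)%:R * (b == c)%:R - (a == c)%:R * (b == e)%:R).
Proof. by rewrite knE !diag_mxE ![(\row_ _ _) _ _]mxE; ring. Qed.

Lemma one_diag : 1%:M = diag_mx (\row_a (fun _ : 'I_4 => 1 : R) a).
Proof. by apply/matrixP => a b; rewrite !mxE. Qed.

(** [frR_diag] reduces the claim to sectional curvatures. The alternative without Q in
    [curvature_alternative] comes with sc = 0, where the last term vanishes, so that one formula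
    covers both alternatives. *)
Lemma curvature_formula : RF x != 0 -> forall i j, Rm G i j x =
  2^-1 *: kn (EF x) (G x) i j +
  (sc / 16) *: ((RF x)^-1 *: kn (QF x) (QF x) i j + 1 *: kn (G x) (G x) i j).
Proof.
move=> r0; apply: (frT_inj (frame_unit hG)) => a b.
rewrite frT_lin frT_lin !frT_kn frame_E frame_Q hG one_diag.
apply/matrixP => c e; rewrite -/(frR G x h a b) frR_diag //.
rewrite !(addmxE, scalemxE) !kn_diag.
have [<-|ab] := eqVneq a b; first by rewrite ![(a == c)%:R * _]mulrC subrr; ring.
have -> : frR G x h a b b a = (fe a + fe b) / 2 + sc / 8 * (fq a * fq b / RF x + 1).
  by case: (curvature_alternative r0) => [[s0 H]|[_ H]]; rewrite H // s0; ring.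
by field.
Qed.

End at_point.

Lemma frame_exists x : D x -> exists (h : 'M[R]_4) (d : 'rV[R]_4),
  h *m G x *m h^T = 1%:M /\ h *m ric G x *m h^T = diag_mx d.
Proof.
move=> Dx; apply: simultaneous_diag; [exact: (lm_sym lm)|exact: (ric_tr lm)|].
exact: (lm_pos lm).
Qed.

End classification.

(** * Frames in which the eigenvalues have equal squares *)

Section sign_algebra.
Context {R : realType}.
Let S4 (f : 'I_4 -> R) := @sum_uniq4 R f _ _ _ _ (isT : uniq [:: o0; o1; o2; o3]).

Lemma two_blocks (e : 'I_4 -> R) (M : R) : M != 0 -> (forall a, e a ^+ 2 = M) ->
  \sum_a e a = 0 ->
  exists a b c d, [/\ uniq [:: a; b; c; d], e b = e a, e c = - e a & e d = - e a].
Proof.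
move=> M0 eM; rewrite S4 => e0.
have E a b : e a ^+ 2 = e b ^+ 2 by rewrite !eM.
have n0 : e o0 != 0 by apply: contraNneq M0 => h; rewrite -(eM o0) h expr0n.
have F : e o0 = 0 -> False by move/eqP; rewrite (negPf n0).
case: (sqr_eq_cases (E o0 o1)) => h1; case: (sqr_eq_cases (E o0 o2)) => h2;
  case: (sqr_eq_cases (E o0 o3)) => h3.
- by exfalso; apply: F; lra.
- by exfalso; apply: F; lra.
- by exfalso; apply: F; lra.
- by exists o0, o1, o2, o3.
- by exfalso; apply: F; lra.
- by exists o0, o2, o1, o3.
- by exists o0, o3, o1, o2.
- by exfalso; apply: F; lra.
Qed.

Lemma sign_cases (e : 'I_4 -> R) (M : R) a b : (forall a, e a ^+ 2 = M) ->
  e b = e a \/ e b = - e a.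
Proof. by move=> eM; apply: sqr_eq_cases; rewrite !eM. Qed.

Lemma sign_neq0 (e : 'I_4 -> R) (M : R) a : M != 0 -> (forall a, e a ^+ 2 = M) -> e a != 0.
Proof. by move=> M0 eM; apply: contraNneq M0 => h; rewrite -(eM a) h expr0n. Qed.

Lemma partner (e : 'I_4 -> R) (M : R) a : M != 0 -> (forall a, e a ^+ 2 = M) ->
  \sum_a e a = 0 -> exists2 b, b != a & e b = e a.
Proof.
move=> M0 eM e0; have [x [y [z [w [u e1 e2 e3]]]]] := two_blocks M0 eM e0.
have : a \in [:: x; y; z; w] by rewrite -(perm_mem (perm_enum4 u)) mem_index_enum.
move: u; rewrite /= !inE !negb_or -!andbA => /and5P[xy xz xw yz /and3P[yw zw _]].
case/or4P => /eqP ->.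
- by exists y; rewrite // eq_sym.
- by exists x.
- by exists w; rewrite ?e2 ?e3 // eq_sym.
- by exists z; rewrite ?e2 ?e3.
Qed.

(** Among the three values e_a, e_b, e_c two agree, and by total symmetry these may be moved to the
    last two places, where their sum is nonzero. *)
Lemma anticommuting_zero (S : 'I_4 -> 'I_4 -> 'I_4 -> R) (e : 'I_4 -> R) (M : R) :
  M != 0 -> (forall a, e a ^+ 2 = M) ->
  (forall a b c, S a b c = S b a c) -> (forall a b c, S a b c = S a c b) ->
  (forall a b c, S a b c * (e b + e c) = 0) -> forall a b c, S a b c = 0.
Proof.
move=> M0 eM s1 s2 H a b c.
have Z x y z : e y + e z != 0 -> S x y z = 0.
  by move=> n; have /eqP := H x y z; rewrite mulf_eq0 (negPf n) orbF => /eqP.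
have n0 x := sign_neq0 x M0 eM.
have nn x y : e y = e x -> e x + e y != 0.
  by move=> ->; rewrite -mulr2n mulrn_eq0 (negPf (n0 x)).
have [bc|bc] := sign_cases b c eM; first by apply: Z; exact: nn.
have [ab|ab] := sign_cases b a eM.
  by rewrite s2 s1; apply: Z; rewrite addrC; exact: nn.
by rewrite s1; apply: Z; apply: nn; rewrite ab bc.
Qed.

(** S stands for nabla E where E^2 = M g with a function M, and phi for the differential of M. An
    index p different from a with e_p = e_a exists because the trace is zero; it gives S_ppa = 0,
    hence phi_a = 2 e_p S_app = 0. *)
Lemma codazzi_square_zero (S : 'I_4 -> 'I_4 -> 'I_4 -> R) (e phi : 'I_4 -> R) (M : R) :
  M != 0 -> (forall a, e a ^+ 2 = M) -> \sum_a e a = 0 ->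
  (forall a b c, S a b c = S b a c) -> (forall a b c, S a b c = S a c b) ->
  (forall a b c, S a b c * (e b + e c) = phi a * (b == c)%:R) ->
  forall a b c, S a b c = 0.
Proof.
move=> M0 eM e0 s1 s2 H; apply: (anticommuting_zero M0 eM s1 s2) => a b c.
rewrite H; suff -> : phi a = 0 by rewrite mul0r.
have [p pa ep] := partner a M0 eM e0.
have : S p p a * (e p + e a) = 0 by rewrite H (negPf pa) mulr0.
move/eqP; rewrite mulf_eq0 ep -mulr2n mulrn_eq0 /= (negPf (sign_neq0 a M0 eM)) orbF => /eqP S0.
by have := H a p p; rewrite eqxx mulr1 => <-; rewrite s1 s2 S0 mul0r.
Qed.

(** S stands for nabla F where F^2 = g, so that it anticommutes with F; the last hypothesis says
    that F.F is divergence-free. Once the traces [dF] are known to vanish, this hypothesis makes f_a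
    S_abc totally symmetric, and [anticommuting_zero] applies. *)
Lemma div_kn_zero (S : 'I_4 -> 'I_4 -> 'I_4 -> R) (f : 'I_4 -> R) :
  (forall a, f a ^+ 2 = 1) -> (forall a b c, S a b c = S a c b) ->
  (forall a b c, S a b c * (f b + f c) = 0) ->
  (forall b c d, \sum_a (S a b a * (f c * (c == d)%:R) + f b * (b == a)%:R * S a c d
     - S a b d * (f c * (c == a)%:R) - f b * (b == d)%:R * S a c a) = 0) ->
  forall a b c, S a b c = 0.
Proof.
move=> f1 s2 H K.
have fn0 a : f a != 0 := sign_neq0 a (oner_neq0 R) f1.
have S0 a c : S a c c = 0.
  have /eqP := H a c c; rewrite mulf_eq0 -mulr2n mulrn_eq0 /= (negPf (fn0 c)) orbF.
  by move/eqP.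
pose dF b := \sum_a S a b a.
have K' b c d : dF b * (f c * (c == d)%:R) + f b * S b c d - f c * S c b d
    - f b * (b == d)%:R * dF c = 0.
  rewrite -[RHS](K b c d) !big_split /= !sumrN -mulr_suml -mulr_sumr.
  congr (_ + _ - _ - _).
  - rewrite (bigD1 b) //= eqxx mulr1 big1 ?addr0 // => i ib.
    by rewrite eq_sym (negPf ib) mulr0 mul0r.
  - rewrite (bigD1 c) //= eqxx mulr1 mulrC big1 ?addr0 // => i ic.
    by rewrite eq_sym (negPf ic) !mulr0.
have D1 b c : b != c -> S c b c = dF b.
  move=> bc; have := K' b c c; rewrite eqxx (negPf bc) S0 !mulr0 mul0r addr0 subr0 mulr1.
  move/eqP; rewrite subr_eq0 mulrC => /eqP /(mulfI (fn0 c)) -> //.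
(* In dF_b the term S_bbb vanishes and each of the other three terms equals dF_b. *)
have dF0 b : dF b = 0.
  have cnt : forall b : 'I_4, \sum_c ((c != b)%:R : R) = 3.
    by apply: ord4P; rewrite S4 /=; ring.
  have : dF b = dF b * 3.
    rewrite -(cnt b) mulr_sumr; apply: eq_bigr => c _.
    have [->|cb] := eqVneq c b; first by rewrite S0 mulr0.
    by rewrite mulr1 D1 // eq_sym.
  lra.
have T b c d : f b * S b c d = f c * S c b d.
  by have := K' b c d; rewrite !dF0 !mul0r !mulr0 add0r subr0 => /eqP; rewrite subr_eq0 => /eqP.
move=> a b c.
have := @anticommuting_zero (fun a b c => f a * S a b c) f 1 (oner_neq0 R) f1 T.
move=> /(_ _ _ a b c)/wrap[]; last by move/eqP; rewrite mulf_eq0 (negPf (fn0 a)) => /eqP.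
- by move=> x y z; rewrite s2.
- by move=> x y z; rewrite -mulrA H mulr0.
Qed.

(** For a parallel E with eigenvalues x, x, -x, -x the curvature is that of a product of two
    surfaces with Gauss curvatures l_a = x + s/4 and l_c = -x + s/4. The weakly Einstein identity
    gives l_a^2 = l_c^2, that is, x s = 0. *)
Lemma parallel_form (T : 'I_4 -> 'I_4 -> 'I_4 -> 'I_4 -> R) (l : 'I_4 -> R) (phi s M : R) :
  (forall a b c d, T a b c d = - T b a c d) ->
  (forall a b c d, T a b c d = - T a b d c) ->
  (forall a b c d, T a b c d = T c d a b) ->
  (forall a b c d, T a b c d + T b c a d + T c a b d = 0) ->
  (forall j k, \sum_i T i j k i = l j * (j == k)%:R) ->
  (forall a c, \sum_b \sum_p \sum_q T a b p q * T c b p q = phi * (a == c)%:R) ->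
  let e x := l x - s / 4 in
  M != 0 -> (forall a, e a ^+ 2 = M) -> \sum_a e a = 0 ->
  (forall a b c d, T a b c d * (e d - e c) = 0) ->
  s = 0 /\ forall a b c d, T a b c d =
    (e a + e b) / 2 * ((a == d)%:R * (b == c)%:R - (a == c)%:R * (b == d)%:R).
Proof.
move=> s12 s34 pair b1 Tric CS e M0 eM e0 par.
have [a [b [c [d [u eb ec ed]]]]] := two_blocks M0 eM e0.
have ea0 := sign_neq0 a M0 eM.
have T11 x y z : T x x y z = 0 by have := s12 x x y z; lra.
have T22 x y z : T y z x x = 0 by rewrite pair T11.
have Z x y z w : e w != e z -> T x y z w = 0.
  move=> h; have /eqP := par x y z w; rewrite mulf_eq0 subr_eq0 (negPf h) orbF.
  by move/eqP.
have Z' x y z w : e y != e x -> T x y z w = 0 by move=> h; rewrite pair Z.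
have nea : - e a != e a.
  by rewrite -subr_eq0 -opprD oppr_eq0 -mulr2n mulrn_eq0.
have nac : e c != e a by rewrite ec.
have nad : e d != e a by rewrite ed.
have nbc : e c != e b by rewrite ec eb.
have nbd : e d != e b by rewrite ed eb.
have Tac y z : T a c y z = 0 by rewrite Z'.
have Tad y z : T a d y z = 0 by rewrite Z'.
have Tbc y z : T b c y z = 0 by rewrite Z'.
have Tbd y z : T b d y z = 0 by rewrite Z'.
have Tca y z : T c a y z = 0 by rewrite s12 Tac oppr0.
have Tda y z : T d a y z = 0 by rewrite s12 Tad oppr0.
have Tcb y z : T c b y z = 0 by rewrite s12 Tbc oppr0.
have Tdb y z : T d b y z = 0 by rewrite s12 Tbd oppr0.
have Tabcd : T a b c d = 0 by have := b1 a b c d; rewrite Tbc Tca !addr0.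
have Tcdab : T c d a b = 0 by rewrite pair.
have S f : \sum_i f i = f a + (f b + (f c + f d)) :> R := sum_uniq4 f u.
have Ka : T a b b a = l a.
  have := Tric a a; rewrite eqxx mulr1 S T11 Tca Tda !addr0 add0r => <-.
  by rewrite s12 s34 opprK.
have Kc : T c d d c = l c.
  have := Tric c c; rewrite eqxx mulr1 S T11 Tac Tbc !add0r => <-.
  by rewrite s12 s34 opprK.
have Z2 x y z w : e w != e z -> T x y z w = 0 by exact: Z.
have CSa : phi = 2 * l a ^+ 2.
  have := CS a a; rewrite eqxx mulr1 => <-; rewrite !S.
  rewrite !(T11, T22, Tac, Tad) !(mul0r, add0r, addr0).
  rewrite Tabcd (s34 _ _ d c) Tabcd (Z a b a c) // (Z a b a d) // (Z a b b c) // (Z a b b d) //.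
  rewrite (s34 a b c a) (s34 a b d a) (s34 a b c b) (s34 a b d b) (s34 a b a b).
  rewrite (Z a b a c) // (Z a b a d) // (Z a b b c) // (Z a b b d) // Ka.
  by rewrite !oppr0 !(mul0r, add0r, addr0); ring.
have ndc : e a != e c by rewrite eq_sym.
have CSc : phi = 2 * l c ^+ 2.
  have := CS c c; rewrite eqxx mulr1 => <-; rewrite !S.
  rewrite !(T11, T22, Tca, Tcb) !(mul0r, add0r, addr0).
  rewrite Tcdab (s34 _ _ b a) Tcdab (Z c d a c) // (Z c d a d) // (Z c d b c) // (Z c d b d) //.
  rewrite (s34 c d c a) (s34 c d d a) (s34 c d c b) (s34 c d d b) (s34 c d c d).
  rewrite (Z c d a c) // (Z c d a d) // (Z c d b c) // (Z c d b d) // Kc.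
  by rewrite !oppr0 !(mul0r, add0r, addr0); ring.
have le x : l x = e x + s / 4 by rewrite /e subrK.
have s0 : s = 0.
  move: CSa; rewrite CSc !le ec => H.
  have : e a * s = 0 by move: H; rewrite !expr2; lra.
  by move/eqP; rewrite mulf_eq0 (negPf ea0) => /eqP.
split => //.
have {}le t : l t = e t by rewrite le s0 mul0r addr0.
have half : forall t : R, (t + t) / 2 = t by move=> t; field.
have nxt : forall t : R, (t + - t) / 2 = 0 by move=> t; rewrite subrr mul0r.
have nxt' : forall t : R, (- t + t) / 2 = 0 by move=> t; rewrite addNr mul0r.
have mem t : t \in [:: a; b; c; d] by rewrite -(perm_mem (perm_enum4 u)) mem_index_enum.
have nca : e a != - e a by rewrite eq_sym.
move: u; rewrite /= !inE !negb_or -!andbA => /and5P[nab nac' nad' nbc' /and3P[nbd' ncd' _]].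
have nba : (b == a) = false by rewrite eq_sym (negPf nab).
have nca' : (c == a) = false by rewrite eq_sym (negPf nac').
have ncb' : (c == b) = false by rewrite eq_sym (negPf nbc').
have ndc' : (d == c) = false by rewrite eq_sym (negPf ncd').
have nda' : (d == a) = false by rewrite eq_sym (negPf nad').
have ndb' : (d == b) = false by rewrite eq_sym (negPf nbd').
pose P x y z w := T x y z w =
    (e x + e y) / 2 * ((x == w)%:R * (y == z)%:R - (x == z)%:R * (y == w)%:R).
have P12 x y z w : P y x z w -> P x y z w.
  by rewrite /P => H; rewrite s12 H [e y + e x]addrC; ring.
have P34 x y z w : P x y w z -> P x y z w by rewrite /P => H; rewrite s34 H; ring.
have blk x y : x != y -> e y = e x ->
    [\/ x = a /\ y = b, x = b /\ y = a, x = c /\ y = d | x = d /\ y = c].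
  have := mem x; have := mem y; rewrite !inE.
  case/or4P => /eqP ->; case/or4P => /eqP ->; rewrite ?eqxx // ?eb ?ec ?ed => _ /eqP;
    rewrite ?(negPf nea) ?(negPf nca) // => _; by [apply: Or41|apply: Or42|apply: Or43|apply: Or44].
have Pab : P a b a b.
  by rewrite /P s34 Ka le eb half !eqxx (negPf nab) /=; ring.
have Pcd : P c d c d.
  by rewrite /P s34 Kc le ec ed half !eqxx (negPf ncd') /=; ring.
have Pabcd : P a b c d by rewrite /P Tabcd (negPf nad') (negPf nac') !mul0r subrr mulr0.
have Pcdab : P c d a b by rewrite /P Tcdab ncb' nca' !mul0r subrr mulr0.
have PP x y z w : x != y -> e y = e x -> z != w -> e w = e z -> P x y z w.
  move=> xy exy zw ezw.
  case: (blk _ _ xy exy) => -[-> ->]; case: (blk _ _ zw ezw) => -[-> ->] //;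
    by [apply: P34|apply: P12|apply: P12; apply: P34].
move=> x y z w.
have [<-|xy] := eqVneq x y; first by rewrite T11 [X in _ - X]mulrC subrr mulr0.
have [<-|zw] := eqVneq z w; first by rewrite T22 subrr mulr0.
have [exy|exy] := eqVneq (e y) (e x); last first.
  rewrite Z' //; case: (sign_cases x y eM) => h; first by rewrite h eqxx in exy.
  by rewrite h subrr !mul0r.
have [ezw|ezw] := eqVneq (e w) (e z).
  exact: PP.
rewrite Z //.
have [xw|_] := eqVneq x w.
  have [yz|_] := eqVneq y z; first by rewrite -xw -yz exy eqxx in ezw.
  have [xz|_] := eqVneq x z; first by rewrite -xz -xw eqxx in ezw.
  by rewrite mulr0 mul0r subrr mulr0.
have [xz|_] := eqVneq x z; last by rewrite !mul0r subrr mulr0.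
have [yw|_] := eqVneq y w; first by rewrite -xz -yw exy eqxx in ezw.
by rewrite mul0r mulr0 subrr mulr0.
Qed.

End sign_algebra.

Lemma local_metric_sub (R : realType) n (D U : set 'rV[R]_n) G :
  open U -> U `<=` D -> local_metric D G -> local_metric U G.
Proof.
move=> oU UD [oD sG symG posG]; split => //.
- by move=> i j; exact: smooth_sub UD (sG i j).
- by move=> x /UD; exact: symG.
- by move=> x /UD; exact: posG.
Qed.

Section parallel_tensor.
Context {R : realType}.
Variables (D : set 'rV[R]_4) (G : 'rV[R]_4 -> 'M[R]_4).
Hypothesis lm : local_metric D G.

(** The curvature commutes with a parallel tensor, so it has no component between eigenvectors of P
    for different eigenvalues. *)
Lemma parallel_frR (P : 'rV[R]_4 -> 'M[R]_4) x h (f : 'I_4 -> R) :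
  mxsmooth D P -> (forall y, D y -> (P y)^T = P y) ->
  (forall i y, D y -> Dc G i P y = 0) -> D x -> h *m G x *m h^T = 1%:M ->
  h *m P x *m h^T = diag_mx (\row_a f a) ->
  forall a b c d, frR G x h a b c d * (f d - f c) = 0.
Proof.
move=> sP symP dP Dx hG hP a b c d.
have dP' i y : D y -> dmx i P y = om G i y *m P y + P y *m (om G i y)^T.
  move=> Dy; have := dP i y Dy; rewrite /Dc => /eqP; rewrite subr_eq0 subr_eq => /eqP ->.
  by rewrite addrC.
have H i j : (h *m Rm G i j x *m h^T) c d * (f d - f c) = 0.
  have E := parallel_cur lm sP dP' i j Dx.
  have E2 : h *m (cur G i j x *m P x) *m h^T = h *m Rm G i j x *m h^T *m diag_mx (\row_a f a).
    by rewrite -hP (curG lm) // -(fr_iG hG) !mulmxA.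
  have : (h *m (cur G i j x *m P x) *m h^T) c d + (h *m (cur G i j x *m P x) *m h^T) d c = 0.
    have -> : (h *m (cur G i j x *m P x) *m h^T) d c = (h *m (P x *m (cur G i j x)^T) *m h^T) c d.
      by rewrite -[LHS]trmxE !trmx_mul trmxK symP // !mulmxA.
    by rewrite -addmxE -mulmxDl -mulmxDr E mulmx0 mul0mx zeromxE.
  rewrite E2.
  have Dg (M : 'M[R]_4) p q : (M *m diag_mx (\row_a f a)) p q = M p q * f q.
    by rewrite mul_mx_diag !mxE.
  rewrite !Dg.
  have -> : (h *m Rm G i j x *m h^T) d c = - (h *m Rm G i j x *m h^T) c d.
    rewrite -[LHS]trmxE !trmx_mul trmxK mulmxA -oppmxE -mulNmx -mulmxN.
    congr ((h *m _ *m h^T) c d); apply/matrixP => k l.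
    rewrite -trmx_mul trmxE -/(Rm G i j x) oppmxE.
    by rewrite (Rm_skew lm).
  by move=> E3; rewrite -[RHS]E3; ring.
rewrite /frR frT_mxE mulr_suml big1 // => i _; rewrite mulr_suml big1 // => j _.
by rewrite -mulrA H mulr0.
Qed.

End parallel_tensor.

Section case_square.
Context {R : realType}.
Variables (D : set 'rV[R]_4) (G : 'rV[R]_4 -> 'M[R]_4) (sc : R).
Hypothesis lm : local_metric D G.
Hypothesis harm : forall x, D x -> forall i j k, div_riemann G i j k x = 0.
Hypothesis wE : forall x, D x -> exists phi, forall i j, curvature_square G i j x = phi * G x i j.
Hypothesis hsc : forall x, D x -> \tr (iG G x *m ric G x) = sc.

Lemma frS_codazzi x h a b c : D x -> frS h (fun l => Dc G l (Ef G sc) x) a b c =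
  frS h (fun l => Dc G l (Ef G sc) x) b a c.
Proof.
by move=> Dx; apply: frS_sym => l j k; rewrite !(Dc_Ef sc lm) // (codazzi_ric lm harm).
Qed.

Lemma frS_Ef_symr x h a b c : D x -> frS h (fun l => Dc G l (Ef G sc) x) a b c =
  frS h (fun l => Dc G l (Ef G sc) x) a c b.
Proof.
by move=> Dx; apply: frS_symr => l; apply: (Dc_sym lm) => // y; exact: (Ef_tr sc lm).
Qed.

Section square.
Hypothesis r0 : forall x, D x -> rf G sc x = 0.
Hypothesis E0 : forall x, D x -> Ef G sc x != 0.

Lemma square_Q0 x : D x -> Qf G sc x = 0.
Proof.
move=> Dx; have [h [d [hG hE]]] := frame_exists lm Dx.
apply: (fr_inj hG); rewrite (frame_Q sc hG hE) mulmx0 mul0mx.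
have := rf_eq0 sc hG hE; rewrite r0 // eqxx => /esym/forallP q0.
by apply/matrixP => a b; rewrite diag_mxE !mxE (eqP (q0 a)) mul0r.
Qed.

(** Since Q = 0, E^2 = M g with a function M; differentiating this gives the hypotheses of
    [codazzi_square_zero]. M has no zeros because E has none. *)
Lemma square_parallel i x : D x -> Dc G i (Ef G sc) x = 0.
Proof.
move=> Dx; have [h [d [hG hE]]] := frame_exists lm Dx.
have sE := Ef_smooth sc lm.
pose EE y := Ef G sc y *m iG G y *m Ef G sc y.
have sEE : mxsmooth D EE by exact: (comp_smooth lm).
have EG y : D y -> EE y = tr4 G EE y *: G y.
  by move=> Dy; apply/eqP; rewrite -subr_eq0; apply/eqP; exact: square_Q0.
have st : smooth_on D (tr4 G EE) by exact: (tr4_smooth lm).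
have H l : Dc G l (Ef G sc) x *m iG G x *m Ef G sc x + Ef G sc x *m iG G x *m Dc G l (Ef G sc) x
    = pd l (tr4 G EE) x *: G x.
  rewrite -(Dc_comp lm) // (eq_on_Dc lm l EG Dx) (@DcZ _ _ D) //; last exact: (lm_smooth lm).
  by rewrite (Dc_metric lm) // scaler0 addr0.
have q0 a : fq sc d a = 0.
  by have := rf_eq0 sc hG hE; rewrite r0 // eqxx => /esym/forallP/(_ a)/eqP.
pose M := (\sum_i fe sc d i ^+ 2) / 4.
have eM a : fe sc d a ^+ 2 = M by apply/eqP; rewrite -subr_eq0; apply/eqP; exact: q0.
have M0 : M != 0.
  apply: contraNneq (E0 Dx) => M0; apply/eqP; apply: (fr_inj hG).
  rewrite (frame_E sc hG hE) mulmx0 mul0mx; apply/matrixP => a b; rewrite diag_mxE !mxE.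
  by have := eM a; rewrite M0 => /eqP; rewrite sqrf_eq0 => /eqP ->; rewrite mul0r.
apply: (@frS_inj0 _ _ G x h hG (fun l => Dc G l (Ef G sc) x)) => a.
apply/matrixP => b c; rewrite zeromxE.
apply: (@codazzi_square_zero _ (fun a b c => frS h (fun l => Dc G l (Ef G sc) x) a b c)
   (fe sc d) (fun a => \sum_l h a l * pd l (tr4 G EE) x) M) => //.
- exact: (fe_sum hsc Dx hG hE).
- by move=> *; exact: frS_codazzi.
- by move=> *; exact: frS_Ef_symr.
- move=> a' b' c'.
  have E l : (h *m Dc G l (Ef G sc) x *m h^T) b' c' * (fe sc d b' + fe sc d c') =
      pd l (tr4 G EE) x * (b' == c')%:R.
    have := H l => /(congr1 (fun M => (h *m M *m h^T) b' c')).
    rewrite mulmxDr mulmxDl !(fr_comp hG) (frame_E sc hG hE) -scalemxAr -scalemxAl hG.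
    rewrite addmxE scalemxE mul_mx_diag mul_diag_mx !mxE => <-.
    by ring.
  rewrite /frS summxE mulr_suml mulr_suml; apply: eq_bigr => l _.
  by rewrite scalemxE -!mulrA E.
Qed.

Lemma square_case x : D x -> sc = 0 /\ forall i j, Rm G i j x = 2^-1 *: kn (Ef G sc x) (G x) i j.
Proof.
move=> Dx; have [h [d [hG hE]]] := frame_exists lm Dx.
have q0 a : fq sc d a = 0.
  by have := rf_eq0 sc hG hE; rewrite r0 // eqxx => /esym/forallP/(_ a)/eqP.
pose M := (\sum_i fe sc d i ^+ 2) / 4.
have eM a : fe sc d a ^+ 2 = M by apply/eqP; rewrite -subr_eq0; apply/eqP; exact: q0.
have M0 : M != 0.
  apply: contraNneq (E0 Dx) => M0; apply/eqP; apply: (fr_inj hG).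
  rewrite (frame_E sc hG hE) mulmx0 mul0mx; apply/matrixP => a b; rewrite diag_mxE !mxE.
  by have := eM a; rewrite M0 => /eqP; rewrite sqrf_eq0 => /eqP ->; rewrite mul0r.
have [phi wEx] := wE Dx.
have par := parallel_frR lm (Ef_smooth sc lm) (fun y => @Ef_tr _ _ D G sc lm y)
   square_parallel Dx hG (frame_E sc hG hE).
have [s0 F] := @parallel_form R (fun a b c e => frR G x h a b c e) (fun a => d 0 a) phi sc M
  (fun a b c e => frR_s12 G x h a b c e) (fun a b c e => frR_s34 lm Dx h a b c e)
  (fun a b c e => frR_pair lm Dx h a b c e) (fun a b c e => frR_b1 lm Dx h a b c e)
  (fun b c => frR_ric lm Dx hG hE b c) (fun a c => frR_square wEx hG a c)
  M0 eM (fe_sum hsc Dx hG hE) par.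
split => //; apply: (frT_inj (frame_unit hG)) => a b.
have -> : (fun i j => 2^-1 *: kn (Ef G sc x) (G x) i j) =
   (fun i j => 2^-1 *: kn (Ef G sc x) (G x) i j + 0 *: kn (Ef G sc x) (G x) i j).
  by apply/funext => i; apply/funext => j; rewrite scale0r addr0.
rewrite frT_lin scale0r addr0 frT_kn (frame_E sc hG hE) hG one_diag.
apply/matrixP => c e; rewrite -/(frR G x h a b) F scalemxE kn_diag /fe; ring.
Qed.

End square.
End case_square.

Section divergence_kn.
Context {R : realType} {n : nat}.
Variables (D : set 'rV[R]_n) (G : 'rV[R]_n -> 'M[R]_n).
Hypothesis lm : local_metric D G.
Implicit Types (X Y : 'I_n -> 'I_n -> 'rV[R]_n -> 'M[R]_n).

Lemma knC (A B : 'M[R]_n) i j : kn A B i j = kn B A i j.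
Proof. by apply/matrixP => k l; rewrite !knE; ring. Qed.

Lemma kn0 (A : 'M[R]_n) i j : kn A 0 i j = 0.
Proof. by apply/matrixP => k l; rewrite knE !zeromxE; ring. Qed.

Lemma knZ (c : R) (A : 'M[R]_n) i j : kn (c *: A) (c *: A) i j = c ^+ 2 *: kn A A i j.
Proof. by apply/matrixP => k l; rewrite scalemxE !knE !scalemxE; ring. Qed.

Lemma eq_on_nabla4 X Y m i j k l x : (forall i j y, D y -> X i j y = Y i j y) -> D x ->
  nabla4 G X m i j k l x = nabla4 G Y m i j k l x.
Proof.
move=> XY Dx; rewrite /nabla4; congr (_ - _).
  by apply: (eq_on_partial m (lm_open lm)) => // y Dy; rewrite XY.
by apply: eq_bigr => s _; rewrite !XY.
Qed.

Lemma nabla4_lin X Y (c d : R) m i j k l x :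
  (forall i j, mxsmooth D (X i j)) -> (forall i j, mxsmooth D (Y i j)) -> D x ->
  nabla4 G (fun i j y => c *: X i j y + d *: Y i j y) m i j k l x =
  c * nabla4 G X m i j k l x + d * nabla4 G Y m i j k l x.
Proof.
move=> sX sY Dx.
have dX : differentiable (fun y => X i j y k l) x by exact: (mxsmooth_differentiable k l (sX i j) Dx).
have dY : differentiable (fun y => Y i j y k l) x by exact: (mxsmooth_differentiable k l (sY i j) Dx).
rewrite /nabla4.
have -> : (fun y => (c *: X i j y + d *: Y i j y) k l) = (fun y => c * X i j y k l + d * Y i j y k l).
  by apply/funext => y; rewrite addmxE !scalemxE.
rewrite partialD; [|by apply: differentiableM => //; exact: differentiable_cst..].
rewrite !partialZ // !mulrBr.
set S := \sum_s _; set S1 := \sum_s _; set S2 := \sum_s _.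
have -> : S = c * S1 + d * S2.
  rewrite /S /S1 /S2 !mulr_sumr -big_split; apply: eq_bigr => s _ /=.
  by rewrite !(addmxE, scalemxE); clear; ring.
by clear; move: (pd _ _ _) (pd _ _ _) S1 S2 => *; ring.
Qed.

Lemma kn_smooth (A B : 'rV[R]_n -> 'M[R]_n) i j : mxsmooth D A -> mxsmooth D B ->
  mxsmooth D (fun y => kn (A y) (B y) i j).
Proof.
move=> sA sB k l; have oD := lm_open lm.
apply: (@smooth_eq _ _ _ oD (fun y => A y i l * B y j k + B y i l * A y j k
  - A y i k * B y j l - B y i k * A y j l)) => [y _|]; first by rewrite knE.
by apply: smoothB => //; [apply: smoothB => //; [apply: smoothD => //|]|]; apply: smoothM => //; (exact: sA || exact: sB).
Qed.

(** For A = nabla E the divergence of E.g consists of the divergence of E and of the Codazzi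
    difference, and both vanish. *)
Lemma div_kn_metric (A : 'I_n -> 'M[R]_n) x i j k : D x ->
  (forall a b c, A a b c = A b a c) ->
  (forall b, \sum_m \sum_l iG G x m l * A m b l = 0) ->
  \sum_m \sum_l iG G x m l * kn (A m) (G x) i j k l = 0.
Proof.
move=> Dx sA dA.
transitivity ((\sum_m \sum_l iG G x m l * A m i l) * G x j k
  + (\sum_m (\sum_l iG G x m l * G x l i) * A m j k)
  - (\sum_m (\sum_l iG G x m l * G x l j) * A m i k)
  - G x i k * (\sum_m \sum_l iG G x m l * A m j l)).
  rewrite !mulr_suml mulr_sumr -!sumrN -!big_split; apply: eq_bigr => m _ /=.
  rewrite !mulr_suml mulr_sumr -!sumrN -!big_split; apply: eq_bigr => l _ /=.
  by rewrite knE (lm_symE lm i l Dx) (lm_symE lm j l Dx); ring.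
have E p (f : 'I_n -> R) : \sum_m (\sum_l iG G x m l * G x l p) * f m = f p.
  under eq_bigr do rewrite -mxmulE (mulVG lm Dx) mxE.
  rewrite (bigD1 p) //= eqxx mul1r big1 ?addr0 // => m mp.
  by rewrite (negPf mp) mul0r.
by rewrite !E !dA sA mul0r mulr0 add0r subrr subr0.
Qed.

Let exchange4 (f : 'I_n -> 'I_n -> 'I_n -> 'I_n -> R) :
  \sum_m \sum_i \sum_j \sum_k f m i j k = \sum_i \sum_j \sum_k \sum_m f m i j k.
Proof.
by rewrite exchange_big3; apply: eq_bigr => i _; apply: eq_bigr => j _; rewrite exchange_big.
Qed.

(** Summing h_am h_al over a gives the inverse metric, so the sum over the frame index is the
    divergence. *)
Lemma frame_div_kn (A : 'I_n -> 'M[R]_n) (B h : 'M[R]_n) x b c d : h *m G x *m h^T = 1%:M ->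
  (forall i j k, \sum_m \sum_l iG G x m l * kn (A m) B i j k l = 0) ->
  \sum_a kn (frS h A a) (h *m B *m h^T) b c d a = 0.
Proof.
move=> hG H.
transitivity (\sum_i \sum_j \sum_k h b i * h c j * h d k *
   \sum_m \sum_l iG G x m l * kn (A m) B i j k l); last first.
  by rewrite big1 // => i _; rewrite big1 // => j _; rewrite big1 // => k _; rewrite H mulr0.
transitivity (\sum_a \sum_m h a m * frT h (kn (A m) B) b c d a).
  apply: eq_bigr => a _; rewrite knE /frS !summxE !mulr_suml !mulr_sumr -!sumrN -!big_split.
  by apply: eq_bigr => m _; rewrite /= frT_kn knE !scalemxE; ring.
transitivity (\sum_a \sum_m \sum_i \sum_j \sum_k \sum_l
    h b i * h c j * h d k * ((h a m * h a l) * kn (A m) B i j k l)).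
  apply: eq_bigr => a _; apply: eq_bigr => m _; rewrite frTE !mulr_sumr.
  apply: eq_bigr => i _; rewrite !mulr_sumr; apply: eq_bigr => j _; rewrite !mulr_sumr.
  by apply: eq_bigr => k _; rewrite !mulr_sumr; apply: eq_bigr => l _; ring.
under eq_bigr do rewrite exchange4.
rewrite exchange4; apply: eq_bigr => i _; apply: eq_bigr => j _; apply: eq_bigr => k _.
rewrite exchange_big mulr_sumr; apply: eq_bigr => m _; rewrite exchange_big mulr_sumr.
apply: eq_bigr => l _; rewrite -mulr_sumr -mulr_suml -(fr_iG hG) mxmulE.
by congr (_ * (_ * _)); apply: eq_bigr => a _; rewrite trmxE.
Qed.

End divergence_kn.

(** * Nonzero scalar curvature and nonvanishing Q exclude each other *)

Section local_classification.
Context {R : realType}.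
Variables (D : set 'rV[R]_4) (G : 'rV[R]_4 -> 'M[R]_4) (sc : R).
Hypothesis lm : local_metric D G.
Hypothesis harm : forall x, D x -> forall i j k, div_riemann G i j k x = 0.
Hypothesis wE : forall x, D x -> exists phi, forall i j, curvature_square G i j x = phi * G x i j.
Hypothesis hsc : forall x, D x -> \tr (iG G x *m ric G x) = sc.

Let oD := lm_open lm.
Let S4 (f : 'I_4 -> R) := @sum_uniq4 R f _ _ _ _ (isT : uniq [:: o0; o1; o2; o3]).

Lemma rf_ge0 x : D x -> 0 <= rf G sc x.
Proof.
move=> Dx; have [h [d [hG hE]]] := frame_exists lm Dx.
rewrite (frame_r sc hG hE) divr_ge0 // sumr_ge0 // => a _; exact: sqr_ge0.
Qed.

Lemma fq_sum (d : 'rV[R]_4) : \sum_a fq sc d a = 0.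
Proof.
rewrite /fq sumrB; apply/eqP; rewrite subr_eq0 sumr_const card_ord -[X in _ == X]mulr_natr.
by rewrite divfK ?pnatr_eq0.
Qed.

Section rigid.
Hypothesis sc0 : sc != 0.
Hypothesis r0 : forall x, D x -> rf G sc x != 0.

(** The function r^(-1/2), written with [expR] and [ln] because these preserve smoothness; thus F =
    Q / sqrt r. *)
Let w y := expR (- ln (rf G sc y) / 2).
Let F y := w y *: Qf G sc y.

Let w2 y : D y -> w y ^+ 2 = (rf G sc y)^-1.
Proof.
move=> Dy; rewrite expr2 -expRD -splitr expRN lnK //.
by rewrite posrE lt_def r0 // rf_ge0.
Qed.

Let sF : mxsmooth D F.
Proof.
apply: mxsmoothZ => //; last exact: (Qf_smooth sc lm).
apply: smooth_expR => //; apply: smoothM => //; last exact: smooth_cst.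
apply: smoothN => //; apply: smooth_ln => //; first exact: (rf_smooth sc lm).
by move=> y Dy; rewrite lt_def r0 // rf_ge0.
Qed.

Let frameF y h d : D y -> h *m G y *m h^T = 1%:M -> h *m ric G y *m h^T = diag_mx d ->
  h *m F y *m h^T = diag_mx (\row_a (w y * fq sc d a)).
Proof.
move=> Dy hG hE; rewrite -scalemxAr -scalemxAl (frame_Q sc hG hE).
by apply/matrixP => a b; rewrite !(scalemxE, diag_mxE) !mxE mulrA.
Qed.

Let second y h d : D y -> h *m G y *m h^T = 1%:M -> h *m ric G y *m h^T = diag_mx d ->
  (forall a, fq sc d a ^+ 2 = rf G sc y) /\ forall a b, a != b ->
  frR G y h a b b a = (fe sc d a + fe sc d b) / 2 + sc / 8 * (fq sc d a * fq sc d b / rf G sc y + 1).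
Proof.
move=> Dy hG hE.
case: (curvature_alternative lm harm wE hsc Dy hG hE (r0 Dy)) => [[/eqP]|//].
by rewrite (negPf sc0).
Qed.

Let f2 y h d : D y -> h *m G y *m h^T = 1%:M -> h *m ric G y *m h^T = diag_mx d ->
  forall a, (w y * fq sc d a) ^+ 2 = 1.
Proof.
move=> Dy hG hE a; have [q2 _] := second Dy hG hE.
by rewrite exprMn w2 // q2 mulVf // r0.
Qed.

Let FF y : D y -> F y *m iG G y *m F y = G y.
Proof.
move=> Dy; have [h [d [hG hE]]] := frame_exists lm Dy.
apply: (fr_inj hG); rewrite (fr_comp hG) (frameF Dy hG hE) hG diag_mul.
by rewrite one_diag; congr diag_mx; apply/rowP => a; rewrite !mxE -expr2 (f2 Dy hG hE).
Qed.

Let RmF i j y : D y -> Rm G i j y = 2^-1 *: kn (Ef G sc y) (G y) i j +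
  (sc / 16) *: (1 *: kn (F y) (F y) i j + 1 *: kn (G y) (G y) i j).
Proof.
move=> Dy; have [h [d [hG hE]]] := frame_exists lm Dy.
rewrite (curvature_formula lm harm wE hsc Dy hG hE (r0 Dy)).
by rewrite /F knZ w2 // !scale1r.
Qed.

Let F_tr y : D y -> (F y)^T = F y.
Proof.
move=> Dy; have [h [d [hG hE]]] := frame_exists lm Dy.
apply: (fr_inj hG); transitivity ((h *m F y *m h^T)^T); first by rewrite !trmx_mul trmxK mulmxA.
by rewrite (frameF Dy hG hE) tr_diag_mx.
Qed.

(** In div R = 0 the part from E.g vanishes by [div_kn_metric], and g.g is parallel. What is left is
    the divergence of F.F with the nonzero factor sc. *)
Let DF_div i j k x : D x ->
  \sum_m \sum_l iG G x m l * kn (Dc G m F x) (F x) i j k l = 0.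
Proof.
move=> Dx; have sE := Ef_smooth sc lm; have sG := lm_smooth lm.
have nab m l : (ncur G m i j x *m G x) k l = 2^-1 * kn (Dc G m (Ef G sc) x) (G x) i j k l
   + sc / 8 * kn (Dc G m F x) (F x) i j k l.
  rewrite -(nabla4_riemann lm) // (eq_on_nabla4 lm m i j k l RmF Dx).
  have s1 a b : mxsmooth D (fun y => kn (Ef G sc y) (G y) a b) by exact: (kn_smooth lm).
  have s2 a b : mxsmooth D (fun y => kn (F y) (F y) a b) by exact: (kn_smooth lm).
  have s3 a b : mxsmooth D (fun y => kn (G y) (G y) a b) by exact: (kn_smooth lm).
  have c1 : smooth_on D (fun=> 1 : R) by exact: smooth_cst.
  rewrite (@nabla4_lin _ _ D G (fun a b y => kn (Ef G sc y) (G y) a b)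
    (fun a b y => 1 *: kn (F y) (F y) a b + 1 *: kn (G y) (G y) a b)) //; last first.
    by move=> a b; apply: mxsmoothD => //; exact: mxsmoothZ.
  rewrite (@nabla4_lin _ _ D G (fun a b y => kn (F y) (F y) a b) (fun a b y => kn (G y) (G y) a b)) // !(@nabla4_kn _ _ D) // (Dc_metric lm) //.
  rewrite kn0 [kn 0 _ _ _]knC kn0 [kn (F x) _ _ _]knC !zeromxE.
  by move: (kn _ _ _ _ _ _) (kn _ _ _ _ _ _) => *; field.
have Dz : \sum_m \sum_l iG G x m l * (ncur G m i j x *m G x) k l = 0.
  rewrite -[RHS](harm Dx i j k) (div_riemannE lm) //.
  by apply: eq_bigr => m _; rewrite (ncur_low lm).
have Ez : \sum_m \sum_l iG G x m l * kn (Dc G m (Ef G sc) x) (G x) i j k l = 0.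
  apply: (div_kn_metric lm) => // [a b c|b].
    by rewrite !(Dc_Ef sc lm) // (codazzi_ric lm harm).
  rewrite -[RHS](@div_ric _ _ D G lm x b Dx) => [|p q]; last exact: harm.
  by apply: eq_bigr => m _; apply: eq_bigr => l _; rewrite (Dc_Ef sc lm).
have : sc / 8 * \sum_m \sum_l iG G x m l * kn (Dc G m F x) (F x) i j k l = 0.
  rewrite -[RHS]Dz -[LHS]add0r -[X in X + _](mulr0 2^-1) -{1}Ez !mulr_sumr -big_split.
  apply: eq_bigr => m _; rewrite !mulr_sumr -big_split; apply: eq_bigr => l _ /=.
  by rewrite nab; ring.
by move/eqP; rewrite !mulf_eq0 (negPf sc0) invr_eq0 pnatr_eq0 /= => /eqP.
Qed.

Let DF0 i x : D x -> Dc G i F x = 0.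
Proof.
move=> Dx; have [h [d [hG hE]]] := frame_exists lm Dx.
have hF := frameF Dx hG hE.
apply: (@frS_inj0 _ _ G x h hG (fun l => Dc G l F x)) => a.
apply/matrixP => b c; rewrite zeromxE.
apply: (@div_kn_zero _ (fun a b c => frS h (fun l => Dc G l F x) a b c) (fun a => w x * fq sc d a)).
- exact: f2 Dx hG hE.
- by move=> a' b' c'; apply: frS_symr => l; apply: (Dc_sym lm) => // y; exact: F_tr.
- move=> a' b' c'.
  have E l : (h *m Dc G l F x *m h^T) b' c' * (w x * fq sc d b' + w x * fq sc d c') = 0.
    have : Dc G l F x *m iG G x *m F x + F x *m iG G x *m Dc G l F x = 0.
      by rewrite -(Dc_comp lm) // (eq_on_Dc lm l FF Dx) (Dc_metric lm).
    move/(congr1 (fun M => (h *m M *m h^T) b' c')).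
    rewrite /= mulmx0 mul0mx zeromxE mulmxDr mulmxDl !(fr_comp hG) hF.
    move: (h *m _ *m h^T) => M.
    by rewrite addmxE mul_mx_diag mul_diag_mx !mxE => <-; ring.
  rewrite /frS summxE mulr_suml big1 // => l _.
  by rewrite scalemxE -mulrA E mulr0.
- move=> b' c' d'.
  have := frame_div_kn b' c' d' hG (fun i j k => DF_div i j k Dx).
  rewrite hF => H; rewrite -[RHS]H; apply: eq_bigr => a' _.
  by rewrite knE !diag_mxE !mxE (eq_sym b'); congr (_ + _ - _ - _); rewrite // mulrC.
Qed.

Lemma rigid_case x : ~ D x.
Proof.
move=> Dx; have [h [d [hG hE]]] := frame_exists lm Dx.
have [q2 K] := second Dx hG hE.
have par := parallel_frR lm sF F_tr DF0 Dx hG (frameF Dx hG hE).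
pose f a := w x * fq sc d a.
have f21 := f2 Dx hG hE.
have f0 : \sum_a f a = 0 by rewrite -mulr_sumr fq_sum mulr0.
(* The plane of a and b is flat since F is parallel, and in the formula for its curvature the term
   with sc vanishes because q_a q_b / r = -1. *)
have opp a b : f b = - f a -> fe sc d b = - fe sc d a.
  move=> fab; have fa0 := sign_neq0 a (oner_neq0 R) f21.
  have ab : a != b.
    apply: contra_eq_neq fab => <-; rewrite -subr_eq0 opprK -mulr2n mulrn_eq0.
    exact: fa0.
  have := par a b b a; rewrite -/(f a) -/(f b) K //.
  have -> : fq sc d a * fq sc d b / rf G sc x = -1.
    have : f a * f b = -1 by rewrite fab mulrN -expr2 f21.
    by rewrite -w2 // /f => <-; ring.
  rewrite fab opprK addNr mulr0 addr0 => /eqP.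
  rewrite mulf_eq0 -mulr2n mulrn_eq0 (negPf fa0) !orbF mulf_eq0 invr_eq0 pnatr_eq0 orbF.
  by rewrite addrC addr_eq0 => /eqP.
have [a [b [c [e [u fb fc fd]]]]] := two_blocks (oner_neq0 R) f21 f0.
have ec := opp a c fc; have ed := opp a e fd.
have eb : fe sc d b = fe sc d a.
  have : f b = - f c by rewrite /f fc opprK.
  by move/opp; rewrite ec opprK.
apply: (rf_neq0_nsq hG hE (r0 Dx)).
suff H t : fe sc d t ^+ 2 = fe sc d a ^+ 2 by move=> p q; rewrite !H.
have : t \in [:: a; b; c; e] by rewrite -(perm_mem (perm_enum4 u)) mem_index_enum.
by rewrite !inE => /or4P[] /eqP ->; rewrite ?eb ?ec ?ed ?sqrrN.
Qed.

End rigid.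
End local_classification.

Section local_consequences.
Context {R : realType}.
Variables (D : set 'rV[R]_4) (G : 'rV[R]_4 -> 'M[R]_4) (sc : R).
Hypothesis lm : local_metric D G.
Hypothesis harm : forall x, D x -> forall i j k, div_riemann G i j k x = 0.
Hypothesis wE : forall x, D x -> exists phi, forall i j, curvature_square G i j x = phi * G x i j.
Hypothesis hsc : forall x, D x -> \tr (iG G x *m ric G x) = sc.

Let oD := lm_open lm.

Lemma open_neq0 (f : 'rV[R]_4 -> R) : smooth_on D f -> open [set x | D x /\ f x != 0].
Proof.
move=> sf; rewrite openE => x [Dx fx].
have df : {for x, continuous f} by apply: differentiable_continuous; exact: smooth_differentiable sf Dx.
near=> y; split; near: y; first exact: open_nbhs_nbhs.
apply: (df [set z | z != 0]); apply: open_nbhs_nbhs; split => //; exact: open_neq.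
Unshelve. all: by end_near.
Qed.

Lemma open_E_neq0 : open [set x | D x /\ Ef G sc x != 0].
Proof.
have -> : [set x | D x /\ Ef G sc x != 0] =
    \bigcup_(p in [set: 'I_4 * 'I_4]) [set x | D x /\ Ef G sc x p.1 p.2 != 0].
  apply/seteqP; split => [x [Dx Ex]|x [[i j] _ /= [Dx Ex]]]; last first.
    by split => //; apply: contraNneq Ex => ->; rewrite zeromxE.
  have /existsP[i /existsP[j ij]] : [exists i, exists j, Ef G sc x i j != 0].
    apply: contraNT Ex; rewrite negb_exists => /forallP H; apply/eqP/matrixP => i j.
    have := H i; rewrite negb_exists => /forallP/(_ j); rewrite negbK => /eqP ->.
    by rewrite zeromxE.
  by exists (i, j).
by apply: bigcup_open => p _; apply: open_neq0; exact: (Ef_smooth sc lm).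
Qed.

Lemma rigid_open x : sc != 0 -> D x -> rf G sc x = 0.
Proof.
move=> sc0 Dx; apply/eqP/negPn/negP => rx.
pose U := [set y | D y /\ rf G sc y != 0].
have oU : open U by apply: open_neq0; exact: (rf_smooth sc lm).
have UD : U `<=` D by move=> y [].
apply: (@rigid_case _ U G sc (local_metric_sub oU UD lm) _ _ _ sc0 _ x) => //.
- by move=> y /UD; exact: harm.
- by move=> y /UD; exact: wE.
- by move=> y /UD; exact: hsc.
- by move=> y [].
Qed.

Let square_open x : D x -> Ef G sc x != 0 ->
  (forall y, D y -> Ef G sc y != 0 -> rf G sc y = 0) ->
  sc = 0 /\ forall i j, Rm G i j x = 2^-1 *: kn (Ef G sc x) (G x) i j.
Proof.
move=> Dx Ex H; pose U := [set y | D y /\ Ef G sc y != 0].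
have oU : open U := open_E_neq0.
have UD : U `<=` D by move=> y [].
apply: (@square_case _ U G sc (local_metric_sub oU UD lm)) => //.
- by move=> y /UD; exact: harm.
- by move=> y /UD; exact: wE.
- by move=> y /UD; exact: hsc.
- by move=> y [Dy Ey]; exact: H.
- by move=> y [].
Qed.

Lemma scalar_neq0_Einstein x : sc != 0 -> D x -> Ef G sc x = 0.
Proof.
move=> sc0 Dx; apply/eqP/negPn/negP => Ex.
have [] := @square_open x Dx Ex _; last by move/eqP; rewrite (negPf sc0).
by move=> y Dy _; exact: rigid_open.
Qed.

Let weyl i j k l y : R := Rm G i j y k l - 2^-1 * kn (Ef G sc y) (G y) i j k l.

(* For zero scalar curvature, the conclusion says that the Weyl tensor vanishes. *)
Lemma scalar_eq0_weyl x : sc = 0 -> D x -> Ef G sc x != 0 ->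
  forall i j, Rm G i j x = 2^-1 *: kn (Ef G sc x) (G x) i j.
Proof.
move=> sc0 Dx Ex.
apply: contrapT => H.
have [i [j [k [l Wx]]]] : exists i j k l, weyl i j k l x != 0.
  apply: contrapT => H'; apply: H => i j; apply/matrixP => k l.
  apply/eqP; rewrite -subr_eq0; apply/negPn/negP => W; apply: H'; exists i, j, k, l.
  by rewrite /weyl -scalemxE.
(* Where E and this component of the Weyl tensor are nonzero, r vanishes by [curvature_formula].
   Hence [square_case] applies on U, and it contradicts the choice of U. *)
pose U := [set y | [set y | D y /\ Ef G sc y != 0] y /\ [set y | D y /\ weyl i j k l y != 0] y].
have oU : open U.
  apply: openI; first exact: open_E_neq0.
  apply: open_neq0; apply: smoothB => //; first exact: (mxsmoothM oD (cur_smooth lm i j) (lm_smooth lm)).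
  apply: smoothM => //; first exact: smooth_cst.
  by apply: (kn_smooth lm i j); [exact: (Ef_smooth sc lm)|exact: (lm_smooth lm)].
have UD : U `<=` D by move=> y [[]].
have [] := @square_case _ U G sc (local_metric_sub oU UD lm) _ _ _ _ _ x.
- by move=> y /UD; exact: harm.
- by move=> y /UD; exact: wE.
- by move=> y /UD; exact: hsc.
- move=> y [[Dy Ey] [_ Wy]]; apply/eqP/negPn/negP => ry.
  have [h [d [hG hE]]] := frame_exists lm Dy.
  move: Wy; rewrite /weyl (curvature_formula lm harm wE hsc Dy hG hE ry).
  by rewrite sc0 mul0r scale0r addr0 scalemxE subrr eqxx.
- by move=> y [[]].
- by split.
by move=> _ F; move: Wx; rewrite /weyl F scalemxE subrr eqxx.
Qed.

End local_consequences.

(** * Unique continuation *)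

Section box.
Context {R : realType} {n : nat}.
Implicit Types (x q : 'rV[R]_n) (f : 'rV[R]_n -> R) (D : set 'rV[R]_n).

Definition box q (L : R) : set 'rV[R]_n := [set x | forall i, `|x 0 i - q 0 i| <= L].

Lemma box_compact q L : compact (box q L).
Proof.
have -> : box q L = [set x : 'rV[R]_n | forall i, `[q 0 i - L, q 0 i + L]%classic (x 0 i)].
  by apply/seteqP; split => x bx i; move: (bx i); rewrite /= in_itv /= ler_distl.
apply: (@rV_compact R n (fun i => `[q 0 i - L, q 0 i + L]%classic)) => i.
exact: segment_compact.
Qed.

Lemma box_bounded D q L f : box q L `<=` D -> smooth_on D f ->
  exists2 C, 0 < C & forall x, box q L x -> `|f x| <= C.
Proof.
move=> bD sf.
have cf : {within box q L, continuous f}.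
  apply: continuous_in_subspaceT => x /set_mem bx.
  by apply: differentiable_continuous; apply: (smooth_differentiable sf); exact: bD.
have /compact_bounded[M [_ H]] := continuous_compact cf (@box_compact q L).
exists (`|M| + 1) => [|x bx]; first by rewrite ltr_wpDl.
by apply: (H (`|M| + 1)); [rewrite (le_lt_trans (ler_norm M)) // ltrDl|exists x].
Qed.

Lemma box_bounded_fin (I : finType) D q L (f : I -> 'rV[R]_n -> R) : box q L `<=` D ->
  (forall i, smooth_on D (f i)) ->
  exists2 C, 0 < C & forall i x, box q L x -> `|f i x| <= C.
Proof.
move=> bD sf.
have /choice[C HC] : forall i, exists C, 0 < C /\ forall x, box q L x -> `|f i x| <= C.
  by move=> i; have [C C0 H] := box_bounded bD (sf i); exists C.
have C0 i := ltW (HC i).1.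
exists (1 + \sum_i C i) => [|i x bx].
  by rewrite ltr_wpDr // sumr_ge0.
rewrite (le_trans ((HC i).2 x bx)) // (bigD1 i) //= addrCA ler_wpDr //.
by rewrite addr_ge0 // sumr_ge0.
Qed.

Lemma entry_line i x (s : R) k : (x + s *: delta_mx 0 i) 0 k = x 0 k + s * (k == i)%:R.
Proof. by rewrite !mxE eqxx. Qed.

Lemma box_line q L i x (h s : R) : box q L x -> box q L (x + h *: delta_mx 0 i) ->
  0 <= s <= h -> box q L (x + s *: delta_mx 0 i).
Proof.
move=> bx bh /andP[s0 sh] k; have := bx k; have := bh k; rewrite !entry_line !ler_norml.
case: (k == i); rewrite ?mulr1 ?mulr0 //; lra.
Qed.

Lemma taylor_box D q L f i C x h : box q L `<=` D -> smooth_on D f ->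
  (forall y, box q L y -> `|pd i (pd i f) y| <= C) -> 0 < h ->
  box q L x -> box q L (x + h *: delta_mx 0 i) ->
  `|f (x + h *: delta_mx 0 i) - f x - h * pd i f x| <= C * h ^+ 2.
Proof.
move=> bD sf HC h0 bx bh.
have inb s : 0 <= s <= h -> box q L (x + s *: delta_mx 0 i) by exact: box_line.
have [c /andP[c0 ch] E] := @MVT_line R n f x (delta_mx 0 i) h h0
  (fun s sh => smooth_differentiable sf (bD _ (inb s sh))).
have spf := smooth_partial i sf.
have inb' s : 0 <= s <= c -> 0 <= s <= h by move=> /andP[-> /le_trans ->]; rewrite // ltW.
have [c' /andP[c'0 c'c] E'] := @MVT_line R n (pd i f) x (delta_mx 0 i) c c0
  (fun s sh => smooth_differentiable spf (bD _ (inb s (inb' s sh)))).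
move: E E'; rewrite -!/(partial i _ _) -!pdE => E E'.
rewrite E [h * _]mulrC -mulrBl E' normrM [`|h|]gtr0_norm // normrM [`|c|]gtr0_norm //.
rewrite expr2 mulrA ler_pM2r // ler_pM ?(ltW c0) ?(ltW ch) //.
by apply: HC; apply: inb; apply: inb'; rewrite !ltW.
Qed.

Section lattice.
Variables (N : nat) (q : 'rV[R]_n) (L : R).
Hypotheses (N0 : (0 < N)%N) (L0 : 0 < L).
Let h : R := 2 * L / N%:R.

Definition lattice_point (z : {ffun 'I_n -> 'I_N}) : 'rV[R]_n :=
  \row_k (q 0 k - L + h * (z k)%:R).

(** The shift is cyclic, hence a permutation of the lattice. In [lattice_telescope] the points where
    it wraps around contribute zero on both sides, as f vanishes on the two faces. *)
Definition lattice_shift i (z : {ffun 'I_n -> 'I_N}) : {ffun 'I_n -> 'I_N} :=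
  [ffun k => if k == i then ordS (z k) else z k].

Lemma lattice_shift_inj i : injective (lattice_shift i).
Proof.
move=> z z' /ffunP E; apply/ffunP => k; have := E k; rewrite !ffunE.
by case: eqP => // _ /(can_inj (@ordSK N)).
Qed.

Let hN : h * N%:R = 2 * L.
Proof. by rewrite divfK // pnatr_eq0 -lt0n. Qed.

Lemma lattice_step_gt0 : 0 < h.
Proof. by rewrite divr_gt0 ?mulr_gt0 // ltr0n. Qed.
Let h0 := lattice_step_gt0.

Lemma lattice_box i z (b : bool) : box q L (lattice_point z + (h *+ b) *: delta_mx 0 i).
Proof.
move=> k; rewrite entry_line mxE ler_norml.
have : h * ((z k)%:R + b%:R * (k == i)%:R) <= 2 * L.
  rewrite -hN ler_pM2l // -natrM -natrD ler_nat.
  by case: b; case: (k == i); rewrite ?muln1 ?muln0 ?addn1 ?addn0 // ltnW.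
have : 0 <= h * ((z k)%:R + b%:R * (k == i)%:R).
  by rewrite mulr_ge0 ?(ltW h0) // addr_ge0 ?mulr_ge0.
rewrite -[h *+ b]mulr_natr; move: (h * _) (mulrDr h (z k)%:R (b%:R * (k == i)%:R)) => t.
rewrite mulrA => -> *; lra.
Qed.

Lemma lattice_telescope (f : 'rV[R]_n -> R) i :
  (forall x, box q L x -> `|x 0 i - q 0 i| = L -> f x = 0) ->
  \sum_z f (lattice_point z + h *: delta_mx 0 i) = \sum_z f (lattice_point z).
Proof.
move=> f0; rewrite [RHS](reindex_inj (@lattice_shift_inj i)); apply: eq_bigr => z _.
have [lt|ge] := ltnP (z i).+1 N.
  congr f; apply/rowP => k; rewrite entry_line !mxE ffunE.
  have [->|_] := eqVneq k i; last by rewrite mulr0 addr0.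
  by rewrite /= modn_small // -addrA -mulrDr -natrD addn1.
have zN : (z i).+1 = N by apply/eqP; rewrite eqn_leq ge ltn_ord.
rewrite !f0 //.
- by have := lattice_box i (lattice_shift i z) false; rewrite mulr0n scale0r addr0.
- rewrite mxE ffunE eqxx /= zN modnn mulr0 addr0 addrAC subrr add0r normrN gtr0_norm //.
- exact: (lattice_box i z true).
- rewrite entry_line mxE eqxx mulr1.
  have -> : q 0 i - L + h * (z i)%:R + h - q 0 i = L.
    have : h * (z i)%:R + h = 2 * L by rewrite -hN -(congr1 (fun m => m%:R) zN) mulrSr mulrDr mulr1.
    lra.
  by rewrite gtr0_norm.
Qed.

End lattice.

(* Replaces the integral of a divergence: the sums of difference quotients over a
   fine lattice telescope. *)
Lemma box_divergence (D : set 'rV[R]_n) (F : 'I_n -> 'rV[R]_n -> R) q (L c1 c2 : R) K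
    (u : 'I_n -> 'I_K) :
  (0 < K)%N -> 0 < L -> box q L `<=` D -> (forall i, smooth_on D (F i)) ->
  (forall i x, box q L x -> `|x 0 i - q 0 i| = L -> F i x = 0) ->
  0 <= c1 -> 0 <= c2 ->
  (forall x, box q L x -> \sum_i pd i (F i) x <= c1) ->
  (forall x, box q L x ->
     (forall i, 2 * L * (u i)%:R <= (x 0 i - q 0 i + L) * K%:R <= 2 * L * (u i).+1%:R) ->
     \sum_i pd i (F i) x <= - c2) ->
  c2 <= c1 * (K ^ n)%:R.
Proof.
move=> K0 L0 bD sF F0 c1_ge0 c2_ge0 H1 H2.
have [C C0 HC] := box_bounded_fin bD (fun i => smooth_partial i (smooth_partial i (sF i))).
rewrite leNgt; apply/negP => gap.
have KR : (0 : R) < K%:R by rewrite ltr0n.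
pose g := c2 - c1 * (K ^ n)%:R; have g0 : 0 < g by rewrite subr_gt0.
(* The gap [g] is to be contradicted. After division by M^n the Taylor errors of the lattice sum are
   at most B / M, which the choice of M makes smaller than g. *)
pose B := (K ^ n)%:R * (n%:R * C) * (2 * L).
have B0 : 0 <= B by rewrite !mulr_ge0 // ltW.
pose M := (Num.bound (B / g)).+1.
have MB : B < g * M%:R.
  rewrite -ltr_pdivrMl // mulrC (lt_trans (archi_boundP _)) ?divr_ge0 ?(ltW g0) //.
  by rewrite ltr_nat.
have N0 : (0 < K * M)%N by rewrite muln_gt0 K0.
pose h : R := 2 * L / (K * M)%:R.
have h0 : 0 < h := lattice_step_gt0 N0 L0.
have hKM : h * K%:R * M%:R = 2 * L.
  by rewrite -mulrA -natrM divfK // pnatr_eq0 -lt0n.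
pose p := @lattice_point (K * M) q L.
have pb z : box q L (p z).
  by move=> k; have := lattice_box q N0 L0 k z false; rewrite mulr0n scale0r addr0.
pose dv x := \sum_i pd i (F i) x.
have step z : \sum_i (F i (p z + h *: delta_mx 0 i) - F i (p z)) <= h * (dv (p z) + n%:R * C * h).
  rewrite mulrDr mulr_sumr -[n%:R * C * h]mulrA mulr_natl -[X in _ *+ X]card_ord -sumr_const.
  rewrite mulr_sumr -big_split; apply: ler_sum => i _ /=.
  have := @taylor_box D q L (F i) i C (p z) h bD (sF i) (HC i) h0 (pb z) (lattice_box q N0 L0 i z true).
  rewrite ler_norml => /andP[_]; rewrite lerBlDr addrC => /le_trans; apply.
  by rewrite lerD2r expr2 mulrA mulrC.
have tel : \sum_z \sum_i (F i (p z + h *: delta_mx 0 i) - F i (p z)) = 0.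
  rewrite exchange_big big1 // => i _ /=; rewrite sumrB.
  by rewrite (lattice_telescope N0 L0 (F0 i)) subrr.
have card_z : #|{: {ffun 'I_n -> 'I_(K * M)}}| = (K ^ n * M ^ n)%N.
  by rewrite card_ffun !card_ord expnMn.
have S1 : 0 <= \sum_z dv (p z) + (K ^ n * M ^ n)%:R * (n%:R * C * h).
  have : \sum_z \sum_i (F i (p z + h *: delta_mx 0 i) - F i (p z)) <=
      \sum_z h * (dv (p z) + n%:R * C * h) by apply: ler_sum => z _; exact: step.
  rewrite tel -mulr_sumr pmulr_rge0 // big_split /= sumr_const card_z -[X in _ + X]mulr_natl //.
have emb_lt (r : {ffun 'I_n -> 'I_M}) k : (u k * M + r k < K * M)%N.
  apply: (@leq_trans ((u k).+1 * M)); last by rewrite leq_mul2r ltn_ord orbT.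
  by rewrite mulSn addnC ltn_add2r ltn_ord.
(* Of the (K M)^n lattice points, M^n lie in the cell given by u. There the divergence is at most -
   c2, elsewhere at most c1. *)
pose emb (r : {ffun 'I_n -> 'I_M}) : {ffun 'I_n -> 'I_(K * M)} :=
  [ffun k => Ordinal (emb_lt r k)].
have emb_inj : injective emb.
  move=> r r' /ffunP E; apply/ffunP => k; have := E k; rewrite !ffunE => /(congr1 val) /=.
  by move/addnI/val_inj.
have S2 : (M ^ n)%:R * (c1 + c2) <= \sum_z (c1 - dv (p z)).
  rewrite (bigID (mem (emb @: [set: {ffun 'I_n -> 'I_M}]%SET))) /= ler_wpDr //.
    by apply: sumr_ge0 => z _; rewrite subr_ge0; apply: H1; exact: pb.
  rewrite big_imset /=; last by move=> r r' _ _; exact: emb_inj.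
  have -> : (M ^ n)%:R * (c1 + c2) = \sum_(r in [set: {ffun 'I_n -> 'I_M}]%SET) (c1 + c2).
    by rewrite sumr_const cardsT card_ffun !card_ord mulr_natl.
  apply: ler_sum => r _; rewrite lerD2l lerNr; apply: H2; first exact: pb.
  move=> i; rewrite !mxE !ffunE /=.
  have -> : (q 0 i - L + h * (u i * M + r i)%:R - q 0 i + L) * K%:R
      = 2 * L * (u i)%:R + h * K%:R * (r i)%:R.
    by rewrite natrD natrM -hKM; ring.
  rewrite -[(u i).+1]addn1 natrD mulrDr mulr1 lerDl lerD2l -hKM !mulr_ge0 ?(ltW h0) ?(ltW KR) ?(ltW L0) //=.
  have hK : 0 <= h * K%:R by rewrite mulr_ge0 ?(ltW h0) ?(ltW KR).
  by apply: (ler_wpM2l hK); rewrite ler_nat ltnW.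
have MR : (0 : R) < (M ^ n)%:R by rewrite ltr0n expn_gt0.
have : (M ^ n)%:R * (c1 + c2) <= (M ^ n)%:R * ((K ^ n)%:R * (c1 + n%:R * C * h)).
  rewrite (le_trans S2) // sumrB sumr_const card_z -[_ *+ _]mulr_natl.
  move: S1; rewrite natrM; move: (\sum_z _) => S; lra.
rewrite ler_pM2l // => S3.
have : (K ^ n)%:R * (n%:R * C * h) < g.
  have h_le : h * M%:R <= 2 * L.
    have hM : 0 <= h * M%:R by rewrite mulr_ge0 ?(ltW h0).
    by rewrite -hKM [leRHS]mulrAC; apply: ler_peMr => //; rewrite ler1n.
  rewrite -(ltr_pM2r (_ : 0 < M%:R)) ?ltr0n // (le_lt_trans _ MB) //.
  have -> : (K ^ n)%:R * (n%:R * C * h) * M%:R = (K ^ n)%:R * (n%:R * C) * (h * M%:R).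
    by clear; ring.
  by apply: ler_wpM2l => //; rewrite !mulr_ge0 // ltW.
rewrite /g => S4; move: S3 S4; rewrite mulrDr; move: (_ * (n%:R * C * h)) => T.
rewrite [c1 * _]mulrC => *; lra.
Qed.

End box.

(** * The pointwise multiplier identity behind the Carleman estimate *)

Section carleman_identity.
Context {R : realType} {n : nat}.
Variables (D : set 'rV[R]_n) (a : 'I_n -> 'I_n -> 'rV[R]_n -> R).
Hypothesis oD : open D.
Hypothesis sa : forall i j, smooth_on D (a i j).
Hypothesis a_sym : forall i j x, D x -> a i j x = a j i x.

Definition second_order (v : 'rV[R]_n -> R) x : R :=
  \sum_i \sum_j a i j x * pd i (pd j v) x.

Definition flux (v : 'rV[R]_n -> R) i x : R := \sum_j a i j x * pd j v x.

Variables (b : 'I_n -> 'rV[R]_n -> R) (N m v : 'rV[R]_n -> R) (t : R).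
Hypotheses (sb : forall i, smooth_on D (b i)) (sN : smooth_on D N)
  (sm : smooth_on D m) (sv : smooth_on D v).

Definition drift x : R := \sum_k b k x * pd k v x.
Definition energy x : R := \sum_i flux v i x * pd i v x.

(** The boundary terms of the integration by parts in [carleman_identity], kept as a vector field
    whose divergence is taken pointwise. *)
Definition carleman_field i x : R :=
  - 2 * t * (flux v i x * drift x) + t * (b i x * energy x)
  - t ^+ 3 * (N x * b i x * (v x * v x)) + t * (m x * v x * flux v i x).

Let sflux i : smooth_on D (flux v i).
Proof. by apply: smooth_sum => // j; apply: smoothM => //; exact: smooth_partial. Qed.

Let sdrift : smooth_on D drift.
Proof. by apply: smooth_sum => // j; apply: smoothM => //; exact: smooth_partial. Qed.

Let senergy : smooth_on D energy.
Proof. by apply: smooth_sum => // j; apply: smoothM => //; exact: smooth_partial. Qed.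

Let df f x : smooth_on D f -> D x -> differentiable f x.
Proof. by move=> sf; exact: smooth_differentiable. Qed.

Let dM i f g x : smooth_on D f -> smooth_on D g -> D x ->
  pd i (fun y => f y * g y) x = pd i f x * g x + f x * pd i g x.
Proof. by move=> sf sg Dx; rewrite partialM //; exact: df. Qed.

Lemma carleman_field_smooth i : smooth_on D (carleman_field i).
Proof.
have sc c : smooth_on D (fun=> c : R) by exact: smooth_cst.
by apply: smoothD => //; [apply: smoothB => //; [apply: smoothD => //|]|];
  repeat (apply: smoothM => //).
Qed.

Let pd_field i x : D x -> pd i (carleman_field i) x =
  - 2 * t * (pd i (flux v i) x * drift x + flux v i x * pd i drift x)
  + t * (pd i (b i) x * energy x + b i x * pd i energy x)
  - t ^+ 3 * (pd i (fun y => N y * b i y) x * (v x * v x) + N x * b i x * (2 * (v x * pd i v x)))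
  + t * (pd i m x * v x * flux v i x + m x * pd i v x * flux v i x + m x * v x * pd i (flux v i) x).
Proof.
move=> Dx; have sc c : smooth_on D (fun=> c : R) by exact: smooth_cst.
have s1 : smooth_on D (fun y => flux v i y * drift y) by apply: smoothM.
have s2 : smooth_on D (fun y => b i y * energy y) by apply: smoothM.
have sNb : smooth_on D (fun y => N y * b i y) by apply: smoothM.
have svv : smooth_on D (fun y => v y * v y) by apply: smoothM.
have s3 : smooth_on D (fun y => N y * b i y * (v y * v y)) by apply: smoothM.
have smv : smooth_on D (fun y => m y * v y) by apply: smoothM.
have s4 : smooth_on D (fun y => m y * v y * flux v i y) by apply: smoothM.
have S1 : smooth_on D (fun y => - 2 * t * (flux v i y * drift y)) by apply: smoothM.
have S2 : smooth_on D (fun y => t * (b i y * energy y)) by apply: smoothM.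
have S3 : smooth_on D (fun y => t ^+ 3 * (N y * b i y * (v y * v y))) by apply: smoothM.
have S4 : smooth_on D (fun y => t * (m y * v y * flux v i y)) by apply: smoothM.
have S12 : smooth_on D (fun y => - 2 * t * (flux v i y * drift y) + t * (b i y * energy y)).
  by apply: smoothD.
have S123 : smooth_on D (fun y => - 2 * t * (flux v i y * drift y) + t * (b i y * energy y)
   - t ^+ 3 * (N y * b i y * (v y * v y))) by apply: smoothB.
rewrite /carleman_field partialD ?partialB ?partialD ?partialZ; try exact: df.
rewrite !(dM i s4, dM i smv (sflux i), dM i sm sv, dM i (sflux i) sdrift, dM i (sb i) senergy,
  dM i sNb svv, dM i sv sv) //.
by clear; move: (pd _ _ _) (pd _ _ _) => *; ring.
Qed.

Let cc j x : R := \sum_i pd i (a i j) x.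

Let flux_div x : D x -> \sum_i pd i (flux v i) x = second_order v x + \sum_j cc j x * pd j v x.
Proof.
move=> Dx; rewrite /second_order.
have -> : \sum_j cc j x * pd j v x = \sum_i \sum_j pd i (a i j) x * pd j v x.
  by rewrite exchange_big; apply: eq_bigr => j _; rewrite mulr_suml.
rewrite -big_split; apply: eq_bigr => i _; rewrite /flux partial_sum => [|j]; last first.
  by apply: (df _ Dx); apply: smoothM => //; exact: smooth_partial.
rewrite -big_split; apply: eq_bigr => j _ /=.
rewrite (dM i (sa i j) (smooth_partial j sv) Dx) addrC //.
Qed.

(** The second derivatives of v cancel, by the symmetry of a and of mixed derivatives. *)
Let drift_energy x : D x ->
  2 * (\sum_i flux v i x * pd i drift x) - \sum_k b k x * pd k energy x =
  2 * (\sum_i \sum_k flux v i x * pd i (b k) x * pd k v x)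
  - \sum_k \sum_i \sum_j b k x * pd k (a i j) x * pd i v x * pd j v x.
Proof.
move=> Dx; have spv k := smooth_partial k sv.
have E1 : \sum_i flux v i x * pd i drift x =
    \sum_i \sum_k flux v i x * pd i (b k) x * pd k v x
    + \sum_k b k x * \sum_i flux v i x * pd k (pd i v) x.
  have -> : \sum_k b k x * \sum_i flux v i x * pd k (pd i v) x =
      \sum_i \sum_k flux v i x * (b k x * pd i (pd k v) x).
    rewrite exchange_big; apply: eq_bigr => k _; rewrite mulr_sumr; apply: eq_bigr => i _.
    by rewrite (smooth_partial_comm oD i k sv Dx) mulrCA.
  rewrite -big_split; apply: eq_bigr => i _; rewrite /drift partial_sum => [|k]; last first.
    by apply: (df _ Dx); apply: smoothM.
  by rewrite mulr_sumr -big_split; apply: eq_bigr => k _ /=; rewrite dM //; ring.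
have E2 k : pd k energy x = \sum_i \sum_j pd k (a i j) x * pd i v x * pd j v x
    + 2 * \sum_i flux v i x * pd k (pd i v) x.
  have -> : 2 * \sum_i flux v i x * pd k (pd i v) x =
     \sum_i (\sum_j a i j x * pd k (pd j v) x * pd i v x + flux v i x * pd k (pd i v) x).
    rewrite mulr2n mulrDl mul1r big_split /=; congr (_ + _).
    rewrite exchange_big; apply: eq_bigr => i _; rewrite /flux mulr_suml.
    by apply: eq_bigr => j _; rewrite (a_sym i j Dx); ring.
  rewrite -big_split; rewrite /energy partial_sum => [|i]; last by apply: (df _ Dx); apply: smoothM.
  apply: eq_bigr => i _ /=; rewrite dM // addrA; congr (_ + _).
  rewrite /flux partial_sum => [|j]; last by apply: (df _ Dx); apply: smoothM.
  rewrite mulr_suml -big_split; apply: eq_bigr => j _ /=.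
  by rewrite dM //; ring.
rewrite E1; under [X in _ - X]eq_bigr do rewrite E2 mulrDr.
rewrite big_split /=.
have -> : \sum_k b k x * (2 * \sum_i flux v i x * pd k (pd i v) x) =
  2 * \sum_k b k x * \sum_i flux v i x * pd k (pd i v) x.
  by rewrite [RHS]mulr_sumr; apply: eq_bigr => k _; rewrite mulrCA.
have -> : \sum_k b k x * (\sum_i \sum_j pd k (a i j) x * pd i v x * pd j v x) =
  \sum_k \sum_i \sum_j b k x * pd k (a i j) x * pd i v x * pd j v x.
  apply: eq_bigr => k _; rewrite mulr_sumr; apply: eq_bigr => i _; rewrite mulr_sumr.
  by apply: eq_bigr => j _; rewrite !mulrA.
by clear; move: (\sum_i _) (\sum_i _) (\sum_i _) => *; ring.
Qed.

(** The conjugated operator will be split into P + t^2 N and a transport term with a multiplier m.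
    In their product derivatives are moved onto the coefficients, which leaves a divergence and
    forms quadratic in v and its first derivatives. The multiplier is free here and is chosen in
    [weight_mult]. *)
Lemma carleman_identity x : D x ->
  (second_order v x + t ^+ 2 * N x * v x) * (- 2 * t * drift x + t * m x * v x) =
  \sum_i pd i (carleman_field i) x +
  (t * (2 * (\sum_j cc j x * pd j v x) * drift x
     + 2 * (\sum_i \sum_k flux v i x * pd i (b k) x * pd k v x)
     - \sum_k \sum_i \sum_j b k x * pd k (a i j) x * pd i v x * pd j v x
     - (\sum_i pd i (b i) x + m x) * energy x)
   + t ^+ 3 * (\sum_i pd i (fun y => N y * b i y) x + m x * N x) * v x ^+ 2
   - t * v x * \sum_j (\sum_i pd i (fun y => m y * a i j y) x) * pd j v x).
Proof.
move=> Dx; under [X in _ = X + _]eq_bigr do rewrite (pd_field _ Dx).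
have ma : \sum_j (\sum_i pd i (fun y => m y * a i j y) x) * pd j v x =
    \sum_i pd i m x * flux v i x + m x * \sum_j cc j x * pd j v x.
  have -> : \sum_i pd i m x * flux v i x = \sum_j \sum_i pd i m x * a i j x * pd j v x.
    rewrite exchange_big; apply: eq_bigr => i _; rewrite /flux mulr_sumr.
    by apply: eq_bigr => j _; rewrite mulrA.
  rewrite mulr_sumr -big_split; apply: eq_bigr => j _ /=.
  rewrite mulrA -mulr_suml -mulrDl; congr (_ * _); rewrite mulr_sumr -big_split.
  by apply: eq_bigr => i _ /=; rewrite dM.
have Sum (f1 f2 f3 f4 f5 f6 f7 f8 f9 : 'I_n -> R) :
   \sum_i (- 2 * t * (f1 i * drift x + f2 i) + t * (f3 i * energy x + f4 i)
     - t ^+ 3 * (f5 i * (v x * v x) + N x * f6 i * (2 * (v x * f7 i)))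
     + t * (f8 i * v x * f9 i + m x * f7 i * f9 i + m x * v x * f1 i)) =
   - 2 * t * ((\sum_i f1 i) * drift x + \sum_i f2 i) + t * ((\sum_i f3 i) * energy x + \sum_i f4 i)
     - t ^+ 3 * ((\sum_i f5 i) * (v x * v x) + N x * (2 * (v x * \sum_i f6 i * f7 i)))
     + t * (v x * (\sum_i f8 i * f9 i) + m x * (\sum_i f9 i * f7 i) + m x * v x * (\sum_i f1 i)).
  do 8 rewrite ?mulr_suml ?mulr_sumr -?sumrN -?big_split /=.
  by apply: eq_bigr => i _; ring.
rewrite Sum flux_div // ma -/(drift x) -/(energy x).
have := drift_energy Dx.
move: (\sum_i flux v i x * pd i drift x) (\sum_k b k x * pd k energy x)
  (\sum_i \sum_k flux v i x * pd i (b k) x * pd k v x) (\sum_k \sum_i \sum_j _)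
  (\sum_j cc j x * pd j v x) (\sum_i pd i (b i) x) (\sum_i pd i (fun y => N y * b i y) x)
  (\sum_i pd i m x * flux v i x) (second_order v x) (drift x) (energy x) (m x) (N x) (v x).
clear => e1 e2 e3 e4 e5 e6 e7 e8 P d e mm NN vv H.
have -> : e4 = 2 * e3 - (2 * e1 - e2) by rewrite H; ring.
ring.
Qed.

End carleman_identity.

Section coordinates.
Context {R : realType} {n : nat}.
Implicit Types (D : set 'rV[R]_n) (q x : 'rV[R]_n).

Lemma partial_coord i k x : pd i (fun y : 'rV[R]_n => y 0 k) x = (k == i)%:R.
Proof.
have lf : linear (fun y : 'rV[R]_n => y 0 k : R^o) by move=> c u v; rewrite !mxE.
pose fM := GRing.isLinear.Build _ _ _ _ _ lf.
pose f : {linear 'rV[R]_n -> R^o} := HB.pack (fun y : 'rV[R]_n => y 0 k : R^o) fM.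
rewrite pdE /partial deriveE; last exact: differentiable_coord.
rewrite (_ : (fun y : 'rV[R]_n => y 0 k) = f) // diff_lin; last exact: coord_continuous.
by rewrite /f /= mxE eqxx.
Qed.

Lemma smooth_coord D k : open D -> smooth_on D (fun y : 'rV[R]_n => y 0 k).
Proof.
move=> oD; apply: (@smooth_coind _ _ (fun f => (exists c : R, f = fun=> c) \/
  f = fun y : 'rV[R]_n => y 0 k)) => //; last by right.
- by move=> f [[c ->]|->] x _; [exact: differentiable_cst|exact: differentiable_coord].
- move=> f i [[c ->]|->]; first by exists (fun=> 0); [left; exists 0|move=> x _; exact: partial_cst].
  by exists (fun=> (k == i)%:R); [left; exists (k == i)%:R|move=> x _; exact: partial_coord].
Qed.

Definition dist2 q x : R := \sum_i (x 0 i - q 0 i) ^+ 2.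

Lemma dist2_smooth D q : open D -> smooth_on D (dist2 q).
Proof.
move=> oD; apply: smooth_sum => // i.
by apply: smoothM => //; apply: smoothB => //; (exact: smooth_coord || exact: smooth_cst).
Qed.

Lemma partial_dist2 q i x : pd i (dist2 q) x = 2 * (x 0 i - q 0 i).
Proof.
have oT : open [set: 'rV[R]_n] by exact: openT.
have sB k : smooth_on [set: 'rV[R]_n] (fun y => y 0 k - q 0 k).
  by apply: smoothB => //; (exact: smooth_coord || exact: smooth_cst).
have dB k : differentiable (fun y : 'rV[R]_n => y 0 k - q 0 k) x.
  exact: smooth_differentiable (sB k) I.
have E k : pd i (fun y : 'rV[R]_n => y 0 k - q 0 k) x = (k == i)%:R.
  by rewrite partialB ?partial_coord ?partial_cst ?subr0 //; exact: differentiable_coord.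
have -> : dist2 q = fun y => \sum_k (y 0 k - q 0 k) * (y 0 k - q 0 k).
  by apply/funext => y; apply: eq_bigr => k _; rewrite expr2.
rewrite partial_sum => [|k]; last by apply: differentiableM; exact: dB.
rewrite (bigD1 i) //= big1 ?addr0 => [|k ki].
  by rewrite partialM // E eqxx mul1r mulr1 mulr_natl mulr2n.
by rewrite partialM // E (negPf ki) mul0r mulr0 addr0.
Qed.

Lemma dist2_coord q x i : (x 0 i - q 0 i) ^+ 2 <= dist2 q x.
Proof.
by rewrite /dist2 (bigD1 i) //= lerDl; apply: sumr_ge0 => k _; exact: sqr_ge0.
Qed.

Lemma dist2_box q x (L : R) : box q L x -> dist2 q x <= n%:R * L ^+ 2.
Proof.
move=> bx; rewrite mulr_natl -[X in _ *+ X]card_ord -sumr_const; apply: ler_sum => i _.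
by rewrite -[leLHS]real_normK ?num_real //; apply: lerXn2r (bx i); rewrite nnegrE // (le_trans _ (bx i)).
Qed.

Lemma quadratic_bound (tau : 'I_n -> 'I_n -> R) (C : R) (xi : 'I_n -> R) :
  (forall p r, `|tau p r| <= C) ->
  `|\sum_p \sum_r tau p r * xi p * xi r| <= n%:R * C * \sum_i xi i ^+ 2.
Proof.
move=> H; apply: (@le_trans _ _ (\sum_p \sum_r C * ((xi p ^+ 2 + xi r ^+ 2) / 2))).
  apply: (le_trans (ler_norm_sum _ _ _)); apply: ler_sum => p _.
  apply: (le_trans (ler_norm_sum _ _ _)); apply: ler_sum => r _.
  rewrite -mulrA normrM ler_pM // normrM.
  have := sqr_ge0 (`|xi p| - `|xi r|); rewrite -[xi p ^+ 2]real_normK ?num_real //.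
  rewrite -[xi r ^+ 2]real_normK ?num_real //; lra.
have -> : \sum_p \sum_r C * ((xi p ^+ 2 + xi r ^+ 2) / 2) =
    C / 2 * (\sum_p \sum_(r < n) xi p ^+ 2 + \sum_(p < n) \sum_r xi r ^+ 2).
  rewrite -big_split mulr_sumr; apply: eq_bigr => p _; rewrite -big_split mulr_sumr.
  by apply: eq_bigr => r _ /=; ring.
under eq_bigr do rewrite sumr_const card_ord.
rewrite sumr_const card_ord sumrMnl; move: (\sum_i xi i ^+ 2) => S.
by rewrite -[S *+ n]mulr_natl le_eqVlt; apply/orP; left; apply/eqP; field.
Qed.

End coordinates.

(** * The Carleman weight exp(- lam dist^2) *)

Section weight.
Context {R : realType} {n : nat}.
Variables (D : set 'rV[R]_n) (a : 'I_n -> 'I_n -> 'rV[R]_n -> R) (q : 'rV[R]_n).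
Hypothesis oD : open D.
Hypothesis sa : forall i j, smooth_on D (a i j).
Hypothesis a_sym : forall i j x, D x -> a i j x = a j i x.

(** The gradient of - [dist2]; [dist_field] is the corresponding vector field with respect to a, and
    [dist_norm] its squared length. *)
Definition dist_grad i (x : 'rV[R]_n) : R := - 2 * (x 0 i - q 0 i).
Definition dist_field k x : R := \sum_j a k j x * dist_grad j x.
Definition dist_norm x : R := \sum_k dist_field k x * dist_grad k x.

Lemma dist_grad_smooth i : smooth_on D (dist_grad i).
Proof.
apply: smoothM => //; first exact: smooth_cst.
by apply: smoothB => //; (exact: smooth_coord || exact: smooth_cst).
Qed.
Let sg := dist_grad_smooth.

Lemma dist_field_smooth k : smooth_on D (dist_field k).
Proof. by apply: smooth_sum => // j; exact: smoothM. Qed.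
Let sf0 := dist_field_smooth.

Lemma dist_norm_smooth : smooth_on D dist_norm.
Proof. by apply: smooth_sum => // j; exact: smoothM. Qed.
Let sn0 := dist_norm_smooth.

Let df f x : smooth_on D f -> D x -> differentiable f x.
Proof. by move=> sf; exact: smooth_differentiable. Qed.

Variables lam mu : R.

Definition weight x : R := expR (- lam * dist2 q x).
Definition weight_field k x : R := lam * weight x * dist_field k x.
Definition weight_norm x : R := lam ^+ 2 * (weight x * weight x) * dist_norm x.
(** With this multiplier the coefficient - (div b + m) of the energy in [carleman_identity] becomes
    mu lam w, at the price of the term - mu [dist_norm] in [zero_order_formE]. *)
Definition weight_mult x : R := - (\sum_k pd k (weight_field k) x) - mu * lam * weight x.

Lemma weight_smooth : smooth_on D weight.
Proof.
by apply: smooth_expR => //; apply: smoothM => //; [exact: smooth_cst|exact: dist2_smooth].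
Qed.

Lemma weight_field_smooth k : smooth_on D (weight_field k).
Proof.
apply: smoothM => //; apply: smoothM => //; last exact: weight_smooth.
exact: smooth_cst.
Qed.

Lemma weight_norm_smooth : smooth_on D weight_norm.
Proof.
apply: smoothM => //; apply: smoothM => //; first exact: smooth_cst.
by apply: smoothM => //; exact: weight_smooth.
Qed.

Lemma weight_mult_smooth : smooth_on D weight_mult.
Proof.
apply: smoothB => //; last by apply: smoothM => //; [exact: smooth_cst|exact: weight_smooth].
by apply: smoothN => //; apply: smooth_sum => // k; apply: smooth_partial; exact: weight_field_smooth.
Qed.

Lemma partial_weight i x : D x -> pd i weight x = lam * weight x * dist_grad i x.
Proof.
move=> Dx; have dd : differentiable (dist2 q) x by apply: (df _ Dx); exact: dist2_smooth.
have dl : differentiable (fun y => - lam * dist2 q y) x.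
  by apply: differentiableM => //; exact: differentiable_cst.
rewrite /weight (@partial_comp1 _ _ expR _ _ (expR (- lam * dist2 q x))) //.
by rewrite partialZ // partial_dist2 /dist_grad; ring.
Qed.

Lemma weight_fieldE k x : D x -> weight_field k x = \sum_j a k j x * pd j weight x.
Proof.
move=> Dx; rewrite /weight_field /dist_field mulr_sumr; apply: eq_bigr => j _.
by rewrite partial_weight //; ring.
Qed.

Lemma weight_normE x : D x -> weight_norm x = \sum_k weight_field k x * pd k weight x.
Proof.
move=> Dx; rewrite /weight_norm /dist_norm mulr_sumr; apply: eq_bigr => j _.
by rewrite partial_weight // /weight_field; ring.
Qed.

Let pd_field i k x : D x -> pd i (weight_field k) x =
  lam * weight x * (pd i (dist_field k) x + lam * dist_grad i x * dist_field k x).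
Proof.
move=> Dx; have dw : differentiable weight x by apply: (df _ Dx); exact: weight_smooth.
have dlw : differentiable (fun y => lam * weight y) x.
  by apply: differentiableM => //; exact: differentiable_cst.
rewrite /weight_field partialM //; last exact: df.
by rewrite partialZ // partial_weight //; ring.
Qed.

Definition coef_div j x : R := \sum_i pd i (a i j) x.
(** The part of the gradient form that depends neither on lam nor on mu once the factor lam w is
    taken out. *)
Definition commutator_coef p r x : R := 2 * (coef_div p x * dist_field r x) + 2 * (\sum_i a i p x * pd i (dist_field r) x)
  - \sum_k dist_field k x * pd k (a p r) x.

Lemma commutator_coef_smooth p r : smooth_on D (commutator_coef p r).
Proof.
have sc c : smooth_on D (fun=> c : R) by exact: smooth_cst.
have scc j : smooth_on D (coef_div j) by apply: smooth_sum => // i; exact: smooth_partial.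
have s1 : smooth_on D (fun x => \sum_i a i p x * pd i (dist_field r) x).
  by apply: smooth_sum => // i; apply: smoothM => //; exact: smooth_partial.
have s2 : smooth_on D (fun x => \sum_k dist_field k x * pd k (a p r) x).
  by apply: smooth_sum => // i; apply: smoothM => //; exact: smooth_partial.
by apply: smoothB => //; apply: smoothD => //; repeat (apply: smoothM => //).
Qed.

(** The quadratic form in the gradient of v that [carleman_identity] multiplies by t;
    [zero_order_form] is its coefficient of t^3 v^2. *)
Definition first_order_form x (xi : 'I_n -> R) : R :=
  2 * (\sum_j coef_div j x * xi j) * (\sum_k weight_field k x * xi k)
  + 2 * (\sum_i \sum_k (\sum_j a i j x * xi j) * pd i (weight_field k) x * xi k)
  - \sum_k \sum_i \sum_j weight_field k x * pd k (a i j) x * xi i * xi j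
  - (\sum_i pd i (weight_field i) x + weight_mult x) * (\sum_i (\sum_j a i j x * xi j) * xi i).

Definition zero_order_form x : R :=
  \sum_i pd i (fun y => weight_norm y * weight_field i y) x + weight_mult x * weight_norm x.

Lemma first_order_formE x xi : D x -> first_order_form x xi = lam * weight x *
  (\sum_p \sum_r commutator_coef p r x * xi p * xi r + 2 * lam * (\sum_k dist_field k x * xi k) ^+ 2
   + mu * \sum_i (\sum_j a i j x * xi j) * xi i).
Proof.
move=> Dx; rewrite /first_order_form /weight_mult.
have -> : \sum_k weight_field k x * xi k = lam * weight x * \sum_k dist_field k x * xi k.
  by rewrite mulr_sumr; apply: eq_bigr => k _; rewrite /weight_field !mulrA.
have -> : \sum_k \sum_i \sum_j weight_field k x * pd k (a i j) x * xi i * xi j =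
   lam * weight x * \sum_i \sum_j (\sum_k dist_field k x * pd k (a i j) x) * xi i * xi j.
  rewrite exchange_big mulr_sumr; apply: eq_bigr => i _; rewrite exchange_big mulr_sumr.
  apply: eq_bigr => j _; rewrite -!mulrA mulr_suml !mulr_sumr; apply: eq_bigr => k _.
  by rewrite /weight_field /=; ring.
have -> : \sum_i \sum_k (\sum_j a i j x * xi j) * pd i (weight_field k) x * xi k =
   lam * weight x * (\sum_p \sum_r (\sum_i a i p x * pd i (dist_field r) x) * xi p * xi r
     + lam * (\sum_k dist_field k x * xi k) ^+ 2).
  have -> : (\sum_k dist_field k x * xi k) ^+ 2 =
      \sum_i \sum_k (\sum_j a i j x * xi j) * dist_grad i x * (dist_field k x * xi k).
    rewrite expr2 mulr_suml.
    transitivity (\sum_j \sum_i a i j x * xi j * dist_grad i x * (\sum_k dist_field k x * xi k)).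
      apply: eq_bigr => j _; rewrite -mulr_suml; congr (_ * _); rewrite /dist_field mulr_suml.
      by apply: eq_bigr => i _; rewrite (a_sym j i Dx); ring.
    rewrite exchange_big; apply: eq_bigr => i _; rewrite -!mulr_suml mulr_sumr.
    by apply: eq_bigr.
  have -> : \sum_p \sum_r (\sum_i a i p x * pd i (dist_field r) x) * xi p * xi r =
      \sum_i \sum_k (\sum_j a i j x * xi j) * pd i (dist_field k) x * xi k.
    transitivity (\sum_p \sum_r \sum_i a i p x * pd i (dist_field r) x * xi p * xi r).
      by apply: eq_bigr => p _; apply: eq_bigr => r _; rewrite !mulr_suml.
    transitivity (\sum_i \sum_p \sum_r a i p x * pd i (dist_field r) x * xi p * xi r).
      rewrite [RHS]exchange_big; apply: eq_bigr => p _; by rewrite exchange_big.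
    apply: eq_bigr => i _; rewrite exchange_big; apply: eq_bigr => r _.
    by rewrite !mulr_suml; apply: eq_bigr => p _; ring.
  rewrite mulr_sumr -big_split mulr_sumr; apply: eq_bigr => i _ /=.
  rewrite mulr_sumr -big_split mulr_sumr; apply: eq_bigr => k _ /=.
  by rewrite pd_field //; ring.
have -> : \sum_p \sum_r commutator_coef p r x * xi p * xi r =
    2 * ((\sum_j coef_div j x * xi j) * (\sum_k dist_field k x * xi k))
    + 2 * (\sum_p \sum_r (\sum_i a i p x * pd i (dist_field r) x) * xi p * xi r)
    - \sum_i \sum_j (\sum_k dist_field k x * pd k (a i j) x) * xi i * xi j.
  rewrite mulr_suml !mulr_sumr -sumrN -!big_split; apply: eq_bigr => p _ /=.
  rewrite !mulr_sumr -sumrN -!big_split; apply: eq_bigr => r _ /=.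
  by rewrite /commutator_coef; ring.
move: (\sum_j coef_div j x * xi j) (\sum_k dist_field k x * xi k) (\sum_p _) (\sum_i _) (\sum_i _) (\sum_i _).
by move=> *; ring.
Qed.

Lemma zero_order_formE x : D x -> zero_order_form x = (lam * weight x) ^+ 3 *
  (2 * lam * dist_norm x ^+ 2 + \sum_i dist_field i x * pd i dist_norm x - mu * dist_norm x).
Proof.
move=> Dx; have dw : differentiable weight x by apply: (df _ Dx); exact: weight_smooth.
have dww : differentiable (fun y => weight y * weight y) x by apply: differentiableM.
have E i : pd i (fun y => weight_norm y * weight_field i y) x =
   weight_norm x * pd i (weight_field i) x +
   (lam * weight x) ^+ 3 * (2 * lam * (dist_field i x * dist_grad i x) * dist_norm x + dist_field i x * pd i dist_norm x).
  rewrite partialM; [|exact: (df weight_norm_smooth)|exact: (df (weight_field_smooth i))].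
  rewrite /weight_norm partialM; last exact: (df dist_norm_smooth); last first.
    by apply: differentiableM => //; exact: differentiable_cst.
  by rewrite partialZ // partialM // partial_weight // /weight_field; ring.
rewrite /zero_order_form /weight_mult; under eq_bigr do rewrite E.
rewrite big_split -!mulr_sumr /= big_split /= -mulr_suml -mulr_sumr -/(dist_norm x) /weight_norm.
by move: (\sum_k _) (\sum_i _) => *; ring.
Qed.

End weight.

Section carleman_estimate.
Context {R : realType} {n : nat}.
Variables (D : set 'rV[R]_n) (a : 'I_n -> 'I_n -> 'rV[R]_n -> R) (q : 'rV[R]_n) (L c0 : R).
Hypothesis oD : open D.
Hypothesis sa : forall i j, smooth_on D (a i j).
Hypothesis a_sym : forall i j x, D x -> a i j x = a j i x.
Hypothesis bD : box q L `<=` D.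
Hypothesis c0_gt0 : 0 < c0.
Hypothesis elliptic : forall x (xi : 'I_n -> R), box q L x ->
  c0 * \sum_i xi i ^+ 2 <= \sum_i (\sum_j a i j x * xi j) * xi i.

Let df f x : smooth_on D f -> D x -> differentiable f x.
Proof. by move=> sf; exact: smooth_differentiable. Qed.

(** First mu is chosen so that ellipticity absorbs the commutator form, then lam so that the term 2
    lam [dist_norm]^2 absorbs the rest of the zero-order form, including the loss caused by mu. The
    second step needs [dist_norm] bounded away from zero, hence the restriction to r2 <= dist2. *)
Lemma weight_positivity (r2 : R) : 0 < r2 -> exists lam mu kap : R,
  [/\ 0 < lam, 0 < kap & forall x, box q L x -> r2 <= dist2 q x ->
    (forall xi, kap * \sum_i xi i ^+ 2 <= first_order_form a q lam mu x xi) /\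
    kap <= zero_order_form a q lam mu x].
Proof.
move=> r2_gt0.
have [Ct Ct0 HCt] := box_bounded_fin bD (fun p : 'I_n * 'I_n => commutator_coef_smooth q oD sa p.1 p.2).
have sn := dist_norm_smooth q oD sa.
have snu : smooth_on D (fun x => \sum_i dist_field a q i x * pd i (dist_norm a q) x).
  apply: smooth_sum => // i; apply: smoothM => //; last exact: smooth_partial.
  exact: dist_field_smooth.
have [C1 C10 HC1] := box_bounded bD snu.
have [C2 C20 HC2] := box_bounded bD sn.
(* A lower bound of [dist_norm], since the Euclidean square of [dist_grad] is 4 dist2. *)
pose n0 := 4 * c0 * r2; have n0_gt0 : 0 < n0 by rewrite !mulr_gt0.
pose mu := (n%:R * Ct + 1) / c0.
have mu0 : 0 < mu by rewrite divr_gt0 // ltr_wpDl // mulr_ge0 // ltW.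
pose lam := (1 + C1 + mu * C2) / (2 * n0 ^+ 2).
have lam0 : 0 < lam by rewrite divr_gt0 ?mulr_gt0 ?exprn_gt0 // !addr_gt0 // mulr_gt0.
have lamE : 2 * lam * n0 ^+ 2 = 1 + C1 + mu * C2.
  by rewrite mulrAC mulrC divfK // gt_eqF // mulr_gt0 ?exprn_gt0.
pose w0 := expR (- lam * (n%:R * L ^+ 2)); have w0_gt0 : 0 < w0 by exact: expR_gt0.
pose k := lam * w0; have k0 : 0 < k by rewrite mulr_gt0.
exists lam, mu, (Num.min k (k ^+ 3)); split => //; first by rewrite lt_min k0 exprn_gt0.
move=> x bx rx; have Dx := bD bx.
have wx : k <= lam * weight q lam x.
  rewrite ler_pM2l // ler_expR !mulNr lerN2 ler_pM2l //; exact: dist2_box.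
have lw0 : 0 <= lam * weight q lam x by rewrite (le_trans (ltW k0)).
split => [xi|].
  set S := \sum_i _; have S0 : 0 <= S by apply: sumr_ge0 => i _; exact: sqr_ge0.
  rewrite (first_order_formE q oD sa a_sym) //.
  apply: (@le_trans _ _ (lam * weight q lam x * S)).
    by apply: ler_wpM2r => //; rewrite ge_min wx.
  apply: ler_wpM2l => //.
  have := @quadratic_bound R n (fun p r => commutator_coef a q p r x) Ct xi
    (fun p r => HCt (p, r) x bx).
  rewrite ler_norml -/S => /andP[+ _].
  have : 0 <= 2 * lam * (\sum_k dist_field a q k x * xi k) ^+ 2.
    exact: mulr_ge0 (mulr_ge0 (ler0n _ _) (ltW lam0)) (sqr_ge0 _).
  have : (n%:R * Ct + 1) * S <= mu * \sum_i (\sum_j a i j x * xi j) * xi i.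
    by rewrite /mu -mulrA ler_wpM2l ?addr_ge0 ?mulr_ge0 ?(ltW Ct0) // ler_pdivlMl // elliptic.
  move: (\sum_p _) (_ ^+ 2) (\sum_i _) => A B C; rewrite mulrDl mul1r; lra.
rewrite (zero_order_formE q oD sa) //.
apply: (@le_trans _ _ ((lam * weight q lam x) ^+ 3)).
  by rewrite ge_min; apply/orP; right; apply: lerXn2r => //; rewrite nnegrE ltW.
apply: ler_peMr; first by rewrite exprn_ge0.
have nx : n0 <= dist_norm a q x.
  have := elliptic (dist_grad q ^~ x) bx; apply: le_trans.
  have -> : \sum_i dist_grad q i x ^+ 2 = 4 * dist2 q x.
    by rewrite /dist2 mulr_sumr; apply: eq_bigr => i _; rewrite /dist_grad; ring.
  by rewrite mulrCA mulrA /n0 ler_pM2l // mulr_gt0.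
have nx2 : 2 * lam * n0 ^+ 2 <= 2 * lam * dist_norm a q x ^+ 2.
  have c2 : 0 <= 2 * lam by rewrite mulr_ge0 // ltW.
  apply: (ler_wpM2l c2); apply: lerXn2r => //; rewrite nnegrE; first exact: ltW.
  exact: le_trans (ltW n0_gt0) nx.
have := HC1 x bx; rewrite ler_norml => /andP[+ _].
have : mu * dist_norm a q x <= mu * C2.
  by rewrite ler_pM2l // (le_trans (ler_norm _) (HC2 x bx)).
move: nx2; rewrite lamE; move: (\sum_i _) (mu * _) (mu * _) (2 * lam * _) => A B C E; lra.
Qed.

Variables (lam mu kap r2 : R).
Hypothesis kap0 : 0 < kap.
Hypothesis pos : forall x, box q L x -> r2 <= dist2 q x ->
    (forall xi, kap * \sum_i xi i ^+ 2 <= first_order_form a q lam mu x xi) /\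
    kap <= zero_order_form a q lam mu x.

Local Notation w := (weight q lam).
Local Notation wb := (weight_field a q lam).
Local Notation wN := (weight_norm a q lam).
Local Notation wm := (weight_mult a q lam mu).
Let sw : smooth_on D w := weight_smooth q oD lam.
Let swb k : smooth_on D (wb k) := weight_field_smooth q oD sa lam k.
Let swN : smooth_on D wN := weight_norm_smooth q oD sa lam.
Let swm : smooth_on D wm := weight_mult_smooth q oD sa lam mu.

Definition conjugate (t : R) (z : 'rV[R]_n -> R) x : R := expR (t * w x) * z x.

Definition weighted_field t z := carleman_field a wb wN wm (conjugate t z) t.

Let sexp t : smooth_on D (fun x => expR (t * w x)).
Proof. by apply: smooth_expR => //; apply: smoothM => //; exact: smooth_cst. Qed.

Lemma conjugate_smooth t z : smooth_on D z -> smooth_on D (conjugate t z).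
Proof. by move=> sz; exact: smoothM. Qed.

Let pd_exp t i x : D x -> pd i (fun x => expR (t * w x)) x = t * pd i w x * expR (t * w x).
Proof.
move=> Dx; have dw : differentiable w x by exact: df.
have dtw : differentiable (fun y => t * w y) x.
  by apply: differentiableM => //; exact: differentiable_cst.
rewrite (@partial_comp1 _ _ expR _ _ (expR (t * w x))) // partialZ //; ring.
Qed.

Lemma partial_conjugate t z i x : smooth_on D z -> D x ->
  pd i (conjugate t z) x = expR (t * w x) * (pd i z x + t * pd i w x * z x).
Proof.
move=> sz Dx; rewrite /conjugate partialM; [|exact: df (sexp t) Dx|exact: df].
by rewrite pd_exp //; ring.
Qed.

Let partial2_conjugate t z i j x : smooth_on D z -> D x ->
  pd i (pd j (conjugate t z)) x = expR (t * w x) *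
    (pd i (pd j z) x + t * pd j w x * pd i z x + t * pd i w x * pd j z x
     + t * pd i (pd j w) x * z x + t ^+ 2 * pd i w x * pd j w x * z x).
Proof.
move=> sz Dx.
have spz := smooth_partial j sz; have spw := smooth_partial j sw.
have s1 : smooth_on D (fun y => t * pd j w y) by apply: smoothM => //; exact: smooth_cst.
have s2 : smooth_on D (fun y => t * pd j w y * z y) by exact: smoothM.
have s3 : smooth_on D (fun y => pd j z y + t * pd j w y * z y) by exact: smoothD.
rewrite (eq_on_partial i oD (g := fun y => expR (t * w y) * (pd j z y + t * pd j w y * z y))) //; last first.
  by move=> y Dy; exact: partial_conjugate.
rewrite partialM; [|exact: df (sexp t) Dx|exact: df s3 Dx].
rewrite pd_exp // partialD; [|exact: df spz Dx|exact: df s2 Dx].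
rewrite partialM; [|exact: df s1 Dx|exact: df sz Dx].
by rewrite partialZ; [ring|exact: df spw Dx].
Qed.

(** The two factors of [carleman_identity] add up to the conjugate of P, except for the zero-order
    term t (P w + m) z. That term costs only t^2 v^2 and is absorbed by the t^3 term. *)
Lemma conjugated_operator t z x : smooth_on D z -> D x ->
  (second_order a (conjugate t z) x + t ^+ 2 * wN x * conjugate t z x)
  + (- 2 * t * drift wb (conjugate t z) x + t * wm x * conjugate t z x) =
  expR (t * w x) * (second_order a z x + t * (second_order a w x + wm x) * z x).
Proof.
move=> sz Dx.
have E1 : drift wb (conjugate t z) x = expR (t * w x) * (drift wb z x + t * wN x * z x).
  rewrite (weight_normE a q oD) // mulr_sumr mulr_suml -big_split mulr_sumr.
  by apply: eq_bigr => k _ /=; rewrite partial_conjugate //; ring.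
have E2 : second_order a (conjugate t z) x = expR (t * w x) *
   (second_order a z x + 2 * t * drift wb z x + t * second_order a w x * z x + t ^+ 2 * wN x * z x).
  have -> : wN x = \sum_i \sum_j a i j x * pd i w x * pd j w x.
    rewrite (weight_normE a q oD) //; apply: eq_bigr => i _.
    by rewrite (weight_fieldE a q oD) // mulr_suml; apply: eq_bigr => j _; ring.
  have -> : 2 * t * drift wb z x = \sum_i \sum_j a i j x * (t * pd j w x * pd i z x + t * pd i w x * pd j z x).
    have D1 : drift wb z x = \sum_i \sum_j a i j x * (pd j w x * pd i z x).
      apply: eq_bigr => i _; rewrite (weight_fieldE a q oD) // mulr_suml.
      by apply: eq_bigr => j _; rewrite mulrA.
    have D2 : drift wb z x = \sum_i \sum_j a i j x * (pd i w x * pd j z x).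
      rewrite D1 exchange_big; apply: eq_bigr => i _; apply: eq_bigr => j _.
      by rewrite (a_sym j i Dx).
    rewrite mulrAC mulr2n mulrDl mul1r mulrDl {1}D1 D2 !mulr_suml -big_split.
    apply: eq_bigr => i _; rewrite !mulr_suml -big_split; apply: eq_bigr => j _ /=.
    ring.
  rewrite /second_order !(mulr_sumr, mulr_suml) -!big_split mulr_sumr.
  apply: eq_bigr => i _ /=; rewrite !(mulr_sumr, mulr_suml) -!big_split mulr_sumr.
  by apply: eq_bigr => j _ /=; rewrite partial2_conjugate //; ring.
rewrite E1 E2 /conjugate; move: (expR _) => e.
by move: (second_order _ _ _) (second_order _ _ _) (drift _ _ _) => *; ring.
Qed.

Lemma weighted_field_smooth t z i : smooth_on D z -> smooth_on D (weighted_field t z i).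
Proof. by move=> sz; apply: carleman_field_smooth => //; exact: conjugate_smooth. Qed.

Lemma weighted_field_eq0 t z i x : D x -> smooth_on D z -> z x = 0 -> (forall k, pd k z x = 0) ->
  weighted_field t z i x = 0.
Proof.
move=> Dx sz z0 dz0.
have v0 : conjugate t z x = 0 by rewrite /conjugate z0 mulr0.
have dv0 k : pd k (conjugate t z) x = 0.
  by rewrite partial_conjugate // dz0 z0 mulr0 addr0 mulr0.
have f0 k : flux a (conjugate t z) k x = 0 by apply: big1 => j _; rewrite dv0 mulr0.
have e0 : energy a (conjugate t z) x = 0 by apply: big1 => k _; rewrite dv0 mulr0.
by rewrite /weighted_field /carleman_field f0 e0 v0 !(mulr0, mul0r, addr0, subr0).
Qed.

(* [X Y <= ((X + Y) / 2) ^ 2], where [X + Y] is the conjugated operator. *)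
Lemma carleman_pointwise : exists2 C : R, 0 < C & forall t z x, 1 <= t -> smooth_on D z ->
  box q L x -> r2 <= dist2 q x ->
  \sum_i pd i (weighted_field t z i) x <=
  expR (t * w x) ^+ 2 * second_order a z x ^+ 2
  - t * kap / 2 * (\sum_i pd i (conjugate t z) x ^+ 2)
  + (C * t ^+ 2 - kap * t ^+ 3) * conjugate t z x ^+ 2.
Proof.
have sP : smooth_on D (fun x => second_order a w x + wm x).
  apply: smoothD => //; apply: smooth_sum => // i; apply: smooth_sum => // j.
  by apply: smoothM => //; apply: smooth_partial; exact: smooth_partial.
have [Cp Cp0 HCp] := box_bounded bD sP.
have sg j : smooth_on D (fun x => \sum_i pd i (fun y => wm y * a i j y) x).
  by apply: smooth_sum => // i; apply: smooth_partial; exact: smoothM.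
have [Cg Cg0 HCg] := box_bounded_fin bD sg.
(* From Young's inequality for the term t v G below: half of kap |dv|^2 is given up, and each of the
   n summands costs Cg^2 / (2 kap) v^2. *)
pose Cq := n%:R * (Cg ^+ 2 / (2 * kap)).
have Cq0 : 0 <= Cq by rewrite mulr_ge0 // divr_ge0 ?sqr_ge0 // mulr_ge0 // ltW.
exists (Cp ^+ 2 + Cq) => [|t z x t1 sz bx rx]; first by rewrite ltr_wpDr // exprn_gt0.
have Dx := bD bx; have sv := conjugate_smooth t sz.
have [p1 p0] := pos bx rx.
set v := conjugate t z.
have ID : (second_order a v x + t ^+ 2 * wN x * v x) * (- 2 * t * drift wb v x + t * wm x * v x) =
  \sum_i pd i (weighted_field t z i) x +
  (t * first_order_form a q lam mu x (fun i => pd i v x) +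
   t ^+ 3 * zero_order_form a q lam mu x * v x ^+ 2
   - t * v x * \sum_j (\sum_i pd i (fun y => wm y * a i j y) x) * pd j v x).
  exact: (carleman_identity oD sa a_sym t swb swN swm sv Dx).
have XY := conjugated_operator t sz Dx; rewrite -/v in XY.
have AG (X Y : R) : X * Y <= (X + Y) ^+ 2 / 4.
  by rewrite -subr_ge0 (_ : _ - _ = ((X - Y) / 2) ^+ 2) ?sqr_ge0 //; field.
have := AG (second_order a v x + t ^+ 2 * wN x * v x) (- 2 * t * drift wb v x + t * wm x * v x).
rewrite {}XY {}ID.
have t0 : 0 <= t by rewrite (le_trans ler01).
set P := second_order a z x; set p := second_order a w x + wm x; set e := expR _.
have vE : v x = e * z x by [].
have H1 : (e * (P + t * p * z x)) ^+ 2 / 4 <= e ^+ 2 * P ^+ 2 / 2 + t ^+ 2 * Cp ^+ 2 / 2 * v x ^+ 2.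
  have pC : p ^+ 2 <= Cp ^+ 2.
    rewrite -[leLHS]real_normK ?num_real // lerXn2r ?nnegrE ?(ltW Cp0) //; exact: HCp.
  have AM (u y : R) : (u + y) ^+ 2 / 4 <= u ^+ 2 / 2 + y ^+ 2 / 2.
    by have := sqr_ge0 (u - y); rewrite !expr2; lra.
  rewrite mulrDr (le_trans (AM _ _)) // -exprMn lerD2l vE.
  have -> : (e * (t * p * z x)) ^+ 2 / 2 = p ^+ 2 * ((t * (e * z x)) ^+ 2 / 2) by ring.
  have -> : t ^+ 2 * Cp ^+ 2 / 2 * (e * z x) ^+ 2 = Cp ^+ 2 * ((t * (e * z x)) ^+ 2 / 2) by ring.
  by apply: ler_wpM2r => //; rewrite divr_ge0 // sqr_ge0.
set S := \sum_i pd i v x ^+ 2.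
set G := \sum_j _ * pd j v x.
have H2 : `|v x * G| <= kap / 2 * S + Cq * v x ^+ 2.
  have -> : kap / 2 * S + Cq * v x ^+ 2 =
      \sum_(j < n) (kap / 2 * pd j v x ^+ 2 + Cg ^+ 2 / (2 * kap) * v x ^+ 2).
    by rewrite big_split /= -mulr_sumr sumr_const card_ord -[X in _ = _ + X]mulr_natl /Cq; congr (_ + _); exact: esym (mulrA _ _ _).
  rewrite mulr_sumr (le_trans (ler_norm_sum _ _ _)) //; apply: ler_sum => j _ /=.
  set g := \sum_i _; have gC : `|g| <= Cg := HCg j x bx.
  rewrite mulrCA [`|g * _|]normrM [`|v x * _|]normrM -[pd j v x ^+ 2]real_normK ?num_real // -[v x ^+ 2]real_normK ?num_real //.
  have gC2 : `|g| ^+ 2 <= Cg ^+ 2 by rewrite lerXn2r ?nnegrE // ltW.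
  move: (`|g|) (`|v x|) (`|pd j v x|) (normr_ge0 (v x)) gC2 => A B E B0 gC2.
  have E1 : A * (B * E) <= kap / 2 * E ^+ 2 + A ^+ 2 / (2 * kap) * B ^+ 2.
    have -> : kap / 2 * E ^+ 2 + A ^+ 2 / (2 * kap) * B ^+ 2 =
        A * (B * E) + (kap * E - A * B) ^+ 2 / (2 * kap).
      by field; rewrite lt0r_neq0.
    by rewrite lerDl divr_ge0 ?sqr_ge0 // mulr_ge0 // ltW.
  apply: (le_trans E1); rewrite lerD2l; apply: ler_wpM2r; first exact: sqr_ge0.
  by apply: ler_wpM2r => //; rewrite invr_ge0 mulr_ge0 // ltW.
have t2 : t <= t ^+ 2 by rewrite expr2 ler_peMr.
have T1 : t * (kap * S) <= t * first_order_form a q lam mu x (fun i => pd i v x).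
  by apply: ler_wpM2l => //; exact: p1.
have v2 : 0 <= v x ^+ 2 by exact: sqr_ge0.
have T2 : t ^+ 3 * kap * v x ^+ 2 <= t ^+ 3 * zero_order_form a q lam mu x * v x ^+ 2.
  by apply: ler_wpM2r => //; apply: ler_wpM2l => //; rewrite exprn_ge0.
have T3 : t * v x * G <= t * (kap / 2 * S) + t ^+ 2 * Cq * v x ^+ 2.
  rewrite -mulrA (le_trans (ler_wpM2l t0 (le_trans (ler_norm _) H2))) // mulrDr lerD2l.
  by rewrite -mulrA; apply: ler_wpM2r => //; rewrite mulr_ge0.
have T4 : 0 <= t ^+ 2 * Cp ^+ 2 / 2 * v x ^+ 2.
  by rewrite -exprMn mulr_ge0 // divr_ge0 // sqr_ge0.
have T5 : 0 <= e ^+ 2 * P ^+ 2 / 2 by rewrite -exprMn divr_ge0 // sqr_ge0.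
have -> : ((Cp ^+ 2 + Cq) * t ^+ 2 - kap * t ^+ 3) * v x ^+ 2 =
  2 * (t ^+ 2 * Cp ^+ 2 / 2 * v x ^+ 2) + t ^+ 2 * Cq * v x ^+ 2 - t ^+ 3 * kap * v x ^+ 2 by field.
have -> : t * kap / 2 * S = t * (kap / 2 * S) by ring.
have E3 : t * (kap * S) = 2 * (t * (kap / 2 * S)) by field.
move: H1 T1 T2 T3 T4 T5; rewrite E3.
move: (t * v x * G) (t * (kap / 2 * S)) (t ^+ 3 * kap * _) (t ^+ 2 * Cq * _) (t ^+ 2 * Cp ^+ 2 / 2 * _)
  (t ^+ 3 * zero_order_form _ _ _ _ _ * _) (t * first_order_form _ _ _ _ _ _) (e ^+ 2 * P ^+ 2)
  ((e * _) ^+ 2 / 4) (\sum_i pd i _ x).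
by move=> *; lra.
Qed.

End carleman_estimate.

(** * The Carleman argument on a box *)

Section vanishing.
Context {R : realType} {n : nat}.

Lemma box_norm (x y : 'rV[R]_n) (d : R) : 0 <= d -> box x d y -> `|x - y| <= d.
Proof.
move=> d0 b; rewrite /Num.Def.normr /= mx_normrE bigmax_le // => -[k l] _ /=.
by rewrite !mxE (ord1 k) distrC; exact: b.
Qed.

Lemma nbhs_box (x : 'rV[R]_n) (P : set 'rV[R]_n) : nbhs x P ->
  exists2 d : R, 0 < d & forall y, box x d y -> P y.
Proof.
move=> /nbhs_ballP[e /= e0 H]; exists (e / 2) => [|y b]; first by rewrite divr_gt0.
apply: H; rewrite -ball_normE /= (le_lt_trans (box_norm _ b)) ?divr_ge0 ?(ltW e0) //.
by rewrite ltr_pdivrMr // ltr_pMr // ltr1n.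
Qed.

(** K is large enough for the cell side 2 L / K to be less than d, and u is the cell that contains
    x0. *)
Lemma fine_cell (q x0 : 'rV[R]_n) (L d : R) : 0 < L -> 0 < d ->
  (forall i, `|x0 0 i - q 0 i| < L) -> exists K (u : 'I_n -> 'I_K), (0 < K)%N /\
  forall x : 'rV[R]_n, (forall i, 2 * L * (u i)%:R <= (x 0 i - q 0 i + L) * K%:R <= 2 * L * (u i).+1%:R) ->
  box x0 d x.
Proof.
move=> L0 d0 x0L.
pose K := (Num.bound (2 * L / d)).+1.
have KR : (0 : R) < K%:R by rewrite ltr0n.
have L2 : 0 < 2 * L by rewrite mulr_gt0.
have Kd : 2 * L < d * K%:R.
  rewrite -ltr_pdivrMl // mulrC (lt_trans (archi_boundP _)) ?divr_ge0 ?(ltW d0) ?(ltW L2) //.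
  by rewrite ltr_nat.
pose s i := (x0 0 i - q 0 i + L) * K%:R / (2 * L).
have s0 i : 0 <= s i.
  have := x0L i; rewrite ltr_norml => /andP[h1 h2].
  by rewrite divr_ge0 ?mulr_ge0 ?(ltW L2) //; lra.
have sK i : (Num.truncn (s i) < K)%N.
  rewrite truncn_lt_nat // ltr_pdivrMr // mulrC ltr_pM2l //.
  by have := x0L i; rewrite ltr_norml => /andP[h1 h2]; lra.
exists K, (fun i => Ordinal (sK i)); split => // x H i.
have /andP[h1 h2] := H i; have /andP[h3 h4] := truncn_itv (s0 i).
move: h1 h2 h3 h4; rewrite /= ler_pdivlMr // ltr_pdivrMr //; set N : R := (Num.truncn (s i))%:R => h1 h2.
rewrite -[(Num.truncn (s i)).+1]addn1 natrD -/N => h3 h4.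
move: h2; rewrite -[(Num.truncn (s i)).+1]addn1 natrD -/N => h2.
have : `|(x 0 i - x0 0 i) * K%:R| <= 2 * L.
  have E : (x 0 i - x0 0 i) * K%:R = (x 0 i - q 0 i + L) * K%:R - (x0 0 i - q 0 i + L) * K%:R by ring.
  rewrite E; move: (_ * K%:R) h1 h2 h3 h4 => A; move: ((x0 0 i - q 0 i + L) * K%:R) => B.
  have -> : 2 * L * (N + 1) = 2 * L * N + 2 * L by ring.
  have -> : (N + 1) * (2 * L) = 2 * L * N + 2 * L by ring.
  by rewrite [N * _]mulrC ler_norml; move: (2 * L * N) => *; lra.
rewrite normrM [`|K%:R|]gtr0_norm // => h5.
by rewrite ltW // -(ltr_pM2r KR) (le_lt_trans h5).
Qed.

Variables (D : set 'rV[R]_n) (a : 'I_n -> 'I_n -> 'rV[R]_n -> R) (q : 'rV[R]_n) (L c0 : R).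
Hypothesis oD : open D.
Hypothesis sa : forall i j, smooth_on D (a i j).
Hypothesis a_sym : forall i j x, D x -> a i j x = a j i x.
Hypothesis L0 : 0 < L.
Hypothesis bD : box q L `<=` D.
Hypothesis c0_gt0 : 0 < c0.
Hypothesis elliptic : forall x (xi : 'I_n -> R), box q L x ->
  c0 * \sum_i xi i ^+ 2 <= \sum_i (\sum_j a i j x * xi j) * xi i.

Variables (I : finType) (z : I -> 'rV[R]_n -> R) (r2 R1 C2 : R).
Hypothesis sz : forall al, smooth_on D (z al).
Hypothesis z_face : forall x, box q L x -> (exists i, `|x 0 i - q 0 i| = L) ->
  forall al, z al x = 0 /\ forall k, pd k (z al) x = 0.
Hypothesis r2_gt0 : 0 < r2.
Hypothesis z_core : forall x, D x -> dist2 q x < r2 -> forall al, z al x = 0.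
Hypothesis C2_ge0 : 0 <= C2.
Hypothesis z_ineq : forall x, box q L x -> dist2 q x <= R1 -> forall al,
  second_order a (z al) x ^+ 2 <= C2 * \sum_be (z be x ^+ 2 + \sum_i pd i (z be) x ^+ 2).

(** The fields [weighted_field] vanish on the faces of the box, so [box_divergence] applies to their
    sum. Where dist2 <= R1, their divergence is at most - e^(2 t w) |z|^2; beyond, it is at most C3
    e^(2 t w) with a smaller w. For large t a cell around x0 on which z is nonzero would outweigh
    all others. *)
Lemma carleman_vanish (x0 : 'rV[R]_n) : (forall i, `|x0 0 i - q 0 i| < L) -> dist2 q x0 < R1 ->
  forall al, z al x0 = 0.
Proof.
move=> x0L x0R al0; apply/eqP/negPn/negP => z0.
have [lam [mu [kap [lam0 kap0 pos]]]] := weight_positivity oD sa a_sym bD c0_gt0 elliptic r2_gt0.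
have [C C0 HC] := carleman_pointwise oD sa a_sym bD kap0 pos.
pose w := weight q lam.
have sw : smooth_on D w by exact: weight_smooth.
have [Cw Cw0 HCw] := box_bounded_fin bD (fun i => smooth_partial i sw).
have sP : smooth_on D (fun x => \sum_al second_order a (z al) x ^+ 2).
  apply: smooth_sum => // al; apply: (@smooth_eq _ _ _ oD (fun x => second_order a (z al) x * second_order a (z al) x)).
    by move=> y _; rewrite expr2.
  have s1 : smooth_on D (second_order a (z al)).
    apply: smooth_sum => // i; apply: smooth_sum => // j; apply: smoothM => //.
    by apply: smooth_partial; exact: smooth_partial.
  exact: smoothM.
have [C3 C30 HC3] := box_bounded bD sP.
pose A : R := #|I|%:R.
pose B1 := 1 + A * C2 + 2 * A * C2 * n%:R * Cw ^+ 2 + C.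
have A0 : 0 <= A by [].
have AC0 : 0 <= A * C2 by rewrite mulr_ge0.
have AC1 : 0 <= 2 * A * C2 * n%:R * Cw ^+ 2 by rewrite mulr_ge0 ?sqr_ge0 // !mulr_ge0.
have AC4 : 0 <= 4 * A * C2 by rewrite -mulrA mulr_ge0.
have B10 : 0 < B1 by rewrite /B1; lra.
have CB : C <= B1 + 4 * A * C2 by rewrite /B1; lra.
have AB : 4 * A * C2 <= B1 + 4 * A * C2 by rewrite lerDr ltW.
(* From t0 on, kap t^3 V and t kap / 2 S dominate C t^2 V and everything that [z_ineq] contributes
   when z is expressed by the conjugated functions. *)
pose t0 := 1 + (B1 + 4 * A * C2) / kap.
have t01 : 1 <= t0 by rewrite lerDl divr_ge0 ?(ltW kap0) // addr_ge0 ?(ltW B10) // -mulrA mulr_ge0.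
pose F t i x := \sum_al weighted_field a q lam mu t (z al) i x.
have swf t al i : smooth_on D (weighted_field a q lam mu t (z al) i) by exact: weighted_field_smooth.
have sF t i : smooth_on D (F t i) by apply: smooth_sum.
have divF t x : D x -> \sum_i pd i (F t i) x = \sum_al \sum_i pd i (weighted_field a q lam mu t (z al) i) x.
  move=> Dx; rewrite [RHS]exchange_big; apply: eq_bigr => i _.
  by rewrite /F partial_sum // => al; exact: smooth_differentiable (swf t al i) Dx.
pose zz x := \sum_al z al x ^+ 2.
have zz0 x : 0 <= zz x by apply: sumr_ge0 => al _; exact: sqr_ge0.
(* The pointwise estimate is available only for r2 <= dist2; nearer to q all fields vanish
   identically. *)
have core t x : box q L x -> dist2 q x < r2 -> \sum_i pd i (F t i) x = 0 /\ zz x = 0.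
  move=> bx rx; have Dx := bD bx; split; last first.
    by apply: big1 => al _; rewrite z_core // expr0n.
  pose U := [set y | D y /\ dist2 q y < r2].
  have oU : open U.
    have sd := dist2_smooth q oD.
    rewrite openE => y [Dy ry]; have cd : {for y, continuous (dist2 q)}.
      by apply: differentiable_continuous; exact: smooth_differentiable sd Dy.
    have h1 : \forall w \near y, D w by exact: open_nbhs_nbhs.
    have h2 : \forall w \near y, dist2 q w < r2.
      by apply: (cd [set s | s < r2]); apply: open_nbhs_nbhs; split => //; exact: open_lt.
    by apply: filterS2 h1 h2.
  have UD : U `<=` D by move=> y [].
  have U0 al y : U y -> z al y = 0 by move=> [Dy ry]; exact: z_core.
  have dU al y k : U y -> pd k (z al) y = 0.
    by move=> Uy; rewrite (eq_on_partial k oU (U0 al) Uy) partial_cst.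
  rewrite big1 // => i _; rewrite (eq_on_partial i oU (g := fun=> 0)) ?partial_cst // => y Uy.
  apply: big1 => al _; apply: (weighted_field_eq0 a q oD) => //; [exact: UD|exact: U0|move=> k; exact: dU].
have bound t x : t0 <= t -> box q L x -> (dist2 q x <= R1 -> \sum_i pd i (F t i) x <= - (expR (t * w x) ^+ 2 * zz x))
   /\ \sum_i pd i (F t i) x <= C3 * expR (t * w x) ^+ 2.
  move=> tt0 bx; have Dx := bD bx.
  have [rx|rx] := ltP (dist2 q x) r2.
    have [-> ->] := core t x bx rx; rewrite mulr0 oppr0; split => //.
    by rewrite mulr_ge0 ?sqr_ge0 // ltW.
  have t1 : 1 <= t by rewrite (le_trans t01).
  have tp : 0 < t by rewrite (lt_le_trans ltr01).
  set e := expR (t * w x).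
  pose V := \sum_al conjugate q lam t (z al) x ^+ 2.
  pose S := \sum_al \sum_i pd i (conjugate q lam t (z al)) x ^+ 2.
  have VE : V = e ^+ 2 * zz x.
    by rewrite /V /zz mulr_sumr; apply: eq_bigr => al _; rewrite /conjugate exprMn.
  have V0 : 0 <= V by rewrite VE mulr_ge0 // sqr_ge0.
  have S0 : 0 <= S by apply: sumr_ge0 => al _; apply: sumr_ge0 => i _; exact: sqr_ge0.
  have main : \sum_i pd i (F t i) x <= e ^+ 2 * (\sum_al second_order a (z al) x ^+ 2)
      - t * kap / 2 * S + (C * t ^+ 2 - kap * t ^+ 3) * V.
    rewrite divF // /S /V !mulr_sumr -sumrN -!big_split; apply: ler_sum => al _ /=.
    exact: HC.
  have t2 : 1 <= t ^+ 2 by rewrite expr_ge1 // ltW.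
  have tk : B1 + 4 * A * C2 <= kap * t.
    by rewrite [kap * t]mulrC -ler_pdivrMr // (le_trans _ tt0) // /t0 lerDr.
  have kt3 : (B1 + 4 * A * C2) * t ^+ 2 <= kap * t ^+ 3.
    by rewrite [t ^+ 3]exprS [kap * (t * _)]mulrA ler_wpM2r // sqr_ge0.
  have g0 : 0 <= t * kap / 2 * S by rewrite !mulr_ge0 ?(ltW tp) ?(ltW kap0) // invr_ge0.
  split => [xR|]; last first.
    apply: (le_trans main); have : e ^+ 2 * (\sum_al second_order a (z al) x ^+ 2) <= C3 * e ^+ 2.
      by rewrite mulrC ler_wpM2r ?sqr_ge0 // (le_trans (ler_norm _)) // HC3.
    have : (C * t ^+ 2 - kap * t ^+ 3) * V <= 0.
      by rewrite mulr_le0_ge0 // subr_le0 (le_trans _ kt3) // ler_wpM2r ?sqr_ge0.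
    by move: (_ * V) (t * kap / 2 * S) g0 (e ^+ 2 * _) (C3 * _) => *; lra.
  rewrite -VE; apply: (le_trans main).
  have grad : e ^+ 2 * (\sum_al second_order a (z al) x ^+ 2) <=
      A * C2 * (V + 2 * S + 2 * n%:R * Cw ^+ 2 * t ^+ 2 * V).
    have e1 al : e ^+ 2 * second_order a (z al) x ^+ 2 <= C2 * (V + 2 * S + 2 * n%:R * Cw ^+ 2 * t ^+ 2 * V).
      apply: (le_trans (ler_wpM2l (sqr_ge0 e) (z_ineq bx xR al))).
      rewrite mulrCA; apply: ler_wpM2l => //.
      rewrite /V /S -addrA addrC -addrA [X in _ <= X + _]mulr_sumr [X in _ <= _ + (X + _)]mulr_sumr -!big_split mulr_sumr.
      apply: ler_sum => be _ /=.
      have -> : 2 * (\sum_i pd i (conjugate q lam t (z be)) x ^+ 2) +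
          (2 * n%:R * Cw ^+ 2 * t ^+ 2 * conjugate q lam t (z be) x ^+ 2 + conjugate q lam t (z be) x ^+ 2) =
          conjugate q lam t (z be) x ^+ 2 + \sum_(i < n) (2 * pd i (conjugate q lam t (z be)) x ^+ 2
             + 2 * Cw ^+ 2 * t ^+ 2 * conjugate q lam t (z be) x ^+ 2).
        rewrite big_split /= -mulr_sumr sumr_const card_ord -[X in _ = _ + (_ + X)]mulr_natl; ring.
      rewrite mulrDr /conjugate exprMn lerD2l mulr_sumr; apply: ler_sum => i _.
      rewrite (partial_conjugate q oD) // -/w -/e.
      set p := pd i (z be) x; set ww := pd i w x; set y := z be x.
      have pw : ww ^+ 2 <= Cw ^+ 2.
        by rewrite -[leLHS]real_normK ?num_real // lerXn2r ?nnegrE ?(ltW Cw0) //; exact: HCw.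
      have : 2 * ww ^+ 2 * t ^+ 2 * (e ^+ 2 * y ^+ 2) <= 2 * Cw ^+ 2 * t ^+ 2 * (e ^+ 2 * y ^+ 2).
        have Y0 : 0 <= 2 * (t * (e * y)) ^+ 2 by rewrite mulr_ge0 ?sqr_ge0.
        have E c : 2 * c * t ^+ 2 * (e ^+ 2 * y ^+ 2) = c * (2 * (t * (e * y)) ^+ 2) by ring.
        by rewrite !E; exact: ler_wpM2r Y0 _ _ pw.
      have : 0 <= (e * p + 2 * (e * (t * ww * y))) ^+ 2 by exact: sqr_ge0.
      have -> : (e * (p + t * ww * y)) ^+ 2 = (e * p) ^+ 2 + 2 * (e * p) * (e * (t * ww * y)) + (e * (t * ww * y)) ^+ 2 by ring.
      have -> : 2 * ww ^+ 2 * t ^+ 2 * (e ^+ 2 * y ^+ 2) = 2 * (e * (t * ww * y)) ^+ 2 by ring.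
      rewrite -[e ^+ 2 * p ^+ 2]exprMn; move: (e * (t * ww * y)) (e * p) (_ * (e ^+ 2 * y ^+ 2)).
      by move=> Y P Z; rewrite !expr2; lra.
    rewrite mulr_sumr; apply: (le_trans (ler_sum _ (fun al _ => e1 al))).
    by rewrite sumr_const -[X in X <= _]mulr_natl -/A mulrA.
  have h1 : 2 * A * C2 * S <= t * kap / 2 * S.
    apply: ler_wpM2r => //; rewrite ler_pdivlMr // [t * kap]mulrC.
    by rewrite (le_trans _ tk) // (le_trans _ AB) // -!mulrA; lra.
  have h2 : A * C2 * V <= A * C2 * t ^+ 2 * V by apply: ler_wpM2r => //; rewrite ler_peMr.
  have h3 : V <= t ^+ 2 * V by rewrite ler_peMl.
  have h4 : (B1 + 4 * A * C2) * t ^+ 2 * V <= kap * t ^+ 3 * V by exact: ler_wpM2r.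
  have h5 : 0 <= 4 * A * C2 * t ^+ 2 * V by do 2 (rewrite mulr_ge0 ?sqr_ge0 //); rewrite !mulr_ge0.
  apply: (le_trans (lerD (lerB grad (lexx _)) (lexx _))).
  have -> : A * C2 * (V + 2 * S + 2 * n%:R * Cw ^+ 2 * t ^+ 2 * V) =
    A * C2 * V + 2 * A * C2 * S + 2 * A * C2 * n%:R * Cw ^+ 2 * (t ^+ 2 * V) by ring.
  move: h4; have -> : (B1 + 4 * A * C2) * t ^+ 2 * V = t ^+ 2 * V + A * C2 * t ^+ 2 * V
     + 2 * A * C2 * n%:R * Cw ^+ 2 * (t ^+ 2 * V) + C * t ^+ 2 * V + 4 * A * C2 * t ^+ 2 * V by rewrite /B1; ring.
  rewrite mulrBl; move: h1 h2 h3 h5.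
  by move: (_ * V) (_ * V) (_ * V) (_ * V) (_ * V) (_ * S) (_ * S) (_ * (t ^+ 2 * V)) => *; lra.
have szz : smooth_on D zz.
  apply: smooth_sum => // al; apply: (@smooth_eq _ _ _ oD (fun x => z al x * z al x)).
    by move=> y _; rewrite expr2.
  exact: smoothM.
have zx0 : 0 < zz x0.
  have : 0 < z al0 x0 ^+ 2 by rewrite lt_def sqr_ge0 sqrf_eq0 z0.
  move/lt_le_trans; apply; rewrite /zz (bigD1 al0) //= lerDl.
  by apply: sumr_ge0 => al _; exact: sqr_ge0.
have bx0 : box q L x0 by move=> i; exact: ltW.
have Dx0 := bD bx0.
(* Strictly between dist2 q x0 and R1: the difference [Del] of the weights at R0 and R1 provides the
   exponential gain. *)
pose R0 := (dist2 q x0 + R1) / 2.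
have R0l : dist2 q x0 < R0 by rewrite /R0; lra.
have R0R : R0 < R1 by rewrite /R0; lra.
have [d d0 Hd] : exists2 d : R, 0 < d & forall y, box x0 d y -> zz x0 / 2 < zz y /\ dist2 q y < R0.
  apply: nbhs_box.
  have cz : {for x0, continuous zz}.
    by apply: differentiable_continuous; exact: smooth_differentiable szz Dx0.
  have cd : {for x0, continuous (dist2 q)}.
    by apply: differentiable_continuous; exact: smooth_differentiable (dist2_smooth q oD) Dx0.
  apply: filterI.
    apply: (cz [set s | zz x0 / 2 < s]); apply: open_nbhs_nbhs; split; first exact: open_gt.
    by rewrite /= ltr_pdivrMr // ltr_pMr // ltr1n.
  by apply: (cd [set s | s < R0]); apply: open_nbhs_nbhs; split => //; exact: open_lt.
have [K [u [K0 Hu]]] := fine_cell L0 d0 x0L.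
pose p1 := expR (- lam * R1); pose p0 := expR (- lam * R0).
have p01 : p1 < p0 by rewrite ltr_expR !mulNr ltrN2 ltr_pM2l.
pose Del := p0 - p1; have Del0 : 0 < Del by rewrite subr_gt0.
pose M := C3 * (K ^ n)%:R; have M0 : 0 <= M by rewrite mulr_ge0 // ltW.
pose h := zz x0 / 2; have h0 : 0 < h by rewrite divr_gt0.
(* As 1 + 2 t Del <= e^(2 t Del), this t makes e^(2 t Del) h exceed M, against [key]. *)
pose t := t0 + M / (2 * Del * h).
have tt0 : t0 <= t by rewrite lerDl divr_ge0 // !mulr_ge0 // ltW.
have tp : 0 < t by rewrite (lt_le_trans _ tt0) // (lt_le_trans ltr01).
have [B2 B3] : (forall x, box q L x -> dist2 q x <= R1 ->
      \sum_i pd i (F t i) x <= - (expR (t * w x) ^+ 2 * zz x)) /\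
    (forall x, box q L x -> \sum_i pd i (F t i) x <= C3 * expR (t * w x) ^+ 2).
  by split => x bx; have [] := bound t x tt0 bx.
have e2 (s s' : R) : s <= s' -> expR (t * s) ^+ 2 <= expR (t * s') ^+ 2.
  by move=> ss; rewrite lerXn2r ?nnegrE ?expR_ge0 // ler_expR ler_pM2l.
have key : expR (t * p0) ^+ 2 * h <= C3 * expR (t * p1) ^+ 2 * (K ^ n)%:R.
  apply: (@box_divergence _ _ D (F t) q L _ _ K u) => //.
  - move=> i x bx xi; apply: big1 => al _.
    have [za dza] := z_face bx (ex_intro _ i xi) al.
    by apply: (weighted_field_eq0 a q oD) => //; exact: bD.
  - by rewrite mulr_ge0 ?sqr_ge0 // ltW.
  - by rewrite mulr_ge0 ?sqr_ge0 // ltW.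
  - move=> x bx; have [xR|xR] := leP (dist2 q x) R1.
      apply: (le_trans (B2 x bx xR)); apply: (@le_trans _ _ 0).
        by rewrite oppr_le0 mulr_ge0 ?sqr_ge0.
      by rewrite mulr_ge0 ?sqr_ge0 // ltW.
    apply: (le_trans (B3 x bx)); rewrite ler_pM2l //; apply: e2.
    by rewrite ler_expR !mulNr lerN2 ler_pM2l // ltW.
  - move=> x bx Hx; have [zx dx] := Hd x (Hu x Hx).
    apply: (le_trans (B2 x bx (ltW (lt_trans dx R0R)))); rewrite lerN2.
    apply: ler_pM; rewrite ?sqr_ge0 ?(ltW h0) ?(ltW zx) //; apply: e2.
    by rewrite ler_expR !mulNr lerN2 ler_pM2l // ltW.
have E0 : expR (t * p0) ^+ 2 = expR (t * p1) ^+ 2 * expR (2 * t * Del).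
  by rewrite !expr2 -!expRD; congr expR; rewrite /Del; ring.
have Q0 : 0 < expR (t * p1) ^+ 2 by rewrite exprn_gt0 // expR_gt0.
have : expR (t * p1) ^+ 2 * (expR (2 * t * Del) * h) <= expR (t * p1) ^+ 2 * M.
  by rewrite mulrA -E0 (le_trans key) // /M le_eqVlt; apply/orP; left; apply/eqP; ring.
rewrite (ler_pM2l Q0); apply/negP; rewrite -ltNge.
have : (1 + 2 * t * Del) * h <= expR (2 * t * Del) * h.
  by rewrite ler_pM2r // expR_ge1Dx.
apply: lt_le_trans; rewrite mulrDl mul1r.
have -> : 2 * t * Del * h = 2 * t0 * Del * h + M.
  rewrite /t; field; rewrite !gt_eqF //.
have : 0 <= 2 * t0 * Del * h by rewrite !mulr_ge0 ?(ltW h0) ?(ltW Del0) // (le_trans ler01).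
lra.
Qed.

End vanishing.

Lemma sqr_sum_le (R : realType) (J : finType) (y : J -> R) :
  (\sum_p y p) ^+ 2 <= #|J|%:R * \sum_p y p ^+ 2.
Proof.
rewrite expr2 mulr_suml; apply: (@le_trans _ _ (\sum_p \sum_q (y p ^+ 2 + y q ^+ 2) / 2)).
  apply: ler_sum => p _; rewrite mulr_sumr; apply: ler_sum => q _.
  by have := sqr_ge0 (y p - y q); rewrite !expr2; lra.
have -> : \sum_p \sum_q (y p ^+ 2 + y q ^+ 2) / 2 =
    (\sum_p \sum_(q : J) y p ^+ 2 + \sum_(p : J) \sum_q y q ^+ 2) / 2.
  rewrite -big_split mulr_suml; apply: eq_bigr => p _ /=.
  by rewrite -big_split mulr_suml.
under eq_bigr do rewrite sumr_const.
rewrite sumr_const sumrMnl; move: (\sum_p y p ^+ 2) => S.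
by rewrite -[S *+ _]mulr_natl le_eqVlt; apply/orP; left; apply/eqP; field.
Qed.

Section unique_continuation.
Context {R : realType} {n : nat}.
Variables (D : set 'rV[R]_n) (a : 'I_n -> 'I_n -> 'rV[R]_n -> R) (q : 'rV[R]_n) (L c0 : R).
Hypothesis oD : open D.
Hypothesis sa : forall i j, smooth_on D (a i j).
Hypothesis a_sym : forall i j x, D x -> a i j x = a j i x.
Hypothesis L0 : 0 < L.
Hypothesis bD : box q L `<=` D.
Hypothesis c0_gt0 : 0 < c0.
Hypothesis elliptic : forall x (xi : 'I_n -> R), box q L x ->
  c0 * \sum_i xi i ^+ 2 <= \sum_i (\sum_j a i j x * xi j) * xi i.

Variables (I : finType) (e : I -> 'rV[R]_n -> R) (r2 C1 : R).
Hypothesis se : forall al, smooth_on D (e al).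
Hypothesis r2_gt0 : 0 < r2.
Hypothesis e_core : forall x, D x -> dist2 q x < r2 -> forall al, e al x = 0.
Hypothesis C1_ge0 : 0 <= C1.

Definition jet_norm (f : I -> 'rV[R]_n -> R) x : R :=
  \sum_be (`|f be x| + \sum_i `|pd i (f be) x|).

Hypothesis e_ineq : forall x, box q L x -> forall al,
  `|second_order a (e al) x| <= C1 * jet_norm e x.

(** A polynomial cutoff: rho vanishes on the faces of the box, so chi = rho^2 vanishes there
    together with its first derivatives. Where dist2 <= R1 < L^2, chi is bounded below, so that z =
    chi e controls e. *)
Let rho (x : 'rV[R]_n) : R := \prod_i (L ^+ 2 - (x 0 i - q 0 i) * (x 0 i - q 0 i)).
Let chi x : R := rho x * rho x.
Let z al x : R := chi x * e al x.

Let srho : smooth_on D rho.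
Proof.
apply: smooth_prod => // i; apply: smoothB => //; first exact: smooth_cst.
by apply: smoothM => //; apply: smoothB => //; (exact: smooth_coord || exact: smooth_cst).
Qed.

Let schi : smooth_on D chi. Proof. exact: smoothM. Qed.
Let sz al : smooth_on D (z al). Proof. exact: smoothM. Qed.

Let df f x : smooth_on D f -> D x -> differentiable f x.
Proof. by move=> sf; exact: smooth_differentiable. Qed.

Let pd_z i al x : D x -> pd i (z al) x = pd i chi x * e al x + chi x * pd i (e al) x.
Proof. by move=> Dx; rewrite /z partialM //; exact: df. Qed.

Let rho_face (x : 'rV[R]_n) i : `|x 0 i - q 0 i| = L -> rho x = 0.
Proof.
move=> xi; rewrite /rho (bigD1 i) //= -[X in L ^+ 2 - X]expr2.
by rewrite -[(_ - _) ^+ 2]real_normK ?num_real // xi subrr mul0r.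
Qed.

Let second_order_z al x : D x -> second_order a (z al) x =
  second_order a chi x * e al x + \sum_i (\sum_j (a i j x + a j i x) * pd j chi x) * pd i (e al) x
  + chi x * second_order a (e al) x.
Proof.
move=> Dx.
have pp i j : pd i (pd j (z al)) x = pd i (pd j chi) x * e al x + pd j chi x * pd i (e al) x
    + (pd i chi x * pd j (e al) x + chi x * pd i (pd j (e al)) x).
  have spc := smooth_partial j schi; have spe := smooth_partial j (se al).
  have s1 : smooth_on D (fun y => pd j chi y * e al y) by exact: smoothM.
  have s2 : smooth_on D (fun y => chi y * pd j (e al) y) by exact: smoothM.
  rewrite (eq_on_partial i oD (fun y Dy => pd_z j al Dy) Dx).
  rewrite partialD; [|exact: df s1 Dx|exact: df s2 Dx].
  rewrite partialM; [|exact: df spc Dx|exact: df (se al) Dx].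
  by rewrite partialM; [|exact: df schi Dx|exact: df spe Dx].
have E : \sum_i (\sum_j (a i j x + a j i x) * pd j chi x) * pd i (e al) x =
   \sum_i \sum_j a i j x * (pd j chi x * pd i (e al) x) + \sum_i \sum_j a i j x * (pd i chi x * pd j (e al) x).
  rewrite [X in _ = _ + X]exchange_big -big_split; apply: eq_bigr => i _ /=.
  rewrite -big_split mulr_suml; apply: eq_bigr => j _ /=; ring.
rewrite E /second_order mulr_suml mulr_sumr -!big_split; apply: eq_bigr => i _ /=.
rewrite mulr_suml mulr_sumr -!big_split; apply: eq_bigr => j _ /=.
by rewrite pp; ring.
Qed.

Let jet_ge al x : `|e al x| <= jet_norm e x /\ forall i, `|pd i (e al) x| <= jet_norm e x.
Proof.
have s0 be : 0 <= \sum_i `|pd i (e be) x| by apply: sumr_ge0.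
have S : `|e al x| + \sum_i `|pd i (e al) x| <= jet_norm e x.
  by rewrite /jet_norm (bigD1 al) //= lerDl; apply: sumr_ge0 => be _; rewrite addr_ge0.
split => [|i]; first by apply: le_trans S; rewrite lerDl.
apply: le_trans S; rewrite (bigD1 i) //= addrCA lerDl addr_ge0 //; exact: sumr_ge0.
Qed.

Theorem unique_continuation x0 : dist2 q x0 < L ^+ 2 -> forall al, e al x0 = 0.
Proof.
move=> x0L.
have L2 (x : 'rV[R]_n) i : dist2 q x < L ^+ 2 -> `|x 0 i - q 0 i| < L.
  move=> xL; rewrite -(ltr_pXn2r (_ : (0 < 2)%N)) ?nnegrE ?(ltW L0) //.
  by rewrite real_normK ?num_real // (le_lt_trans (dist2_coord q x i)).
pose R1 := (dist2 q x0 + L ^+ 2) / 2.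
have R1L : R1 < L ^+ 2 by rewrite /R1; lra.
have R1x : dist2 q x0 < R1 by rewrite /R1; lra.
pose g := L ^+ 2 - R1; have g0 : 0 < g by rewrite subr_gt0.
(* A lower bound of chi where dist2 <= R1, since each of the n factors of rho is at least g
   there. *)
pose k := g ^+ n * g ^+ n; have k0 : 0 < k by rewrite mulr_gt0 // exprn_gt0.
have chik (x : 'rV[R]_n) : dist2 q x <= R1 -> k <= chi x.
  move=> xR; have gn : 0 <= g ^+ n by rewrite exprn_ge0 // ltW.
  have : g ^+ n <= rho x.
    rewrite /rho -[X in g ^+ X]card_ord -prodr_const; apply: ler_prod => i _.
    rewrite (ltW g0) /= /g lerB // -expr2 (le_trans (dist2_coord q x i)) //.
  by move=> H; rewrite /k /chi ler_pM.
have sP : smooth_on D (second_order a chi).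
  apply: smooth_sum => // i; apply: smooth_sum => // j; apply: smoothM => //.
  by apply: smooth_partial; exact: smooth_partial.
have sd i : smooth_on D (fun x => \sum_j (a i j x + a j i x) * pd j chi x).
  apply: smooth_sum => // j; apply: smoothM => //; first exact: smoothD.
  exact: smooth_partial.
have [Cc Cc0 HCc] := box_bounded bD schi.
have [CP CP0 HCP] := box_bounded bD sP.
have [Cd Cd0 HCd] := box_bounded_fin bD sd.
have [C' C'0 HC'] := box_bounded_fin bD (fun i => smooth_partial i schi).
pose C4 := CP + n%:R * Cd + Cc * C1.
have C40 : 0 <= C4 by rewrite !addr_ge0 ?mulr_ge0 // ltW.
have jet0 f x : 0 <= jet_norm f x.
  by apply: sumr_ge0 => be _; rewrite addr_ge0 //; exact: sumr_ge0.
(* On the whole box the operator applied to z is bounded by the jet of e. The passage to the jet of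
   z, by [ez], is possible only where dist2 <= R1. *)
have Pz x al : box q L x -> `|second_order a (z al) x| <= C4 * jet_norm e x.
  move=> bx; have Dx := bD bx; rewrite second_order_z //; have [j0 j1] := jet_ge al x.
  rewrite /C4 !mulrDl; apply: (le_trans (ler_normD _ _)); apply: lerD.
    apply: (le_trans (ler_normD _ _)); apply: lerD.
      by rewrite normrM ler_pM // HCP.
    apply: (le_trans (ler_norm_sum _ _ _)).
    rewrite -mulrA mulr_natl -[X in _ *+ X]card_ord -sumr_const; apply: ler_sum => i _.
    by rewrite normrM ler_pM //; exact: HCd.
  by rewrite normrM -mulrA ler_pM // ?HCc // e_ineq.
pose C5 := 1 + n%:R * C' / k.
have C'k : 0 <= n%:R * C' / k by apply: divr_ge0; [apply: mulr_ge0 => //; exact: ltW|exact: ltW].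
have C50 : 0 <= C5 by exact: addr_ge0.
have C45 : 0 <= C4 * C5 / k by apply: divr_ge0; [exact: mulr_ge0|exact: ltW].
have ez x : box q L x -> dist2 q x <= R1 -> k * jet_norm e x <= C5 * jet_norm z x.
  move=> bx xR; have Dx := bD bx; have kx := chik x xR.
  have c0' : 0 < chi x by rewrite (lt_le_trans k0).
  rewrite /jet_norm !mulr_sumr; apply: ler_sum => be _.
  have h0 : k * `|e be x| <= `|z be x|.
    by rewrite /z normrM ler_wpM2r // gtr0_norm.
  have h1 i : k * `|pd i (e be) x| <= `|pd i (z be) x| + C' / k * `|z be x|.
    have : chi x * pd i (e be) x = pd i (z be) x - pd i chi x * e be x.
      by rewrite pd_z // addrC addKr.
    move/(congr1 (fun s => `|s|)); rewrite normrM gtr0_norm // => E.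
    apply: (@le_trans _ _ (chi x * `|pd i (e be) x|)); first by rewrite ler_wpM2r.
    rewrite E (le_trans (ler_normB _ _)) // lerD2l normrM -mulrA ler_pM // ?HC' //.
    by rewrite ler_pdivlMl.
  rewrite /C5 mulrDr mulrDl mul1r mulr_sumr.
  have h2 : \sum_i k * `|pd i (e be) x| <= \sum_i `|pd i (z be) x| + n%:R * C' / k * `|z be x|.
    rewrite -!mulrA mulr_natl -[X in _ *+ X]card_ord -sumr_const -big_split.
    by apply: ler_sum => i _ /=; rewrite mulrA.
  have h3 : 0 <= n%:R * C' / k * \sum_i `|pd i (z be) x|.
    by apply: mulr_ge0 => //; exact: sumr_ge0.
  by apply: (le_trans (lerD h0 h2)); rewrite addrA lerD2l mulrDr lerDl.
pose A : R := #|I|%:R.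
(* The factors A and 2 (n + 1) come from Cauchy-Schwarz, which passes from the square of the sum
   [jet_norm] to a sum of squares. *)
pose C2 := (C4 * C5 / k) ^+ 2 * (A * (2 * (n%:R + 1))).
have C20 : 0 <= C2 by rewrite mulr_ge0 ?sqr_ge0 // !mulr_ge0 // addr_ge0.
have zx0 : forall al, z al x0 = 0.
  apply: (@carleman_vanish R n D a q L c0 oD sa a_sym L0 bD c0_gt0 elliptic I z r2 R1 C2) => //.
  - move=> x bx [i xi] al; have Dx := bD bx; have r0 := rho_face xi.
    split => [|j]; first by rewrite /z /chi r0 !mul0r.
    by rewrite pd_z // /chi r0 partialM ?r0 ?mul0r ?mulr0 ?addr0 ?mul0r //; exact: df.
  - by move=> x Dx xr al; rewrite /z e_core // mulr0.
  - move=> x bx xR al; rewrite -[leLHS]real_normK ?num_real //.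
    have h : `|second_order a (z al) x| <= C4 * C5 / k * jet_norm z x.
      apply: (le_trans (Pz x al bx)); rewrite -!mulrA ler_wpM2l // mulrCA mulrC.
      by rewrite ler_pdivlMr // mulrC; exact: ez.
    have h2 : `|second_order a (z al) x| ^+ 2 <= (C4 * C5 / k * jet_norm z x) ^+ 2.
      by apply: lerXn2r => //; rewrite nnegrE; exact: mulr_ge0.
    apply: (le_trans h2); rewrite exprMn /C2.
    move: ((C4 * C5 / k) ^+ 2) (sqr_ge0 (C4 * C5 / k)) => Q Q0.
    rewrite -[leRHS]mulrA; apply: ler_wpM2l => //.
    apply: (le_trans (sqr_sum_le _)); rewrite -/A -[leRHS]mulrA ler_wpM2l // mulr_sumr.
    apply: ler_sum => be _.
    have := @sqr_sum_le R 'I_n (fun i => `|pd i (z be) x|).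
    under [X in _ * X]eq_bigr do rewrite real_normK ?num_real //.
    rewrite card_ord; set S := \sum_i `|_|; set T := \sum_i _ ^+ 2 => ST.
    have T0 : 0 <= T by apply: sumr_ge0 => i _; exact: sqr_ge0.
    have n0 : (0 : R) <= n%:R by [].
    have nz : 0 <= n%:R * `|z be x| ^+ 2 by rewrite mulr_ge0 ?sqr_ge0.
    rewrite -[z be x ^+ 2]real_normK ?num_real //.
    have := sqr_ge0 (`|z be x| - S).
    have -> : 2 * (n%:R + 1) * (`|z be x| ^+ 2 + T) =
      2 * (n%:R * `|z be x| ^+ 2) + 2 * `|z be x| ^+ 2 + 2 * (n%:R * T) + 2 * T by ring.
    move: ST nz T0; move: (n%:R * T) (n%:R * _) => U W; rewrite !expr2; lra.
  - by move=> i; exact: L2.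
move=> al; have /eqP := zx0 al; rewrite /z mulf_eq0 => /orP[|/eqP //].
by rewrite gt_eqF // (lt_le_trans k0) // chik // ltW.
Qed.

End unique_continuation.

(** * The elliptic system for the traceless Ricci tensor *)

Section ricci_continuation.
Context {R : realType} {n : nat}.
Variables (D : set 'rV[R]_n) (G : 'rV[R]_n -> 'M[R]_n) (sc : R).
Hypothesis lm : local_metric D G.
Hypothesis harm : forall x, D x -> forall i j k, div_riemann G i j k x = 0.

Let oD := lm_open lm.
Let sE : mxsmooth D (Ef G sc) := Ef_smooth sc lm.
Let df f x : smooth_on D f -> D x -> differentiable f x.
Proof. by move=> sf; exact: smooth_differentiable. Qed.

Let E p := fun x => Ef G sc x p.1 p.2.
Let sEp (p : 'I_n * 'I_n) : smooth_on D (E p). Proof. exact: sE. Qed.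

(** Linear in the components of E with smooth coefficients. The first derivatives of such a function
    are [dominated], that is, bounded on the box by the jet of E. *)
Let linear_in_E (T : 'rV[R]_n -> R) := exists2 c : 'I_n * 'I_n -> 'rV[R]_n -> R,
  (forall p, smooth_on D (c p)) & forall x, D x -> T x = \sum_p c p x * E p x.

Let lin_entry p : linear_in_E (E p).
Proof.
exists (fun p' => fun=> (p' == p)%:R) => [p'|x Dx]; first exact: smooth_cst.
rewrite (bigD1 p) //= eqxx mul1r big1 ?addr0 // => p' pp.
by rewrite (negPf pp) mul0r.
Qed.

Let linD T T' : linear_in_E T -> linear_in_E T' -> linear_in_E (fun x => T x + T' x).
Proof.
move=> [c sc' H] [d sd H']; exists (fun p x => c p x + d p x) => [p|x Dx]; first exact: smoothD.
by rewrite H // H' // -big_split; apply: eq_bigr => p _; rewrite mulrDl.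
Qed.

Let linM f T : smooth_on D f -> linear_in_E T -> linear_in_E (fun x => f x * T x).
Proof.
move=> sf [c sc' H]; exists (fun p x => f x * c p x) => [p|x Dx]; first exact: smoothM.
by rewrite H // mulr_sumr; apply: eq_bigr => p _; rewrite mulrA.
Qed.

Let linN T : linear_in_E T -> linear_in_E (fun x => - T x).
Proof.
move=> [c sc' H]; exists (fun p x => - c p x) => [p|x Dx]; first exact: smoothN.
by rewrite H // -sumrN; apply: eq_bigr => p _; rewrite mulNr.
Qed.

Let lin_sum (T : 'I_n -> 'rV[R]_n -> R) : (forall i, linear_in_E (T i)) ->
  linear_in_E (fun x => \sum_i T i x).
Proof.
move=> /(_ _)/cid2-/all_sig2[c sc' H]; exists (fun p x => \sum_i c i p x) => [p|x Dx].
  by apply: smooth_sum.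
under eq_bigr do rewrite H //; rewrite exchange_big; apply: eq_bigr => p _.
by rewrite mulr_suml.
Qed.

Variables (q : 'rV[R]_n) (L : R).
Hypothesis bD : box q L `<=` D.

Let dominated (T : 'rV[R]_n -> R) := exists2 C, 0 <= C & forall x, box q L x ->
  `|T x| <= C * jet_norm E x.

Let jet0 x : 0 <= jet_norm E x.
Proof. by apply: sumr_ge0 => be _; rewrite addr_ge0 //; exact: sumr_ge0. Qed.

Let domD T T' : dominated T -> dominated T' -> dominated (fun x => T x + T' x).
Proof.
move=> [C C0 H] [C' C'0 H']; exists (C + C') => [|x bx]; first exact: addr_ge0.
by rewrite (le_trans (ler_normD _ _)) // mulrDl lerD ?H ?H'.
Qed.

Let domM f T : smooth_on D f -> dominated T -> dominated (fun x => f x * T x).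
Proof.
move=> sf [C C0 H]; have [C' C'0 H'] := box_bounded bD sf.
exists (C' * C) => [|x bx]; first by rewrite mulr_ge0 // ltW.
by rewrite normrM -mulrA ler_pM ?H ?H'.
Qed.

Let domN T : dominated T -> dominated (fun x => - T x).
Proof. by move=> [C C0 H]; exists C => // x bx; rewrite normrN H. Qed.

Let dom_sum (J : finType) (T : J -> 'rV[R]_n -> R) : (forall i, dominated (T i)) ->
  dominated (fun x => \sum_i T i x).
Proof.
move=> /(_ _)/cid2-/all_sig2[C C0 H]; exists (\sum_i C i) => [|x bx]; first exact: sumr_ge0.
rewrite (le_trans (ler_norm_sum _ _ _)) // mulr_suml; apply: ler_sum => i _; exact: H.
Qed.

Let eq_dom T T' : (forall x, D x -> T x = T' x) -> dominated T' -> dominated T.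
Proof. by move=> TT' [C C0 H]; exists C => // x bx; rewrite TT' ?H //; exact: bD. Qed.

Let jet_le p x : `|E p x| <= jet_norm E x /\ forall i, `|pd i (E p) x| <= jet_norm E x.
Proof.
have s0 be : 0 <= \sum_i `|pd i (E be) x| by apply: sumr_ge0.
have S : `|E p x| + \sum_i `|pd i (E p) x| <= jet_norm E x.
  by rewrite /jet_norm (bigD1 p) //= lerDl; apply: sumr_ge0 => be _; rewrite addr_ge0.
split => [|i]; first by apply: le_trans S; rewrite lerDl.
apply: le_trans S; rewrite (bigD1 i) //= addrCA lerDl addr_ge0 //; exact: sumr_ge0.
Qed.

Let dom_entry p : dominated (E p).
Proof. by exists 1 => // x _; rewrite mul1r; have [] := jet_le p x. Qed.

Let dom_pd_entry i p : dominated (pd i (E p)).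
Proof. by exists 1 => // x _; rewrite mul1r; have [] := jet_le p x. Qed.

Let dom_pd_lin i T : linear_in_E T -> dominated (pd i T).
Proof.
move=> [c sc' H]; apply: (@eq_dom _ (fun x => \sum_p (pd i (c p) x * E p x + c p x * pd i (E p) x))).
  move=> x Dx; rewrite (eq_on_partial i oD H Dx) partial_sum => [|p].
    apply: eq_bigr => p _; rewrite partialM //; exact: df Dx.
  by apply: (df _ Dx); exact: smoothM.
apply: dom_sum => p; apply: domD; apply: domM => //; exact: smooth_partial.
Qed.

Let conn i j k x : R := (om G i x *m Ef G sc x + Ef G sc x *m (om G i x)^T) j k.

Let lin_conn i j k : linear_in_E (conn i j k).
Proof.
have som := om_smooth lm.
have -> : conn i j k = fun x => \sum_p om G i x j p * E (p, k) x + \sum_p om G i x k p * E (j, p) x.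
  apply/funext => x; rewrite /conn addmxE !mxmulE; congr (_ + _).
  by apply: eq_bigr => p _; rewrite trmxE mulrC.
by apply: linD; apply: lin_sum => p; apply: linM => //; exact: som.
Qed.

Let codazzi_E i j k x : D x ->
  pd i (E (j, k)) x = pd j (E (i, k)) x + (conn i j k x - conn j i k x).
Proof.
move=> Dx; have := codazzi_ric lm harm i j k Dx.
rewrite -!(Dc_Ef sc lm) // /Dc !(addmxE, oppmxE) !dmxE /conn !addmxE.
move: (pd _ _ _) (pd _ _ _) => A B; move: ((_ *m _) j k) ((_ *m _) j k) ((_ *m _) i k) ((_ *m _) i k).
by move=> *; lra.
Qed.

Let div_E i x : D x ->
  \sum_m \sum_k iG G x m k * pd m (E (i, k)) x = \sum_m \sum_k iG G x m k * conn m i k x.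
Proof.
move=> Dx; apply/eqP; rewrite -subr_eq0 -sumrB; apply/eqP.
rewrite -[RHS](@div_ric _ _ D G lm x i Dx) => [|p r]; last exact: harm.
apply: eq_bigr => m _; rewrite -sumrB; apply: eq_bigr => k _.
rewrite -(Dc_Ef sc lm) // /Dc !(addmxE, oppmxE) dmxE /conn addmxE -mulrBr.
by congr (_ * _); rewrite opprD addrA.
Qed.

(** Up to terms of order at most one in E, the Codazzi equation gives d_l d_i E_jk = d_j d_l E_ik.
    Contraction with g^li turns the right side into a derivative of the divergence sum, which by
    [div_E] is the derivative of an expression linear in E. *)
Lemma ricci_elliptic_inequality : exists2 C, 0 <= C & forall x, box q L x -> forall p,
  `|second_order (fun i j x => iG G x i j) (E p) x| <= C * jet_norm E x.
Proof.
have siG := ginv_smooth lm.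
suff H0 : forall p, dominated (second_order (fun i j x => iG G x i j) (E p)).
  have [C C0 H] := all_sig2 (fun p => cid2 (H0 p)).
  exists (\sum_p C p) => [|x bx p]; first exact: sumr_ge0.
  apply: (le_trans (H p x bx)); apply: ler_wpM2r => //.
  by rewrite (bigD1 p) //= lerDl; exact: sumr_ge0.
case=> j k; pose Mk x := \sum_m \sum_r iG G x m r * conn m k r x.
apply: (@eq_dom _ (fun x => pd j Mk x - \sum_l \sum_i pd j (fun y => iG G y l i) x * pd l (E (i, k)) x
   + \sum_l \sum_i iG G x l i * pd l (fun y => conn i j k y - conn j i k y) x)).
  move=> x Dx; have spE l p := smooth_partial l (sEp p).
  have sconn i' j' k' : smooth_on D (conn i' j' k').
    have [c sc' H] := lin_conn i' j' k'.
    apply: (@smooth_eq _ _ _ oD (fun x => \sum_p c p x * E p x)); first by move=> y Dy; rewrite H.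
    by apply: smooth_sum => // p; exact: smoothM.
  have sEk i : E (k, i) = fun y => E (k, i) y by [].
  have Esym i y : D y -> E (k, i) y = E (i, k) y.
    by move=> Dy; rewrite /E /= -{1}(Ef_tr sc lm Dy) trmxE.
  have MkE y : D y -> Mk y = \sum_l \sum_i iG G y l i * pd l (E (i, k)) y.
    move=> Dy; rewrite /Mk -div_E //; apply: eq_bigr => l _; apply: eq_bigr => i _.
    by rewrite (eq_on_partial l oD (Esym i) Dy).
  have sg l i : smooth_on D (fun y => iG G y l i) by exact: siG.
  have pM : pd j Mk x = \sum_l \sum_i (pd j (fun y => iG G y l i) x * pd l (E (i, k)) x
      + iG G x l i * pd j (pd l (E (i, k))) x).
    have s1 l i : smooth_on D (fun y => iG G y l i * pd l (E (i, k)) y) by exact: smoothM.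
    rewrite (eq_on_partial j oD MkE Dx) partial_sum => [|l]; last first.
      by apply: (df _ Dx); exact: smooth_sum.
    apply: eq_bigr => l _; rewrite partial_sum => [|i]; last exact: df Dx.
    apply: eq_bigr => i _; rewrite partialM //; [exact: df (sg l i) Dx|exact: df (spE l (i, k)) Dx].
  rewrite pM -sumrB -big_split; apply: eq_bigr => l _ /=; rewrite -sumrB -big_split.
  apply: eq_bigr => i _ /=.
  have -> : pd l (pd i (E (j, k))) x =
      pd j (pd l (E (i, k))) x + pd l (fun y => conn i j k y - conn j i k y) x.
    rewrite (eq_on_partial l oD (fun y Dy => codazzi_E i j k Dy) Dx).
    rewrite partialD; [|exact: df (spE j (i, k)) Dx|by apply: (df _ Dx); exact: smoothB].
    by rewrite (smooth_partial_comm oD l j (sEp (i, k)) Dx).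
  by ring.
have sg l i : smooth_on D (fun y => iG G y l i) by exact: siG.
apply: domD; last first.
  apply: dom_sum => l; apply: dom_sum => i; apply: domM => //.
  by apply: dom_pd_lin; apply: linD => //; exact: linN.
apply: domD.
  by apply: dom_pd_lin; apply: lin_sum => m; apply: lin_sum => r; apply: linM => //; exact: siG.
apply: domN; apply: dom_sum => l; apply: dom_sum => i; apply: domM => //; exact: smooth_partial.
Qed.

(** Positivity of G at u = v g^-1 - v / B, combined with v G v^T <= B |v|^2, gives v g^-1 v^T >=
    |v|^2 / B; so an upper bound for the entries of G suffices. *)
Lemma metric_elliptic : exists2 c0, 0 < c0 & forall x (xi : 'I_n -> R), box q L x ->
  c0 * \sum_i xi i ^+ 2 <= \sum_i (\sum_j iG G x i j * xi j) * xi i.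
Proof.
have [C C0 HC] := box_bounded_fin bD (fun p : 'I_n * 'I_n => lm_smooth lm p.1 p.2).
pose B := n%:R * C + 1; have B0 : 0 < B by rewrite ltr_wpDl // mulr_ge0 // ltW.
exists B^-1 => [|x xi bx]; first by rewrite invr_gt0.
have Dx := bD bx.
pose v : 'rV[R]_n := \row_i xi i.
have vv : (v *m v^T) 0 0 = \sum_i xi i ^+ 2.
  by rewrite mxmulE; apply: eq_bigr => i _; rewrite !mxE expr2.
have vG : (v *m G x *m v^T) 0 0 <= B * \sum_i xi i ^+ 2.
  have := @quadratic_bound R n (fun p r => G x p r) C xi (fun p r => HC (p, r) x bx).
  rewrite ler_norml => /andP[_]; have -> : (v *m G x *m v^T) 0 0 = \sum_p \sum_r G x p r * xi p * xi r.
    rewrite mxmulE exchange_big; apply: eq_bigr => r _; rewrite mxmulE mulr_suml.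
    by apply: eq_bigr => p _; rewrite !mxE; ring.
  move/le_trans; apply; rewrite /B; apply: ler_wpM2r; last by rewrite lerDl.
  by apply: sumr_ge0 => i _; exact: sqr_ge0.
have viG : (v *m iG G x *m v^T) 0 0 = \sum_i (\sum_j iG G x i j * xi j) * xi i.
  rewrite mxmulE; apply: eq_bigr => i _; rewrite mxmulE !mxE; congr (_ * _).
  by apply: eq_bigr => j _; rewrite !mxE mulrC (ginv_symE lm).
pose u := v *m iG G x - B^-1 *: v.
have uu : 0 <= (u *m G x *m u^T) 0 0.
  have [->|u0] := eqVneq u 0; first by rewrite mul0mx mul0mx mxE.
  exact: ltW (lm_pos lm Dx u0).
have uE : u *m G x *m u^T = v *m iG G x *m v^T - (2 * B^-1) *: (v *m v^T)
    + (B^-1 * B^-1) *: (v *m G x *m v^T).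
  have iGt : (iG G x)^T = iG G x by exact: (ginv_sym lm).
  have uG : u *m G x = v - B^-1 *: (v *m G x).
    by rewrite /u mulmxBl -mulmxA (mulVG lm) // mulmx1 -scalemxAl.
  have ut : u^T = iG G x *m v^T - B^-1 *: v^T.
    by rewrite /u trmxD trmxN trmxZ trmx_mul iGt.
  have vGi : v *m G x *m (iG G x *m v^T) = v *m v^T.
    by rewrite mulmxA -[v *m G x *m _]mulmxA (mulGV lm) // mulmx1.
  rewrite uG ut mulmxBl !mulmxBr -!scalemxAl -!scalemxAr vGi mulmxA.
  by apply/matrixP => i j; rewrite !(addmxE, oppmxE, scalemxE); ring.
have := uu; rewrite uE !(addmxE, oppmxE, scalemxE) vv viG.
have : B^-1 * B^-1 * (v *m G x *m v^T) 0 0 <= B^-1 * \sum_i xi i ^+ 2.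
  rewrite -mulrA; apply: ler_wpM2l; first by rewrite invr_ge0 ltW.
  by rewrite ler_pdivrMl.
move: (_ * (v *m G x *m v^T) 0 0) => T; move: (\sum_i _) => S.
rewrite -mulrA; move: (B^-1 * S) => Z; lra.
Qed.

Lemma Ef_continuation x : 0 < L -> (\forall y \near q, Ef G sc y = 0) ->
  dist2 q x < L ^+ 2 -> Ef G sc x = 0.
Proof.
move=> L0 Eq xL.
have [c0 c00 ell] := metric_elliptic.
have [C C0 HC] := ricci_elliptic_inequality.
have [d d0 Hd] := nbhs_box Eq.
have core y : D y -> dist2 q y < d ^+ 2 -> forall p, E p y = 0.
  move=> Dy yd p; rewrite /E Hd ?zeromxE // => i.
  rewrite -(ler_pXn2r (_ : (0 < 2)%N)) ?nnegrE ?(ltW d0) //.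
  by rewrite real_normK ?num_real // (le_trans (dist2_coord q y i)) // ltW.
have d20 : 0 < d ^+ 2 by rewrite exprn_gt0.
have H := @unique_continuation R n D (fun i j x => iG G x i j) q L c0 oD
  (ginv_smooth lm) (fun i j x Dx => ginv_symE lm i j Dx) L0 bD c00 ell _ E (d ^+ 2) C sEp d20 core C0 HC x xL.
by apply/matrixP => i j; rewrite zeromxE -[RHS](H (i, j)).
Qed.

End ricci_continuation.

(** * Flat linear systems *)

Section linear_ode.
Context {R : realType}.
Implicit Types (f F : R -> R) (t C : R).

Lemma cvg_bigsum (J : Type) (s : seq J) (u : J -> R -> R) (l : J -> R) t :
  (forall j, u j x @[x --> t] --> l j) -> \sum_(j <- s) u j x @[x --> t] --> \sum_(j <- s) l j.
Proof.
move=> H; elim: s => [|j s IH].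
  by rewrite big_nil; under eq_fun do rewrite big_nil; exact: cvg_cst.
by rewrite big_cons; under eq_fun do rewrite big_cons; exact: cvgD.
Qed.

(** Projection of the line onto [0, 1]. Precomposition with it makes coefficients and primitives
    continuous on the whole line, so that no one-sided continuity occurs at the end points. *)
Definition clamp01 t : R := (`|t| - `|t - 1| + 1) / 2.

Lemma clamp01_id t : 0 <= t <= 1 -> clamp01 t = t.
Proof.
by move=> /andP[t0 t1]; rewrite /clamp01 ger0_norm // distrC ger0_norm ?subr_ge0 //; field.
Qed.

Lemma clamp01_itv t : 0 <= clamp01 t <= 1.
Proof.
by rewrite /clamp01; case: (ger0P t) => h1; case: (ger0P (t - 1)) => h2; lra.
Qed.

Lemma clamp01_continuous : continuous clamp01.
Proof.
move=> t; rewrite /continuous_at /clamp01; apply: cvgM; last exact: cvg_cst.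
apply: cvgD; last exact: cvg_cst.
apply: cvgB; first by apply: cvg_norm; exact: cvg_id.
by apply: cvg_norm; apply: cvgB; [exact: cvg_id|exact: cvg_cst].
Qed.

Definition unit_primitive F f := [/\ continuous F, F 0 = 0,
  forall t : R, 0 < t < 1 -> is_derive t 1 F (f t) & forall t, F t = F (clamp01 t)].

Lemma unit_primitive_exists f : continuous f -> exists F, unit_primitive F f.
Proof.
move=> cf; pose mu := @lebesgue_measure R.
(* The limits -1 and 3 leave room around [0, 1], so that H is differentiable at its end points as
   well. *)
pose H x := (\int[mu]_(t in [set` `[(-1 : R), x]]) (f t))%R.
have intf : mu.-integrable `[(-1 : R), 3] (EFin \o f).
  apply: continuous_compact_integrable; first exact: segment_compact.
  exact: continuous_subspaceT.
have dH (x : R) : -1 < x -> x < 3 -> is_derive x 1 H (f x).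
  move=> x1 x3; have [dx ex] := @continuous_FTC1_closed R f (-1) x 3 x3 intf x1 (cf x).
  exact: DeriveDef dx (etrans (esym (derive1E _ _)) ex).
exists (fun t => H (clamp01 t) - H 0); split.
- move=> t; rewrite /continuous_at; apply: cvgB; last exact: cvg_cst.
  apply: (@continuous_comp _ _ _ clamp01 H); first exact: clamp01_continuous.
  have /andP[c0 c1] := clamp01_itv t.
  have [dx _] : is_derive (clamp01 t) 1 H (f (clamp01 t)) by apply: dH; lra.
  by apply: differentiable_continuous; exact/derivable1_diffP.
- by rewrite clamp01_id ?subrr // lexx ler01.
- move=> t /andP[t0 t1].
  have d1 : is_derive t 1 (fun t => H t - H 0) (f t).
    rewrite -[f t]subr0; apply: is_deriveB; apply: dH; lra.
  apply: near_eq_is_derive d1.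
  have : \forall s \near t, s \in `]0, 1[ by apply: near_in_itvoo; rewrite in_itv /= t0 t1.
  apply: filterS => s; rewrite in_itv /= => /andP[s0 s1].
  by rewrite clamp01_id // !ltW.
- by move=> t; rewrite [clamp01 (clamp01 t)]clamp01_id // clamp01_itv.
Qed.

Lemma unit_increment F (df : R -> R) C (t : R) : 0 <= C -> continuous F ->
  (forall s : R, 0 < s < 1 -> is_derive s 1 F (df s)) ->
  (forall s : R, 0 < s < 1 -> `|df s| <= C) -> 0 <= t <= 1 -> `|F t - F 0| <= C.
Proof.
move=> C0 cF dF HC /andP[]; rewrite le_eqVlt => /predU1P[<-|t0] t1; first by rewrite subrr normr0.
have in01 (x : R) : x \in `]0, t[ -> 0 < x < 1.
  by rewrite in_itv /= => /andP[-> /lt_le_trans]; apply.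
have [c c0t ->] := @MVT R F df 0 t t0 (fun x xi => dF x (in01 x xi)) (continuous_subspaceT cF).
rewrite subr0 normrM (ger0_norm (ltW t0)) -[leRHS]mulr1; apply: ler_pM => //; first exact: ltW.
by apply: HC; exact: in01.
Qed.

Lemma unit_primitive_diff F G f g C t : 0 <= C -> unit_primitive F f -> unit_primitive G g ->
  (forall s : R, `|f s - g s| <= C) -> `|F t - G t| <= C.
Proof.
move=> C0 [cF F0 dF Fc] [cG G0 dG Gc] H; rewrite Fc Gc.
have := @unit_increment (fun s => F s - G s) (fun s => f s - g s) C (clamp01 t) C0.
rewrite F0 G0 subrr subr0; apply => //; last exact: clamp01_itv.
- by move=> s; apply: cvgB; [exact: cF|exact: cG].
- by move=> s s01; apply: is_deriveB; [exact: dF|exact: dG].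
Qed.

(** The intervals with centre u_k and radius C 2^-k are nested; the limit is the supremum of their
    left ends. *)
Lemma geometric_limit (u : nat -> R) C : 0 <= C ->
  (forall k, `|u k.+1 - u k| <= C * 2^-1 ^+ k.+1) -> exists l, forall k, `|u k - l| <= C * 2^-1 ^+ k.
Proof.
move=> C0 H.
pose a k := u k - C * 2^-1 ^+ k; pose b k := u k + C * 2^-1 ^+ k.
have half k : C * 2^-1 ^+ k = 2 * (C * 2^-1 ^+ k.+1) by rewrite exprS; field.
have p0 k : 0 <= C * 2^-1 ^+ k by rewrite mulr_ge0 // exprn_ge0.
have a1 k : a k <= a k.+1.
  by have := H k; rewrite /a (half k) ler_norml => /andP[]; move: (C * _) => *; lra.
have b1 k : b k.+1 <= b k.
  by have := H k; rewrite /b (half k) ler_norml => /andP[]; move: (C * _) => *; lra.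
have am k j : (k <= j)%N -> a k <= a j.
  by move=> /subnK <-; elim: (_ - _)%N => //= i IH; rewrite addSn (le_trans IH).
have bm k j : (k <= j)%N -> b j <= b k.
  by move=> /subnK <-; elim: (_ - _)%N => //= i IH; rewrite addSn (le_trans (b1 _)).
have ab k j : a k <= b j.
  apply: (le_trans (am _ _ (leq_maxl k j))); apply: (le_trans _ (bm _ _ (leq_maxr k j))).
  by have := p0 (maxn k j); rewrite /a /b; move: (C * _) => *; lra.
have hs : has_sup [set a k | k in [set: nat]].
  by split; [exists (a 0%N), 0%N|exists (b 0%N) => _ [k _ <-]].
exists (sup [set a k | k in [set: nat]]) => k.
have h1 : a k <= sup [set a k | k in [set: nat]] by apply: ub_le_sup; [case: hs|exists k].
have h2 : sup [set a k | k in [set: nat]] <= b k.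
  by apply: ge_sup; [case: hs|move=> _ [j _ <-]].
by move: h1 h2; rewrite /a /b ler_norml => *; lra.
Qed.

Lemma uniform_limit_continuous (u : nat -> R -> R) (l : R -> R) C : 0 <= C ->
  (forall k, continuous (u k)) -> (forall k t, `|u k t - l t| <= C * 2^-1 ^+ k) -> continuous l.
Proof.
move=> C0 cu H t; apply/cvgrPdist_lt => e e0.
have [k Ck] : exists k, C * 2^-1 ^+ k < e / 3.
  pose m := Num.bound (3 * C / e); exists m.
  rewrite exprVn ltr_pdivrMr ?exprn_gt0 // -ltr_pdivrMl ?divr_gt0 //.
  have -> : (e / 3)^-1 * C = 3 * C / e by field; rewrite gt_eqF.
  rewrite (lt_trans (archi_boundP _)) ?divr_ge0 ?mulr_ge0 ?(ltW e0) //.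
  by rewrite -natrX ltr_nat ltn_expl.
have /cvgrPdist_lt/(_ (e / 3)) := cu k t.
move=> /(_ (divr_gt0 e0 (ltr0n _ 3))); apply: filterS => s.
have := H k s; have := H k t; rewrite !ltr_norml !ler_norml => /andP[h1 h2] /andP[h3 h4] /andP[h5 h6].
by apply/andP; split; lra.
Qed.

(** Picard iteration from the constant s0: the smallness of |J| beta makes the integral operator a
    contraction with factor 1/2. The limit differs from s0 by at most M, whence the bound 2 M. *)
Theorem linear_ode (J : finType) (B : J -> J -> R -> R) (beta M : R) (s0 : J -> R) :
  0 <= beta -> #|J|%:R * beta <= 2^-1 -> 0 <= M -> (forall j, `|s0 j| <= M) ->
  (forall i j, continuous (B i j)) -> (forall i j t, `|B i j t| <= beta) ->
  exists S : J -> R -> R, [/\ forall j, continuous (S j), forall j, S j 0 = s0 j,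
    forall j (t : R), 0 < t < 1 -> is_derive t 1 (S j) (\sum_i S i t * B i j t)
    & forall j t, `|S j t| <= 2 * M].
Proof.
move=> beta0 Jb M0 sM cB bB.
have [Pr HPr] : exists Pr : (R -> R) -> R -> R, forall f, continuous f -> unit_primitive (Pr f) f.
  have /choice[Pr HPr] : forall f : R -> R, exists F, continuous f -> unit_primitive F f.
    move=> f; have [cf|ncf] := pselect (continuous f); last by exists f.
    by have [F HF] := unit_primitive_exists cf; exists F.
  by exists Pr.
pose rhs (S : J -> R -> R) j t := \sum_i S i t * B i j t.
have crhs S j : (forall i, continuous (S i)) -> continuous (rhs S j).
  move=> cS t; rewrite /continuous_at /rhs; apply: cvg_bigsum => i.
  by apply: cvgM; [exact: cS|exact: cB].
pose T S j t := s0 j + Pr (rhs S j) t.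
have cT S : (forall i, continuous (S i)) -> forall j, continuous (T S j).
  move=> cS j t; apply: cvgD; first exact: cvg_cst.
  by have [c _ _ _] := HPr _ (crhs S j cS); exact: c.
have contr S S' C : 0 <= C -> (forall i, continuous (S i)) -> (forall i, continuous (S' i)) ->
    (forall i t, `|S i t - S' i t| <= C) -> forall j t, `|T S j t - T S' j t| <= C * 2^-1.
  move=> C0 cS cS' H j t; rewrite /T [s0 j + _]addrC addrKA.
  apply: (unit_primitive_diff _ _ (HPr _ (crhs S j cS)) (HPr _ (crhs S' j cS'))) => [|s].
    by rewrite mulr_ge0.
  rewrite /rhs -sumrB (le_trans (ler_norm_sum _ _ _)) //.
  apply: (@le_trans _ _ (\sum_(i : J) C * beta)).
    by apply: ler_sum => i _; rewrite -mulrBl normrM ler_pM.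
  by rewrite sumr_const -[X in X <= _]mulr_natl mulrCA ler_wpM2l.
pose S_ k := iter k T (fun j => fun=> s0 j).
have cS_ k j : continuous (S_ k j).
  elim: k j => [|k IH] j; first by move=> t; exact: cvg_cst.
  exact: cT.
have dS k : forall j t, `|S_ k.+1 j t - S_ k j t| <= M * 2^-1 ^+ k.+1.
  elim: k => [|k IH] j t; last first.
    rewrite [2^-1 ^+ k.+2]exprSr mulrA.
    apply: (contr (S_ k.+1) (S_ k)) => [|i|i|]; [|exact: cS_|exact: cS_|exact: IH].
    by rewrite mulr_ge0 // exprn_ge0.
  have z0 : unit_primitive (fun=> 0) (fun=> 0).
    by split => // [t'|t' _]; [exact: cvg_cst|exact: is_derive_cst].
  rewrite /= /T addrAC subrr add0r -[Pr _ _]subr0.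
  apply: (unit_primitive_diff _ _ (HPr _ (crhs _ j (cS_ 0%N))) z0) => [|s].
    by rewrite mulr_ge0 // exprn_ge0.
  rewrite subr0 /rhs (le_trans (ler_norm_sum _ _ _)) //.
  apply: (@le_trans _ _ (\sum_(i : J) M * beta)).
    by apply: ler_sum => i _; rewrite normrM; apply: ler_pM => //; exact: sM.
  by rewrite sumr_const -[X in X <= _]mulr_natl mulrCA expr1 ler_wpM2l.
have /choice[S HS] : forall p : J * R, exists l, forall k, `|S_ k p.1 p.2 - l| <= M * 2^-1 ^+ k.
  by move=> [j t]; apply: geometric_limit => // k; exact: dS.
pose L j t := S (j, t).
have HL k j t : `|S_ k j t - L j t| <= M * 2^-1 ^+ k := HS (j, t) k.
have cL j : continuous (L j).
  exact: (@uniform_limit_continuous (fun k => S_ k j) (L j) M M0 (fun k => cS_ k j) (fun k t => HL k j t)).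
have LE j t : L j t = T L j t.
  apply/eqP; rewrite -subr_eq0 -normr_eq0 eq_le normr_ge0 andbT.
  apply/ler_addgt0Pr => e e0; rewrite add0r.
  have [k Ck] : exists k, M * 2^-1 ^+ k < e.
    pose m := Num.bound (M / e); exists m.
    rewrite exprVn ltr_pdivrMr ?exprn_gt0 // -ltr_pdivrMl // mulrC.
    by rewrite (lt_trans (archi_boundP _)) ?divr_ge0 ?(ltW e0) // -natrX ltr_nat ltn_expl.
  have h1 := HL k.+1 j t.
  have h2 : `|T (S_ k) j t - T L j t| <= M * 2^-1 ^+ k * 2^-1.
    by apply: contr => //; rewrite mulr_ge0 // exprn_ge0.
  have h3 : M * 2^-1 ^+ k.+1 = M * 2^-1 ^+ k / 2 by rewrite exprSr mulrA.
  move: h1 h2; rewrite h3 -[S_ k.+1 j t]/(T (S_ k) j t) !ler_norml; move: (M * _) Ck => *; lra.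
exists L; split => // [j|j t t01|j t].
- rewrite LE /T; have [_ -> _ _] := HPr _ (crhs L j cL); exact: addr0.
- have -> : L j = T L j by apply/funext => s; exact: LE.
  have [_ _ d _] := HPr _ (crhs L j cL).
  by rewrite -[\sum_i _]add0r; apply: is_deriveD; exact: d.
- have := HL 0%N j t; have := sM j; rewrite expr0 mulr1 /= !ler_norml => /andP[h1 h2] /andP[h3 h4].
  by apply/andP; split; lra.
Qed.

(** A bound N for d on [0, 1] improves to N / 2 + C, by the smallness of |J| beta; iterating from
    any bound leads to the fixed point 2 C. *)
Lemma gronwall_unit (J : finType) (B : J -> J -> R -> R) (r d : J -> R -> R) (beta C : R) :
  0 <= beta -> #|J|%:R * beta <= 2^-1 -> 0 <= C -> (forall j, continuous (d j)) ->
  (forall j, d j 0 = 0) ->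
  (forall j (t : R), 0 < t < 1 -> is_derive t 1 (d j) (\sum_i d i t * B i j t + r j t)) ->
  (forall i j (t : R), 0 < t < 1 -> `|B i j t| <= beta) -> (forall j (t : R), 0 < t < 1 -> `|r j t| <= C) ->
  forall j, `|d j 1| <= 2 * C.
Proof.
move=> beta0 Jb C0 cd d0 dd bB rC.
have /choice[N HN] : forall j, exists N, 0 <= N /\ forall t, 0 <= t <= 1 -> `|d j t| <= N.
  move=> j; have cj : {within `[0, 1 : R], continuous (d j)} by exact: continuous_subspaceT.
  have /compact_bounded[M [_ H]] := continuous_compact cj (@segment_compact R 0 1).
  exists (`|M| + 1); split => [|t t01]; first by rewrite addr_ge0.
  by apply: (H (`|M| + 1)); [rewrite (le_lt_trans (ler_norm M)) // ltrDl|exists t; rewrite //= in_itv].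
have step N' : 0 <= N' -> (forall j (t : R), 0 <= t <= 1 -> `|d j t| <= N') ->
    forall j (t : R), 0 <= t <= 1 -> `|d j t| <= N' / 2 + C.
  move=> N0 H j t t01.
  rewrite -[d j t]subr0 -(d0 j).
  apply: (unit_increment _ (cd j) (dd j)) => // [|s s01].
    by rewrite addr_ge0 // divr_ge0.
  rewrite (le_trans (ler_normD _ _)) // lerD ?rC //.
  rewrite (le_trans (ler_norm_sum _ _ _)) //.
  apply: (@le_trans _ _ (\sum_(i : J) N' * beta)).
    apply: ler_sum => i _; rewrite normrM ler_pM ?bB // H //.
    by case/andP: s01 => /ltW -> /ltW ->.
  by rewrite sumr_const -[X in X <= _]mulr_natl mulrCA ler_wpM2l.
pose N0 := \sum_j N j.
have N00 : 0 <= N0 by apply: sumr_ge0 => j _; case: (HN j).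
have it k : forall j (t : R), 0 <= t <= 1 -> `|d j t| <= N0 * 2^-1 ^+ k + 2 * C.
  elim: k => [|k IH] j t t01.
    rewrite expr0 mulr1 (le_trans ((HN j).2 t t01)) // /N0 (bigD1 j) //= -addrA lerDl addr_ge0 ?mulr_ge0 //.
    by apply: sumr_ge0 => i _; case: (HN i).
  apply: (le_trans (step _ _ IH j t t01)).
    by rewrite addr_ge0 ?mulr_ge0 // exprn_ge0.
  by rewrite exprSr; move: (2^-1 ^+ k) => P; lra.
move=> j; apply/ler_addgt0Pr => e e0.
have [k Ck] : exists k, N0 * 2^-1 ^+ k < e.
  pose m := Num.bound (N0 / e); exists m.
  rewrite exprVn ltr_pdivrMr ?exprn_gt0 // -ltr_pdivrMl // mulrC.
  by rewrite (lt_trans (archi_boundP _)) ?divr_ge0 ?(ltW e0) // -natrX ltr_nat ltn_expl.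
have := it k j 1; rewrite ler01 lexx => /(_ isT); move: Ck; move: (N0 * _) => *; lra.
Qed.

End linear_ode.

(** * Derivatives from first-order expansions with quadratic error *)

Section approximation.
Context {R : realType} {n : nat}.
Implicit Types (D : set 'rV[R]_n) (f : 'rV[R]_n -> R) (x w : 'rV[R]_n).

Lemma partial_of_approx f x (a : 'I_n -> R) :
  (forall e : R, 0 < e -> \forall y \near x,
    `|f y - f x - \sum_i a i * (y - x) 0 i| <= e * `|y - x|) ->
  differentiable f x /\ forall i, pd i f x = a i.
Proof.
move=> H; have df : differentiable f x by apply/differentiableE; exists a.
split => // i; apply/eqP; rewrite -subr_eq0 -normr_eq0 eq_le normr_ge0 andbT.
apply/ler_addgt0Pr => e e0; rewrite add0r.
have e20 : 0 < e / 2 by rewrite divr_gt0.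
have [d /= d0 Hd] : nbhs_ball x (fun y =>
    `|f y - f x - \sum_i a i * (y - x) 0 i| <= e / 2 * `|y - x| /\
    `|f y - f x - \sum_i pd i f x * (y - x) 0 i| <= e / 2 * `|y - x|).
  by apply/nbhs_ballP; apply: filterI; [exact: H|exact: differentiable_approx].
pose h := d / 2; have h0 : 0 < h by rewrite divr_gt0.
pose y := x + h *: delta_mx 0 i.
have yx : y - x = h *: delta_mx 0 i by rewrite /y addrC addKr.
have ny : `|y - x| <= h.
  by rewrite yx normrZ gtr0_norm // -[leRHS]mulr1 ler_wpM2l ?norm_delta_row // ltW.
have [H1 H2] : `|f y - f x - \sum_i a i * (y - x) 0 i| <= e / 2 * `|y - x| /\
    `|f y - f x - \sum_i pd i f x * (y - x) 0 i| <= e / 2 * `|y - x|.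
  apply: Hd; rewrite -ball_normE /= distrC (le_lt_trans ny) // /h.
  by rewrite ltr_pdivrMr // ltr_pMr // ltr1n.
have S (c : 'I_n -> R) : \sum_i c i * (y - x) 0 i = h * c i.
  rewrite yx (bigD1 i) //= !mxE !eqxx mulr1 mulrC big1 ?addr0 // => k ki.
  by rewrite !mxE (negPf ki) andbF !mulr0.
move: H1 H2; rewrite !S.
have en : e / 2 * `|y - x| <= e / 2 * h by rewrite ler_pM2l.
move=> /le_trans/(_ en) H1 /le_trans/(_ en) H2.
rewrite -(ler_pM2l h0) -{1}(gtr0_norm h0) -normrM mulrBr.
move: H1 H2; move: (h * pd i f x) (h * a i) (f y - f x) => A B C.
have -> : e / 2 * h = h * e / 2 by ring.
by rewrite !ler_norml => /andP[? ?] /andP[? ?]; apply/andP; split; lra.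
Qed.

Definition norm1 w : R := \sum_k `|w 0 k|.

Lemma norm1_le w : norm1 w <= n%:R * `|w|.
Proof.
rewrite /norm1 mulr_natl -[X in _ *+ X]card_ord -sumr_const; apply: ler_sum => k _.
rewrite [leRHS]/Num.Def.normr /= mx_normrE.
exact: (le_bigmax _ (fun ij => `|w ij.1 ij.2|) (0, k)).
Qed.

Lemma partial_of_quadratic f x (a : 'I_n -> R) (C d : R) : 0 <= C -> 0 < d ->
  (forall w, `|w| < d -> `|f (x + w) - f x - \sum_i a i * w 0 i| <= C * norm1 w ^+ 2) ->
  differentiable f x /\ forall i, pd i f x = a i.
Proof.
move=> C0 d0 H; apply: partial_of_approx => e e0.
pose B := C * n%:R ^+ 2 + 1; have B0 : 0 < B by rewrite ltr_wpDl // mulr_ge0 // exprn_ge0.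
apply/nbhs_ballP; exists (Num.min d (e / B)); first by rewrite /= lt_min d0 divr_gt0.
move=> y; rewrite -ball_normE /= distrC lt_min => /andP[yd ye].
have := H (y - x) yd; rewrite addrCA subrr addr0 => /le_trans; apply.
have n0 : 0 <= norm1 (y - x) by apply: sumr_ge0.
apply: (@le_trans _ _ (C * (n%:R * `|y - x|) ^+ 2)).
  by apply: ler_wpM2l => //; rewrite lerXn2r ?nnegrE ?mulr_ge0 ?norm1_le.
rewrite exprMn expr2 [`|y - x| ^+ 2]expr2 !mulrA; apply: ler_wpM2r => //.
move: ye; rewrite ltr_pdivlMr // => /ltW; apply: le_trans.
by rewrite [leLHS]mulrC -[C * _ * _]mulrA /B expr2 mulrDr mulr1 lerDl.
Qed.

Lemma MVT_segment D f x w : smooth_on D f ->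
  (forall s : R, 0 <= s <= 1 -> D (x + s *: w)) ->
  exists2 c : R, 0 < c < 1 & f (x + w) - f x = \sum_k w 0 k * pd k f (x + c *: w).
Proof.
move=> sf inD.
have [c c01 E] := @MVT_line R n f x w 1 ltr01
  (fun s sh => smooth_differentiable sf (inD s sh)).
exists c => //; rewrite scale1r mulr1 in E; rewrite E.
have dc : differentiable f (x + c *: w).
  by apply: (smooth_differentiable sf); apply: inD; case/andP: c01 => /ltW -> /ltW ->.
by rewrite deriveE // diff_partial //; apply: eq_bigr => k _; rewrite mulrC.
Qed.

Lemma increment_bound D f x w C : smooth_on D f ->
  (forall s : R, 0 <= s <= 1 -> D (x + s *: w)) ->
  (forall s : R, 0 <= s <= 1 -> forall k, `|pd k f (x + s *: w)| <= C) ->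
  `|f (x + w) - f x| <= norm1 w * C.
Proof.
move=> sf inD HC; have [c /andP[c0 c1] ->] := MVT_segment sf inD.
rewrite (le_trans (ler_norm_sum _ _ _)) // mulr_suml; apply: ler_sum => k _.
by rewrite normrM ler_wpM2l // HC // !ltW.
Qed.

Lemma taylor_segment D f x w C : smooth_on D f ->
  (forall s : R, 0 <= s <= 1 -> D (x + s *: w)) ->
  (forall s : R, 0 <= s <= 1 -> forall k l, `|pd l (pd k f) (x + s *: w)| <= C) ->
  `|f (x + w) - f x - \sum_k w 0 k * pd k f x| <= norm1 w ^+ 2 * C.
Proof.
move=> sf inD HC; have [c /andP[c0 c1] ->] := MVT_segment sf inD.
rewrite -sumrB (le_trans (ler_norm_sum _ _ _)) // expr2 -mulrA mulr_suml.
apply: ler_sum => k _; rewrite -mulrBr normrM ler_wpM2l //.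
have C0 : 0 <= C.
  by apply: le_trans (HC 0 _ k k); rewrite ?lexx ?ler01.
have sub s : 0 <= s <= 1 -> 0 <= s * c <= 1.
  move=> /andP[s0 s1]; rewrite mulr_ge0 ?(ltW c0) //= -[leRHS]mulr1 ler_pM // ?ltW //.
have := @increment_bound D (pd k f) x (c *: w) C (smooth_partial k sf).
have -> : norm1 (c *: w) = c * norm1 w.
  by rewrite /norm1 mulr_sumr; apply: eq_bigr => l _; rewrite mxE normrM gtr0_norm.
move=> H; apply: le_trans (H _ _) _ => [s s01|s s01 l|]; rewrite ?scalerA.
- by apply: inD; exact: sub.
- by apply: HC; exact: sub.
- apply: ler_wpM2r => //; rewrite -[leRHS]mul1r ler_wpM2r ?(ltW c1) //; exact: sumr_ge0.
Qed.

End approximation.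

Lemma is_derive_bigsum (R : realType) (J : Type) (r : seq J) (h : J -> R -> R) (dh : J -> R) (t : R) :
  (forall j, is_derive t 1 (h j) (dh j)) ->
  is_derive t 1 (fun s => \sum_(j <- r) h j s) (\sum_(j <- r) dh j).
Proof.
move=> H; elim: r => [|j r IH].
  by rewrite big_nil; under eq_fun do rewrite big_nil; exact: is_derive_cst.
by rewrite big_cons; under eq_fun do rewrite big_cons; exact: is_deriveD.
Qed.

Lemma is_derive_mul (R : realType) (f g : R -> R) (df dg t : R) :
  is_derive t 1 f df -> is_derive t 1 g dg ->
  is_derive t 1 (fun s => f s * g s) (df * g t + f t * dg).
Proof.
move=> hf hg; have := is_deriveM hf hg; move/is_derive_eq; apply.
by rewrite addrC; congr (_ + _); exact: mulrC.
Qed.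

Section clamped_line.
Context {R : realType} {n : nat}.
Variables (D : set 'rV[R]_n) (f : 'rV[R]_n -> R) (p y : 'rV[R]_n).
Hypothesis sf : smooth_on D f.
Hypothesis inD : forall t : R, 0 <= t <= 1 -> D (p + t *: y).

Lemma clamped_line_continuous : continuous (fun t : R => f (p + clamp01 t *: y)).
Proof.
move=> t; apply: (@continuous_comp _ _ _ (fun t => p + clamp01 t *: y) f).
  apply: cvgD; first exact: cvg_cst.
  by apply: cvgZr_tmp; exact: clamp01_continuous.
apply: differentiable_continuous; apply: (smooth_differentiable sf); apply: inD.
exact: clamp01_itv.
Qed.

Lemma clamped_line_derive (t : R) : 0 < t < 1 ->
  is_derive t 1 (fun t => f (p + clamp01 t *: y)) (\sum_m y 0 m * pd m f (p + t *: y)).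
Proof.
move=> /andP[t0 t1]; have Dt : D (p + t *: y) by apply: inD; rewrite !ltW.
have df := smooth_differentiable sf Dt.
have E : 'D_y f (p + t *: y) = \sum_m y 0 m * pd m f (p + t *: y).
  by rewrite deriveE // diff_partial //; apply: eq_bigr => k _; rewrite mulrC.
rewrite -E; apply: near_eq_is_derive (line_is_derive df).
have : \forall s \near t, s \in `]0, 1[ by apply: near_in_itvoo; rewrite in_itv /= t0 t1.
apply: filterS => s; rewrite in_itv /= => /andP[s0 s1].
by rewrite clamp01_id // !ltW.
Qed.

End clamped_line.

Section flat_system.
Context {R : realType} {n : nat} {J : finType}.
Variables (D : set 'rV[R]_n) (A : 'I_n -> J -> J -> 'rV[R]_n -> R).
Hypothesis oD : open D.
Hypothesis sA : forall i al be, smooth_on D (A i al be).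
Hypothesis flat : forall i j al be x, D x ->
  pd i (A j al be) x - pd j (A i al be) x
  + \sum_g (A i al g x * A j g be x - A j al g x * A i g be x) = 0.

Section local.
Variables (p : 'rV[R]_n) (s0 : J -> R) (L a a1 a2 : R).
Hypothesis L0 : 0 < L.
Hypothesis bD : box p L `<=` D.
Hypotheses (a0 : 0 <= a) (a10 : 0 <= a1) (a20 : 0 <= a2).
Hypothesis Aa : forall i al be x, box p L x -> `|A i al be x| <= a.
Hypothesis Aa1 : forall k i al be x, box p L x -> `|pd k (A i al be) x| <= a1.
Hypothesis Aa2 : forall k l i al be x, box p L x -> `|pd k (pd l (A i al be)) x| <= a2.
Hypothesis small : #|J|%:R * (n%:R * L * a) <= 2^-1.

Let M : R := \sum_j `|s0 j|.

(** Coefficients of the linear equation along the ray t -> p + t y; its solution at t = 1 is taken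
    as the value at p + y. *)
Let ray_coef (y : 'rV[R]_n) i j t : R := \sum_k y 0 k * A k i j (p + clamp01 t *: y).

Let in_box y (t : R) : box p L (p + y) -> 0 <= t <= 1 -> box p L (p + t *: y).
Proof.
move=> b /andP[t0' t1] i; have := b i; rewrite !mxE ![p 0 i + _]addrC !addrK normrM.
by rewrite (ger0_norm t0') => /(le_trans _); apply; rewrite -[leRHS]mul1r ler_wpM2r.
Qed.

Let coef_bound y i j t : box p L (p + y) -> `|ray_coef y i j t| <= n%:R * L * a.
Proof.
move=> b; rewrite (le_trans (ler_norm_sum _ _ _)) // -mulrA mulr_natl -[X in _ *+ X]card_ord -sumr_const.
apply: ler_sum => k _; rewrite normrM ler_pM //.
  by have := b k; rewrite !mxE [p 0 k + _]addrC addrK.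
by apply: Aa; apply: in_box b _; exact: clamp01_itv.
Qed.

Let ray_exists : exists S : 'rV[R]_n -> J -> R -> R, forall y, box p L (p + y) ->
  [/\ forall j, continuous (S y j), forall j, S y j 0 = s0 j,
    forall j (t : R), 0 < t < 1 -> is_derive t 1 (S y j) (\sum_i S y i t * ray_coef y i j t)
    & forall j t, `|S y j t| <= 2 * M].
Proof.
suff /choice[S HS] : forall y, exists S : J -> R -> R, box p L (p + y) ->
    [/\ forall j, continuous (S j), forall j, S j 0 = s0 j,
    forall j (t : R), 0 < t < 1 -> is_derive t 1 (S j) (\sum_i S i t * ray_coef y i j t)
    & forall j t, `|S j t| <= 2 * M] by exists S.
move=> y; have [b|nb] := pselect (box p L (p + y)); last by exists (fun _ _ => 0).
have [|||||S HS] := @linear_ode R J (ray_coef y) (n%:R * L * a) M s0 _ small.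
- by rewrite !mulr_ge0 // ltW.
- exact: sumr_ge0.
- by move=> j; rewrite /M (bigD1 j) //= lerDl; exact: sumr_ge0.
- move=> i j t; apply: cvg_bigsum => k; apply: cvgM; first exact: cvg_cst.
  apply: (clamped_line_continuous (sA k i j)) => s s01; apply: bD; exact: in_box.
- by move=> i j t; exact: coef_bound.
- by exists S.
Qed.

Let S := sval (cid ray_exists).
Let HS y (b : box p L (p + y)) : [/\ forall j, continuous (S y j), forall j, S y j 0 = s0 j,
    forall j (t : R), 0 < t < 1 -> is_derive t 1 (S y j) (\sum_i S y i t * ray_coef y i j t)
    & forall j t, `|S y j t| <= 2 * M] := svalP (cid ray_exists) y b.

Definition ray_solution j x : R := S (x - p) j 1.

Lemma ray_solution_base j : ray_solution j p = s0 j.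
Proof.
have b0 : box p L (p + (p - p)) by move=> i; rewrite subrr addr0 subrr normr0 ltW.
have [cS S0 dS _] := HS b0.
have := @unit_increment R (S (p - p) j) (fun t => \sum_i S (p - p) i t * ray_coef (p - p) i j t) 0 1
  (lexx 0) (cS j) (dS j).
rewrite S0 -/(ray_solution j p) => H; apply/eqP; rewrite -subr_eq0 -normr_eq0 eq_le normr_ge0 andbT.
apply: H => [t t01|]; last by rewrite ler01 lexx.
rewrite big1 ?normr0 // => i _; rewrite /ray_coef big1 ?mulr0 // => k _.
by rewrite subrr mxE mul0r.
Qed.

Let M0 : 0 <= M. Proof. exact: sumr_ge0. Qed.

Let Crho := a1 + n%:R * L * a2 + #|J|%:R * (a * (n%:R * L * a1 + a)).

(** The defect in the equation satisfied by [d] in [ray_solution_increment]. Flatness removes its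
    terms linear in w, so that it is quadratic in w ([rho_bound]). *)
Let rho y w l j t : R :=
  ray_coef (y + w) l j t - ray_coef y l j t - \sum_k w 0 k * A k l j (p + t *: y)
  - t * (\sum_k \sum_m w 0 k * (y 0 m * pd m (A k l j) (p + t *: y)))
  + t * \sum_i ((\sum_k w 0 k * A k l i (p + t *: y)) * ray_coef (y + w) i j t
     - ray_coef y l i t * (\sum_k w 0 k * A k i j (p + t *: y))).

Let rho_bound y w l j (t : R) : box p L (p + y) -> box p L (p + (y + w)) -> 0 < t < 1 ->
  `|rho y w l j t| <= Crho * norm1 w ^+ 2.
Proof.
move=> by_ byw /andP[t0 t1]; have t01 : 0 <= t <= 1 by rewrite !ltW.
pose z := p + t *: y.
have zw : p + t *: (y + w) = z + t *: w by rewrite scalerDr addrA.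
have bz : box p L z by exact: in_box.
have bzw s : 0 <= s <= 1 -> box p L (z + s *: (t *: w)).
  move=> /andP[h0 h1] k; have := bz k; have := in_box byw t01 k; rewrite zw.
  have -> : (z + t *: w) 0 k = z 0 k + (t *: w) 0 k by rewrite addmxE.
  have -> : (z + s *: (t *: w)) 0 k = z 0 k + s * (t *: w) 0 k by rewrite [LHS]addmxE [X in _ + X = _]scalemxE.
  move: (z 0 k) ((t *: w) 0 k) (p 0 k) => Z W P h2 h3.
  have -> : Z + s * W - P = (1 - s) * (Z - P) + s * (Z + W - P) by ring.
  rewrite (le_trans (ler_normD _ _)) // !normrM (ger0_norm h0) ger0_norm ?subr_ge0 //.
  have -> : L = (1 - s) * L + s * L by ring.
  by rewrite lerD // ler_wpM2l // subr_ge0.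
have N0 : 0 <= norm1 w by exact: sumr_ge0.
have Ntw : norm1 (t *: w) <= norm1 w.
  by apply: ler_sum => k _; rewrite scalemxE normrM gtr0_norm // -[leRHS]mul1r ler_wpM2r // ltW.
have Ntw0 : 0 <= norm1 (t *: w) by exact: sumr_ge0.
have Dz := bD bz; have tn : `|t| <= 1 by rewrite gtr0_norm // ltW.
have cy : clamp01 t = t by exact: clamp01_id.
have inD s : 0 <= s <= 1 -> D (z + s *: (t *: w)) by move=> s01; apply: bD; exact: bzw.
have yw k : `|y 0 k + w 0 k| <= L.
  by have := byw k; rewrite !addmxE [p 0 k + _]addrC addrK.
have dA k i' j' : `|A k i' j' (z + t *: w) - A k i' j' z| <= norm1 w * a1.
  apply: le_trans (ler_wpM2r a10 Ntw).
  by apply: (increment_bound (sA k i' j') inD) => s s01 m; apply: Aa1; exact: bzw.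
pose Rk k := A k l j (z + t *: w) - A k l j z - \sum_m (t *: w) 0 m * pd m (A k l j) z.
have RkB k : `|Rk k| <= norm1 w ^+ 2 * a2.
  apply: (@le_trans _ _ (norm1 (t *: w) ^+ 2 * a2)).
    by apply: (taylor_segment (sA k l j) inD) => s s01 m m'; apply: Aa2; exact: bzw.
  by apply: ler_wpM2r => //; rewrite lerXn2r.
have By i' j' : ray_coef y i' j' t = \sum_k y 0 k * A k i' j' z by rewrite /ray_coef cy.
have Byw i' j' : ray_coef (y + w) i' j' t = \sum_k (y 0 k + w 0 k) * A k i' j' (z + t *: w).
  by rewrite /ray_coef cy zw; apply: eq_bigr => k _; rewrite addmxE.
pose V i' j' := \sum_k w 0 k * A k i' j' z.
have dB i' j' : ray_coef (y + w) i' j' t - ray_coef y i' j' t =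
    \sum_k (y 0 k + w 0 k) * (A k i' j' (z + t *: w) - A k i' j' z) + V i' j'.
  rewrite By Byw -sumrB -big_split; apply: eq_bigr => k _ /=; ring.
have dBB i' j' : `|ray_coef (y + w) i' j' t - ray_coef y i' j' t| <= norm1 w * (n%:R * L * a1 + a).
  rewrite dB (le_trans (ler_normD _ _)) // mulrDr lerD //.
    rewrite (le_trans (ler_norm_sum _ _ _)) //.
    have -> : norm1 w * (n%:R * L * a1) = \sum_(k < n) L * (norm1 w * a1).
      by rewrite sumr_const card_ord -[RHS]mulr_natl; ring.
    by apply: ler_sum => k _; rewrite normrM ler_pM.
  rewrite (le_trans (ler_norm_sum _ _ _)) // mulr_suml; apply: ler_sum => k _.
  by rewrite normrM ler_wpM2l // Aa.
have VB i' j' : `|V i' j'| <= norm1 w * a.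
  rewrite (le_trans (ler_norm_sum _ _ _)) // mulr_suml; apply: ler_sum => k _.
  by rewrite normrM ler_wpM2l // Aa.
(* The flatness equation contracted with the directions y and w. *)
have flat0 : \sum_k \sum_m y 0 k * w 0 m * (pd m (A k l j) z - pd k (A m l j) z) +
    \sum_i (V l i * ray_coef y i j t - ray_coef y l i t * V i j) = 0.
  have -> : \sum_i (V l i * ray_coef y i j t - ray_coef y l i t * V i j) =
      \sum_k \sum_m y 0 k * w 0 m * \sum_i (A m l i z * A k i j z - A k l i z * A m i j z).
    transitivity (\sum_i \sum_k \sum_m y 0 k * w 0 m * (A m l i z * A k i j z - A k l i z * A m i j z)).
      apply: eq_bigr => i _; rewrite !By /V !mulr_suml -[X in X - _]mulr_suml mulr_sumr -sumrB.
      apply: eq_bigr => k _; rewrite mulr_suml mulr_sumr -sumrB; apply: eq_bigr => m _; ring.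
    rewrite exchange_big; apply: eq_bigr => k _; rewrite exchange_big; apply: eq_bigr => m _.
    by rewrite mulr_sumr.
  rewrite -big_split big1 // => k _ /=; rewrite -big_split big1 // => m _ /=.
  by rewrite -mulrDr flat // mulr0.
have E : rho y w l j t = \sum_k (y 0 k + w 0 k) * Rk k
   + t * (\sum_k \sum_m w 0 k * (w 0 m * pd m (A k l j) z))
   + t * \sum_i V l i * (ray_coef (y + w) i j t - ray_coef y i j t).
  rewrite /rho -/z -/(V l j); set X := \sum_i (_ - _).
  have -> : X = \sum_i V l i * (ray_coef (y + w) i j t - ray_coef y i j t)
      + \sum_i (V l i * ray_coef y i j t - ray_coef y l i t * V i j).
    by rewrite /X -big_split; apply: eq_bigr => i _ /=; rewrite -/(V l i) -/(V i j); ring.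
  have := flat0; set Y := \sum_i (V l i * ray_coef y i j t - _) => fl.
  have -> : Y = - \sum_k \sum_m y 0 k * w 0 m * (pd m (A k l j) z - pd k (A m l j) z).
    by apply/eqP; rewrite -addr_eq0 addrC fl.
  rewrite dB.
  have -> : \sum_k (y 0 k + w 0 k) * Rk k = \sum_k (y 0 k + w 0 k) * (A k l j (z + t *: w) - A k l j z)
     - t * (\sum_k \sum_m y 0 k * (w 0 m * pd m (A k l j) z))
     - t * (\sum_k \sum_m w 0 k * (w 0 m * pd m (A k l j) z)).
    rewrite !mulr_sumr -!sumrB; apply: eq_bigr => k _.
    have -> : Rk k = A k l j (z + t *: w) - A k l j z - t * \sum_m w 0 m * pd m (A k l j) z.
      by rewrite /Rk mulr_sumr; congr (_ - _); apply: eq_bigr => m _; rewrite scalemxE mulrA.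
    by rewrite -!mulr_sumr; ring.
  have -> : \sum_k \sum_m y 0 k * w 0 m * (pd m (A k l j) z - pd k (A m l j) z) =
     \sum_k \sum_m y 0 k * (w 0 m * pd m (A k l j) z)
     - \sum_k \sum_m w 0 k * (y 0 m * pd m (A k l j) z).
    rewrite [X in _ - X]exchange_big -sumrB; apply: eq_bigr => k _; rewrite -sumrB.
    by apply: eq_bigr => m _; ring.
  by ring.
rewrite E /Crho !mulrDl -!addrA addrCA.
rewrite (le_trans (ler_normD _ _)) // lerD //.
  rewrite normrM -[leRHS]mul1r ler_pM //.
  rewrite (le_trans (ler_norm_sum _ _ _)) // mulrC expr2 -mulrA mulr_suml; apply: ler_sum => k _.
  rewrite -mulr_sumr normrM ler_wpM2l // (le_trans (ler_norm_sum _ _ _)) // mulr_suml.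
  by apply: ler_sum => m _; rewrite normrM ler_wpM2l // Aa1.
rewrite (le_trans (ler_normD _ _)) // lerD //.
  rewrite (le_trans (ler_norm_sum _ _ _)) //.
  have -> : n%:R * L * a2 * norm1 w ^+ 2 = \sum_(k < n) L * (norm1 w ^+ 2 * a2).
    by rewrite sumr_const card_ord -[RHS]mulr_natl; ring.
  by apply: ler_sum => k _; rewrite normrM ler_pM.
rewrite normrM -[leRHS]mul1r ler_pM // (le_trans (ler_norm_sum _ _ _)) //.
have -> : #|J|%:R * (a * (n%:R * L * a1 + a)) * norm1 w ^+ 2 =
    \sum_(i : J) (norm1 w * a) * (norm1 w * (n%:R * L * a1 + a)).
  by rewrite sumr_const -[RHS]mulr_natl; ring.
by apply: ler_sum => i _; rewrite normrM ler_pM.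
Qed.

(** The expected first variation of the ray solution in direction w is t S A(w). The deviation [d]
    from it solves the equation of the ray to y + w up to the defect [rho], starts at zero and is
    estimated by [gronwall_unit]. At t = 1 this is the expansion that yields d_k s = s A_k. *)
Lemma ray_solution_increment x w j : box p L x -> box p L (x + w) ->
  `|ray_solution j (x + w) - ray_solution j x
    - \sum_k (\sum_i ray_solution i x * A k i j x) * w 0 k| <=
  2 * (#|J|%:R * (2 * M * Crho)) * norm1 w ^+ 2.
Proof.
move=> bx bxw; pose y := x - p.
have xE : x = p + y by rewrite /y addrC subrK.
have by_ : box p L (p + y) by rewrite -xE.
have byw : box p L (p + (y + w)) by rewrite addrA -xE.
have [cS S0 dS bS] := HS by_; have [cS' S'0 dS' bS'] := HS byw.
pose V i j' t := \sum_k w 0 k * A k i j' (p + clamp01 t *: y).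
have inD t : 0 <= t <= 1 -> D (p + t *: y) by move=> t01; apply: bD; exact: in_box.
pose d j' t := S (y + w) j' t - S y j' t - t * \sum_i S y i t * V i j' t.
have cV i j' : continuous (V i j').
  by move=> t; apply: cvg_bigsum => k; apply: cvgM; [exact: cvg_cst|exact: (clamped_line_continuous (sA k i j') inD)].
have cd j' : continuous (d j').
  move=> t; apply: cvgB; first by apply: cvgB; [exact: cS'|exact: cS].
  by apply: cvgM; [exact: cvg_id|apply: cvg_bigsum => i; apply: cvgM; [exact: cS|exact: cV]].
have dV i j' (t : R) : 0 < t < 1 -> is_derive t 1 (V i j')
    (\sum_k \sum_m w 0 k * (y 0 m * pd m (A k i j') (p + t *: y))).
  move=> t01; apply: is_derive_bigsum => k; rewrite -mulr_sumr.
  apply: is_deriveZ; exact: (clamped_line_derive (sA k i j') inD).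
have dd j' (t : R) : 0 < t < 1 -> is_derive t 1 (d j')
   (\sum_i d i t * ray_coef (y + w) i j' t + \sum_l S y l t * rho y w l j' t).
  move=> t01; have cy : clamp01 t = t by apply: clamp01_id; case/andP: t01 => /ltW -> /ltW ->.
  pose SV t := \sum_i S y i t * V i j' t.
  have dSV : is_derive t 1 SV (\sum_i ((\sum_l S y l t * ray_coef y l i t) * V i j' t
       + S y i t * (\sum_k \sum_m w 0 k * (y 0 m * pd m (A k i j') (p + t *: y))))).
    apply: is_derive_bigsum => i.
    exact: is_derive_mul (dS i t t01) (dV i j' t t01).
  have dtSV : is_derive t 1 (fun s => s * SV s) (SV t + t * (\sum_i ((\sum_l S y l t * ray_coef y l i t) * V i j' t
       + S y i t * (\sum_k \sum_m w 0 k * (y 0 m * pd m (A k i j') (p + t *: y)))))).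
    by have := is_derive_mul (is_derive_id t 1) dSV; rewrite mul1r.
  have := is_deriveB (is_deriveB (dS' j' t t01) (dS j' t t01)) dtSV.
  move/is_derive_eq; apply.
  rewrite /SV; have -> : \sum_i d i t * ray_coef (y + w) i j' t =
      \sum_i S (y + w) i t * ray_coef (y + w) i j' t - \sum_i S y i t * ray_coef (y + w) i j' t
      - t * \sum_l S y l t * (\sum_i V l i t * ray_coef (y + w) i j' t).
    have -> : \sum_l S y l t * (\sum_i V l i t * ray_coef (y + w) i j' t) =
        \sum_i (\sum_l S y l t * V l i t) * ray_coef (y + w) i j' t.
      under eq_bigr do rewrite mulr_sumr; rewrite exchange_big; apply: eq_bigr => i _.
      by rewrite mulr_suml; apply: eq_bigr => l _; rewrite mulrA.
    rewrite mulr_sumr -!sumrB; apply: eq_bigr => i _; rewrite /d.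
    by move: (\sum_i0 _) => *; ring.
  have -> : \sum_i ((\sum_l S y l t * ray_coef y l i t) * V i j' t
       + S y i t * (\sum_k \sum_m w 0 k * (y 0 m * pd m (A k i j') (p + t *: y)))) =
     \sum_l S y l t * (\sum_i ray_coef y l i t * V i j' t
       + \sum_k \sum_m w 0 k * (y 0 m * pd m (A k l j') (p + t *: y))).
    rewrite big_split /=.
    have -> : \sum_i (\sum_l S y l t * ray_coef y l i t) * V i j' t =
        \sum_l S y l t * \sum_i ray_coef y l i t * V i j' t.
      under [RHS]eq_bigr do rewrite mulr_sumr; rewrite [RHS]exchange_big; apply: eq_bigr => i _.
      by rewrite mulr_suml; apply: eq_bigr => l _; rewrite mulrA.
    by rewrite -big_split; apply: eq_bigr => l _ /=; rewrite mulrDr.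
  have VE l i : V l i t = \sum_k w 0 k * A k l i (p + t *: y) by rewrite /V cy.
  have -> : \sum_l S y l t * rho y w l j' t =
     \sum_l S y l t * ray_coef (y + w) l j' t - \sum_l S y l t * ray_coef y l j' t
     - \sum_l S y l t * V l j' t
     - t * (\sum_l S y l t * (\sum_i ray_coef y l i t * V i j' t
       + \sum_k \sum_m w 0 k * (y 0 m * pd m (A k l j') (p + t *: y))))
     + t * \sum_l S y l t * (\sum_i V l i t * ray_coef (y + w) i j' t).
    rewrite !mulr_sumr -!sumrB -big_split; apply: eq_bigr => l _ /=.
    rewrite /rho sumrB VE.
    have -> : \sum_i (\sum_k w 0 k * A k l i (p + t *: y)) * ray_coef (y + w) i j' t =
       \sum_i V l i t * ray_coef (y + w) i j' t by apply: eq_bigr => i _; rewrite VE.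
    have -> : \sum_i ray_coef y l i t * (\sum_k w 0 k * A k i j' (p + t *: y)) =
       \sum_i ray_coef y l i t * V i j' t by apply: eq_bigr => i _; rewrite VE.
    by move: (\sum_i V l i t * _) (\sum_i ray_coef y l i t * _) (\sum_k _) (\sum_k _) => *; ring.
  move: (\sum_i S (y + w) i t * _) (\sum_i S y i t * ray_coef y i j' t) (\sum_i S y i t * ray_coef (y + w) i j' t).
  move: (\sum_i S y i t * V i j' t) (\sum_l _ * (_ + _)) (\sum_l _ * _) => *; ring.
have J0 : 0 <= #|J|%:R * (n%:R * L * a) :> R by rewrite !mulr_ge0 // ltW.
have Cr0 : 0 <= Crho by rewrite !addr_ge0 ?mulr_ge0 ?addr_ge0 ?mulr_ge0 ?(ltW L0).
have N20 : 0 <= norm1 w ^+ 2 by exact: sqr_ge0.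
have := @gronwall_unit R J (ray_coef (y + w)) (fun j t => \sum_l S y l t * rho y w l j t) d
  (n%:R * L * a) (#|J|%:R * (2 * M * (Crho * norm1 w ^+ 2))) _ small _ cd _ dd _ _ j.
have -> : d j 1 = ray_solution j (x + w) - ray_solution j x
    - \sum_k (\sum_i ray_solution i x * A k i j x) * w 0 k.
  have yw' : x + w - p = y + w by rewrite /y addrAC.
  rewrite /d /ray_solution yw' -/y mul1r; congr (_ - _).
  have c1 : clamp01 1 = 1 :> R by apply: clamp01_id; rewrite ler01 lexx.
  rewrite /V c1 scale1r -xE; under eq_bigr do rewrite mulr_sumr; rewrite exchange_big.
  by apply: eq_bigr => k _; rewrite mulr_suml; apply: eq_bigr => i _; rewrite [w 0 k * _]mulrC mulrA.
have -> : 2 * (#|J|%:R * (2 * M * (Crho * norm1 w ^+ 2))) = 2 * (#|J|%:R * (2 * M * Crho)) * norm1 w ^+ 2.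
  by ring.
apply.
- by rewrite !mulr_ge0 // ltW.
- by apply: mulr_ge0 => //; apply: mulr_ge0; [exact: mulr_ge0|exact: mulr_ge0 Cr0 N20].
- by move=> i; rewrite /d S0 S'0 subrr mul0r subrr.
- by move=> i j' t _; exact: coef_bound.
- move=> i t t01; rewrite (le_trans (ler_norm_sum _ _ _)) //.
  have -> : #|J|%:R * (2 * M * (Crho * norm1 w ^+ 2)) = \sum_(l : J) 2 * M * (Crho * norm1 w ^+ 2).
    by rewrite sumr_const -[RHS]mulr_natl.
  by apply: ler_sum => l _; rewrite normrM ler_pM // rho_bound.
Qed.

End local.

(* Frobenius for a flat linear connection: integrate along the rays from [p]. *)
Theorem flat_system_solution (p : 'rV[R]_n) (s0 : J -> R) : D p ->
  exists (V : set 'rV[R]_n) (s : J -> 'rV[R]_n -> R), [/\ open V, V p, V `<=` D,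
    (forall j, s j p = s0 j) &
    forall j, smooth_on V (s j) /\
      forall i x, V x -> pd i (s j) x = \sum_k s k x * A i k j x].
Proof.
move=> Dp; have [L1 L10 HL1] := nbhs_box (open_nbhs_nbhs (conj oD Dp)).
have bD1 : box p L1 `<=` D by exact: HL1.
have [a a_gt0 Ha] := box_bounded_fin (f := fun q : 'I_n * J * J => A q.1.1 q.1.2 q.2) bD1
  (fun q => sA q.1.1 q.1.2 q.2).
have [a1 a1_gt0 Ha1] := box_bounded_fin (f := fun q : 'I_n * 'I_n * J * J => pd q.1.1.1 (A q.1.1.2 q.1.2 q.2)) bD1
  (fun q => smooth_partial _ (sA q.1.1.2 q.1.2 q.2)).
have [a2 a2_gt0 Ha2] := box_bounded_fin (f := fun q : 'I_n * 'I_n * 'I_n * J * J =>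
    pd q.1.1.1.1 (pd q.1.1.1.2 (A q.1.1.2 q.1.2 q.2))) bD1
  (fun q => smooth_partial _ (smooth_partial _ (sA q.1.1.2 q.1.2 q.2))).
(* Chosen so that L <= 1 / K gives the smallness |J| n L a <= 1 / 2 required along the rays. *)
pose K := 2 * (#|J|%:R * n%:R * a) + 1.
have K0 : 0 < K by rewrite ltr_wpDl // !mulr_ge0 // ltW.
pose L := Num.min L1 K^-1.
have L0 : 0 < L by rewrite lt_min L10 invr_gt0.
have LK : L <= K^-1 by rewrite ge_min lexx orbT.
have bb : box p L `<=` box p L1.
  by move=> x bx i; rewrite (le_trans (bx i)) // ge_min lexx.
have bD : box p L `<=` D by move=> x /bb /bD1.
have small : #|J|%:R * (n%:R * L * a) <= 2^-1.
  have -> : #|J|%:R * (n%:R * L * a) = #|J|%:R * n%:R * a * L by ring.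
  apply: (@le_trans _ _ (#|J|%:R * n%:R * a * K^-1)).
    by rewrite ler_wpM2l // !mulr_ge0 // ltW.
  by rewrite ler_pdivrMr // /K; lra.
have Aa i al be x : box p L x -> `|A i al be x| <= a.
  by move=> /bb bx; exact: (Ha (i, al, be)).
have Aa1 k i al be x : box p L x -> `|pd k (A i al be) x| <= a1.
  by move=> /bb bx; exact: (Ha1 (k, i, al, be)).
have Aa2 k l i al be x : box p L x -> `|pd k (pd l (A i al be)) x| <= a2.
  by move=> /bb bx; exact: (Ha2 (k, l, i, al, be)).
pose s := ray_solution s0 L0 bD (ltW a_gt0) Aa small.
pose V := ball p L.
have Vb x : V x -> box p L x.
  rewrite /V -ball_normE /= => h i; apply: le_trans (ltW h).
  rewrite distrC [leRHS]/Num.Def.normr /= mx_normrE.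
  have := le_bigmax (0 : R) (fun ij => `|(p - x) ij.1 ij.2|) (0, i); rewrite /= !mxE distrC.
  by [].
have oV : open V by exact: ball_open.
have ds j x : V x -> differentiable (s j) x /\ forall i, pd i (s j) x = \sum_k s k x * A i k j x.
  move=> Vx; have [d /= d0 Hd] : nbhs_ball x V by apply/nbhs_ballP; exact: open_nbhs_nbhs.
  apply: (@partial_of_quadratic R n (s j) x (fun i => \sum_k s k x * A i k j x) _ d _ d0); last first.
    move=> w wd; apply: (ray_solution_increment s0 L0 bD (ltW a_gt0) (ltW a1_gt0) (ltW a2_gt0) Aa Aa1 Aa2 small).
      exact: Vb.
    by apply: Vb; apply: Hd; rewrite -ball_normE /= opprD addNKr normrN.
  rewrite !mulr_ge0 ?sumr_ge0 // !addr_ge0 ?mulr_ge0 ?addr_ge0 ?mulr_ge0 //; exact: ltW.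
have VD : V `<=` D by move=> x /Vb /bD.
exists V, s; split => // [|j|j]; first exact: ballxx.
  exact: ray_solution_base.
split => [|i x Vx]; last by have [_ ->] := ds j x Vx.
(* The first derivatives of the solution are combinations of its components with smooth
   coefficients, so all orders follow at once. *)
apply: (@smooth_closure_smooth R n V (fun f => exists j, f = s j)) => //.
- by move=> _ [j' ->] x Vx; have [] := ds j' x Vx.
- move=> _ i [j' ->]; exists (fun x => \sum_k s k x * A i k j' x); last first.
    by move=> x Vx; have [_ ->] := ds j' x Vx.
  elim: (index_enum J) => [|k r IH].
    have -> : (fun x : 'rV[R]_n => \sum_(k <- [::]) s k x * A i k j' x) = (fun=> 0).
      by apply/funext => x; rewrite big_nil.
    by apply: sc_smooth; exact: smooth_cst.
  have -> : (fun x : 'rV[R]_n => \sum_(k <- k :: r) s k x * A i k j' x) =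
      (fun x => s k x * A i k j' x + \sum_(k <- r) s k x * A i k j' x).
    by apply/funext => x; rewrite big_cons.
  apply: sc_add => //; apply: sc_mul.
    by apply: sc_base; exists k.
  by apply: sc_smooth; exact: smooth_sub VD (sA i k j').
- by apply: sc_base; exists j.
Qed.

End flat_system.

(** * Conformal flatness *)

Lemma sum_delta (R : realType) n (i : 'I_n) (f : 'I_n -> R) : \sum_l f l * (i == l)%:R = f i.
Proof.
rewrite (bigD1 i) //= eqxx mulr1 big1 ?addr0 // => l li.
by rewrite eq_sym (negPf li) mulr0.
Qed.

(** * Curvature of a conformal metric *)

Section conformal_change.
Context {R : realType} {n : nat}.
Variables (D : set 'rV[R]_n) (G : 'rV[R]_n -> 'M[R]_n) (u : 'rV[R]_n -> R).
Hypothesis lm : local_metric D G.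
Hypothesis su : smooth_on D u.

Let oD := lm_open lm.
Let sG := lm_smooth lm.
Let siG := ginv_smooth lm.

Definition conformal (x : 'rV[R]_n) := expR (2 * u x) *: G x.

Definition differential (x : 'rV[R]_n) : 'rV[R]_n := \row_k pd k u x.
Definition gradient (x : 'rV[R]_n) : 'rV[R]_n := differential x *m iG G x.
Definition hess i (x : 'rV[R]_n) : 'rV[R]_n := dmx i differential x - differential x *m (om G i x)^T.

Let c k x := pd k u x.
Let v l x := gradient x 0 l.

Let duE x k : differential x 0 k = c k x. Proof. by rewrite mxE. Qed.

Let sdu : mxsmooth D differential.
Proof. by move=> i k; under eq_fun do rewrite mxE; exact: smooth_partial. Qed.

Let sgu : mxsmooth D gradient. Proof. exact: mxsmoothM. Qed.

Let se : smooth_on D (fun x => expR (2 * u x)).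
Proof. by apply: smooth_expR => //; apply: smoothM => //; exact: smooth_cst. Qed.

Let lmc : local_metric D conformal.
Proof.
split=> // [|x Dx|x Dx w w0]; first exact: mxsmoothZ.
  by rewrite trmxZ (lm_sym lm).
by rewrite -scalemxAr -scalemxAl scalemxE mulr_gt0 ?expR_gt0 //; exact: (lm_pos lm).
Qed.

(** The change of the Christoffel symbols caused by the factor e^(2u); [omc] confirms it by
    [om_uniq]. *)
Let B i x : 'M[R]_n := \matrix_(k, l) (c k x * (i == l)%:R + c i x * (k == l)%:R - G x i k * v l x).

Let BE i x k l : B i x k l = c k x * (i == l)%:R + c i x * (k == l)%:R - G x i k * v l x.
Proof. by rewrite mxE. Qed.

Let sumB i x (a : 'I_n -> R) l : \sum_m a m * B i x m l =
  (\sum_m a m * c m x) * (i == l)%:R + c i x * a l - (\sum_m a m * G x i m) * v l x.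
Proof.
under eq_bigr do rewrite BE.
have -> : c i x * a l = \sum_m c i x * (a m * (l == m)%:R) by rewrite -mulr_sumr sum_delta.
rewrite !mulr_suml -big_split -sumrB; apply: eq_bigr => m _ /=.
by rewrite [m == l]eq_sym; move: (_%:R) (_%:R) => *; ring.
Qed.

Let Bsum k i x (a : 'I_n -> R) : \sum_m B i x k m * a m =
  c k x * a i + c i x * a k - G x i k * \sum_m v m x * a m.
Proof.
under eq_bigr do rewrite BE.
have -> : c k x * a i = \sum_m c k x * (a m * (i == m)%:R) by rewrite -mulr_sumr sum_delta.
have -> : c i x * a k = \sum_m c i x * (a m * (k == m)%:R) by rewrite -mulr_sumr sum_delta.
rewrite mulr_sumr -big_split -sumrB; apply: eq_bigr => m _ /=.
by move: (_%:R) (_%:R) => *; ring.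
Qed.

Let sum_vG i x : D x -> \sum_m v m x * G x i m = c i x.
Proof.
move=> Dx; rewrite -duE -[differential x]mulmx1 -(mulVG lm Dx) mulmxA -/(gradient x) mxmulE.
by apply: eq_bigr => m _; rewrite (lm_symE lm i m).
Qed.

Let omc i x : D x -> om conformal i x = om G i x + B i x.
Proof.
move=> Dx; symmetry; apply: (om_uniq lmc Dx (W := fun i => om G i x + B i x)) => [j k l|j].
  rewrite [LHS]addmxE [RHS]addmxE (om_sym lm) // !BE (lm_symE lm j k) //.
  by congr (_ + _); congr (_ - _); rewrite addrC.
rewrite /conformal (@dmxZ _ _ D) // (om_compat lm) //.
apply/matrixP => k m; rewrite addmxE !scalemxE [RHS]addmxE.
have pe : pd j (fun y => expR (2 * u y)) x = expR (2 * u x) * (2 * c j x).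
  rewrite (@partial_comp1 _ _ expR (fun y => 2 * u y) x (expR (2 * u x))) //.
    by rewrite partialZ //; exact: (smooth_differentiable su).
  by apply: differentiableZ; exact: (smooth_differentiable su).
have E1 : ((om G j x + B j x) *m (expR (2 * u x) *: G x)) k m = expR (2 * u x) *
    ((om G j x *m G x) k m + (c k x * G x j m + c j x * G x k m - G x j k * c m x)).
  rewrite -scalemxAr scalemxE mulmxDl addmxE; congr (_ * (_ + _)).
  rewrite mxmulE Bsum; congr (_ - _ * _).
  by rewrite -(sum_vG m Dx); apply: eq_bigr => s _; rewrite (lm_symE lm s m).
have E2 : ((expR (2 * u x) *: G x) *m (om G j x + B j x)^T) k m = expR (2 * u x) *
    ((G x *m (om G j x)^T) k m + (c m x * G x j k + c j x * G x k m - G x j m * c k x)).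
  rewrite -scalemxAl scalemxE trmxD mulmxDr addmxE; congr (_ * (_ + _)).
  rewrite mxmulE; under eq_bigr do rewrite trmxE mulrC.
  by rewrite Bsum (sum_vG k Dx) (lm_symE lm k m) // (lm_symE lm k j).
by rewrite E1 E2 pe addmxE; move: ((om G j x *m G x) k m) ((G x *m _) k m) => *; ring.
Qed.

Let dgu i x : D x -> dmx i gradient x = hess i x *m iG G x - gradient x *m om G i x.
Proof.
move=> Dx; rewrite (@dmxM _ _ D) // (diG lm) // /hess /gradient.
by mxring.
Qed.

Lemma hessE i k x : hess i x 0 k = pd i (pd k u) x - \sum_m pd m u x * om G i x k m.
Proof.
rewrite /hess addmxE oppmxE dmxE mxmulE; congr (_ - _).
  by under eq_fun do rewrite mxE.
by apply: eq_bigr => m _; rewrite duE trmxE.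
Qed.

Let conformal_cur_local i j k l x : D x -> cur conformal i j x k l =
  cur G i j x k l + hess i x 0 k * (j == l)%:R - hess j x 0 k * (i == l)%:R
  - G x j k * (hess i x *m iG G x) 0 l + G x i k * (hess j x *m iG G x) 0 l
  + c k x * c j x * (i == l)%:R - c k x * c i x * (j == l)%:R
  - c j x * G x i k * v l x + c i x * G x j k * v l x
  - (\sum_m v m x * c m x) * (G x j k * (i == l)%:R - G x i k * (j == l)%:R).
Proof.
move=> Dx.
have dW a b : dmx a (om conformal b) x k l = dmx a (om G b) x k l
   + (hess a x 0 k + \sum_m c m x * om G a x k m) * (b == l)%:R
   + (hess a x 0 b + \sum_m c m x * om G a x b m) * (k == l)%:R
   - ((\sum_m om G a x b m * G x k m) + \sum_m om G a x k m * G x b m) * v l x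
   - G x b k * ((hess a x *m iG G x) 0 l - \sum_m v m x * om G a x m l).
  rewrite (eq_on_dmx oD a (B := fun y => om G b y + B b y) _ Dx); last exact: omc.
  have dC q : differentiable (fun y => c q y) x.
    by apply: smooth_differentiable Dx; exact: smooth_partial.
  have dv : differentiable (fun y => v l y) x := smooth_differentiable (sgu 0 l) Dx.
  have dG : differentiable (fun y => G y b k) x := smooth_differentiable (sG b k) Dx.
  have dom : differentiable (fun y => om G b y k l) x := smooth_differentiable (om_smooth lm b k l) Dx.
  have dB : differentiable (fun y => B b y k l) x.
    under eq_fun do rewrite BE.
    apply: differentiableB; last exact: differentiableM.
    by apply: differentiableD; apply: differentiableM.
  rewrite dmxE; under eq_fun do rewrite addmxE.
  rewrite partialD // -dmxE -!addrA; congr (_ + _).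
  under eq_fun do rewrite BE.
  have dcd q (z : R) : differentiable (fun y => c q y * z) x by apply: differentiableM.
  rewrite partialB ?partialD ?partialM //; last by apply: differentiableM.
    rewrite !partial_cst.
    have -> : pd a (fun y => G y b k) x = \sum_m om G a x b m * G x k m + \sum_m om G a x k m * G x b m.
      rewrite -dmxE (om_compat lm) // addmxE !mxmulE; congr (_ + _); apply: eq_bigr => m _.
        by rewrite (lm_symE lm m k).
      by rewrite trmxE mulrC.
    have -> : pd a (v l) x = (hess a x *m iG G x) 0 l - \sum_m v m x * om G a x m l.
      by rewrite -dmxE dgu // addmxE oppmxE [(gradient x *m _) 0 l]mxmulE.
    have h q : pd a (c q) x = hess a x 0 q + \sum_m c m x * om G a x q m by rewrite hessE subrK.
    by rewrite !h; move: (_%:R) (_%:R) (\sum_m _) (\sum_m _) (\sum_m _) (\sum_m _) (\sum_m _) => *; ring.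
  by apply: differentiableD; exact: dcd.
have curX G' : cur G' i j x k l = dmx i (om G' j) x k l - dmx j (om G' i) x k l
    + \sum_m om G' j x k m * om G' i x m l - \sum_m om G' i x k m * om G' j x m l.
  by rewrite cur.unlock !(addmxE, oppmxE) !mxmulE.
rewrite !curX !dW.
have oE a p q : om conformal a x p q = om G a x p q + B a x p q by rewrite omc // addmxE.
have oW a b : \sum_m om conformal a x k m * om conformal b x m l =
    \sum_m om G a x k m * om G b x m l
    + ((\sum_m c m x * om G a x k m) * (b == l)%:R + c b x * om G a x k l
       - (\sum_m om G a x k m * G x b m) * v l x)
    + (c k x * om G b x a l + c a x * om G b x k l - G x a k * \sum_m v m x * om G b x m l)
    + (c k x * (c a x * (b == l)%:R + c b x * (a == l)%:R - G x b a * v l x)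
       + c a x * (c k x * (b == l)%:R + c b x * (k == l)%:R - G x b k * v l x)
       - G x a k * ((\sum_m v m x * c m x) * (b == l)%:R + c b x * v l x - c b x * v l x)).
  have -> : \sum_m om conformal a x k m * om conformal b x m l =
    \sum_m om G a x k m * om G b x m l + \sum_m om G a x k m * B b x m l
    + \sum_m B a x k m * om G b x m l + \sum_m B a x k m * B b x m l.
    rewrite -!big_split; apply: eq_bigr => m _ /=.
    by rewrite !oE; ring.
  rewrite (sumB b x (fun m => om G a x k m)) !Bsum (sumB b x (fun m => v m x)) !BE (sum_vG b Dx).
  have -> : \sum_m om G a x k m * c m x = \sum_m c m x * om G a x k m.
    by apply: eq_bigr => m _; rewrite mulrC.
  by [].
rewrite !oW.
have hs : hess i x 0 j = hess j x 0 i.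
  rewrite !hessE (smooth_partial_comm oD i j su Dx); congr (_ - _).
  by apply: eq_bigr => m _; rewrite (om_sym lm).
have os a b q : \sum_m om G a x b m * G x q m = \sum_m om G b x a m * G x q m.
  by apply: eq_bigr => m _; rewrite (om_sym lm).
have as_ a b : \sum_m c m x * om G a x b m = \sum_m c m x * om G b x a m.
  by apply: eq_bigr => m _; rewrite (om_sym lm).
rewrite (os j i) (os j k i) (os i k j) (as_ j i) (as_ j k) (as_ i k) hs (om_sym lm j i l) //.
rewrite (om_sym lm j k l) // (om_sym lm i k l) // (lm_symE lm j i) //.
move: (\sum_m v m x * c m x) ((hess j x *m _) 0 l) ((hess i x *m _) 0 l) => N X Y.
move: (hess j x 0 i) (hess j x 0 k) (hess i x 0 k) => h1 h2 h3.
move: (_%:R) (_%:R) (_%:R) => d1 d2 d3.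
move: (\sum_m om G k x j m * G x i m) (\sum_m om G k x i m * G x j m) (\sum_m om G i x j m * G x k m) => o1 o2 o3.
by ring.
Qed.

Lemma conformal_cur i j k l x : D x -> cur conformal i j x k l =
  cur G i j x k l + hess i x 0 k * (j == l)%:R - hess j x 0 k * (i == l)%:R
  - G x j k * (hess i x *m iG G x) 0 l + G x i k * (hess j x *m iG G x) 0 l
  + pd k u x * pd j u x * (i == l)%:R - pd k u x * pd i u x * (j == l)%:R
  - pd j u x * G x i k * gradient x 0 l + pd i u x * G x j k * gradient x 0 l
  - (\sum_m gradient x 0 m * pd m u x) * (G x j k * (i == l)%:R - G x i k * (j == l)%:R).
Proof. exact: conformal_cur_local. Qed.

End conformal_change.

Lemma sum_option (R : realType) (I : finType) (F : option I -> R) :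
  \sum_j F j = F None + \sum_i F (Some i).
Proof.
rewrite (bigD1 None) //=; congr (_ + _); rewrite (reindex_omap Some id) => [|[]] //=.
by apply: eq_bigl => i; rewrite eqxx.
Qed.

(** * The conformal tractor connection *)

Section weyl_schouten.
Context {R : realType} {n : nat}.
Variables (D : set 'rV[R]_n) (G P : 'rV[R]_n -> 'M[R]_n).
Hypothesis lm : local_metric D G.
Hypothesis sP : mxsmooth D P.
Hypothesis P_tr : forall x, D x -> (P x)^T = P x.
Hypothesis P_codazzi : forall i j k x, D x -> Dc G i P x j k = Dc G j P x i k.
(* The Weyl tensor vanishes; P is the Schouten tensor, and P_codazzi says that the Cotton
   tensor vanishes. *)
Hypothesis curvP : forall i j x, D x -> Rm G i j x = kn (P x) (G x) i j.

Let oD := lm_open lm.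
Let sG := lm_smooth lm.
Let siG := ginv_smooth lm.

Definition raise x : 'M[R]_n := P x *m iG G x.

Let P_symE x i j : D x -> P x i j = P x j i.
Proof. by move=> Dx; rewrite -{1}(P_tr Dx) mxE. Qed.

Let s_raise : mxsmooth D raise. Proof. exact: mxsmoothM. Qed.

Let raise_codazzi i j k x : D x ->
  pd i (fun y => raise y j k) x - \sum_m om G j x i m * raise x m k + \sum_m raise x j m * om G i x m k =
  pd j (fun y => raise y i k) x - \sum_m om G i x j m * raise x m k + \sum_m raise x i m * om G j x m k.
Proof.
move=> Dx.
have H a : dmx a raise x = om G a x *m raise x + Dc G a P x *m iG G x - raise x *m om G a x.
  rewrite /raise (@dmxM _ _ D) // (diG lm) // /Dc; mxring.
have E a b : pd a (fun y => raise y b k) x = \sum_m om G a x b m * raise x m k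
    + \sum_m Dc G a P x b m * iG G x m k - \sum_m raise x b m * om G a x m k.
  by rewrite -dmxE H addmxE oppmxE [X in X - _]addmxE !mxmulE.
have -> : \sum_m om G j x i m * raise x m k = \sum_m om G i x j m * raise x m k.
  by apply: eq_bigr => m _; rewrite (om_sym lm).
rewrite !E; have -> : \sum_m om G j x i m * raise x m k = \sum_m om G i x j m * raise x m k.
  by apply: eq_bigr => m _; rewrite (om_sym lm).
have -> : \sum_m Dc G i P x j m * iG G x m k = \sum_m Dc G j P x i m * iG G x m k.
  by apply: eq_bigr => m _; rewrite P_codazzi.
by move: (\sum_m raise x i m * _) (\sum_m raise x j m * _) => *; ring.
Qed.

Let curE_P i j k l x : D x -> cur G i j x k l =
  raise x i l * G x j k + (i == l)%:R * P x j k - P x i k * (j == l)%:R - G x i k * raise x j l.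
Proof.
move=> Dx; have dd a : (a == l)%:R = \sum_m G x a m * iG G x m l :> R.
  by rewrite -mxmulE (mulGV lm Dx) mxE.
rewrite (curG lm) // mxmulE curvP // !dd /raise !mxmulE !mulr_sumr !mulr_suml.
rewrite -big_split -!sumrB; apply: eq_bigr => m _ /=; rewrite knE.
by move: (G x j k) (iG G x m l) => *; ring.
Qed.

(* Parallel sections [sigma, rho, mu] of the conformal tractor connection:
   d_i sigma = mu_i, nabla_i mu_j = rho G_ij - sigma P_ij, d_i rho = - P_i^k mu_k. *)
Definition tractor (i : 'I_n) (al be : option (option 'I_n)) (x : 'rV[R]_n) : R :=
  match al, be with
  | None, Some (Some j) => - P x i j
  | Some None, Some (Some j) => G x i j
  | Some (Some k), None => (i == k)%:R
  | Some (Some k), Some None => - raise x i k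
  | Some (Some k), Some (Some j) => om G i x j k
  | _, _ => 0
  end.

Let s_tractor i al be : smooth_on D (tractor i al be).
Proof.
have c0 c : smooth_on D (fun=> c : R) by exact: smooth_cst.
case: al be => [[k|]|] [[j|]|]; try exact: c0.
- exact: (om_smooth lm i j k).
- exact: (@smoothN _ _ D oD _ (s_raise i k)).
- exact: sG.
- exact: (@smoothN _ _ D oD _ (sP i j)).
Qed.

(** Block by block: the middle block is the curvature formula [curE_P], two blocks are the Cotton
    equation for P, and the others follow from the symmetry of the Christoffel symbols, metric
    compatibility and the symmetry of G, P and P g^-1 P. *)
Let tractor_flat i j al be x : D x ->
  pd i (tractor j al be) x - pd j (tractor i al be) x
  + \sum_g (tractor i al g x * tractor j g be x - tractor j al g x * tractor i g be x) = 0.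
Proof.
move=> Dx.
have swap (f g : 'I_n -> R) : \sum_m (f m * g m) = \sum_m (g m * f m).
  by apply: eq_bigr => m _; rewrite mulrC.
have sN (f g : 'I_n -> R) : \sum_m f m * - g m = - \sum_m f m * g m.
  by rewrite -sumrN; apply: eq_bigr => m _; rewrite mulrN.
have Ns (f g : 'I_n -> R) : \sum_m - f m * g m = - \sum_m f m * g m.
  by rewrite -sumrN; apply: eq_bigr => m _; rewrite mulNr.
rewrite !sum_option sumrB.
case: al be => [[k|]|] [[l|]|] /=; rewrite ?partial_cst ?(mul0r, mulr0, subrr, add0r, addr0, oppr0).
- have := curE_P i j l k Dx; rewrite cur.unlock !(addmxE, oppmxE) !dmxE ![(om _ _ _ *m _) l k]mxmulE.
  rewrite (swap _ (fun m => om G j x l m)) (swap _ (fun m => om G i x l m)).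
  rewrite -[tractor j _ _]/(fun y => om G j y l k) -[tractor i _ _]/(fun y => om G i y l k).
  move: (pd _ _ _) (pd _ _ _) (\sum_m _) (\sum_m _) (_%:R) (_%:R) => a b c d e f H.
  by move/eqP: H; rewrite -subr_eq0 => /eqP H; rewrite -[RHS]H; ring.
- rewrite !sN -[tractor j _ _]/(fun y => - raise y j k) -[tractor i _ _]/(fun y => - raise y i k).
  rewrite !partialN; try exact: (smooth_differentiable (s_raise _ _)).
  have := raise_codazzi i j k Dx.
  have -> : \sum_m om G j x i m * raise x m k = \sum_m om G i x j m * raise x m k.
    by apply: eq_bigr => m _; rewrite (om_sym lm).
  rewrite (swap (fun m => om G i x m k)) (swap (fun m => om G j x m k)).
  by move: (pd _ _ _) (pd _ _ _) (\sum_m _) (\sum_m _) (\sum_m _) => a b c d e; lra.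
- by rewrite !sum_delta (om_sym lm) ?subrr.
- have E a b : pd a (fun y => G y b l) x = \sum_m om G a x b m * G x m l + \sum_m G x b m * om G a x l m.
    rewrite -dmxE (om_compat lm) // addmxE !mxmulE; congr (_ + _).
    by apply: eq_bigr => m _; rewrite trmxE.
  rewrite -[tractor j _ _]/(fun y => G y j l) -[tractor i _ _]/(fun y => G y i l).
  rewrite !E; have -> : \sum_m om G j x i m * G x m l = \sum_m om G i x j m * G x m l.
    by apply: eq_bigr => m _; rewrite (om_sym lm).
  by move: (\sum_m _) (\sum_m _) (\sum_m _) => *; ring.
- rewrite !sN; have E a b : \sum_m G x a m * raise x b m = P x b a.
    transitivity ((raise x *m G x) b a).
      by rewrite mxmulE; apply: eq_bigr => m _; rewrite mulrC (lm_symE lm a m).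
    by rewrite /raise -mulmxA (mulVG lm) // mulmx1.
  by rewrite !E (P_symE i j) // subrr.
- by rewrite !sum_delta (lm_symE lm) ?subrr.
- rewrite -[tractor j _ _]/(fun y => - P y j l) -[tractor i _ _]/(fun y => - P y i l).
  rewrite !Ns !partialN; try exact: (smooth_differentiable (sP _ _)).
  have := P_codazzi i j l Dx; rewrite /Dc !(addmxE, oppmxE) !dmxE !mxmulE.
  have -> : \sum_m om G j x i m * P x m l = \sum_m om G i x j m * P x m l.
    by apply: eq_bigr => m _; rewrite (om_sym lm).
  have tr (f : 'I_n -> R) (A : 'M[R]_n) : \sum_m f m * A^T m l = \sum_m f m * A l m.
    by apply: eq_bigr => m _; rewrite trmxE.
  rewrite !tr.
  by move: (pd _ _ _) (pd _ _ _) (\sum_m _) (\sum_m _) (\sum_m _) => a b c d e; lra.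
- rewrite !Ns !sN !opprK; have E a b : \sum_m P x a m * raise x b m = (P x *m iG G x *m P x) b a.
    by rewrite mxmulE; apply: eq_bigr => m _; rewrite mulrC (P_symE a m).
  rewrite !E -[X in X - _]trmxE !trmx_mul (ginv_sym lm) // P_tr // mulmxA subrr.
  by [].
- by rewrite !Ns !sum_delta P_symE ?subrr.
Qed.

Theorem weyl_schouten (p : 'rV[R]_n) : D p ->
  exists (V : set 'rV[R]_n) (u : 'rV[R]_n -> R),
    [/\ open V, V p, V `<=` D, smooth_on V u & flat_on V (fun x => expR (2 * u x) *: G x)].
Proof.
move=> Dp.
(* A parallel section with sigma = 1 at p; the conserved quantity 2 sigma rho - |mu|^2
   vanishes at p, and sigma^-2 g is flat. *)
have [V0 [s [oV0 V0p V0D s0 Hs]]] := flat_system_solution oD s_tractor tractor_flat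
  (fun al => if al is None then 1 else 0) Dp.
have ss al : smooth_on V0 (s al) by have [] := Hs al.
pose sg := s None; pose rh := s (Some None); pose mu k := s (Some (Some k)).
pose m (x : 'rV[R]_n) : 'rV[R]_n := \row_k mu k x.
have mE x k : m x 0 k = mu k x by rewrite mxE.
have dsg i (x : 'rV[R]_n) : V0 x -> pd i sg x = mu i x.
  move=> Vx; have [_ ->] := Hs None; rewrite // !sum_option /= !mulr0 !add0r.
  by rewrite -[RHS](sum_delta i (fun k => mu k x)).
have drh i (x : 'rV[R]_n) : V0 x -> pd i rh x = - \sum_k mu k x * raise x i k.
  move=> Vx; have [_ ->] := Hs (Some None); rewrite // !sum_option /= !mulr0 !add0r.
  by rewrite -sumrN; apply: eq_bigr => k _; rewrite mulrN.
have dmu i j (x : 'rV[R]_n) : V0 x -> pd i (mu j) x = rh x * G x i j - sg x * P x i j + \sum_k mu k x * om G i x j k.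
  move=> Vx; have [_ ->] := Hs (Some (Some j)); rewrite // !sum_option /= mulrN addrA.
  by rewrite [- _ + _]addrC.
have [e e0 He] : exists2 e : R, 0 < e & ball p e `<=` [set x | V0 x /\ 0 < sg x].
  have csg : {for p, continuous sg}.
    by apply: differentiable_continuous; exact: smooth_differentiable (ss None) V0p.
  have : \forall x \near p, 0 < sg x by apply: (cvgr_gt (sg p) csg); rewrite /sg s0 ltr01.
  move=> Hp; have : nbhs p [set x | V0 x /\ 0 < sg x].
    by apply: filterI Hp; exact: open_nbhs_nbhs.
  by move/nbhs_ballP => [e e0 He]; exists e.
pose V : set 'rV[R]_n := ball p e; have VV0 : V `<=` V0 by move=> x /He[].
have sg0 (x : 'rV[R]_n) : V x -> 0 < sg x by move=> /He[].
have oV : open V by exact: ball_open.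
have Vp : V p by exact: ballxx.
have VD : V `<=` D by move=> x /VV0 /V0D.
have lmV := local_metric_sub oV VD lm.
have ssV al : smooth_on V (s al) := smooth_sub VV0 (ss al).
have sm : mxsmooth V m by move=> i k; under eq_fun do rewrite mxE; exact: ssV.
have siGV := ginv_smooth lmV.
have dm i (x : 'rV[R]_n) : V x -> dmx i m x = rh x *: row i (G x) - sg x *: row i (P x) + m x *m (om G i x)^T.
  move=> Vx; have V0x := VV0 _ Vx; apply/matrixP => o j; rewrite (ord1 o) dmxE.
  under eq_fun do rewrite mxE.
  rewrite dmu // [RHS]addmxE; congr (_ + _); first by rewrite !mxE.
  by rewrite mxmulE; apply: eq_bigr => k _; rewrite mE trmxE.
have rowG i (x : 'rV[R]_n) : V x -> (row i (G x) *m iG G x *m (m x)^T) 0 0 = mu i x.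
  by move=> Vx; rewrite -row_mul (mulGV lmV) // -row_mul mul1mx mxE trmxE mE.
have rowP i (x : 'rV[R]_n) : V x -> (row i (P x) *m iG G x *m (m x)^T) 0 0 = \sum_k mu k x * raise x i k.
  move=> Vx; rewrite -row_mul mxmulE; apply: eq_bigr => k _.
  by rewrite trmxE mE mulrC mxE.
pose nm (x : 'rV[R]_n) : R := (m x *m iG G x *m (m x)^T) 0 0.
have snm : smooth_on V nm by apply: mxsmoothM => //; [exact: mxsmoothM|exact: mxsmooth_tr].
have dnm i (x : 'rV[R]_n) : V x -> pd i nm x = 2 * (rh x * mu i x - sg x * \sum_k mu k x * raise x i k).
  move=> Vx; rewrite /nm -dmxE (@dmxM _ _ V) //; [|exact: mxsmoothM|exact: mxsmooth_tr].
  rewrite (@dmxM _ _ V) // dmx_tr dm // (diG lmV) //.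
  pose z := rh x *: row i (G x) - sg x *: row i (P x).
  rewrite -/z; transitivity ((z *m iG G x *m (m x)^T + (z *m iG G x *m (m x)^T)^T) 0 0).
    by clearbody z; congr (fun_of_matrix _ 0 0); rewrite !trmx_mul (ginv_sym lmV) // trmxK; mxring.
  have -> : z *m iG G x *m (m x)^T = rh x *: (row i (G x) *m iG G x *m (m x)^T)
      - sg x *: (row i (P x) *m iG G x *m (m x)^T).
    by rewrite /z !mulmxBl -!scalemxAl.
  move: (rowG i x Vx) (rowP i x Vx); move: (row i (G x) *m _ *m _) (row i (P x) *m _ *m _) => a b Ea Eb.
  by rewrite addmxE trmxE addmxE oppmxE !scalemxE Ea Eb; ring.
pose q (x : 'rV[R]_n) : R := 2 * (sg x * rh x) - nm x.
have sq : smooth_on V q.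
  by apply: smoothB => //; apply: smoothM => //; [exact: smooth_cst|apply: smoothM => //; exact: ssV].
have dq i (x : 'rV[R]_n) : V x -> pd i q x = 0.
  move=> Vx; have V0x := VV0 _ Vx; have d al := smooth_differentiable (ssV al) Vx.
  rewrite /q partialB; [|by apply: differentiableZ; apply: differentiableM; exact: d
    |exact: smooth_differentiable Vx].
  rewrite dnm // partialZ; last by apply: differentiableM; exact: d.
  rewrite partialM; [|exact: d|exact: d].
  by rewrite dsg // drh //; ring.
have q0 (x : 'rV[R]_n) : V x -> nm x = 2 * (sg x * rh x).
  move=> Vx; have inV (t : R) : 0 <= t <= 1 -> V (p + t *: (x - p)).
    move=> /andP[t0 t1]; rewrite /V -ball_normE /= opprD addrA subrr sub0r normrN normrZ ger0_norm //.
    move: Vx; rewrite /V -ball_normE /= distrC; apply: le_lt_trans.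
    by rewrite -[leRHS]mul1r ler_wpM2r.
  have := @increment_bound _ _ V q p (x - p) 0 sq inV _.
  rewrite mulr0 subrKC normr_le0 subr_eq0 => H.
  have /eqP qp : q x == q p by apply: H => t t01 k; rewrite dq ?normr0 //; exact: inV.
  have np : nm p = 0.
    have m0 : m p = 0 by apply/matrixP => o k; rewrite (ord1 o) mE /mu s0 zeromxE.
    by rewrite /nm m0 !mul0mx zeromxE.
  have rp : rh p = 0 by rewrite /rh s0.
  by move: qp; rewrite /q np rp !mulr0 subr0 => /eqP; rewrite subr_eq0 => /eqP.
pose u (x : 'rV[R]_n) : R := - ln (sg x).
have su : smooth_on V u by apply: smoothN => //; apply: smooth_ln => //; exact: ssV.
have du k (x : 'rV[R]_n) : V x -> pd k u x = - (mu k x / sg x).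
  move=> Vx; have V0x := VV0 _ Vx; have d := smooth_differentiable (ssV None) Vx.
  rewrite /u partialN; last by apply: smooth_differentiable Vx; apply: smooth_ln => //; exact: ssV.
  rewrite (partial_comp1 k (is_derive1_ln (sg0 _ Vx)) d) dsg //; congr (- _); exact: mulrC.
exists V, u; split => // x Vx i j k l; have V0x := VV0 _ Vx.
rewrite -RmE /Rm mxmulE big1 // => b _.
have grad c : gradient G u x 0 c = - ((m x *m iG G x) 0 c / sg x).
  rewrite /gradient !mxmulE mulr_suml -sumrN; apply: eq_bigr => a _.
  by rewrite mE mxE du //; move: (iG _ _ _ _) => ?; ring.
have sgn : sg x != 0 by rewrite gt_eqF // sg0.
(* For u = - ln sigma the parallel equations give nabla du = P - (rho / sigma) g + du du. In
   [conformal_cur] the terms with P then cancel the curvature of g, and those with g cancel by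
   |du|^2 = 2 rho / sigma, which is [N]. *)
have h i' k' : hess G u i' x 0 k' = P x i' k' - rh x / sg x * G x i' k' + pd i' u x * pd k' u x.
  rewrite hessE.
  have -> : pd i' (pd k' u) x = - (pd i' (mu k') x / sg x) + mu i' x * mu k' x / sg x ^+ 2.
    have d al := smooth_differentiable (ssV al) Vx.
    have dV : differentiable (fun y => (sg y)^-1) x.
      apply: (smooth_differentiable _ Vx); apply: smoothV => [//||y Vy]; first exact: ssV.
      by rewrite gt_eqF // sg0.
    rewrite (eq_on_partial i' oV (g := fun y => - (mu k' y * (sg y)^-1)) _ Vx) => [|y Vy]; last exact: du.
    rewrite partialN; last by apply: differentiableM; [exact: d|].
    rewrite partialM; [|exact: d|by []]; rewrite partialV; [|exact: d|by []].
    by rewrite dsg //; field.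
  have -> : \sum_a pd a u x * om G i' x k' a = - ((\sum_a mu a x * om G i' x k' a) / sg x).
    by rewrite mulr_suml -sumrN; apply: eq_bigr => a _; rewrite du //; ring.
  by rewrite dmu // !du //; move: (\sum_a _) => ?; field.
have hu i' l' : (hess G u i' x *m iG G x) 0 l' = raise x i' l' - rh x / sg x * (i' == l')%:R
    + pd i' u x * gradient G u x 0 l'.
  have dd : (i' == l')%:R = \sum_a G x i' a * iG G x a l' :> R.
    by rewrite -mxmulE (mulGV lmV Vx) mxE.
  rewrite mxmulE dd /raise /gradient !mxmulE !mulr_sumr -sumrB -big_split; apply: eq_bigr => a _ /=.
  by rewrite h mxE; ring.
have N : \sum_a gradient G u x 0 a * pd a u x = 2 * (rh x / sg x).
  have -> : \sum_a gradient G u x 0 a * pd a u x = nm x / sg x ^+ 2.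
    rewrite /nm mxmulE mulr_suml; apply: eq_bigr => a _.
    by rewrite grad du // trmxE mE; field.
  by rewrite q0 //; field.
suff -> : cur (conformal G u) i j x k b = 0 by rewrite mul0r.
rewrite (conformal_cur lmV su) // curE_P //; last exact: VD.
rewrite !h !hu N.
by move: (_%:R) (_%:R) (gradient _ _ _ _ _) (raise _ _ _) (raise _ _ _) => *; ring.
Qed.

End weyl_schouten.

(** * Global argument *)

Section change_of_coordinates.
Context {R : realType} {n : nat}.
Variables (U U' : set 'rV[R]_n) (G G' : 'rV[R]_n -> 'M[R]_n).
Variable tau : 'rV[R]_n -> 'rV[R]_n.
Hypotheses (lm : local_metric U G) (lm' : local_metric U' G').

Definition jacmx (x : 'rV[R]_n) : 'M[R]_n := \matrix_(i, p) pd i (fun y => tau y 0 p) x.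

Hypothesis s_tau : forall k, smooth_on U (fun x => tau x 0 k).
Hypothesis tauU : forall x, U x -> U' (tau x).
Hypothesis GG' : forall x, U x -> G x = jacmx x *m G' (tau x) *m (jacmx x)^T.

Let oU := lm_open lm.
Let sG := lm_smooth lm.
Local Notation J := jacmx.

Let JE x i p : J x i p = pd i (fun y => tau y 0 p) x. Proof. by rewrite mxE. Qed.

Let sJ : mxsmooth U J.
Proof. by move=> i p; under eq_fun do rewrite JE; exact: smooth_partial. Qed.

Let J_unit x : U x -> J x \in unitmx.
Proof.
by move=> Ux; have := lm_unit lm Ux; rewrite GG' // !unitmx_mul => /andP[/andP[]].
Qed.

Let comp_smooth (A : 'rV[R]_n -> 'M[R]_n) : mxsmooth U' A -> mxsmooth U (fun y => A (tau y)).
Proof. by move=> sA i j; exact: smooth_comp oU s_tau tauU (sA i j). Qed.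

Let dmx_comp i (A : 'rV[R]_n -> 'M[R]_n) x : mxsmooth U' A -> U x ->
  dmx i (fun y => A (tau y)) x = \sum_p J x i p *: dmx p A (tau x).
Proof.
move=> sA Ux; apply/matrixP => a b; rewrite dmxE (@partial_chain _ _ _ tau (fun z => A z a b)).
- by rewrite summxE; apply: eq_bigr => p _; rewrite scalemxE JE dmxE.
- by move=> k; exact: smooth_differentiable (s_tau k) Ux.
- exact: smooth_differentiable (sA a b) (tauU Ux).
Qed.

Let Om i x : 'M[R]_n := \sum_p J x i p *: om G' p (tau x).

Let sOm i : mxsmooth U (Om i).
Proof.
move=> a b; have -> : (fun x => Om i x a b) = (fun x => \sum_p J x i p * om G' p (tau x) a b).
  by apply/funext => x; rewrite /Om summxE; apply: eq_bigr => p _; rewrite scalemxE.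
apply: smooth_sum => // p; apply: smoothM => //.
by apply: (comp_smooth (A := om G' p)); exact: om_smooth lm' p.
Qed.

Let dJ_sym i k p x : U x -> dmx i J x k p = dmx k J x i p.
Proof.
move=> Ux; rewrite !dmxE; under eq_fun do rewrite JE; under [in RHS]eq_fun do rewrite JE.
exact: smooth_partial_comm Ux.
Qed.

(** Solved for [om G i x], the right side is torsion-free and compatible with G, so [om_uniq]
    applies. *)
Let om_trans i x : U x -> om G i x *m J x = dmx i J x + J x *m Om i x.
Proof.
move=> Ux; have Ju := J_unit Ux.
suff <- : (dmx i J x + J x *m Om i x) *m invmx (J x) = om G i x by rewrite mulmxKV.
apply: (om_uniq lm Ux (W := fun i => (dmx i J x + J x *m Om i x) *m invmx (J x))) => [j k l|j].
  rewrite !mxmulE; apply: eq_bigr => q _; congr (_ * _).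
  rewrite [LHS]addmxE [RHS]addmxE dJ_sym //; congr (_ + _).
  have E a b : (J x *m Om a x) b q = \sum_r \sum_p J x b r * J x a p * om G' p (tau x) r q.
    rewrite mxmulE; apply: eq_bigr => r _; rewrite /Om summxE mulr_sumr.
    by apply: eq_bigr => p _; rewrite scalemxE mulrA.
  rewrite !E exchange_big; apply: eq_bigr => r _; apply: eq_bigr => p _ /=.
  by rewrite [J x k p * _]mulrC (om_sym lm') //; exact: tauU.
rewrite (eq_on_dmx oU j GG') //.
have sG'c := comp_smooth (lm_smooth lm').
rewrite (@dmxM _ _ U) //; [|exact: mxsmoothM|exact: mxsmooth_tr].
rewrite (@dmxM _ _ U) // dmx_tr (dmx_comp _ (lm_smooth lm')) // GG' //.
have -> : \sum_p J x j p *: dmx p G' (tau x) = Om j x *m G' (tau x) + G' (tau x) *m (Om j x)^T.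
  rewrite /Om mulmx_suml linear_sum mulmx_sumr -big_split; apply: eq_bigr => p _ /=.
  by rewrite (om_compat lm' p (tauU Ux)) scalerDr -scalemxAl trmxZ -scalemxAr.
have -> : (dmx j J x + J x *m Om j x) *m invmx (J x) *m (J x *m G' (tau x) *m (J x)^T) =
    (dmx j J x + J x *m Om j x) *m (G' (tau x) *m (J x)^T).
  by rewrite !mulmxA mulmxKV.
have -> : J x *m G' (tau x) *m (J x)^T *m ((dmx j J x + J x *m Om j x) *m invmx (J x))^T =
    J x *m G' (tau x) *m (dmx j J x + J x *m Om j x)^T.
  rewrite [in LHS]trmx_mul -!mulmxA; congr (_ *m (_ *m _)).
  by rewrite mulmxA -trmx_mul mulVmx // trmx1 mul1mx.
move: (dmx j J x) (J x) (Om j x) (G' _) => a b c d; mxring.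
Qed.

Let dOm i j x : U x -> dmx i (Om j) x = \sum_p dmx i J x j p *: om G' p (tau x)
  + \sum_p \sum_q (J x i q * J x j p) *: dmx q (om G' p) (tau x).
Proof.
move=> Ux; apply/matrixP => a b; rewrite dmxE.
have -> : (fun y => Om j y a b) = (fun y => \sum_p J y j p * om G' p (tau y) a b).
  by apply/funext => y; rewrite /Om summxE; apply: eq_bigr => p _; rewrite scalemxE.
have dJ p := smooth_differentiable (sJ j p) Ux.
have dO p := smooth_differentiable (comp_smooth (om_smooth lm' p) a b) Ux.
rewrite partial_sum; last by move=> p; exact: differentiableM (dJ p) (dO p).
rewrite addmxE !summxE -big_split; apply: eq_bigr => p _ /=.
rewrite (partialM i (dJ p) (dO p)) scalemxE -!dmxE; congr (_ + _).
have /matrixP/(_ a b) := dmx_comp i (om_smooth lm' p) Ux.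
rewrite dmxE => ->; rewrite !summxE mulr_sumr; apply: eq_bigr => q _.
by rewrite !scalemxE; ring.
Qed.

(** [om_trans] is differentiated and skew-symmetrized: the second derivatives of the Jacobian matrix
    cancel, and its first derivatives are eliminated by [om_trans] itself. *)
Let cur_trans i j x : U x -> cur G i j x *m J x =
  J x *m \sum_p \sum_q (J x i p * J x j q) *: cur G' p q (tau x).
Proof.
move=> Ux.
have H a b : dmx a (om G b) x *m J x + om G b x *m dmx a J x =
    dmx a (dmx b J) x + dmx a J x *m Om b x + J x *m dmx a (Om b) x.
  have := eq_on_dmx oU a (fun y (Uy : U y) => om_trans b Uy) Ux.
  rewrite (@dmxM _ _ U) //; last exact: om_smooth lm b.
  rewrite (@dmxD _ _ U) //; [|exact: mxsmooth_dmx|exact: mxsmoothM].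
  by rewrite (@dmxM _ _ U) // addrA.
have -> : \sum_p \sum_q (J x i p * J x j q) *: cur G' p q (tau x) =
    dmx i (Om j) x - dmx j (Om i) x + Om j x *m Om i x - Om i x *m Om j x.
  rewrite !dOm //.
  have -> : \sum_p dmx i J x j p *: om G' p (tau x) = \sum_p dmx j J x i p *: om G' p (tau x).
    by apply: eq_bigr => p _; rewrite dJ_sym.
  have E a b : Om a x *m Om b x = \sum_p \sum_q (J x a p * J x b q) *: (om G' p (tau x) *m om G' q (tau x)).
    rewrite /Om mulmx_suml; apply: eq_bigr => p _; rewrite mulmx_sumr; apply: eq_bigr => q _.
    by rewrite -scalemxAl -scalemxAr scalerA.
  rewrite !E; rewrite [\sum_p \sum_q (J x i q * _) *: _]exchange_big.
  rewrite [\sum_p \sum_q (J x j p * J x i q) *: (_ *m _)]exchange_big /=.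
  rewrite opprD addrACA subrr add0r -!sumrB -big_split -sumrB; apply: eq_bigr => p _ /=.
  rewrite -!sumrB -big_split -sumrB; apply: eq_bigr => q _ /=.
  rewrite cur.unlock [J x j q * J x i p]mulrC; move: (J x i p * _) => c.
  by rewrite !(scalerBr, scalerDr).
have Hi := om_trans i Ux; have Hj := om_trans j Ux.
have := H i j; have := H j i; rewrite (dmx_comm oU i j sJ Ux) cur.unlock.
move: (dmx i (om G j) x) (dmx j (om G i) x) (dmx j (dmx i J) x) (dmx i (Om j) x) (dmx j (Om i) x).
move: (om G i x) (om G j x) (dmx i J x) (dmx j J x) (Om i x) (Om j x) (J x) Hi Hj.
move=> oi oj di dj Oi Oj K Hi Hj aij aji dd eij eji H1 H2.
have {}H1 : aji *m K = dd + dj *m Oi + K *m eji - oi *m dj by rewrite -H1 addrK.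
have {}H2 : aij *m K = dd + di *m Oj + K *m eij - oj *m di by rewrite -H2 addrK.
rewrite mulmxBl mulmxDl mulmxBl -!mulmxA H1 H2 Hi Hj !mulmxDr !mulmxA Hi Hj; mxring.
Qed.

Lemma ric_trans x : U x -> ric G x = J x *m ric G' (tau x) *m (J x)^T.
Proof.
move=> Ux; have Ju := J_unit Ux; apply/matrixP => j k.
have cE i : cur G i j x k i =
    \sum_s \sum_p \sum_q (invmx (J x) s i * J x i p) * (J x j q * (J x *m cur G' p q (tau x)) k s).
  have -> : cur G i j x = J x *m (\sum_p \sum_q (J x i p * J x j q) *: cur G' p q (tau x)) *m invmx (J x).
    by rewrite -cur_trans // mulmxK.
  rewrite mxmulE; apply: eq_bigr => s _; rewrite mulmx_sumr summxE mulr_suml; apply: eq_bigr => p _.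
  rewrite mulmx_sumr summxE mulr_suml; apply: eq_bigr => q _.
  by rewrite -scalemxAr scalemxE; move: ((J x *m _) k s) => ?; ring.
rewrite ricE; under eq_bigr do rewrite cE.
rewrite exchange_big /=.
transitivity (\sum_s \sum_q J x j q * (J x *m cur G' s q (tau x)) k s).
  apply: eq_bigr => s _; rewrite exchange_big /= .
  transitivity (\sum_p (p == s)%:R * \sum_q J x j q * (J x *m cur G' p q (tau x)) k s).
    apply: eq_bigr => p _; rewrite exchange_big /= mulr_sumr; apply: eq_bigr => q _.
    rewrite -mulr_suml; congr (_ * _).
    by have /matrixP/(_ s p) := mulVmx Ju; rewrite mxmulE mxE eq_sym.
  rewrite (bigD1 s) //= eqxx mul1r [X in _ + X]big1 ?addr0 // => p ps.
  by rewrite (negPf ps) mul0r.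
rewrite exchange_big /= -mulmxA mxmulE; apply: eq_bigr => q _; rewrite -mulr_sumr; congr (_ * _).
rewrite mxmulE; under eq_bigr do rewrite mxmulE.
rewrite exchange_big /=; apply: eq_bigr => r _.
by rewrite -mulr_sumr trmxE mulrC ricE.
Qed.

Lemma scalar_curvature_trans x : U x -> scalar_curvature G x = scalar_curvature G' (tau x).
Proof.
move=> Ux; have Ju := J_unit Ux; have U'x := tauU Ux.
rewrite (scalar_curvatureE lm) // (scalar_curvatureE lm') // ric_trans //.
have -> : iG G x = (invmx (J x))^T *m iG G' (tau x) *m invmx (J x).
  have GK : G x *m ((invmx (J x))^T *m iG G' (tau x) *m invmx (J x)) = 1%:M.
    rewrite GG' // !mulmxA -[X in X *m _ *m _]mulmxA -trmx_mul mulVmx // trmx1 mulmx1.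
    by rewrite -[X in X *m _]mulmxA (mulGV lm') // mulmx1 mulmxV.
  by rewrite -[LHS]mulmx1 -GK mulmxA (mulVG lm) // mul1mx.
rewrite !mulmxA mxtrace_mulC !mulmxA -trmx_mul mulVmx // trmx1 mul1mx.
by rewrite -[X in \tr (X *m _)]mulmxA mulVmx // mulmx1.
Qed.

End change_of_coordinates.

(* [coord] is also the name of the coordinates of vectors in a basis. *)
Local Notation coord := Defs.coord.

Lemma connected_near (M : topologicalType) (P : set M) : connected [set: M] ->
  (exists p, P p) -> (forall p, P p -> \forall q \near p, P q) ->
  (forall p, ~ P p -> \forall q \near p, ~ P q) -> forall p, P p.
Proof.
move=> cM [p0 P0] oP cP p.
have oPP : open P by rewrite openE => q /oP.
have cPP : closed P.
  by rewrite -[P]setCK; apply: open_closedC; rewrite openE => q /cP.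
have -> : P = setT; last by [].
apply: cM; first by exists p0.
- by exists P; rewrite ?setTI.
- by exists P; rewrite ?setTI.
Qed.

Lemma pd0_constant (R : realType) n (D : set 'rV[R]_n) (f : 'rV[R]_n -> R) x : open D -> D x ->
  smooth_on D f -> (forall i y, D y -> pd i f y = 0) -> \forall y \near x, f y = f x.
Proof.
move=> oD Dx sf df.
have [d d0 Hd] := nbhs_box (open_nbhs_nbhs (conj oD Dx)).
have : \forall y \near x, box x d y.
  apply/nbhs_ballP; exists d => // y; rewrite -ball_normE /= => xy i.
  rewrite distrC (le_trans _ (ltW xy)) // [leRHS]/Num.Def.normr /= mx_normrE.
  have := le_bigmax (0 : R) (fun ij => `|(x - y) ij.1 ij.2|) (0, i).
  by rewrite /= !mxE.
apply: filterS => y b; apply/eqP; rewrite -subr_eq0 -normr_le0.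
have E : x + (y - x) = y by rewrite subrKC.
have inD (s : R) : 0 <= s <= 1 -> D (x + s *: (y - x)).
  move=> /andP[s0 s1]; apply: Hd => i; rewrite !mxE [x 0 i + _]addrC addrK.
  rewrite normrM ger0_norm // (le_trans _ (b i)) // -[leRHS]mul1r ler_wpM2r //.
have := @increment_bound _ _ D f x (y - x) 0 sf inD; rewrite E mulr0; apply => s s01 k.
by rewrite df ?normr0 //; exact: inD.
Qed.

Lemma dist2_lt_near (R : realType) n (q x : 'rV[R]_n) (e : R) : dist2 q x < e ->
  \forall y \near x, dist2 q y < e.
Proof.
move=> qx; have cd : {for x, continuous (dist2 q)}.
  apply: differentiable_continuous; apply: (@smooth_differentiable _ _ setT) => //.
  by apply: dist2_smooth; exact: openT.
by apply: (cd [set s | s < e]); apply: open_nbhs_nbhs; split => //; exact: open_lt.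
Qed.

Lemma dist2C (R : realType) n (q x : 'rV[R]_n) : dist2 q x = dist2 x q.
Proof. by apply: eq_bigr => i _; rewrite -sqrrN opprB. Qed.

Lemma dist2_near (R : realType) n (q : 'rV[R]_n) (e : R) : 0 < e -> \forall x \near q, dist2 q x < e.
Proof.
by move=> e0; apply: dist2_lt_near; rewrite /dist2 big1 // => i _; rewrite subrr expr0n.
Qed.

Section charts.
Context {R : realType} {n : nat} {M : topologicalType} {X : smooth_manifold R n M}.
Variable g : riemannian_metric X.

Local Notation D a := (coord a @` dom a).

Lemma chart_metric (a : chart X) : local_metric (D a) (g a).
Proof.
split.
- exact: coord_open.
- by move=> i j; exact: metric_smooth.
- by move=> _ [p dp <-]; exact: (Defs.metric_sym g dp).
- by move=> _ [p dp <-] v v0; exact: (@metric_posdef _ _ _ _ g a p dp v v0).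
Qed.

Lemma coord_near (a : chart X) p (P : set 'rV[R]_n) : dom a p ->
  (\forall x \near coord a p, P x) -> \forall q \near p, P (coord a q).
Proof.
move=> dp HP; have := @Defs.coord_continuous _ _ _ X a.
by rewrite continuous_open_subspace; [move=> /(_ p); apply; rewrite ?inE|exact: dom_open].
Qed.

Lemma param_near (a : chart X) p (P : set M) : dom a p ->
  (\forall q \near p, P q) -> \forall x \near coord a p, P (param a x).
Proof.
move=> dp HP; have := @param_continuous _ _ _ X a.
rewrite continuous_open_subspace; last exact: coord_open.
move=> /(_ (coord a p)); rewrite inE => /(_ _); apply; first by exists p.
by rewrite coordK.
Qed.

Lemma overlap_open (a b : chart X) : open (coord a @` (dom a `&` dom b)).
Proof.
rewrite openE => _ [p [da db] <-].
have Hb : \forall q \near p, dom b q by apply: open_nbhs_nbhs; split => //; exact: dom_open.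
have Ha : \forall x \near coord a p, D a x.
  by apply: open_nbhs_nbhs; split; [exact: coord_open|exists p].
have := param_near da Hb; apply: filterS2 Ha => _ [q dq <-]; rewrite coordK // => bq.
by exists q.
Qed.

Section transition.
Variables a b : chart X.
Let U := coord a @` (dom a `&` dom b).
Let tau x := coord b (param a x).

Let subU : U `<=` D a. Proof. by move=> _ [p [da _] <-]; exists p. Qed.
Let tauU x : U x -> D b (tau x).
Proof. by move=> [p [da db] <-]; rewrite /tau coordK //; exists p. Qed.
Let lmU : local_metric U (g a) := local_metric_sub (@overlap_open a b) subU (chart_metric a).

Let GG' x : U x -> g a x = jacmx tau x *m g b (tau x) *m (jacmx tau x)^T.
Proof.
move=> [p [da db] <-]; apply/matrixP => i j; rewrite (metric_transition g da db).
rewrite mxmulE exchange_big /=; apply: eq_bigr => l _; rewrite mxmulE mulr_suml; apply: eq_bigr => k _.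
by rewrite trmxE !mxE -!pdE [in RHS]/tau coordK //; ring.
Qed.

Let s_tau k : smooth_on U (fun x => tau x 0 k).
Proof. exact: transition_smooth. Qed.

Lemma scalar_curvature_chart p : dom a p -> dom b p ->
  scalar_curvature (g a) (coord a p) = scalar_curvature (g b) (coord b p).
Proof.
move=> da db; rewrite (scalar_curvature_trans lmU (chart_metric b) s_tau tauU GG'); last by exists p.
by rewrite /tau coordK.
Qed.

Lemma Ef_chart sc p : dom a p -> dom b p ->
  Ef (g b) sc (coord b p) = 0 -> Ef (g a) sc (coord a p) = 0.
Proof.
move=> da db Eb; have Ux : U (coord a p) by exists p.
rewrite /Ef (ric_trans lmU (chart_metric b) s_tau tauU GG' Ux) GG' //.
have -> : tau (coord a p) = coord b p by rewrite /tau coordK.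
by rewrite scalemxAl scalemxAr -mulmxBl -mulmxBr -/(Ef (g b) sc (coord b p)) Eb mulmx0 mul0mx.
Qed.

End transition.

Lemma scalar_curvature_constant : harmonic_curvature g ->
  exists sc, forall (a : chart X) p, dom a p -> scalar_curvature (g a) (coord a p) = sc.
Proof.
(* For an empty M any constant will do. *)
move=> hc; have [[p0 _]|M0] := pselect (exists p : M, True); last first.
  by exists 0 => a p; case: M0; exists p.
have [a0 d0] := dom_cover X p0; exists (scalar_curvature (g a0) (coord a0 p0)).
set sc := scalar_curvature _ _.
suff H (p : M) : exists2 a : chart X, dom a p & scalar_curvature (g a) (coord a p) = sc.
  by move=> a p dp; have [b db <-] := H p; exact: scalar_curvature_chart.
have loc (r : M) (a : chart X) : dom a r ->
    \forall q \near r, dom a q /\ scalar_curvature (g a) (coord a q) = scalar_curvature (g a) (coord a r).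
  move=> dp; have lm := chart_metric a.
  have Dp : D a (coord a r) by exists r.
  have : \forall q \near r, dom a q by apply: open_nbhs_nbhs; split => //; exact: dom_open.
  have ss : smooth_on (D a) (scalar_curvature (g a)).
    have oD := lm_open lm.
    apply: (smooth_eq oD (f := fun x => \sum_j \sum_k iG (g a) x j k * ric (g a) x j k)) => [x Dx|].
      by apply: eq_bigr => j _; apply: eq_bigr => k _; rewrite iGE ric.unlock mxE.
    apply: smooth_sum => // j; apply: smooth_sum => // k; apply: smoothM => //.
      exact: (ginv_smooth lm).
    exact: (ric_smooth lm).
  have := pd0_constant (lm_open lm) Dp ss (fun i x Dx => scalar_curvature_pd0 lm i Dx _).
  have Hx : forall x, D a x -> forall i j k, div_riemann (g a) i j k x = 0 by move=> _ [q dq <-]; exact: hc.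
  move=> /(_ Hx) /(coord_near dp) H1 H2.
  by apply: filterS2 H1 H2 => q -> dq.
apply: (connected_near (P := fun p => exists2 a, dom a p & scalar_curvature (g a) (coord a p) = sc)).
- exact: (manifold_connected X).
- by exists p0, a0.
- move=> q [a dq Eq]; apply: filterS (loc q a dq) => q' [dq' E']; exact: (ex_intro2 _ _ a dq' (etrans E' Eq)).
- move=> q Hq; have [a dq] := dom_cover X q; apply: filterS (loc q a dq) => q' [dq' E'] [b db Eb].
  exact: Hq (ex_intro2 _ _ a dq (etrans (esym E') (etrans (scalar_curvature_chart dq' db) Eb))).
Qed.

(* Unique continuation makes the set where [Ef] vanishes near a point closed. *)
Lemma Ef_everywhere sc p0 (a0 : chart X) : harmonic_curvature g -> dom a0 p0 ->
  (\forall x \near coord a0 p0, Ef (g a0) sc x = 0) ->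
  forall (a : chart X) p, dom a p -> Ef (g a) sc (coord a p) = 0.
Proof.
move=> hc d0 E0.
pose Z q := exists2 a : chart X, dom a q & Ef (g a) sc (coord a q) = 0.
have Zc a q : dom a q -> Z q -> Ef (g a) sc (coord a q) = 0.
  by move=> da [b db Eb]; exact: Ef_chart Eb.
suff H (p : M) : \forall q \near p, Z q.
  by move=> a p dp; apply: Zc => //; exact: (nbhs_singleton (H p)).
have harm a x : D a x -> forall i j k, div_riemann (g a) i j k x = 0 by move=> [q dq <-]; exact: hc.
have ZE a q : dom a q -> (\forall q' \near q, Z q') -> \forall x \near coord a q, Ef (g a) sc x = 0.
  move=> dq HZ; have Dq : \forall x \near coord a q, D a x.
    by apply: open_nbhs_nbhs; split; [exact: coord_open|exists q].
  apply: filterS2 Dq (param_near dq HZ) => _ [q' dq' <-]; rewrite coordK //.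
  exact: Zc.
have EZ a q : dom a q -> (\forall x \near coord a q, Ef (g a) sc x = 0) -> \forall q' \near q, Z q'.
  move=> dq HE; have Dq : \forall q' \near q, dom a q' by apply: open_nbhs_nbhs; split => //; exact: dom_open.
  by apply: filterS2 Dq (coord_near dq HE) => q' dq' Eq'; exists a.
apply: (connected_near (P := fun p => \forall q \near p, Z q)).
- exact: (manifold_connected X).
- by exists p0; exact: EZ d0 E0.
- by move=> q HZ; exact: (nbhs_interior HZ).
- move=> q nZ; have [a dq] := dom_cover X q.
  have Dq : nbhs (coord a q) (D a) by apply: open_nbhs_nbhs; split; [exact: coord_open|exists q].
  have [L L0 HL] := nbhs_box Dq.
  (* For q' close to q, the box and ball of size L / 2 about q' stay in the chart and the ball
     contains q, so that vanishing near q' carries over to a neighbourhood of q. *)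
  have L20 : 0 < L / 2 by rewrite divr_gt0.
  have near_small : \forall x \near coord a q, box (coord a q) (L / 2) x /\ dist2 (coord a q) x < (L / 2) ^+ 2.
    have := dist2_near (coord a q) (exprn_gt0 2 L20); apply: filterS => x dx; split=> // i; rewrite -ler_sqr ?nnegrE ?(ltW L20) // real_normK ?num_real //.
    exact: le_trans (dist2_coord _ _ _) (ltW dx).
  have Dq' : \forall q' \near q, dom a q' by apply: open_nbhs_nbhs; split => //; exact: dom_open.
  apply: filterS2 Dq' (coord_near dq near_small) => q' dq' [bq' dd] HZ; apply: nZ.
  have bD : box (coord a q') (L / 2) `<=` D a.
    move=> x bx; apply: HL => i; have -> : x 0 i - coord a q 0 i = (x 0 i - coord a q' 0 i) + (coord a q' 0 i - coord a q 0 i) by ring.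
    rewrite (le_trans (ler_normD _ _)) // [leRHS](_ : _ = L / 2 + L / 2); last by field.
    by rewrite lerD.
  have oB : \forall x \near coord a q, dist2 (coord a q') x < (L / 2) ^+ 2.
    by apply: dist2_lt_near; rewrite dist2C.
  apply: (EZ a q dq); apply: filterS oB => x dx.
  by apply: (Ef_continuation (chart_metric a) (harm a) bD L20 _ dx); exact: ZE.
Qed.

End charts.

(** The Weyl tensor vanishes where E is nonzero, and such points are dense. A component that is
    nonzero at some point is nonzero on an open set, hence at one of them. *)
Lemma non_einstein_weyl (R : realType) (D : set 'rV[R]_4) (G : 'rV[R]_4 -> 'M[R]_4) :
  local_metric D G ->
  (forall x, D x -> forall i j k, div_riemann G i j k x = 0) ->
  (forall x, D x -> exists phi, forall i j, curvature_square G i j x = phi * G x i j) ->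
  (forall x, D x -> \tr (iG G x *m ric G x) = 0) ->
  (forall x, D x -> ~ \forall y \near x, Ef G 0 y = 0) ->
  forall i j x, D x -> Rm G i j x = kn (2^-1 *: ric G x) (G x) i j.
Proof.
move=> lm harm wE hsc dense i j x Dx; have oD := lm_open lm.
pose f k l (y : 'rV[R]_4) := Rm G i j y k l - kn (2^-1 *: ric G y) (G y) i j k l.
apply/matrixP => k l; apply/eqP; rewrite -subr_eq0 -/(f k l x); apply/negPn/negP => fx.
have sf : smooth_on D (f k l).
  apply: smoothB => //; first exact: (mxsmoothM oD (cur_smooth lm i j) (lm_smooth lm)).
  apply: (kn_smooth lm i j); last exact: (lm_smooth lm).
  by apply: mxsmoothZ => //; [exact: smooth_cst|exact: (ric_smooth lm)].
have oU := open_neq0 lm sf.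
have [y [[Dy fy] Ey]] : exists y, (D y /\ f k l y != 0) /\ Ef G 0 y != 0.
  apply: contrapT => H; apply: (dense x Dx).
  have : \forall y \near x, D y /\ f k l y != 0 by exact: (open_nbhs_nbhs (conj oU (conj Dx fx))).
  apply: filterS => y Hy; apply/eqP/negPn/negP => Ey; apply: H; exists y; by split.
move: fy; rewrite /f (scalar_eq0_weyl lm harm wE hsc erefl Dy Ey).
have -> : Ef G 0 y = ric G y by rewrite /Ef mul0r scale0r subr0.
by rewrite knE [_ k l]scalemxE knE ![(2^-1 *: ric G y) _ _]scalemxE => /eqP; apply; ring.
Qed.

Theorem theorem22p3 (R : realType) :
  ~ exists (M : topologicalType) (X : smooth_manifold R 4 M)
      (g : riemannian_metric X),
      proper_weakly_einstein g /\ harmonic_curvature g.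
Proof.
move=> [M [X [g [[we ne nc] hc]]]].
have [sc Hsc] := scalar_curvature_constant hc.
have Z_ne : ~ forall (a : chart X) p, dom a p -> Ef (g a) sc (coord a p) = 0.
  move=> Z; apply: ne; exists (sc / 4) => a p dp i j.
  have /matrixP/(_ i j) := Z a p dp.
  by rewrite /Ef ric.unlock !mxE => /eqP; rewrite subr_eq0 => /eqP.
have lm := chart_metric g.
have harm a x : (coord a @` dom a) x -> forall i j k, div_riemann (g a) i j k x = 0.
  by move=> [q dq <-]; exact: hc.
have wE a x : (coord a @` dom a) x ->
    exists phi, forall i j, curvature_square (g a) i j x = phi * g a x i j.
  by move=> [q dq <-]; have [phi Hphi] := we; exists (phi q); exact: Hphi.
have tsc a x : (coord a @` dom a) x -> \tr (iG (g a) x *m ric (g a) x) = sc.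
  by move=> [q dq <-]; rewrite -(scalar_curvatureE (lm a)) ?Hsc //; exists q.
have [sc0|sc0] := eqVneq sc 0; last first.
  apply: Z_ne => a p dp.
  by apply: (scalar_neq0_Einstein (lm a) (harm a) (wE a) (tsc a) sc0); exists p.
apply: nc; split; last by move=> a p dp; rewrite Hsc.
subst sc; move=> a p dp; have Dp : (coord a @` dom a) (coord a p) by exists p.
have sric := ric_smooth (lm a).
(* In dimension four and for zero scalar curvature the Schouten tensor is Ric / 2. *)
apply: (weyl_schouten (P := fun x => 2^-1 *: ric (g a) x) (lm a)) => //.
- apply: mxsmoothZ => //; [exact: coord_open|exact: smooth_cst].
- by move=> x Dx; rewrite trmxZ (ric_tr (lm a)).
- move=> i j k x Dx; have c := @smooth_cst R 4 (coord a @` dom a) (2^-1).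
  have E b : Dc (g a) b (fun x => 2^-1 *: ric (g a) x) x = 2^-1 *: Dc (g a) b (ric (g a)) x.
    by rewrite (@DcZ _ _ (coord a @` dom a)) // ?partial_cst ?scale0r ?add0r //; exact: coord_open.
  rewrite !E [LHS]scalemxE [RHS]scalemxE.
  by rewrite (codazzi_ric (lm a) (harm a)).
(* If E vanished near one point, it would vanish everywhere and g would be Einstein. *)
- move=> i j x Dx; apply: (non_einstein_weyl (lm a) (harm a) (wE a) (tsc a)) => // _ [q dq <-] E0.
  by apply: Z_ne; exact: Ef_everywhere hc dq E0.
Qed.
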